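(* Let $f:\mathbb{T}^2\to\mathbb{T}^2$ be a $C^2$ Anosov endomorphism with constant Jacobian $|\det Df|$, and let $A$ be its linearization. If the unstable foliation of $f$ is absolutely continuous with uniformly bounded densities (i.e. has the UBD property), then $\lambda^{\sigma}_f\equiv\lambda^{\sigma}_A$ for $\sigma\in\{u,s\}$; that is, $\lambda^u_f(x)=\lambda^u_A$ and $\lambda^s_f(x)=\lambda^s_A$ for every $x\in\mathbb{T}^2$.
   Context: Anosov endomorphism: a local $C^1$ diffeomorphism $f:M\to M$ of a closed Riemannian manifold such that for every full orbit $\tilde x=(x_i)_{i\in\mathbb{Z}}$ ($f(x_i)=x_{i+1}$) there is a splitting $T_{x_i}M=E^u(x_i)\oplus E^s(x_i)$, with $Df(x_i)E^{\sigma}(x_i)=E^{\sigma}(x_{i+1})$, and constants $c>0$, $\lambda>1$ such that for all $n\ge 0$ and all $i$: $\|Df^n(x_i)v\|\ge c^{-1}\lambda^n\|v\|$ for $v\in E^u(x_i)$ and $\|Df^n(x_i)v\|\le c\lambda^{-n}\|v\|$ for $v\in E^s(x_i)$. The map need not be invertible, and the unstable direction at a point may depend on the chosen past orbit. Standing convention: $E^s$ is nontrivial (expanding maps are excluded), so on $\mathbb{T}^2$ both $E^s$ and $E^u$ are one-dimensional. The linearization $A$ of $f$ is the unique linear toral endomorphism homotopic to $f$. The Lyapunov exponents are $\lambda^{\sigma}_f(x)=\lim_{n\to\infty}\frac1n\log\|Df^n(x)v\|$ for $0\ne v\in E^\sigma$ at $x$ (for $\sigma=u$, $v$ in an unstable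 direction at $x$; the value does not depend on the choice of past orbit defining it). $\lambda^u_A$, $\lambda^s_A$ are the logarithms of the moduli of the eigenvalues of $A$ of modulus $>1$ and $<1$, respectively. A lift $F:\mathbb{R}^2\to\mathbb{R}^2$ of $f$ to the universal cover is an Anosov diffeomorphism with stable and unstable foliations $W^s_F$, $W^u_F$ of $\mathbb{R}^2$. UBD property: a one-dimensional foliation $\mathcal F$ of a Riemannian manifold has the uniform bounded density property (is absolutely continuous with uniformly bounded densities) if there is $C>1$ such that, for every foliated box $\mathcal B$ (a set homeomorphic to $X\times Y$, with $X$ a local leaf and $Y$ a local transversal, the sets $X\times\{y\}$ corresponding to local leaves), the disintegration $\{m^{\mathcal B}_x\}$ of the volume normalized to $\mathcal B$ along the local leaves satisfies $C^{-1}\le \frac{d m^{\mathcal B}_x}{d\hat\lambda^{\mathcal B}_x}\le C$, where $\hat\lambda^{\mathcal B}_x$ is the normalized induced volume (length) on the connected component of $\mathcal F(x)\cap\mathcal B$ containing $x$. ''The unstable foliation of $f$ has the UBD property'' means that the unstable foliation $W^u_F$ of a lift $F$ of $f$ has it. *)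

(* Defs.v *)
From HB Require Import structures.
From mathcomp Require Import all_boot all_order all_algebra.
From mathcomp Require Import generic_quotient.
From mathcomp Require Import all_classical all_reals all_analysis.
From mathcomp Require Import measurable_realfun.

Set Implicit Arguments.
Unset Strict Implicit.
Unset Printing Implicit Defensive.

Import Order.TTheory GRing.Theory Num.Theory.
Import numFieldNormedType.Exports.

Local Open Scope classical_set_scope.
Local Open Scope ring_scope.
Local Open Scope quotient_scope.

(* [plane] carries the topology, norm and vector space structure, [mplane] the
   product sigma-algebra; the underlying type is R * R in both cases. *)
Notation plane R := (R^o * R^o)%type.
Notation mplane R := (measurableTypeR R * measurableTypeR R)%type.

(* The canonical norm of a product type is the maximum norm. *)
Definition enorm (R : realType) (v : plane R) : R :=
  Num.sqrt (v.1 ^+ 2 + v.2 ^+ 2).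

Definition area (R : realType) : set (mplane R) -> \bar R :=
  (@lebesgue_measure R \x @lebesgue_measure R)%E.

HB.instance Definition _ (R : realType) := Measure.on (@area R).

Definition zequiv (R : realType) (x y : plane R) : bool :=
  (x.1 - y.1 \is a Num.int) && (x.2 - y.2 \is a Num.int).

Lemma zequiv_refl (R : realType) : reflexive (@zequiv R).
Proof. by move=> x; rewrite /zequiv !subrr !rpred0. Qed.

Lemma zequiv_sym (R : realType) : symmetric (@zequiv R).
Proof.
by move=> x y; congr andb; rewrite -opprB rpredN.
Qed.

Lemma zequiv_trans (R : realType) : transitive (@zequiv R).
Proof.
move=> y x z /andP[xy1 xy2] /andP[yz1 yz2]; apply/andP; split.
  by rewrite -(subrKA y.1) rpredD.
by rewrite -(subrKA y.2) rpredD.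
Qed.

Canonical zequiv_rel (R : realType) : equiv_rel (plane R) :=
  EquivRel (@zequiv R) (@zequiv_refl R) (@zequiv_sym R) (@zequiv_trans R).

Definition torus (R : realType) : Type :=
  quotient_topology {eq_quot (zequiv_rel R)}.

HB.instance Definition _ (R : realType) :=
  Quotient.on (torus R).
HB.instance Definition _ (R : realType) :=
  Topological.on (torus R).

Definition torus_proj (R : realType) (x : plane R) : torus R := \pi_(torus R) x.

Definition is_lift (R : realType) (f : torus R -> torus R)
    (F : plane R -> plane R) : Prop :=
  continuous F /\ forall x, f (torus_proj x) = torus_proj (F x).

(* In finite dimension, F is C^(k+1) iff it is differentiable and all its
   directional derivatives are C^k; U is meant to be open. *)
Fixpoint Ck_on (R : realType) (V W : normedModType R) (k : nat) (U : set V)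
    (F : V -> W) : Prop :=
  match k with
  | 0 => forall x, U x -> {for x, continuous F}
  | k'.+1 => (forall x, U x -> differentiable F x) /\
             (forall v, Ck_on k' U (fun x => 'd F x v))
  end.

Definition local_C1_diffeo (R : realType) (F : plane R -> plane R) : Prop :=
  forall x, exists (U : set (plane R)) (G : plane R -> plane R),
    [/\ open U /\ U x, open (F @` U), Ck_on 1 U F, Ck_on 1 (F @` U) G &
        forall y, U y -> G (F y) = y].

(* The derivative at p of the torus map lifted by F, every tangent space being
   identified with the plane.  Since 'd F is Z^2-periodic, neither the lift nor
   the representative of p matters. *)
Definition tD (R : realType) (F : plane R -> plane R) (p : torus R)
    (v : plane R) : plane R :=
  'd F (repr p) v.

Definition jac (R : realType) (F : plane R -> plane R) (p : torus R) : R :=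
  (tD F p (1, 0)).1 * (tD F p (0, 1)).2
  - (tD F p (0, 1)).1 * (tD F p (1, 0)).2.

Definition full_orbit (R : realType) (f : torus R -> torus R)
    (p : int -> torus R) : Prop :=
  forall i, f (p i) = p (i + 1).

(* The dimensions encode the convention that the stable bundle is nontrivial
   and expanding maps are excluded. *)
Definition hyperbolic_splitting (R : realType) (F : plane R -> plane R)
    (p : int -> torus R) (Eu Es : int -> {vspace plane R}) : Prop :=
  [/\ forall i, \dim (Eu i) = 1%N /\ \dim (Es i) = 1%N,
      forall i, (Eu i + Es i)%VS = fullv /\ (Eu i :&: Es i)%VS = 0%VS,
      forall i, tD F (p i) @` [set` Eu i] = [set` Eu (i + 1)] /\
                tD F (p i) @` [set` Es i] = [set` Es (i + 1)] &
      exists c lam : R, [/\ 0 < c, 1 < lam &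
        forall (n : nat) (i : int),
          (forall v, v \in Eu i ->
             c^-1 * lam ^+ n * enorm v <= enorm (tD (iter n F) (p i) v)) /\
          (forall v, v \in Es i ->
             enorm (tD (iter n F) (p i) v) <= c * lam ^- n * enorm v)]].

Definition anosov (R : realType) (f : torus R -> torus R)
    (F : plane R -> plane R) : Prop :=
  local_C1_diffeo F /\
  forall p, full_orbit f p -> exists Eu Es, hyperbolic_splitting F p Eu Es.

Definition constant_jacobian (R : realType) (F : plane R -> plane R) : Prop :=
  exists J : R, forall p, `|jac F p| = J.

Definition lin (R : realType) (A : 'M[int]_2) (x : plane R) : plane R :=
  ((A 0 0)%:~R * x.1 + (A 0 1)%:~R * x.2,
   (A 1 0)%:~R * x.1 + (A 1 1)%:~R * x.2).

Definition torus_lin (R : realType) (A : 'M[int]_2) (p : torus R) : torus R :=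
  torus_proj (lin A (repr p)).

Definition homotopic (R : realType) (f g : torus R -> torus R) : Prop :=
  exists H : R * torus R -> torus R,
    [/\ {within `[0, 1] `*` [set: torus R], continuous H},
        forall p, H (0, p) = f p & forall p, H (1, p) = g p].

Definition linearization (R : realType) (f : torus R -> torus R)
    (A : 'M[int]_2) : Prop :=
  homotopic f (torus_lin A).

(* An eigenvalue of a real 2 x 2 matrix is automatically real when the other
   one has a different modulus. *)
Definition lin_exponent_u (R : realType) (A : 'M[int]_2) (l : R) : Prop :=
  exists mu : R, [/\ eigenvalue (map_mx intr A) mu, 1 < `|mu| & l = ln `|mu|].

Definition lin_exponent_s (R : realType) (A : 'M[int]_2) (l : R) : Prop :=
  exists mu : R,
    [/\ eigenvalue (map_mx intr A) mu, 0 < `|mu| < 1 & l = ln `|mu|].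

Definition unstable_vector (R : realType) (f : torus R -> torus R)
    (F : plane R -> plane R) (x : torus R) (v : plane R) : Prop :=
  v != 0 /\ exists p Eu Es,
    [/\ full_orbit f p, p 0 = x, hyperbolic_splitting F p Eu Es & v \in Eu 0].

Definition stable_vector (R : realType) (f : torus R -> torus R)
    (F : plane R -> plane R) (x : torus R) (v : plane R) : Prop :=
  v != 0 /\ exists p Eu Es,
    [/\ full_orbit f p, p 0 = x, hyperbolic_splitting F p Eu Es & v \in Es 0].

Definition growth_rate (R : realType) (F : plane R -> plane R) (x : torus R)
    (v : plane R) (l : R) : Prop :=
  (fun n : nat => n%:R^-1 * ln (enorm (tD (iter n F) x v))) @ \oo --> l.

(* The limit is required for every admissible vector, hence for every past of
   x; the first conjunct prevents vacuity. *)
Definition lyapunov_u (R : realType) (f : torus R -> torus R)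
    (F : plane R -> plane R) (x : torus R) (l : R) : Prop :=
  (exists v, unstable_vector f F x v) /\
  forall v, unstable_vector f F x v -> growth_rate F x v l.

Definition lyapunov_s (R : realType) (f : torus R -> torus R)
    (F : plane R -> plane R) (x : torus R) (l : R) : Prop :=
  (exists v, stable_vector f F x v) /\
  forall v, stable_vector f F x v -> growth_rate F x v l.

Definition past_orbit (R : realType) (F : plane R -> plane R) (x : plane R)
    (xs : nat -> plane R) : Prop :=
  xs 0%N = x /\ forall n, F (xs n.+1) = xs n.

(* The leaf through x: the points backward asymptotic to x.  The lift of an
   Anosov endomorphism is bijective, so each point has exactly one past. *)
Definition unstable_leaf (R : realType) (F : plane R -> plane R)
    (x : plane R) : set (plane R) :=
  [set y | exists xs ys, [/\ past_orbit F x xs, past_orbit F y ys &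
    (fun n => enorm (xs n - ys n)) @ \oo --> (0 : R)]].

(* A one-dimensional foliation of the plane is given by the map sending a
   point to its leaf.  The parametrization h of a box is a homeomorphism onto
   its image by compactness. *)
Definition unit_square (R : realType) : set (plane R) :=
  `[0, 1] `*` `[0, 1].

Definition foliated_box (R : realType) (leaf : plane R -> set (plane R))
    (B : set (plane R)) : Prop :=
  exists h : plane R -> plane R,
    [/\ {within @unit_square R, continuous h},
        {in @unit_square R &, injective h},
        h @` @unit_square R = B &
        forall s s' t : R, s \in `[0, 1] -> s' \in `[0, 1] -> t \in `[0, 1] ->
          leaf (h (s, t)) (h (s', t))].

Definition plaque (R : realType) (leaf : plane R -> set (plane R))
    (B : set (plane R)) (x : plane R) : set (plane R) :=
  connected_component (leaf x `&` B) x.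

(* gamma is an arc length parametrization of the C^1 arc P, extended beyond
   `[0, l] with unit speed. *)
Definition normalized_length (R : realType) (P : set (plane R))
    (lam : probability (mplane R) R) : Prop :=
  exists (gamma : R^o -> plane R) (l : R),
    [/\ 0 < l,
        Ck_on 1 [set: R^o] gamma /\ (forall s, enorm ('D_1 gamma s) = 1),
        {in `[0, l] &, injective gamma},
        gamma @` `[0, l] = P &
        forall E : set (mplane R), measurable E ->
          lam E = (l^-1%:E * lebesgue_measure (`[0%R, l] `&` gamma @^-1` E))%E].

(* The normalization of the area on B by area B cancels in the last clause. *)
Definition disintegration (R : realType) (leaf : plane R -> set (plane R))
    (B : set (plane R)) (m : plane R -> probability (mplane R) R) : Prop :=
  [/\ forall x y (E : set (mplane R)), B x -> plaque leaf B x y ->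
        measurable E -> m y E = m x E,
      forall x, B x -> m x (plaque leaf B x) = 1%E,
      forall E : set (mplane R), measurable E ->
        measurable_fun (B : set (mplane R)) (m ^~ E) &
      forall E : set (mplane R), measurable E ->
        (\int[@area R]_(x in B) m x E)%E = area (B `&` E)].

Definition UBD (R : realType) (leaf : plane R -> set (plane R)) : Prop :=
  exists C : R, 1 < C /\
    forall B : set (plane R), foliated_box leaf B ->
      exists m : plane R -> probability (mplane R) R,
        disintegration leaf B m /\
        {ae @area R, forall x, B x ->
          exists (lam : probability (mplane R) R) (rho : mplane R -> R),
            [/\ normalized_length (plaque leaf B x) lam,
                measurable_fun [set: mplane R] rho,
                forall E : set (mplane R), measurable E ->
                  m x E = (\int[lam]_(y in E) (rho y)%:E)%E &
                {ae lam, forall y, C^-1 <= rho y <= C}]}.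

(* Main.v *)
Require Import Defs.
From HB Require Import structures.
From mathcomp Require Import all_boot all_order all_algebra.
From mathcomp Require Import generic_quotient.
From mathcomp Require Import all_classical all_reals all_analysis.
From mathcomp Require Import measurable_realfun.
From mathcomp Require Import zify ring lra.
Set Implicit Arguments.
Unset Strict Implicit.
Unset Printing Implicit Defensive.
Import Order.TTheory GRing.Theory Num.Theory.
Import numFieldNormedType.Exports.
Local Open Scope classical_set_scope.
Local Open Scope ring_scope.

(* Let U_n(x) be the norm of D F^n on the unit unstable vector at x.
   The image under F^n of a thin foliated box is again a foliated box, with the
   same density bound; comparing areas with lengths of plaques there shows that
   U_n is comparable, uniformly in n, at any two points of an unstable plaque.
   The Jacobian being constant, the invariant line fields are Lipschitz, so that
   U_n also has bounded distortion along stable plaques.  Local product structure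
   and periodicity then give U_n(x) <= k U_n(y) for all x, y and n.
   Let E be a smooth field transverse to the unstable direction.  Stokes' formula
   for the form cross(E, .) bounds the distance between the F^n-images of the ends
   of a short segment transverse to the stable direction from below by a multiple
   of U_n.  For m large, rounding the difference of the two F^m-images gives a
   lattice vector k with |A^n k| >= U_n, since F^n(x + k) = F^n(x) + A^n k; so the
   norm of A^n is comparable to U_n.  Stokes' formula for x dy shows that det A is
   the Jacobian of F.  Hence A is hyperbolic, U_n grows like the n-th power of its
   unstable eigenvalue, and the stable exponent follows from the determinant. *)

(** The Anosov hypothesis gives constants that depend on the orbit and an unstable direction that
    depends on the past. In the plane the lift is invertible, so both directions become functions of
    the point; but [eu] is not periodic, only the derivatives of [F] and of its iterates are.
    Uniform constants therefore come from a compactness argument on bounded trajectories, not from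
    compactness applied to the splitting. The directions are unit vectors with arbitrary signs, so
    everything about them is phrased through [cross] and norms. Constancy of the Jacobian makes the
    product of the stable and unstable rates comparable to [j]: this is what bounds the expansion of
    distances in the Lipschitz estimate, and it makes the surface term of Stokes' formula
    negligible, [|j| ^ n] being at most a constant times [th ^ n * U_n]. Hyperbolicity of [A] is a
    conclusion: its eigenvalues are located from the fact that [U_n] exceeds both 1 and [|j| ^ n] by
    a factor of order [th ^ - n]. Norms are maximum norms; comparison with the Euclidean one costs
    factors 2. *)

Section PlaneAlgebra.
Variable R : realType.
Implicit Types (u v w x y z : plane R) (a b t : R).

Lemma p1Z a u : (a *: u).1 = a * u.1 :> R. Proof. by []. Qed.
Lemma p2Z a u : (a *: u).2 = a * u.2 :> R. Proof. by []. Qed.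
Lemma p1D u v : (u + v).1 = u.1 + v.1 :> R. Proof. by []. Qed.
Lemma p2D u v : (u + v).2 = u.2 + v.2 :> R. Proof. by []. Qed.
Lemma p1N u : (- u).1 = - u.1 :> R. Proof. by []. Qed.
Lemma p2N u : (- u).2 = - u.2 :> R. Proof. by []. Qed.
Definition pE := (p1Z, p2Z, p1D, p2D, p1N, p2N).

Lemma peq u v : u.1 = v.1 :> R -> u.2 = v.2 :> R -> u = v.
Proof. by case: u v => [u1 u2] [v1 v2] /= -> ->. Qed.

(** The area form. Its vanishing expresses that two directions agree, whatever the signs of the
    vectors that represent them. *)
Definition cross u v : R := u.1 * v.2 - u.2 * v.1.

Lemma crossDl u v w : cross (u + v) w = cross u w + cross v w.
Proof. rewrite /cross /=; ring. Qed.

Lemma crossDr u v w : cross w (u + v) = cross w u + cross w v.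
Proof. rewrite /cross /=; ring. Qed.

Lemma crossZl a u w : cross (a *: u) w = a * cross u w.
Proof. rewrite /cross !pE; ring. Qed.

Lemma crossZr a u w : cross w (a *: u) = a * cross w u.
Proof. rewrite /cross !pE; ring. Qed.

Lemma crossC u v : cross u v = - cross v u.
Proof. rewrite /cross; ring. Qed.

Lemma crossvv u : cross u u = 0.
Proof. rewrite /cross; ring. Qed.

Lemma crossNl u v : cross (- u) v = - cross u v.
Proof. rewrite /cross /=; ring. Qed.

Lemma crossNr u v : cross u (- v) = - cross u v.
Proof. rewrite /cross /=; ring. Qed.

Lemma cross0l u : cross 0 u = 0.
Proof. rewrite /cross /=; ring. Qed.

Lemma cross0r u : cross u 0 = 0.
Proof. rewrite /cross /=; ring. Qed.

Lemma cramer u v w : cross u v *: w = cross w v *: u + cross u w *: v.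
Proof. by apply: peq; rewrite !pE /cross; ring. Qed.

Lemma cramer_div u v w : cross u v != 0 ->
  w = (cross w v / cross u v) *: u + (cross u w / cross u v) *: v.
Proof.
move=> h; apply: (scalerI h); rewrite cramer scalerDr !scalerA.
by rewrite !(mulrC (cross u v)) !divfK.
Qed.

Definition e1 : plane R := (1, 0).
Definition e2 : plane R := (0, 1).

Lemma e12E v : v = (v.1 : R) *: e1 + (v.2 : R) *: e2.
Proof. by apply: peq; rewrite !pE /=; ring. Qed.

Lemma lin2E (L : {linear plane R -> plane R}) v :
  L v = (v.1 : R) *: L e1 + (v.2 : R) *: L e2.
Proof. by rewrite {1}[v]e12E linearD !linearZ. Qed.

Lemma cross_lin (L : {linear plane R -> plane R}) u v :
  cross (L u) (L v) = cross (L e1) (L e2) * cross u v.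
Proof.
rewrite (lin2E L u) (lin2E L v) !(crossDl, crossDr, crossZl, crossZr) !crossvv.
rewrite (crossC (L e2)) [cross u v]/cross; ring.
Qed.

Lemma pnormE u : `|u| = Num.max `|u.1 : R| `|u.2 : R| :> R.
Proof. by []. Qed.

Lemma norm1_le u : `|u.1 : R| <= `|u|.
Proof. by rewrite pnormE le_max lexx. Qed.

Lemma norm2_le u : `|u.2 : R| <= `|u|.
Proof. by rewrite pnormE le_max lexx orbT. Qed.

Lemma pnorm_le u a : `|u.1 : R| <= a -> `|u.2 : R| <= a -> `|u| <= a.
Proof. by move=> h1 h2; rewrite pnormE ge_max h1 h2. Qed.

Lemma norm_cross u v : `|cross u v| <= 2 * (`|u| * `|v|).
Proof.
rewrite /cross (le_trans (ler_normB _ _))// !normrM mulr2n mulrDl mul1r.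
by apply: lerD; apply: ler_pM => //; rewrite ?norm1_le ?norm2_le.
Qed.

Lemma enorm_ge v : `|v| <= enorm v.
Proof.
rewrite /enorm; apply: pnorm_le; rewrite -sqrtr_sqr ler_wsqrtr//.
  by rewrite lerDl sqr_ge0.
by rewrite lerDr sqr_ge0.
Qed.

Lemma enorm_le v : enorm v <= 2 * `|v|.
Proof.
rewrite /enorm -[leRHS]ger0_norm ?mulr_ge0// -sqrtr_sqr.
apply: ler_wsqrtr; rewrite exprMn.
have h1 : (v.1 : R) ^+ 2 <= `|v| ^+ 2.
  by rewrite -real_normK ?num_real// lerXn2r ?nnegrE// norm1_le.
have h2 : (v.2 : R) ^+ 2 <= `|v| ^+ 2.
  by rewrite -real_normK ?num_real// lerXn2r ?nnegrE// norm2_le.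
have := sqr_ge0 `|v|; lra.
Qed.

Lemma enorm_gt0 v : v != 0 -> 0 < enorm v.
Proof. by move=> h; rewrite (lt_le_trans _ (enorm_ge v))// normr_gt0. Qed.

End PlaneAlgebra.

(** * Derivatives and mean value estimates in the plane *)

Section PlaneCalculus.
Variable R : realType.
Implicit Types (u v w x y z : plane R) (a b t : R).

Lemma is_derive_cvg (V : normedModType R) (c : R -> V) (t : R) (v : V) :
  is_derive t 1 c v <-> h^-1 *: (c (h + t) - c t) @[h --> (0:R)^'] --> v.
Proof.
have E : (fun h : R => h^-1 *: ((c \o shift t) (h *: 1) - c t)) =
    (fun h => h^-1 *: (c (h + t) - c t)).
  by apply/funext => h; rewrite /= /GRing.scale /= mulr1.
split.
  move=> [dc <-]; rewrite /derive -E; exact: dc.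
move=> h; split.
  by rewrite /derivable E; apply/cvg_ex; exists v.
by rewrite /derive E; apply/cvg_lim.
Qed.

Lemma is_derive_fst (c : R -> plane R) (t : R) (v : plane R) :
  is_derive t 1 c v -> is_derive t 1 (fun s => (c s).1 : R) v.1.
Proof.
move=> /is_derive_cvg h; apply/is_derive_cvg.
rewrite -[X in X @ _ --> _]/(fst \o (fun h => h^-1 *: (c (h + t) - c t))).
apply: cvg_comp; first exact: h.
exact: cvg_fst.
Qed.

Lemma is_derive_snd (c : R -> plane R) (t : R) (v : plane R) :
  is_derive t 1 c v -> is_derive t 1 (fun s => (c s).2 : R) v.2.
Proof.
move=> /is_derive_cvg h; apply/is_derive_cvg.
rewrite -[X in X @ _ --> _]/(snd \o (fun h => h^-1 *: (c (h + t) - c t))).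
apply: cvg_comp; first exact: h.
exact: cvg_snd.
Qed.

Lemma is_derive_pair (c1 c2 : R -> R) t a b :
  is_derive t 1 c1 a -> is_derive t 1 c2 b ->
  is_derive t 1 (fun s => (c1 s, c2 s) : plane R) (a, b).
Proof.
move=> [d1 <-] [d2 <-].
have /derivable1_diffP e1 := d1.
have /derivable1_diffP e2 := d2.
have e : differentiable (fun s => (c1 s, c2 s) : plane R) t.
  exact: differentiable_pair.
split; first exact/derivable1_diffP.
by rewrite deriveE // diff_pair //= !deriveE.
Qed.

(* The library's differential is a choice that unification may unfold; it is
   sealed here. *)
Fact D_sealed : {D : forall (V : normedModType R) (F : plane R -> V),
  plane R -> {linear plane R -> V} | forall V F x, D V F x = 'd F x}.
Proof. by exists (fun V F x => 'd F x). Qed.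

Definition D (V : normedModType R) (F : plane R -> V) (x : plane R) :
  {linear plane R -> V} := sval D_sealed V F x.

Lemma DE (V : normedModType R) (F : plane R -> V) x : D F x = 'd F x.
Proof. exact: (svalP D_sealed). Qed.

Lemma D_derive (V : normedModType R) (F : plane R -> V) x v :
  differentiable F x -> D F x v = 'D_v F x.
Proof. by move=> dF; rewrite DE deriveE. Qed.

Lemma is_derive_comp2 (F : plane R -> plane R) (c : R -> plane R) (t : R) v :
  differentiable F (c t) -> is_derive t 1 c v ->
  is_derive t 1 (F \o c) (D F (c t) v).
Proof.
move=> dF [dc <-].
have /derivable1_diffP d := dc.
have df : differentiable (F \o c) t by apply: differentiable_comp.
split; first exact/derivable1_diffP.
by rewrite DE deriveE // diff_comp //= deriveE.
Qed.

Lemma is_derive_affine (V : normedModType R) (x v : V) (t : R) :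
  is_derive t 1 (fun s : R => x + s *: v) v.
Proof.
apply/is_derive_cvg.
apply: cvg_near_cst; near=> h.
rewrite opprD addrACA subrr add0r -scalerBl addrK scalerA mulVf ?scale1r//.
by near: h; exact: nbhs_dnbhs_neq.
Unshelve. all: by end_near. Qed.

Lemma MVT_cc (g dg : R -> R) a b : a <= b ->
  (forall t : R, a <= t <= b -> is_derive t 1 g (dg t)) ->
  exists2 t, a <= t <= b & g b - g a = dg t * (b - a).
Proof.
move=> ab h.
have [||t] := @MVT_segment R g dg a b ab.
- by move=> t; rewrite in_itv /= => /andP[/ltW t1 /ltW t2]; apply/h/andP.
- apply: derivable_within_continuous => t; rewrite in_itv /= => tab.
  by have [] := h _ tab.
- by rewrite in_itv /= => tab e; exists t.
Qed.

Lemma mvt_plane (c dc : R -> plane R) a b : a <= b ->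
  (forall t : R, a <= t <= b -> is_derive t 1 c (dc t)) ->
  (exists2 t, a <= t <= b & (c b).1 - (c a).1 = (dc t).1 * (b - a) :> R) /\
  (exists2 t, a <= t <= b & (c b).2 - (c a).2 = (dc t).2 * (b - a) :> R).
Proof.
move=> ab h; split.
- by apply: (@MVT_cc (fun s => (c s).1) (fun s => (dc s).1)) => // t /h /is_derive_fst.
- by apply: (@MVT_cc (fun s => (c s).2) (fun s => (dc s).2)) => // t /h /is_derive_snd.
Qed.

(** Each coordinate obeys the scalar mean value theorem with its own intermediate point; for the
    maximum norm no constant is lost. *)
Lemma mvt_curve_le (c dc : R -> plane R) a b B : a <= b ->
  (forall t : R, a <= t <= b -> is_derive t 1 c (dc t)) ->
  (forall t, a <= t <= b -> `|dc t| <= B) -> `|c b - c a| <= B * (b - a).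
Proof.
move=> ab h hB; have [[t tab e] [s sab e']] := mvt_plane ab h.
have ba : `|b - a| = b - a by rewrite ger0_norm// subr_ge0.
apply: pnorm_le; rewrite pE.
- by rewrite p1N e normrM ba ler_wpM2r ?subr_ge0// (le_trans (norm1_le _))// hB.
- by rewrite p2N e' normrM ba ler_wpM2r ?subr_ge0// (le_trans (norm2_le _))// hB.
Qed.

Lemma is_derive_on_line (F : plane R -> plane R) (x v : plane R) (t : R) :
  (forall z, differentiable F z) ->
  is_derive t 1 (fun s : R => F (x + s *: v)) (D F (x + t *: v) v).
Proof.
move=> dF; apply: (@is_derive_comp2 F (fun s => x + s *: v)) => //.
exact: is_derive_affine.
Qed.

Lemma mvt_plane_le (F : plane R -> plane R) (x y : plane R) B :
  (forall z, differentiable F z) ->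
  (forall t, 0 <= t <= 1 -> `|D F (x + t *: (y - x)) (y - x)| <= B) ->
  `|F y - F x| <= B.
Proof.
move=> dF hB.
have := @mvt_curve_le (fun s => F (x + s *: (y - x)))
   (fun t => D F (x + t *: (y - x)) (y - x)) 0 1 B ler01.
rewrite scale1r scale0r addr0 [x + _]addrC subrK subr0 mulr1; apply => //.
by move=> t _; exact: is_derive_on_line.
Qed.

(* The remainder of the first-order expansion is controlled by the mean value
   inequality applied to the difference with the linear part. *)
Lemma taylor_plane_le (F : plane R -> plane R) (x y : plane R) (C : R) :
  (forall z, differentiable F z) ->
  (forall z w v, `|D F z v - D F w v| <= C * `|z - w| * `|v|) ->
  `|F y - F x - D F x (y - x)| <= C * `|y - x| ^+ 2.
Proof.
move=> dF hC.
have := @mvt_curve_le (fun s => F (x + s *: (y - x)) - s *: D F x (y - x))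
   (fun t => D F (x + t *: (y - x)) (y - x) - D F x (y - x)) 0 1
   (C * `|y - x| ^+ 2) ler01.
rewrite !scale1r !scale0r addr0 [x + (y - x)]addrC subrK !subr0 mulr1 addrAC; apply.
- move=> t _; apply: is_deriveB; first exact: is_derive_on_line.
  have := is_derive_affine 0 (D F x (y - x)) t.
  by under eq_fun do rewrite add0r.
- move=> t /andP[t0 t1]; rewrite (le_trans (hC _ _ _))// expr2 mulrA.
  rewrite ler_wpM2r// addrAC subrr add0r normrZ ger0_norm//.
  (* The sign of [C] is read off the Lipschitz bound at a nonzero vector. *)
  have : 0 <= C * `|y - x|.
    have := le_trans (normr_ge0 _) (hC y x (1, 0)).
    rewrite pmulr_lge0// normr_gt0; apply/eqP => -[/eqP]; by rewrite oner_eq0.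
  move: t0 t1; move: `|y - x| => d *; nra.
Qed.

End PlaneCalculus.

(** * Maps of the torus and their lifts *)

Section IntegerTranslations.
Variable R : realType.
Implicit Types (u v w x y z k : plane R) (a b t : R).

Definition zpt k := (k.1 \is a Num.int) && (k.2 \is a Num.int).

Lemma zptD k l : zpt k -> zpt l -> zpt (k + l).
Proof. by move=> /andP[k1 k2] /andP[l1 l2]; apply/andP; rewrite !rpredD. Qed.

Lemma zptN k : zpt k -> zpt (- k).
Proof. by move=> /andP[k1 k2]; apply/andP; rewrite !rpredN. Qed.

Lemma torus_projP x y : torus_proj x = torus_proj y <-> zpt (x - y).
Proof.
split=> [/eqP|h].
  by rewrite /torus_proj => /eqP/eqquotP.
by apply/eqquotP.
Qed.

Lemma repr_torus x : zpt (repr (torus_proj x) - x).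
Proof. by apply/torus_projP; rewrite /torus_proj reprK. Qed.

Lemma torus_repr (p : torus R) : torus_proj (repr p) = p.
Proof. exact: reprK. Qed.

(** Two different integer values would force, by the intermediate value theorem, a value of the form
    [z + 1/2]. *)
Lemma int_valued_cst (g : R -> R) a b : continuous g ->
  (forall t, g t \is a Num.int) -> g a = g b.
Proof.
move=> cg ig.
have half (z : int) : ~ (z%:~R + 2^-1 : R) \is a Num.int.
  move=> /intrP[m /(congr1 (fun r : R => 2 * r))].
  rewrite mulrDr divff// -[2]/(2%:~R) -[1]/(1%:~R) -!intrM -intrD => /eqP.
  by rewrite eqr_int => /eqP; lia.
have step (z m : int) : z < m -> (z%:~R : R) + 2^-1 <= m%:~R.
  rewrite -lezD1 -(ler_int R) intrD; lra.
have key c d : c <= d -> g c = g d.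
  move=> cd; apply/eqP/negPn/negP => ne.
  have /intrP[z hz] := ig c; have /intrP[m hm] := ig d.
  have {ne} : z != m by rewrite -(eqr_int R) -hz -hm.
  rewrite neq_lt => /orP[] zm; have := step _ _ zm; rewrite ?hz ?hm => zm'.
  - have [e _ he] : exists2 e, e \in `[c, d] & g e = z%:~R + 2^-1.
      apply: IVT => //; first exact: continuous_subspaceT.
      by rewrite hz hm ge_min le_max zm' lerDl invr_ge0 ler0n orbT.
    by apply: (half z); rewrite -he.
  - have [e _ he] : exists2 e, e \in `[c, d] & g e = m%:~R + 2^-1.
      apply: IVT => //; first exact: continuous_subspaceT.
      by rewrite hz hm ge_min le_max zm' lerDl invr_ge0 ler0n orbT.
    by apply: (half m); rewrite -he.
by case: (leP a b) => [/key//|/ltW/key].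
Qed.

Lemma floor_pt x : exists2 k, zpt k & 0 <= ((x - k).1 : R) <= 1 /\ 0 <= ((x - k).2 : R) <= 1.
Proof.
exists ((Num.floor (x.1 : R))%:~R, (Num.floor (x.2 : R))%:~R).
  by rewrite /zpt /= !intr_int.
have h (r : R) : 0 <= r - (Num.floor r)%:~R <= 1.
  have /andP[h1 h2] := floor_itv r.
  rewrite subr_ge0 h1 lerBlDr addrC; apply: ltW.
  by rewrite -[1]/(1%:~R) -intrD.
by split; apply: h.
Qed.

Lemma compact_square : compact (`[0, 1] `*` `[0, 1] : set (plane R)).
Proof. by apply: compact_setX; apply: segment_compact. Qed.

Lemma periodic_bounded (V : normedModType R) (g : plane R -> V) : continuous g ->
  (forall x k, zpt k -> g (x + k) = g x) -> exists2 B : R, 0 < B & forall x, `|g x| <= B.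
Proof.
move=> cg pg.
have [|||c _ hc] := @compact_EVT_max (plane R) R (fun x => `|g x|) (`[0, 1] `*` `[0, 1]).
- by exists (0, 0); split => /=; rewrite in_itv /= lexx ler01.
- exact: compact_square.
- by apply: continuous_subspaceT => x; apply: (continuous_comp (cg x)); apply: norm_continuous.
exists (`|g c| + 1) => [|x]; first by rewrite ltr_wpDl.
have [k zk [k1 k2]] := floor_pt x.
rewrite -[x](subrK k) pg // (le_trans (hc _ _)) ?lerDl//.
by rewrite inE; split; rewrite /= in_itv.
Qed.

End IntegerTranslations.

Section LiftBasics.
Variable R : realType.
Implicit Types (u v w x y z k : plane R) (a b t : R).

Lemma diff_translate (V : normedModType R) (F : plane R -> V) (k : plane R) (b : V) :
  (forall x, differentiable F x) -> (forall x, F (x + k) = F x + b) ->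
  forall x v, D F (x + k) v = D F x v.
Proof.
move=> dF Fk x v; rewrite (D_derive v (dF x)) (D_derive v (dF (x + k))) /derive.
suff -> : (fun h : R => h^-1 *: ((F \o shift (x + k)) (h *: v) - F (x + k))) =
   (fun h : R => h^-1 *: ((F \o shift x) (h *: v) - F x)) by [].
apply/funext => h /=; congr (_ *: _).
by rewrite addrA !Fk opprD addrACA subrr addr0.
Qed.

(** The difference [F (x + k) - F x] is continuous and has integer coordinates, hence is constant;
    connectedness is used along the segment from 0 to [x], one coordinate at a time. *)
Lemma lift_translate (f : torus R -> torus R) (F : plane R -> plane R) (k : plane R) :
  is_lift f F -> zpt k ->
  zpt (F k - F 0) /\ forall x, F (x + k) = F x + (F k - F 0).
Proof.
move=> [cF lF] zk.
have zz x : zpt (F (x + k) - F x).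
  apply/torus_projP; rewrite -!lF; congr (f _); apply/torus_projP.
  by rewrite addrAC subrr add0r.
split=> [|x]; first by have := zz 0; rewrite add0r.
have cl (h : plane R -> R) : continuous h -> continuous (fun s : R => h (F (s *: x + k) - F (s *: x))).
  move=> ch s.
  apply: (@continuous_comp _ _ _ (fun s : R => F (s *: x + k) - F (s *: x)) h); last exact: ch.
  apply: continuousB.
    apply: (@continuous_comp _ _ _ (fun s : R => s *: x + k) F); last exact: cF.
    by apply: continuousD; [exact: scalel_continuous|exact: cst_continuous].
  apply: (@continuous_comp _ _ _ (fun s : R => s *: x) F); last exact: cF.
  exact: scalel_continuous.
have c1 := cl fst; have c2 := cl snd.
suff e : F (x + k) - F x = F k - F 0 by rewrite -e [RHS]addrC subrK.
apply: peq.
- have := @int_valued_cst R (fun s : R => (F (s *: x + k) - F (s *: x)).1) 1 0.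
  rewrite scale1r scale0r add0r; apply; first by apply: c1 => ?; exact: cvg_fst.
  by move=> t; have /andP[] := zz (t *: x).
- have := @int_valued_cst R (fun s : R => (F (s *: x + k) - F (s *: x)).2) 1 0.
  rewrite scale1r scale0r add0r; apply; first by apply: c2 => ?; exact: cvg_snd.
  by move=> t; have /andP[] := zz (t *: x).
Qed.

(** What the proof retains of C^2 regularity: a form with explicit constants that survives
    composition and inversion. *)
Definition C11 (F : plane R -> plane R) (M C : R) :=
  [/\ forall z, differentiable F z, 0 < M, 0 < C,
      forall z v, `|D F z v| <= M * `|v| &
      forall z w v, `|D F z v - D F w v| <= C * `|z - w| * `|v|].

Lemma norm_lin2 (L : {linear plane R -> plane R}) B v :
  `|L (e1 R)| <= B -> `|L (e2 R)| <= B -> `|L v| <= 2 * B * `|v|.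
Proof.
move=> h1 h2; rewrite lin2E (le_trans (ler_normD _ _))// !normrZ mulr2n !mulrDl mul1r.
rewrite !(mulrC B); apply: lerD; apply: ler_pM => //; rewrite ?norm1_le ?norm2_le//.
Qed.

(** [F] is not periodic, but its first two derivatives are, hence they are bounded by compactness of
    the unit square; the Lipschitz bound is the mean value inequality for [D F] along a fixed
    vector. *)
Lemma lift_C11 (f : torus R -> torus R) (F : plane R -> plane R) :
  is_lift f F -> Ck_on 2 setT F -> exists M C, C11 F M C.
Proof.
move=> lF [/= dF hF].
have {}dF x : differentiable F x by apply: dF.
have {}hF v : (forall x, True -> differentiable (fun x => D F x v) x) /\
    (forall w x, True -> {for x, continuous (fun x => D (fun y => D F y v) x w)}).
  have e : (fun x => D F x v) = (fun x => 'd F x v) by apply/funext => x; rewrite DE.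
  have [h1 h2] := hF v; split; first by rewrite e.
  move=> w x _; rewrite e.
  have -> : (fun x => D (fun y => 'd F y v) x w) = (fun x => 'd (fun y => 'd F y v) x w).
    by apply/funext => y; rewrite DE.
  exact: h2.
have pF k x v : zpt k -> D F (x + k) v = D F x v.
  by move=> zk; have [_ h] := lift_translate lF zk; apply: (diff_translate dF h).
have d2 v x : differentiable (fun x => D F x v) x by case: (hF v) => + _; apply.
have cd v : continuous (fun x => D F x v).
  by move=> x; apply: differentiable_continuous.
have cd2 v w : continuous (fun x => D (fun x => D F x v) x w).
  by move=> x; case: (hF v) => _ /(_ w x I).
have p2 v k x w : zpt k -> D (fun x => D F x v) (x + k) w = D (fun x => D F x v) x w.
  move=> zk; apply: (@diff_translate _ _ k 0); first exact: d2.
  by move=> y; rewrite addr0; apply: pF.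
have bd v : exists2 B : R, 0 < B & forall x, `|D F x v| <= B.
  by apply: periodic_bounded => // x k /pF ->.
have bd2 v w : exists2 B : R, 0 < B & forall x, `|D (fun x => D F x v) x w| <= B.
  by apply: periodic_bounded => // x k /p2 ->.
have [B1 B1p hB1] := bd (e1 R); have [B2 B2p hB2] := bd (e2 R).
have [B11 B11p hB11] := bd2 (e1 R) (e1 R); have [B12 B12p hB12] := bd2 (e1 R) (e2 R).
have [B21 B21p hB21] := bd2 (e2 R) (e1 R); have [B22 B22p hB22] := bd2 (e2 R) (e2 R).
pose B := B11 + B12 + B21 + B22.
have Lip v z w : (forall x, `|D (fun x => D F x v) x (e1 R)| <= B) ->
    (forall x, `|D (fun x => D F x v) x (e2 R)| <= B) ->
    `|D F z v - D F w v| <= 2 * B * `|z - w|.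
  move=> h1 h2; apply: (@mvt_plane_le _ (fun x => D F x v)) => // t _.
  exact: norm_lin2.
exists (2 * (B1 + B2)), (2 * (2 * B)); split => //.
- by rewrite mulr_gt0// addr_gt0.
- by rewrite !mulr_gt0// /B !addr_gt0.
- move=> z v; apply: norm_lin2; [rewrite (le_trans (hB1 _))//|rewrite (le_trans (hB2 _))//]; lra.
- move=> z w v.
  have := @norm_lin2 (D F z \- D F w) (2 * B * `|z - w|) v; rewrite /= !mulrA; apply.
  + by rewrite -mulrA mulrA; apply: Lip => x; [rewrite (le_trans (hB11 _))//|rewrite (le_trans (hB12 _))//]; rewrite /B; lra.
  + by rewrite -mulrA mulrA; apply: Lip => x; [rewrite (le_trans (hB21 _))//|rewrite (le_trans (hB22 _))//]; rewrite /B; lra.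
Qed.

End LiftBasics.

(** * The Jacobian determinant of the lift *)

Section Jacobian.
Variable R : realType.
Implicit Types (u v w x y z : plane R) (a b t : R).

Lemma pnorm_e1 : `|e1 R| = 1.
Proof. by rewrite pnormE /= normr1 normr0 max_l. Qed.

Lemma pnorm_e2 : `|e2 R| = 1.
Proof. by rewrite pnormE /= normr1 normr0 max_r. Qed.

Lemma local_diffeo_inj (F : plane R -> plane R) x v :
  local_C1_diffeo F -> D F x v = 0 -> v = 0.
Proof.
move=> /(_ x)[U [G [[oU Ux] oFU [dF _] [dG _] GF]]] Fv0.
have dFx : differentiable F x by apply: dF.
have dGx : differentiable G (F x) by apply: dG; exists x.
have dGF : differentiable (G \o F) x by apply: differentiable_comp.
have e : D (G \o F) x v = 0.
  by rewrite DE diff_comp //= -!DE Fv0 linear0.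
rewrite -e D_derive // -[LHS](@derive_id _ _ x v).
apply: near_eq_derive; near=> z; rewrite /= GF //.
near: z; exact: open_nbhs_nbhs.
Unshelve. all: by end_near. Qed.

Definition jdet (F : plane R -> plane R) x : R := cross (D F x (e1 R)) (D F x (e2 R)).

Lemma jdetE F x u v : cross (D F x u) (D F x v) = jdet F x * cross u v.
Proof. exact: cross_lin. Qed.

Lemma continuous_cross (T : topologicalType) (g h : T -> plane R) :
  continuous g -> continuous h -> continuous (fun p : T => cross (g p) (h p)).
Proof.
move=> cg ch p.
have c1 (k : T -> plane R) : continuous k -> (fun p => (k p).1 : R) x @[x --> p] --> ((k p).1 : R).
  by move=> ck; apply: (@cvg_comp _ _ _ k fst); [exact: ck|exact: cvg_fst].
have c2 (k : T -> plane R) : continuous k -> (fun p => (k p).2 : R) x @[x --> p] --> ((k p).2 : R).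
  by move=> ck; apply: (@cvg_comp _ _ _ k snd); [exact: ck|exact: cvg_snd].
by apply: cvgB; apply: cvgM; [exact: c1|exact: c2|exact: c2|exact: c1].
Qed.

Lemma C11_continuousD (F : plane R -> plane R) M C v :
  C11 F M C -> continuous (fun x => D F x v).
Proof.
move=> [_ _ C0 _ hC] x; apply/cvgrPdist_le => e e0.
have K0 : 0 < C * (`|v| + 1) by rewrite mulr_gt0// ltr_wpDl.
near=> z; rewrite (le_trans (hC _ _ _))//.
have : `|x - z| <= e / (C * (`|v| + 1)).
  by near: z; apply: cvgr_dist_le; rewrite ?divr_gt0//; exact: cvg_id.
rewrite ler_pdivlMr// => h.
have := normr_ge0 v; have := normr_ge0 (x - z); move: h; move: `|x - z| `|v| => p q; nra.
Unshelve. all: by end_near. Qed.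

Lemma segment_ivt (g : plane R -> R) x y : continuous g -> g x < 0 -> 0 < g y ->
  exists2 t, 0 <= t <= 1 & g (x + t *: (y - x)) = 0.
Proof.
move=> cg gx gy.
have [||t ht e] := @IVT R (fun t => g (x + t *: (y - x))) 0 1 0 ler01.
- apply: continuous_subspaceT => t.
  apply: (@continuous_comp _ _ _ (fun t : R => x + t *: (y - x)) g); last exact: cg.
  by apply: continuousD; [exact: cst_continuous|exact: scalel_continuous].
- by rewrite scale0r addr0 scale1r [x + _]addrC subrK ge_min le_max (ltW gx) (ltW gy) orbT.
- by exists t => //; move: ht; rewrite in_itv.
Qed.

(** The hypothesis controls only the absolute value. The determinant never vanishes, because [F] is
    a local diffeomorphism, and it is continuous along segments, so its sign cannot change. *)
Lemma constant_jdet (f : torus R -> torus R) (F : plane R -> plane R) M C :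
  is_lift f F -> C11 F M C -> local_C1_diffeo F -> constant_jacobian F ->
  exists2 j : R, j != 0 & forall x u v, cross (D F x u) (D F x v) = j * cross u v.
Proof.
move=> lF hF ld [J hJ]; have [dF _ _ _ _] := hF.
have jJ x : `|jdet F x| = J.
  rewrite -(hJ (torus_proj x)) /jac /tD.
  have /andP[z1 z2] := repr_torus x; set k := _ - x in z1 z2.
  have zk : zpt k by rewrite /zpt z1.
  have -> : repr (torus_proj x) = x + k by rewrite /k addrC subrK.
  have [_ h] := lift_translate lF zk.
  rewrite -!DE !(diff_translate dF h) /jdet /cross; congr (`|_|).
  by rewrite -/(e1 R) -/(e2 R); ring.
have j0 x : jdet F x != 0.
  apply/eqP => j0; suff : e1 R = 0 by move=> [/eqP]; rewrite oner_eq0.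
  have c0 v : cross (D F x (e1 R)) (D F x v) = 0 by rewrite jdetE j0 mul0r.
  have Fe1 : D F x (e1 R) = 0.
    case: (eqVneq (D F x (e1 R)) 0) => // ne.
    (* If the determinant vanishes, the vectors of [w1] and [w2], built from the entries of the
       matrix, lie in its trivial kernel; this makes the first column zero. *)
    pose a := (D F x (e1 R)).1 : R; pose b := (D F x (e1 R)).2 : R.
    pose c := (D F x (e2 R)).1 : R; pose d := (D F x (e2 R)).2 : R.
    have hcd : a * d = b * c by have := c0 (e2 R); rewrite /cross -/a -/b -/c -/d; lra.
    have w1 : D F x (c *: e1 R - a *: e2 R) = 0.
      rewrite linearB !linearZ /=; apply: peq; rewrite !pE -/a -/b -/c -/d /=; lra.
    have w2 : D F x (d *: e1 R - b *: e2 R) = 0.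
      rewrite linearB !linearZ /=; apply: peq; rewrite !pE -/a -/b -/c -/d /=; lra.
    have /(congr1 snd) := local_diffeo_inj ld w1; have /(congr1 snd) := local_diffeo_inj ld w2.
    rewrite /= /GRing.scale /= !mulr0 !mulr1 !add0r => /eqP; rewrite oppr_eq0 => /eqP b0 /eqP.
    rewrite oppr_eq0 => /eqP a0.
    by apply: peq; rewrite -/a -/b /=.
  exact: local_diffeo_inj ld Fe1.
have cj : continuous (jdet F).
  by apply: continuous_cross => x; exact: (C11_continuousD hF).
have jcst x : jdet F x = jdet F 0.
  have neq p q : jdet F p < 0 -> 0 < jdet F q -> False.
    by move=> hp hq; have [t _ /eqP] := segment_ivt cj hp hq; rewrite (negbTE (j0 _)).
  have := jJ x; rewrite -(jJ 0); have := j0 x; have := j0 0.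
  rewrite !neq_lt => /orP[] h0 /orP[] hx.
  - by rewrite !ltr0_norm// => /oppr_inj.
  - by case: (neq _ _ h0 hx).
  - by case: (neq _ _ hx h0).
  - by rewrite !gtr0_norm.
by exists (jdet F 0) => // x u v; rewrite jdetE jcst.
Qed.

End Jacobian.

(** * Global invertibility of the lift *)

Section GlobalInverse.
Variable R : realType.
Implicit Types (u v w x y z : plane R) (a b t : R).

Definition lin2 u v w : plane R := (w.1 : R) *: u + (w.2 : R) *: v.

Lemma lin2_linear u v : linear (lin2 u v).
Proof.
move=> a w z; rewrite /lin2 scalerDr !scalerA !pE !scalerDl addrACA; congr (_ + _ + _).
Qed.

HB.instance Definition _ u v :=
  GRing.isLinear.Build R (plane R) (plane R) _ (lin2 u v) (lin2_linear u v).

Lemma continuous_lin2 u v : continuous (lin2 u v).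
Proof.
move=> w; apply: cvgD.
  apply: (@cvg_comp _ _ _ (fun w : plane R => w.1 : R) (fun t : R => t *: u)); first exact: cvg_fst.
  exact: scalel_continuous.
apply: (@cvg_comp _ _ _ (fun w : plane R => w.2 : R) (fun t : R => t *: v)); first exact: cvg_snd.
exact: scalel_continuous.
Qed.

(** A quadratic error is stronger than the little-o that characterizes the differential. This is the
    route to differentiability of the inverse map. *)
Lemma quadratic_differentiable (F : plane R -> plane R) x u v (K r : R) : 0 < r ->
  (forall y, `|y - x| <= r -> `|F y - F x - lin2 u v (y - x)| <= K * `|y - x| ^+ 2) ->
  differentiable F x /\ forall w, D F x w = lin2 u v w.
Proof.
move=> r0 hK.
have h : F \o shift x = cst (F x) + lin2 u v +o_ (0 : plane R) id.
  apply/eqaddoP => e e0.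
  have n1 (d : R) : 0 < d -> \forall z \near (0 : plane R), `|z| <= d by exact: nbhs0_le.
  near=> z; have hz : `|z| <= r by near: z; apply: n1.
  have hz' : `|z| <= e / (`|K| + 1) by near: z; apply: n1; rewrite divr_gt0// ltr_wpDl.
  have := hK (z + x); rewrite addrK => /(_ hz).
  have -> : (F \o shift x - (cst (F x) + lin2 u v)) z = F (z + x) - F x - lin2 u v z.
    by rewrite -[RHS]addrA -opprD.
  move=> /le_trans; apply.
  rewrite expr2 mulrA ler_wpM2r// (le_trans (ler_norm _))// normrM normr_id.
  rewrite ler_pdivlMr ?ltr_wpDl// in hz'; have := normr_ge0 K; have := normr_ge0 z.
  nra.
have e : 'd F x = lin2 u v :> (plane R -> plane R).
  exact: diff_unique (@continuous_lin2 u v) h.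
split; last by move=> w; rewrite DE e.
apply/diff_locallyP; rewrite e; split => //; exact: continuous_lin2.
Unshelve. all: by end_near. Qed.

Variables (F : plane R -> plane R) (M C j : R).
Hypothesis hF : C11 F M C.
Hypothesis j0 : j != 0.
Hypothesis hj : forall x u v, cross (D F x u) (D F x v) = j * cross u v.

Let dF : forall z, differentiable F z. Proof. by case: hF. Qed.
Let M0 : 0 < M. Proof. by case: hF. Qed.
Let C0 : 0 < C. Proof. by case: hF. Qed.
Let hM z v : `|D F z v| <= M * `|v|. Proof. by case: hF. Qed.
Let hC z w v : `|D F z v - D F w v| <= C * `|z - w| * `|v|. Proof. by case: hF. Qed.

(** Up to sign, a coordinate of [v] is a cross product with a basis vector, and [D F x] multiplies
    cross products by [j]; so [D F x v] cannot be small unless [v] is. *)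
Lemma D_expand : exists2 N, 0 < N & forall x v, `|v| <= N * `|D F x v|.
Proof.
have nj : 0 < `|j| by rewrite normr_gt0.
exists (2 * M / `|j|) => [|x v]; first by rewrite divr_gt0// mulr_gt0.
have h w : `|w| = 1 -> `|cross v w| <= 2 * M / `|j| * `|D F x v|.
  move=> w1; rewrite mulrAC ler_pdivlMr// -normrM [_ * j]mulrC -(hj x).
  rewrite (le_trans (norm_cross _ _))// -mulrA ler_pM2l// mulrC ler_wpM2r//.
  by rewrite (le_trans (hM _ _))// w1 mulr1.
apply: pnorm_le.
- have := h _ (pnorm_e2 R); by rewrite /cross /= mulr1 mulr0 subr0.
- have := h _ (pnorm_e1 R); by rewrite /cross /= mulr1 mulr0 sub0r normrN.
Qed.

Lemma D_surj x c : exists w, D F x w = c.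
Proof.
exists ((cross c (D F x (e2 R)) / j) *: e1 R + (cross (D F x (e1 R)) c / j) *: e2 R).
have e : cross (D F x (e1 R)) (D F x (e2 R)) = j by rewrite hj /cross /= !mulr1 mulr0 subr0 mulr1.
by rewrite linearD !linearZ /= -{1 2}e -cramer_div // e.
Qed.

Lemma F_lip x y : `|F y - F x| <= M * `|y - x|.
Proof. by apply: mvt_plane_le. Qed.

Lemma F_taylor x y : `|F y - F x - D F x (y - x)| <= C * `|y - x| ^+ 2.
Proof. exact: taylor_plane_le. Qed.

Variable N : R.
Hypothesis N0 : 0 < N.
Hypothesis hN : forall x v, `|v| <= N * `|D F x v|.

(** Within distance [1 / (2 N C)] the quadratic Taylor remainder eats at most half of the linear
    lower bound. The radius is the same at all points, which the two chain arguments rely on. *)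
Lemma F_expand : exists2 r : R, 0 < r &
  forall x y, `|y - x| <= r -> `|y - x| <= 2 * N * `|F y - F x|.
Proof.
have NC : 0 < 2 * N * C by rewrite !mulr_gt0.
exists (2 * N * C)^-1 => [|x y h]; first by rewrite invr_gt0.
have h1 : `|D F x (y - x)| <= `|F y - F x| + C * `|y - x| ^+ 2.
  rewrite -[D F x _](subKr (F y - F x)) (le_trans (ler_normB _ _))// lerD2l.
  exact: F_taylor.
have h2 := le_trans (hN x (y - x)) (ler_wpM2l (ltW N0) h1).
have : N * (C * `|y - x| ^+ 2) <= `|y - x| / 2.
  have : 2 * N * C * `|y - x| <= 1.
    by move: h; rewrite -[_^-1]mul1r ler_pdivlMr // mulrC.
  have := normr_ge0 (y - x); rewrite expr2; move: `|_| => d d0 hd; nra.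
lra.
Qed.

Variable r : R.
Hypothesis r0 : 0 < r.
Hypothesis hr : forall x y, `|y - x| <= r -> `|y - x| <= 2 * N * `|F y - F x|.

Lemma compact_box x (s : R) :
  compact (`[(x.1 : R) - s, (x.1 : R) + s] `*` `[(x.2 : R) - s, (x.2 : R) + s] : set (plane R)).
Proof. by apply: compact_setX; apply: segment_compact. Qed.

Lemma in_box x y (s : R) :
  ((`[(x.1 : R) - s, (x.1 : R) + s] `*` `[(x.2 : R) - s, (x.2 : R) + s]) y) <-> `|y - x| <= s.
Proof.
rewrite /= !in_itv /= -!ler_distlC pnormE ge_max !pE.
by rewrite [`|x.1 - _|]distrC [`|x.2 - _|]distrC; split => [[-> ->]//|/andP[]].
Qed.

(* At a minimum z of the distance to the target y, moving along the preimage
   of y - F z under the differential would decrease the distance. *)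
Lemma local_surj x y : `|y - F x| < r / (8 * N) -> exists2 z, `|z - x| <= r & F z = y.
Proof.
pose delta := r / (8 * N); rewrite -/delta => yx; have cF : continuous F by move=> ?; apply: differentiable_continuous.
have [||z] := @compact_EVT_min (plane R) R (fun z => `|F z - y|) _ _ (@compact_box x r).
- by exists x; apply/in_box; rewrite subrr normr0 ltW.
- apply: continuous_subspaceT => z; apply: (@cvg_comp _ _ _ (fun z => F z - y) (fun v => `|v|)).
    by apply: cvgB; [exact: cF|exact: cvg_cst].
  exact: norm_continuous.
rewrite inE => /in_box zx hz; exists z => //.
have {}hz w : `|w - x| <= r -> `|F z - y| <= `|F w - y|.
  by move=> /in_box wx; apply: hz; rewrite inE.
apply/eqP; rewrite -subr_eq0; apply/negPn/negP; rewrite -normr_gt0 => g0.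
have gd : `|F z - y| < delta.
  by rewrite (le_lt_trans (hz x _)) ?subrr ?normr0 1?ltW// -opprB normrN.
(* The minimum is interior: [F z] is within [2 * delta] of [F x], while points at distance [r] from
   [x] are sent at distance at least [4 * delta]. *)
have zi : `|z - x| < r.
  apply: le_lt_trans (hr zx) _.
  rewrite mulrC -ltr_pdivlMr ?mulr_gt0//.
  rewrite -[F z - F x](subrKA y) (le_lt_trans (ler_normD _ _))//.
  have -> : r / (2 * N) = 4 * delta by rewrite /delta; field; rewrite gt_eqF.
  move: gd yx; lra.
have [w hw] := D_surj z (y - F z).
have [t [t0 t1 tw tq]] : exists t, [/\ 0 < t, t <= 1, t * `|w| <= r - `|z - x| &
    C * `|w| ^+ 2 * t <= `|F z - y| / 2].
  (* The second term keeps the displaced point in the box; the third makes the quadratic error at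
     most half of the first-order gain. *)
  exists (Num.min 1 (Num.min ((r - `|z - x|) / (`|w| + 1)) (`|F z - y| / 2 / (C * `|w| ^+ 2 + 1)))).
  have p1 : 0 < `|w| + 1 by rewrite ltr_wpDl.
  have p2 : 0 < C * `|w| ^+ 2 + 1 by rewrite ltr_wpDl// mulr_ge0// ?sqr_ge0// ltW.
  set m := Num.min _ _.
  have m0 : 0 < m by rewrite !lt_min ltr01 !divr_gt0// subr_gt0.
  have m1 : m <= 1 by rewrite ge_min lexx.
  have m2 : m <= (r - `|z - x|) / (`|w| + 1) by rewrite !ge_min lexx !orbT.
  have m3 : m <= `|F z - y| / 2 / (C * `|w| ^+ 2 + 1) by rewrite !ge_min lexx !orbT.
  split => //.
  - by move: m2; rewrite ler_pdivlMr// mulrDr mulr1; move: m0; lra.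
  - by move: m3; rewrite ler_pdivlMr// mulrDr mulr1 mulrC; move: m0; lra.
have := hz (z + t *: w).
rewrite addrAC (le_trans (ler_normD _ _)); last by rewrite normrZ (gtr0_norm t0) -lerBrDl.
move=> /(_ isT).
have := F_taylor z (z + t *: w); rewrite [z + _ - z]addrAC subrr add0r linearZ /= hw normrZ (gtr0_norm t0).
have -> : F (z + t *: w) - F z - t *: (y - F z) = (F (z + t *: w) - y) - (1 - t) *: (F z - y).
  by apply: peq; rewrite !pE; ring.
move=> h1 h2.
have h3 : `|F (z + t *: w) - y| <= C * (t * `|w|) ^+ 2 + (1 - t) * `|F z - y|.
  rewrite -[F (z + _) - y](subrK ((1 - t) *: (F z - y))) (le_trans (ler_normD _ _))//.
  by apply: lerD => //; rewrite normrZ ger0_norm ?subr_ge0.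
have : t * `|F z - y| <= C * (t * `|w|) ^+ 2 by move: h2 h3; lra.
rewrite exprMn; have : t * (C * `|w| ^+ 2 * t) <= t * (`|F z - y| / 2) by rewrite ler_wpM2l// ltW.
rewrite expr2; have : 0 < t * `|F z - y| by rewrite mulr_gt0.
move: (t * `|F z - y|) => q; lra.
Qed.

Lemma nat_gt a : exists2 n : nat, 0 < (n%:R : R) & a < n%:R.
Proof.
exists (Num.truncn `|a|).+1; first by rewrite ltr0n.
by rewrite (le_lt_trans (ler_norm _))// truncnS_gt.
Qed.

Variable d : R.
Hypothesis d0 : 0 < d.
Hypothesis hd : forall x y, `|y - F x| < d -> exists2 z, `|z - x| <= r / 4 & F z = y.

(** Around each of its points the image contains a ball of the fixed radius [d], so preimages can be
    continued along the segment from [F 0] to [y]. *)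
Lemma chain_surj y : exists z, F z = y.
Proof.
have [n n0 hn] := nat_gt (`|y - F 0| / d).
have [z] : exists z, F z = F 0 + (n%:R / n%:R) *: (y - F 0).
  have : (n <= n)%N by [].
  move: {1 3}n => i; elim: i => [_|i IH ilt].
    by exists 0; rewrite mul0r scale0r addr0.
  have [z hz] := IH (ltnW ilt).
  have [|z' _ hz'] := @hd z (F 0 + ((i.+1)%:R / n%:R) *: (y - F 0)); last by exists z'.
  rewrite hz opprD addrACA subrr add0r -scalerBl -mulrBl -natrB// subSnn mul1r.
  rewrite normrZ ger0_norm ?invr_ge0 ?ler0n// mulrC ltr_pdivrMr//.
  by rewrite mulrC -ltr_pdivrMr.
by rewrite divff ?gt_eqF// scale1r addrC subrK => <-; exists z.
Qed.

(* The image of the segment from x to y is a loop; contracting it linearly to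
   its base point and lifting each of the small deformation steps at the
   nodes of a fine mesh moves the segment, with its end points fixed, to a
   chain of preimages of the base point. *)
Lemma chain_inj x y : F x = F y -> x = y.
Proof.
move=> Fxy.
pose g t := F (x + t *: (y - x)).
have gc t : 0 <= t <= 1 -> `|g t - F x| <= M * `|y - x|.
  move=> /andP[t0 t1]; rewrite (le_trans (F_lip _ _))// addrAC subrr add0r.
  by rewrite ler_pM2l// normrZ ger0_norm// ler_piMl.
have gl s t : `|g s - g t| <= M * (`|s - t| * `|y - x|).
  rewrite (le_trans (F_lip _ _))// opprD addrACA subrr add0r -scalerBl.
  by rewrite normrZ.
have g0 : g 0 = F x by rewrite /g scale0r addr0.
have g1 : g 1 = F x by rewrite /g scale1r addrC subrK.
have [n n0 hn] := nat_gt (M * `|y - x| / d).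
have [m m0 hm] := nat_gt (Num.max (2 * N * M) 1 * `|y - x| / (r / 2)).
have r20 : 0 < r / 2 by rewrite divr_gt0.
have hm1 : 2 * N * (M * (m%:R^-1 * `|y - x|)) <= r / 2.
  have : Num.max (2 * N * M) 1 * `|y - x| < m%:R * (r / 2) by rewrite -ltr_pdivrMr.
  have : 2 * N * M * `|y - x| <= Num.max (2 * N * M) 1 * `|y - x|.
    by rewrite ler_wpM2r// le_max lexx.
  move=> h1 h2; have : 2 * N * M * `|y - x| <= m%:R * (r / 2) by lra.
  by rewrite -ler_pdivrMl// => /(le_trans _); apply; rewrite le_eqVlt; apply/orP; left; apply/eqP; ring.
have hm2 : m%:R^-1 * `|y - x| <= r / 2.
  have : Num.max (2 * N * M) 1 * `|y - x| < m%:R * (r / 2) by rewrite -ltr_pdivrMr.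
  have : 1 * `|y - x| <= Num.max (2 * N * M) 1 * `|y - x|.
    by rewrite ler_wpM2r// le_max lexx orbT.
  move=> h1 h2; have : `|y - x| <= m%:R * (r / 2) by lra.
  by rewrite -ler_pdivrMl.
(* [H i k] is the image of the k-th mesh node after i of the [n] contraction steps. [n] makes each
   step shorter than [d]; [m] makes neighbouring images so close that their lifts stay within
   [r / 2]. *)
pose H (i k : nat) := F x + (1 - i%:R / n%:R) *: (g (k%:R / m%:R) - F x).
have km k : (k <= m)%N -> 0 <= (k%:R : R) / m%:R <= 1.
  by move=> km; rewrite divr_ge0 ?ler0n//= ler_pdivrMr// mul1r ler_nat.
have kmS k : `|((k.+1)%:R : R) / m%:R - k%:R / m%:R| = m%:R^-1.
  by rewrite -mulrBl -natrB// subSnn mul1r ger0_norm// invr_ge0 ler0n.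
have [G [hG G0 Gm hGS]] : exists G : nat -> plane R,
    [/\ forall k, (k <= m)%N -> F (G k) = H n k, G 0%N = x, G m = y &
        forall k, (k < m)%N -> `|G k.+1 - G k| <= r / 2].
  have : (n <= n)%N by [].
  move: {1 3}n => i; elim: i => [_|i IH ilt].
    exists (fun k => x + (k%:R / m%:R) *: (y - x)); split.
    - by move=> k _; rewrite /H mul0r subr0 scale1r [RHS]addrC subrK.
    - by rewrite mul0r scale0r addr0.
    - by rewrite divff ?gt_eqF// scale1r addrC subrK.
    - by move=> k _; rewrite opprD addrACA subrr add0r -scalerBl normrZ kmS.
  have [G [hG G0 Gm hGS]] := IH (ltnW ilt).
  have /choice[G' hG'] : forall k, exists z, (k <= m)%N -> `|z - G k| <= r / 4 /\ F z = H i.+1 k.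
    move=> k; case: (leqP k m) => [km'|_]; last by exists 0.
    have [|z z1 z2] := @hd (G k) (H i.+1 k); last by exists z.
    rewrite hG // /H opprD addrACA subrr add0r -scalerBl normrZ.
    have -> : 1 - (i.+1)%:R / n%:R - (1 - i%:R / n%:R) = - n%:R^-1 :> R.
      by rewrite -natr1; field; rewrite gt_eqF.
    rewrite normrN ger0_norm ?invr_ge0 ?ler0n//.
    rewrite (le_lt_trans (ler_wpM2l _ (gc _ (km _ km'))))// ?invr_ge0 ?ler0n//.
    by rewrite ltr_pdivrMl// -ltr_pdivrMr.
  have rr : r / 4 <= r by move: r0; lra.
  exists G'; split.
  - by move=> k /hG'[].
  (* The image of an end node does not move, so injectivity at scale [r] keeps its lift in place. *)
  - have [] := hG' 0%N isT; rewrite G0 /H mul0r g0 subrr scaler0 addr0 => h1 h2.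
    have := hr (le_trans h1 rr); rewrite h2 subrr normr0 mulr0.
    by rewrite normr_le0 subr_eq0 => /eqP.
  - have [] := hG' m (leqnn m); rewrite Gm /H divff ?gt_eqF// g1 subrr scaler0 addr0 Fxy => h1 h2.
    have := hr (le_trans h1 rr); rewrite h2 subrr normr0 mulr0.
    by rewrite normr_le0 subr_eq0 => /eqP.
  (* The old gap [r / 2] and two displacements by [r / 4] give a gap at most [r], where the
     expansion bound applies; contraction not increasing the gaps between images, it restores
     [r / 2]. *)
  - move=> k km'; have [a1 a2] := hG' _ km'; have [b1 b2] := hG' _ (ltnW km').
    have h1 : `|G' k.+1 - G' k| <= r.
      have -> : G' k.+1 - G' k = (G' k.+1 - G k.+1) + (G k.+1 - G k) - (G' k - G k).
        by apply: peq; rewrite !pE; ring.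
      rewrite (le_trans (ler_normB _ _))// -[r](_ : r / 4 + r / 2 + r / 4 = r); last by field.
      rewrite lerD// (le_trans (ler_normD _ _))// lerD//; exact: hGS.
    apply: le_trans (hr h1) (le_trans _ hm1); rewrite a2 b2 ler_pM2l ?mulr_gt0//.
    rewrite /H opprD addrACA subrr add0r -scalerBr opprB subrKA normrZ.
    rewrite -[leRHS]mul1r ler_pM//; last by rewrite (le_trans (gl _ _))// kmS.
    have /andP[q0 q1] : 0 <= ((i.+1)%:R / n%:R : R) <= 1.
      by rewrite divr_ge0 ?ler0n//= ler_pdivrMr// mul1r ler_nat.
    by rewrite ger0_norm ?subr_ge0// gerBl.
have Fc k : (k <= m)%N -> F (G k) = F x.
  by move=> /hG ->; rewrite /H divff ?gt_eqF// subrr scale0r addr0.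
rewrite -Gm -{1}G0; have : (m <= m)%N by [].
move: {1 3}m => k; elim: k => // k IH km'; rewrite (IH (ltnW km')).
have h1 : `|G k.+1 - G k| <= r by rewrite (le_trans (hGS _ km'))//; move: r0; lra.
have := hr h1; rewrite (Fc _ km') (Fc _ (ltnW km')) subrr normr0 mulr0.
by rewrite normr_le0 subr_eq0 => /eqP ->.
Qed.

End GlobalInverse.

Section InverseC11.
Variable R : realType.
Implicit Types (u v w x y z : plane R) (a b t : R).

(** The inverse obtained by choice is locally Lipschitz, because nearby values are reached by [hd]
    at nearby points, which injectivity identifies with those of [G]. Taylor's formula for [F] at
    [G y], multiplied by the inverse matrix, then has a quadratic error and yields the differential
    of [G]. *)
Lemma C11_inverse (F : plane R -> plane R) M C (j : R) : C11 F M C -> j != 0 ->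
  (forall x u v, cross (D F x u) (D F x v) = j * cross u v) ->
  exists G M' C', [/\ cancel F G, cancel G F, C11 G M' C',
    (forall x v, D G (F x) (D F x v) = v) /\
      (forall x v, D F (G x) (D G x v) = v) &
    (forall x u v, cross (D G x u) (D G x v) = j^-1 * cross u v)].
Proof.
move=> hF j0 hj; have [dF M0 C0 hM hC] := hF.
have [N N0 hN] := D_expand hF j0 hj.
have [r r0 hr] := F_expand hF N0 hN.
have r40 : 0 < r / 4 by rewrite divr_gt0.
have hr4 x y : `|y - x| <= r / 4 -> `|y - x| <= 2 * N * `|F y - F x|.
  by move=> h; apply: hr; rewrite (le_trans h)//; move: r0; lra.
have hd := local_surj hF j0 hj N0 r40 hr4.
have d0 : 0 < r / 4 / (8 * N) by rewrite divr_gt0// mulr_gt0.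
have surj := chain_surj d0 hd.
have inj : injective F by move=> x y; exact: (chain_inj hF N0 r0 hr d0 hd).
have [G GK] := choice surj.
have FK : cancel F G by move=> x; apply: inj; rewrite GK.
have GL y y' : `|y' - y| < r / 4 / (8 * N) -> `|G y' - G y| <= 2 * N * `|y' - y|.
  move=> h; have [|z hz Fz] := @hd (G y) y'; first by rewrite GK.
  by have ez : z = G y' by [rewrite -Fz FK]; have := hr4 _ _ hz; rewrite Fz GK ez.
have De x : cross (D F x (e1 R)) (D F x (e2 R)) = j.
  by rewrite hj /cross /= !mulr1 mulr0 subr0 mulr1.
(* Columns of the inverse of [D F x], by Cramer's rule with determinant [j]. *)
pose u1 x : plane R := (cross (e1 R) (D F x (e2 R)) / j, cross (D F x (e1 R)) (e1 R) / j).
pose u2 x : plane R := (cross (e2 R) (D F x (e2 R)) / j, cross (D F x (e1 R)) (e2 R) / j).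
have LiE x w : lin2 (u1 x) (u2 x) w =
    (cross w (D F x (e2 R)) / j, cross (D F x (e1 R)) w / j).
  by apply: peq; rewrite /lin2 !pE /u1 /u2 /cross /=; ring.
have LiF x v : lin2 (u1 x) (u2 x) (D F x v) = v.
  by rewrite LiE !hj; apply: peq; rewrite /= mulrAC divff// mul1r /cross /=; ring.
have [hG1 hG2] : (forall y, differentiable G y) /\ forall y w, D G y w = lin2 (u1 (G y)) (u2 (G y)) w.
  suff h y : differentiable G y /\ forall w, D G y w = lin2 (u1 (G y)) (u2 (G y)) w.
    by split => y; case: (h y).
  apply: (@quadratic_differentiable _ _ _ _ _ (N * (C * (2 * N) ^+ 2)) (r / 4 / (8 * N) / 2)).
    by rewrite divr_gt0.
  move=> y' hy'; have hy : `|y' - y| < r / 4 / (8 * N) by rewrite (le_lt_trans hy')// ltr_pdivrMr//; move: d0; lra.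
  have h1 := GL _ _ hy.
  rewrite -{1}[G y' - G y](LiF (G y)) -linearB /=.
  set w := _ - _; have [w' ew] := D_surj j0 hj (G y) w.
  rewrite -ew LiF (le_trans (hN (G y) w'))// ew -!mulrA ler_pM2l//.
  rewrite /w -opprB normrN -{1}[y']GK -{1}[y]GK (le_trans (F_taylor hF _ _))//.
  rewrite ler_pM2l// (_ : 2 * _ = (2 * N * `|y' - y|) ^+ 2); last by ring.
  by rewrite lerXn2r ?nnegrE// (le_trans _ h1).
have DGF x v : D G (F x) (D F x v) = v by rewrite hG2 FK LiF.
have DG1 y v : D G y (D F (G y) v) = v by have := DGF (G y) v; rewrite GK.
have DG2 y v : D F (G y) (D G y v) = v.
  by have [v' <-] := D_surj j0 hj (G y) v; rewrite DG1.
have NG y v : `|D G y v| <= N * `|v|.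
  have [w ew] := D_surj j0 hj (G y) v.
  by rewrite -ew DG1; apply: hN.
exists G, N, (N * (C * N * N)); split => //.
- split => //; first by rewrite !mulr_gt0.
  move=> z w v.
  (* Resolvent identity for the difference of two inverse matrices. *)
  have -> : D G z v - D G w v = D G z (D F (G w) (D G w v) - D F (G z) (D G w v)).
    by rewrite linearB /= DG1 DG2.
  rewrite (le_trans (NG _ _))// -!mulrA ler_pM2l// (le_trans (hC _ _ _))// -mulrA ler_pM2l//.
  have e : N * (N * (`|z - w| * `|v|)) = (N * `|z - w|) * (N * `|v|) by ring.
  by rewrite e ler_pM// distrC; exact: mvt_plane_le.
- move=> x u v.
  have [u' <-] := D_surj j0 hj (G x) u; have [v' <-] := D_surj j0 hj (G x) v.
  by rewrite !DG1 hj mulKf.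
Qed.

End InverseC11.

(** * Degree and the homotopy class of a lift *)

Section TopologyHelpers.

Lemma continuous_pair (T U V : topologicalType) (f : T -> U) (g : T -> V) :
  continuous f -> continuous g -> continuous (fun p => (f p, g p)).
Proof. by move=> cf cg x; apply: cvg_pair; [exact: cf|exact: cg]. Qed.

Lemma continuous_compose (T U V : topologicalType) (f : T -> U) (g : U -> V) :
  continuous f -> continuous g -> continuous (fun p => g (f p)).
Proof. by move=> cf cg x; apply: continuous_comp; [exact: cf|exact: cg]. Qed.

Lemma continuous_fst (T U V : topologicalType) (f : T -> U * V) :
  continuous f -> continuous (fun p => (f p).1).
Proof. by move=> cf; apply: continuous_compose => // x; exact: cvg_fst. Qed.

Lemma continuous_snd (T U V : topologicalType) (f : T -> U * V) :
  continuous f -> continuous (fun p => (f p).2).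
Proof. by move=> cf; apply: continuous_compose => // x; exact: cvg_snd. Qed.

Lemma continuous_id (T : topologicalType) : continuous (fun p : T => p).
Proof. by move=> x; exact: cvg_id. Qed.

(** A homotopy is continuous only within [[0, 1]] times the torus; composed with a clamped map it
    becomes continuous everywhere. *)
Lemma within_precomp (T U V : topologicalType) (A : set U) (g : T -> U) (f : U -> V) :
  continuous g -> (forall p, A (g p)) -> {within A, continuous f} ->
  continuous (f \o g).
Proof.
move=> cg Ag cf x W nW.
have h : within A (nbhs (g x)) (f @^-1` W).
  by rewrite nbhs_subspace_in//; exact: cf.
have : nbhs x (g @^-1` (fun y => A y -> (f @^-1` W) y)) := cg x _ h.
by apply: filterS => y /(_ (Ag y)).
Qed.

End TopologyHelpers.

Section CircleLifting.
Variable R : realType.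
Implicit Types (u v w x y z : plane R) (a b s t : R).

Definition circ a : plane R := (cos (2 * pi * a), sin (2 * pi * a)).

Lemma periodic_int (g : R -> R) (p : R) : periodic g p ->
  forall (m : int) a, g (a + p *~ m) = g a.
Proof.
move=> pg; have pn (n : nat) a : g (a + p *+ n) = g a.
  by elim: n => [|n IH]; rewrite ?mulr0n ?addr0// mulrSr addrA pg.
move=> [n|n] a; first exact: pn.
by rewrite NegzE mulrNz -{2}[a](subrK (p *~ n.+1)); exact: esym (pn n.+1 _).
Qed.

Lemma circ_int a b : a - b \is a Num.int -> circ a = circ b.
Proof.
move=> /intrP[m hm]; have -> : a = b + m%:~R by rewrite -hm addrC subrK.
have e : 2 * pi * (b + m%:~R) = 2 * pi * b + (pi *+ 2) *~ m :> R.
  by rewrite -[(pi *+ 2) *~ m]mulrzr -mulr_natl; ring.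
by rewrite /circ e (periodic_int (@cosD2pi R)) (periodic_int (@sinD2pi R)).
Qed.

Lemma cos2pi_eq1 a : cos (2 * pi * a) = 1 -> a \is a Num.int.
Proof.
move=> ca; set m := Num.floor a.
have /andP[m1 m2] := floor_itv a; rewrite -/m in m1 m2.
have e : circ (a - m%:~R) = circ a by apply: circ_int; rewrite addrAC subrr add0r rpredN intr_int.
have c1 : cos (2 * pi * (a - m%:~R)) = 1 by have /(congr1 fst) := e; rewrite /= ca.
suff -> : a = m%:~R by exact: intr_int.
apply/eqP; rewrite -subr_eq0; set c := a - m%:~R in c1 *.
have c0 : 0 <= c by rewrite subr_ge0.
have c2 : c < 1 by rewrite ltrBlDr addrC; move: m2; rewrite intrD.
rewrite eq_le c0 andbT leNgt; apply/negP => cp.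
have sp : 0 < sin (pi * c).
  by apply: sin_gt0_pi; rewrite mulr_gt0 ?pi_gt0//= gtr_pMr ?pi_gt0.
have : cos (2 * pi * c) = 1 - 2 * sin (pi * c) ^+ 2.
  have -> : 2 * pi * c = pi * c + pi * c :> R by ring.
  rewrite cosD -!expr2 cos2sin2; ring.
rewrite c1; have := exprn_gt0 2 sp; lra.
Qed.

Lemma circ_inj a b : circ a = circ b -> a - b \is a Num.int.
Proof.
move=> [c s]; apply: cos2pi_eq1; rewrite mulrBr cosB -c -s -!expr2 cos2Dsin2 //.
Qed.

(** Unit vectors this close have a positive scalar product [d], so the signed angle between them is
    the arcsine of [cross g h], a continuous function of the pair. *)
Lemma circ_rotate (g h : plane R) : g.1 ^+ 2 + g.2 ^+ 2 = 1 :> R -> h.1 ^+ 2 + h.2 ^+ 2 = 1 :> R ->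
  `|g - h| < 2^-1 -> -1 < cross g h < 1 /\
  forall a, g = circ a -> h = circ (a + asin (cross g h) / (2 * pi)).
Proof.
move=> g1 h1 gh; set c := cross g h; pose d : R := g.1 * h.1 + g.2 * h.2.
have cd : c ^+ 2 + d ^+ 2 = 1.
  have -> : c ^+ 2 + d ^+ 2 = (g.1 ^+ 2 + g.2 ^+ 2) * (h.1 ^+ 2 + h.2 ^+ 2) :> R.
    by rewrite /c /d /cross; ring.
  by rewrite g1 h1 mulr1.
have d0 : 0 < d.
  have n1 := le_lt_trans (norm1_le _) gh; have n2 := le_lt_trans (norm2_le _) gh.
  move: n1 n2; rewrite !pE !ltr_norml => /andP[p1 p2] /andP[q1 q2].
  have : (g.1 - h.1) ^+ 2 < 1 by nra.
  have : (g.2 - h.2) ^+ 2 < 1 by nra.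
  rewrite /d; move: g1 h1; nra.
have c1 : -1 < c < 1 by apply/andP; split; nra.
split=> // a ga.
have c2 : -1 <= c <= 1 by case/andP: c1 => *; apply/andP; split; exact: ltW.
have e : 2 * pi * (a + asin c / (2 * pi)) = 2 * pi * a + asin c :> R.
  by rewrite mulrDr [_ * (asin c / _)]mulrC divfK// mulf_neq0 ?pnatr_eq0// gt_eqF// pi_gt0.
have cc : cos (asin c) = d.
  by rewrite cos_asin// (_ : 1 - c ^+ 2 = d ^+ 2) ?sqrtr_sqr ?gtr0_norm//; lra.
rewrite /circ e cosD sinD asinK ?in_itv//= cc.
move: ga => /[dup] /(congr1 fst) /= <- /(congr1 snd) /= <-.
apply: peq; rewrite /= /c /d /cross.
- rewrite -[LHS]mulr1 -g1; ring.
- rewrite -[LHS]mulr1 -g1; ring.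
Qed.

(** The triples that violate the bound form a compact set away from the diagonal; the minimum of
    [|t - t'|] on it is the modulus [d]. *)
Lemma heine (g : R * R -> plane R) (e : R) : continuous g -> 0 < e ->
  exists2 d : R, 0 < d & forall t t' s, 0 <= t <= 1 -> 0 <= t' <= 1 -> 0 <= s <= 1 ->
    `|t - t'| < d -> `|g (t, s) - g (t', s)| < e.
Proof.
move=> cg e0.
pose K : set (R * R * R) := ((`[0, 1] `*` `[0, 1]) `*` `[0, 1]) `&`
  [set x | e <= `|g (x.1.1, x.2) - g (x.1.2, x.2)|].
have cK : compact K.
  apply: compact_closedI; first by do !apply: compact_setX; apply: segment_compact.
  have := @preimage_closed _ _ (fun x : R * R * R => `|g (x.1.1, x.2) - g (x.1.2, x.2)|) [set r : R | e <= r].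
  apply => [x _|]; last exact: closed_ge.
  have cid := @continuous_id (R * R * R)%type.
  have c1 := continuous_compose (continuous_pair (continuous_fst (continuous_fst cid)) (continuous_snd cid)) cg.
  have c2 := continuous_compose (continuous_pair (continuous_snd (continuous_fst cid)) (continuous_snd cid)) cg.
  apply: (@cvg_comp _ _ _ (fun x : R * R * R => g (x.1.1, x.2) - g (x.1.2, x.2)) (fun v => `|v|)); last exact: norm_continuous.
  by apply: cvgB; [exact: c1|exact: c2].
have [K0|/set0P K0] := eqVneq K set0.
  exists 1 => // t t' s ht ht' hs _; rewrite ltNge; apply/negP => h.
  have : K ((t, t'), s) by split => //=; rewrite !in_itv.
  by rewrite K0.
have [|c] := compact_EVT_min K0 cK (_ : {within K, continuous (fun x : R * R * R => `|x.1.1 - x.1.2|)}).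
  apply: continuous_subspaceT => y; have cid := @continuous_id (R * R * R)%type.
  apply: cvg_norm; apply: cvgB; first exact: (continuous_fst (continuous_fst cid)).
  exact: (continuous_snd (continuous_fst cid)).
rewrite inE => -[[[c1 c2] c3] c4] hmin.
exists `|c.1.1 - c.1.2| => [|t t' s ht ht' hs h].
  rewrite normr_gt0 subr_eq0; apply/eqP => E; move: c4; rewrite /= E subrr normr0.
  by rewrite leNgt e0.
rewrite ltNge; apply/negP => h'.
have : K ((t, t'), s) by split => //=; rewrite !in_itv.
by move=> /mem_set/hmin /=; rewrite leNgt h.
Qed.


Definition clamp01 t : R := Num.max 0 (Num.min 1 t).

Lemma clamp01_in t : 0 <= clamp01 t <= 1.
Proof. by rewrite /clamp01 le_max lexx ge_max ler01 ge_min lexx. Qed.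

Lemma clamp01_id t : 0 <= t <= 1 -> clamp01 t = t.
Proof. by move=> /andP[h0 h1]; rewrite /clamp01 min_r// max_r. Qed.

Lemma clamp01_lip s t : `|clamp01 s - clamp01 t| <= `|s - t|.
Proof.
have h1 := ler_norm (s - t); have h2 := ler_norm (t - s); rewrite distrC in h2.
move: h1 h2; move: `|s - t| => q h1 h2.
rewrite ler_norml /clamp01.
case: (leP 1 s) => s1; case: (leP 1 t) => t1; rewrite ?(max_r ler01).
- by apply/andP; split; lra.
- by case: (leP 0 t) => t0; apply/andP; split; lra.
- by case: (leP 0 s) => s0; apply/andP; split; lra.
- by case: (leP 0 s) => s0; case: (leP 0 t) => t0; apply/andP; split; lra.
Qed.

Lemma continuous_clamp01 : continuous clamp01.
Proof.
move=> t; apply/cvgrPdist_le => e e0; near=> s.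
rewrite (le_trans (clamp01_lip _ _))//; near: s; exact: cvgr_dist_le.
Unshelve. all: by end_near. Qed.

(* Homotopy invariance of the degree: along a homotopy the angle is lifted by
   finitely many small rotations, each of which is periodic in s. *)
Lemma homotopy_degree (g : R * R -> plane R) (th th' : R -> R) : continuous g ->
  (forall p, (g p).1 ^+ 2 + (g p).2 ^+ 2 = 1 :> R) ->
  (forall t, g (t, 0) = g (t, 1)) ->
  continuous th -> continuous th' ->
  (forall s, 0 <= s <= 1 -> g (0, s) = circ (th s)) ->
  (forall s, 0 <= s <= 1 -> g (1, s) = circ (th' s)) ->
  th 1 - th 0 = th' 1 - th' 0.
Proof.
move=> cg ng pg cth cth' h0 h1.
have i2 : (0:R) < 2^-1 by rewrite invr_gt0.
have [d d0 hd] := heine cg i2.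
have [n n0 hn] := nat_gt d^-1.
have [phi [cphi hphi dphi]] : exists phi : R -> R, [/\ continuous phi,
    forall s, g (n%:R / n%:R, clamp01 s) = circ (phi s) & phi 1 - phi 0 = th 1 - th 0].
  have : (n <= n)%N by [].
  move: {1 3}n => i; elim: i => [_|i IH ilt].
    exists (th \o clamp01); split.
    - by move=> s; apply: (@cvg_comp _ _ _ clamp01 th); [exact: continuous_clamp01|exact: cth].
    - by move=> s; rewrite mul0r h0// clamp01_in.
    - by rewrite /= !clamp01_id ?lexx ?ler01.
  have [phi [cphi hphi dphi]] := IH (ltnW ilt).
  pose c s := cross (g (i%:R / n%:R, clamp01 s)) (g (i.+1%:R / n%:R, clamp01 s)).
  have near_g s : `|g (i%:R / n%:R, clamp01 s) - g (i.+1%:R / n%:R, clamp01 s)| < 2^-1.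
    have in01 k : (k <= n)%N -> 0 <= (k%:R / n%:R : R) <= 1.
      by move=> km; rewrite divr_ge0 ?ler0n//= ler_pdivrMr// mul1r ler_nat.
    apply: hd; rewrite ?in01 ?clamp01_in// 1?ltnW//.
    rewrite distrC -mulrBl -natrB// subSnn mul1r ger0_norm ?invr_ge0 ?ler0n//.
    by rewrite invf_plt ?posrE.
  have rot s := circ_rotate (ng _) (ng _) (near_g s).
  have gcont (r : R) : continuous (fun s => g (r, clamp01 s)).
    apply: continuous_compose cg; apply: continuous_pair; first exact: cst_continuous.
    exact: continuous_clamp01.
  exists (fun s => phi s + asin (c s) / (2 * pi)); split.
  - move=> s; apply: cvgD; first exact: cphi.
    have cc : continuous c := continuous_cross (gcont _) (gcont _).
    by apply: cvgMl; apply: (@continuous_comp _ _ _ c asin); [exact: cc|apply: continuous_asin; have [] := rot s].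
  - by move=> s; have [_] := rot s; apply.
  (* The loop is closed at each time, so the rotation angles at [s = 0] and [s = 1] coincide and the
     total variation of the angle is unchanged. *)
  - rewrite /c !clamp01_id ?lexx ?ler01// -!pg -dphi; ring.
rewrite divff ?gt_eqF// in hphi.
(* Two continuous angles of the same loop differ by a constant integer. *)
have : phi 1 - th' (clamp01 1) = phi 0 - th' (clamp01 0).
  apply: (@int_valued_cst R (fun s => phi s - th' (clamp01 s))).
    move=> s; apply: cvgB; first exact: cphi.
    by apply: (@cvg_comp _ _ _ clamp01 th'); [exact: continuous_clamp01|exact: cth'].
  by move=> s; apply: circ_inj; rewrite -hphi h1// clamp01_in.
by rewrite !clamp01_id ?lexx ?ler01// -dphi => ?; lra.
Qed.

End CircleLifting.

Section HomotopyClass.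
Local Open Scope quotient_scope.
Variable R : realType.

(** Coordinates on the torus make sense only modulo integers, and [repr] is discontinuous; the value
    on the circle is continuous as soon as lattice translations change the coordinate by
    integers. *)
Definition torus_circ (pi : plane R -> R) (p : torus R) : plane R := circ (pi (repr p)).

Lemma torus_circE (c : plane R -> R) (x : plane R) :
  (forall k, zpt k -> c (x + k) - c x \is a Num.int) ->
  torus_circ c (torus_proj x) = circ (c x).
Proof.
move=> hc; apply: circ_int; have := hc _ (repr_torus x).
by rewrite [x + _]addrC subrK.
Qed.

Lemma continuous_torus_circ (c : plane R -> R) : continuous c ->
  (forall x k, zpt k -> c (x + k) - c x \is a Num.int) -> continuous (torus_circ c).
Proof.
move=> cc hc.
have ccirc : continuous (@circ R).
  have c1 : continuous (fun b : R => 2 * pi * b) by move=> a; apply: cvgMr; exact: cvg_id.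
  apply: continuous_pair.
    by apply: continuous_compose c1 _; exact: continuous_cos.
  by apply: continuous_compose c1 _; exact: continuous_sin.
have := @repr_comp_continuous (plane R) {eq_quot (zequiv_rel R)} (plane R) (fun x => circ (c x)).
apply.
  by move=> x; apply: (@cvg_comp _ _ _ c (@circ R)); [exact: cc|exact: ccirc].
move=> a b /eqP/torus_projP ab; apply/eqP/circ_int.
by have := hc b _ ab; rewrite [b + _]addrC subrK.
Qed.

Lemma lin_add (A : 'M[int]_2) (x y : plane R) : lin A (x + y) = lin A x + lin A y.
Proof. by apply: peq; rewrite /lin !pE /=; ring. Qed.

Lemma lin_zpt (A : 'M[int]_2) (k : plane R) : zpt k -> zpt (lin A k).
Proof.
by move=> /andP[k1 k2]; apply/andP; split; rewrite rpredD// rpredM ?intr_int.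
Qed.

(** [lift_translate] leaves only the vector [F k - F 0] to be identified. Each of its coordinates is
    the degree of the loop [s |-> s *: k] followed by [f] and a circle coordinate, and the homotopy
    carries this degree to that of the linear map. *)
Lemma lift_linearization (f : torus R -> torus R) (F : plane R -> plane R) (A : 'M[int]_2) :
  is_lift f F -> linearization f A ->
  forall x k, zpt k -> F (x + k) = F x + lin A k.
Proof.
move=> lF [H [cH H0 H1]] x k zk.
have [_ ->] := lift_translate lF zk; congr (_ + _).
have key (c : plane R -> R) : continuous c -> (forall x y, c (x + y) = c x + c y) ->
    (forall k, zpt k -> c k \is a Num.int) -> c (F k - F 0) = c (lin A k).
  move=> cc lc zc.
  have hc y l : zpt l -> c (y + l) - c y \is a Num.int.
    by move=> zl; rewrite lc addrAC subrr add0r zc.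
  pose T (p : R * R) : R * torus R := (clamp01 p.1, torus_proj (clamp01 p.2 *: k)).
  have cT : continuous T.
    have cid := @continuous_id (R * R)%type.
    have cc2 := continuous_compose (continuous_snd cid) (@continuous_clamp01 R).
    apply: continuous_pair.
      by apply: continuous_compose (@continuous_clamp01 R); exact: continuous_fst.
    apply: (@continuous_compose _ _ _ (fun p : R * R => clamp01 p.2 *: k) (@torus_proj R)); last exact: pi_continuous.
    by apply: (@continuous_compose _ _ _ _ (fun t : R => t *: k) cc2); exact: scalel_continuous.
  have cHT : continuous (H \o T).
    have TA p : (`[0, 1]%classic `*` [set: torus R]) (T p).
      by split => //=; rewrite in_itv /= clamp01_in.
    exact: within_precomp cT TA cH.
  have c0 : forall x0 l, zpt l -> c (lin A (x0 + l)) - c (lin A x0) \is a Num.int.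
    by move=> y l zl; rewrite lin_add hc// lin_zpt.
  have ck : continuous (fun s : R => c (F (s *: k))).
    have [cF _] := lF.
    by apply: (@continuous_compose _ _ _ (fun s : R => F (s *: k)) c) => //; apply: (continuous_compose _ cF); exact: scalel_continuous.
  have clA : continuous (fun s : R => c (lin A (s *: k))).
    apply: (@continuous_compose _ _ _ (fun s : R => lin A (s *: k)) c) => //.
    have -> : (fun s : R => lin A (s *: k)) = (fun s : R => s *: lin A k).
      by apply/funext => s; apply: peq; rewrite /lin !pE /=; ring.
    exact: scalel_continuous.
  have := @homotopy_degree R (torus_circ c \o (H \o T)) (fun s => c (F (s *: k))) (fun s => c (lin A (s *: k))).
  rewrite !scale1r !scale0r => h.
  have cB a b : c (a - b) = c a - c b by apply/eqP; rewrite eq_sym subr_eq -lc subrK.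
  have l0 : c (lin A 0) = 0.
    have -> : lin A 0 = 0 - 0 :> plane R by apply: peq; rewrite /lin /= !mulr0 addr0 subrr.
    by rewrite cB subrr.
  rewrite cB -[RHS]subr0 -l0; apply: h => //.
  - apply: (continuous_compose cHT); exact: continuous_torus_circ.
  - by move=> p; rewrite /torus_circ /circ /= cos2Dsin2.
  - have [k0 k1] : clamp01 0 = 0 :> R /\ clamp01 1 = 1 :> R by rewrite !clamp01_id ?lexx ?ler01.
    move=> t; rewrite /T /= k0 k1.
    have -> // : torus_proj (0 *: k) = torus_proj (1 *: k).
    by apply/torus_projP; rewrite scale1r scale0r sub0r zptN.
  - move=> s hs; rewrite /T /= !clamp01_id ?lexx ?ler01// H0.
    have [_ ->] := lF; by rewrite torus_circE // => l; exact: hc.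
  - move=> s hs; rewrite /T /= !clamp01_id ?lexx ?ler01// H1 /torus_lin.
    rewrite torus_circE => [|l]; last exact: hc.
    by apply: circ_int; have := c0 (s *: k) _ (repr_torus (s *: k)); rewrite [s *: k + _]addrC subrK.
apply: peq.
  by apply: (key fst) => [?| |? /andP[]//]; first exact: cvg_fst.
by apply: (key snd) => [?| |? /andP[]//]; first exact: cvg_snd.
Qed.

End HomotopyClass.

(** * Hyperbolic splitting of the lift *)

Section Iterates.
Variable R : realType.
Implicit Types (u v w x y z k : plane R) (a b s t : R).

Lemma differentiable_iter (F : plane R -> plane R) n :
  (forall x, differentiable F x) -> forall x, differentiable (iter n F) x.
Proof.
move=> dF; elim: n => [|n IH] x; first by apply: ex_diff.
have -> : iter n.+1 F = F \o iter n F by apply/funext => y.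
by apply: differentiable_comp.
Qed.

Lemma DvE (V : normedModType R) (F : plane R -> V) x v : D F x v = 'd F x v.
Proof. by rewrite DE. Qed.

Lemma D_comp (F G : plane R -> plane R) x v : differentiable G x ->
  differentiable F (G x) -> D (F \o G) x v = D F (G x) (D G x v).
Proof.
move=> dG dF.
have e : 'd (F \o G) x v = 'd F (G x) ('d G x v) :=
  congr1 (fun L => L v) (diff_comp dG dF).
exact: etrans (DvE _ _ _) (etrans e (esym (etrans (DvE _ _ _) (congr1 _ (DvE _ _ _))))).
Qed.

Lemma D_id x v : D id x v = v.
Proof. by rewrite D_derive// derive_id. Qed.

Lemma D_iterS (F : plane R -> plane R) n x v : (forall x, differentiable F x) ->
  D (iter n.+1 F) x v = D F (iter n F x) (D (iter n F) x v).
Proof. by move=> dF; apply: D_comp => //; exact: differentiable_iter. Qed.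

Lemma D_iter0 (F : plane R -> plane R) x v : D (iter 0 F) x v = v.
Proof. exact: D_id. Qed.

Lemma D_iterD (F : plane R -> plane R) n m x v : (forall x, differentiable F x) ->
  D (iter (n + m) F) x v = D (iter n F) (iter m F x) (D (iter m F) x v).
Proof.
move=> dF; elim: n => [|n IH]; first by rewrite D_iter0.
by rewrite addSn !D_iterS// IH iterD.
Qed.

Lemma D_iter_le (F : plane R -> plane R) M C n x v : C11 F M C ->
  `|D (iter n F) x v| <= M ^+ n * `|v|.
Proof.
move=> [dF M0 _ hM _]; elim: n => [|n IH]; first by rewrite D_iter0 expr0 mul1r.
by rewrite D_iterS// (le_trans (hM _ _))// exprS -mulrA ler_pM2l.
Qed.

Lemma D_iter_cross (F : plane R -> plane R) j n x u v : (forall x, differentiable F x) ->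
  (forall x u v, cross (D F x u) (D F x v) = j * cross u v) ->
  cross (D (iter n F) x u) (D (iter n F) x v) = j ^+ n * cross u v.
Proof.
move=> dF hj; elim: n => [|n IH]; first by rewrite !D_iter0 expr0 mul1r.
by rewrite !D_iterS// hj IH exprS mulrA.
Qed.

Lemma iter_cancelK (T : Type) (F G : T -> T) n : cancel F G -> cancel (iter n F) (iter n G).
Proof. by move=> FK; elim: n => // n IH x; rewrite iterSr /= FK IH. Qed.

Lemma D_iterK (F G : plane R -> plane R) n x v : cancel F G ->
  (forall x, differentiable F x) -> (forall x, differentiable G x) ->
  D (iter n G) (iter n F x) (D (iter n F) x v) = v.
Proof.
move=> FK dF dG; rewrite -D_comp; try exact: differentiable_iter.
have -> : iter n G \o iter n F = id by apply/funext => y; exact: iter_cancelK.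
exact: D_id.
Qed.

Lemma iter_lift (F : plane R -> plane R) (A : 'M[int]_2) n x k :
  (forall x k, zpt k -> F (x + k) = F x + lin A k) -> zpt k ->
  zpt (iter n (lin A) k) /\ iter n F (x + k) = iter n F x + iter n (lin A) k.
Proof.
move=> hF zk; elim: n => [//|n [z1 e1]]; split; first exact: lin_zpt.
by rewrite /= e1 hF.
Qed.

Lemma D_iter_translate (F : plane R -> plane R) (A : 'M[int]_2) n x k v :
  (forall x, differentiable F x) ->
  (forall x k, zpt k -> F (x + k) = F x + lin A k) -> zpt k ->
  D (iter n F) (x + k) v = D (iter n F) x v.
Proof.
move=> dF hF zk; apply: (@diff_translate _ _ (iter n F) k (iter n (lin A) k)).
  exact: differentiable_iter.
by move=> y; have [] := iter_lift n y hF zk.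
Qed.

Lemma geometric_bounded_eq0 (lam a B : R) : 1 < lam -> 0 <= a ->
  (forall n : nat, lam ^+ n * a <= B) -> a = 0.
Proof.
move=> lam1 a0 h; apply/eqP; rewrite eq_le a0 andbT leNgt; apply/negP => ap.
have bern n : 1 + n%:R * (lam - 1) <= lam ^+ n.
  elim: n => [|n IH]; first by rewrite mul0r addr0 expr0.
  rewrite exprS -natr1; have : 0 <= (n%:R : R) by rewrite ler0n.
  move: IH; move: (lam ^+ n) (n%:R : R) => p q IH q0.
  have h1 : lam * (1 + q * (lam - 1)) <= lam * p by rewrite ler_pM2l// (lt_trans ltr01).
  have : 0 <= q * (lam - 1) ^+ 2 by rewrite mulr_ge0// sqr_ge0.
  nra.
have d0 : 0 < (lam - 1) * a by rewrite mulr_gt0// subr_gt0.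
have [n n0 hn] := nat_gt (B / ((lam - 1) * a)).
have := h n; rewrite ltr_pdivrMr// in hn.
have := bern n; rewrite -(ler_pM2r ap); lra.
Qed.

Lemma addzS (i : int) n : i + n.+1%:Z = i + n%:Z + 1.
Proof. by rewrite -addn1 PoszD addrA. Qed.

(** * Bounded trajectories of the derivative vanish *)

Section NoBoundedTrajectory.
Variables (f : torus R -> torus R) (F : plane R -> plane R) (A : 'M[int]_2).
Hypothesis lF : is_lift f F.
Hypothesis dF : forall x, differentiable F x.
Hypothesis hA : forall x k, zpt k -> F (x + k) = F x + lin A k.
Hypothesis hf : anosov f F.

Variable q : int -> plane R.
Hypothesis hq : forall i, zpt (F (q i) - q (i + 1)).

Lemma tD_iter n i v : tD (iter n F) (torus_proj (q i)) v = D (iter n F) (q i) v.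
Proof.
rewrite /tD -DE; have z := repr_torus (q i).
by rewrite -[repr _](subrK (q i)) addrC (D_iter_translate n (q i) v dF hA z).
Qed.

(** [q] is an orbit only modulo the lattice, so that limits of orbits brought back to the unit
    square are covered; [D F] being periodic, derivatives along [q] still compose. *)
Lemma pseudo_iter n i : zpt (iter n F (q i) - q (i + n%:Z)).
Proof.
elim: n => [|n IH]; first by rewrite addr0 subrr /zpt /= rpred0.
rewrite addzS /=; set y := iter n F (q i) in IH *; set c := q (i + n%:Z) in IH.
have -> : F y = F (c + (y - c)) by rewrite addrC subrK.
rewrite hA // addrAC; apply: zptD; [exact: hq|exact: lin_zpt].
Qed.

Lemma DF_pseudo n i v : D F (iter n F (q i)) v = D F (q (i + n%:Z)) v.
Proof.
have z := pseudo_iter n i.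
by rewrite -[iter n F (q i)](subrK (q (i + n%:Z))) addrC -{1}[F]/(iter 1 F) (D_iter_translate 1 _ _ dF hA z).
Qed.

Lemma D_iter_traj (w : int -> plane R) n i :
  (forall i, D F (q i) (w i) = w (i + 1)) -> D (iter n F) (q i) (w i) = w (i + n%:Z).
Proof.
move=> hw; elim: n => [|n IH]; first by rewrite D_iter0 addr0.
by rewrite D_iterS// IH DF_pseudo hw addzS.
Qed.

Lemma splitting_orbit : full_orbit f (fun i => torus_proj (q i)).
Proof. by move=> i; have [_ ->] := lF; apply/torus_projP. Qed.

Lemma splitting_mem (E : int -> {vspace plane R}) n i v :
  (forall i, tD F (torus_proj (q i)) @` [set` E i] = [set` E (i + 1)]) ->
  v \in E i -> D (iter n F) (q i) v \in E (i + n%:Z).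
Proof.
move=> hE vE; elim: n => [|n IH]; first by rewrite D_iter0 addr0.
rewrite D_iterS// DF_pseudo addzS.
have : (tD F (torus_proj (q (i + n%:Z))) @` [set` E (i + n%:Z)]) (D F (q (i + n%:Z)) (D (iter n F) (q i) v)).
  by exists (D (iter n F) (q i) v) => //; rewrite -[F in tD F]/(iter 1 F) tD_iter.
by rewrite hE.
Qed.

(** Boundedness in the future kills the unstable part of [w 0]. At time [- n] the unstable part is
    sent into both [Eu 0] and [Es 0], hence is zero too; so [w 0] is the image of a bounded stable
    vector contracted [n] times, for every [n]. Constants that depend on the orbit do no harm to a
    vanishing statement. *)
Lemma no_bounded_trajectory (w : int -> plane R) (B : R) :
  (forall i, D F (q i) (w i) = w (i + 1)) -> (forall i, `|w i| <= B) -> w 0 = 0.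
Proof.
move=> hw hB.
have [Eu [Es [_ hS hinv [c [lam [c0 lam1 hcl]]]]]] := hf.2 _ splitting_orbit.
have hu n i v : v \in Eu i -> lam ^+ n * `|v| <= c * (2 * `|D (iter n F) (q i) v|).
  move=> /((hcl n i).1 v); rewrite tD_iter -mulrA ler_pdivrMl// => h.
  rewrite (le_trans _ (le_trans h _))//; last by rewrite ler_pM2l// enorm_le.
  by rewrite ler_wpM2l ?enorm_ge// exprn_ge0// ltW// (lt_trans ltr01).
have hs n i v : v \in Es i -> lam ^+ n * `|D (iter n F) (q i) v| <= c * (2 * `|v|).
  have l0 : 0 < lam ^+ n by rewrite exprn_gt0// (lt_trans ltr01).
  move=> /((hcl n i).2 v); rewrite tD_iter mulrAC ler_pdivlMr// mulrC => h.
  rewrite (le_trans _ (le_trans h _))//; last by rewrite ler_pM2l// enorm_le.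
  by rewrite ler_pM2l// enorm_ge.
have lge n : 1 <= lam ^+ n by rewrite exprn_ege1// ltW.
have split i v : exists u z, [/\ u \in Eu i, z \in Es i & v = u + z].
  have : v \in (Eu i + Es i)%VS by rewrite (hS i).1 memvf.
  by case/memv_addP => u hu' [z hz' ->]; exists u, z.
have Du n i u : u \in Eu i -> D (iter n F) (q i) u \in Eu (i + n%:Z).
  by apply: splitting_mem => i'; case: (hinv i').
have Ds n i u : u \in Es i -> D (iter n F) (q i) u \in Es (i + n%:Z).
  by apply: splitting_mem => i'; case: (hinv i').
have [u [s [uE sE e]]] := split 0 (w 0).
have u0 : u = 0.
  apply/eqP; rewrite -normr_eq0; apply/eqP.
  apply: (@geometric_bounded_eq0 lam _ (c * (2 * (B + c * (2 * `|s|))))) => // n.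
  rewrite (le_trans (hu n 0 u uE))// !ler_pM2l//.
  have -> : D (iter n F) (q 0) u = w (0 + n%:Z) - D (iter n F) (q 0) s.
    by rewrite -D_iter_traj// e linearD addrK.
  rewrite (le_trans (ler_normB _ _))// lerD// (le_trans _ (hs n 0 s sE))//.
  by rewrite ler_peMl.
have w0s : w 0 \in Es 0 by rewrite e u0 add0r.
apply/eqP; rewrite -normr_eq0; apply/eqP.
apply: (@geometric_bounded_eq0 lam _ (c * (2 * B))) => // n.
have en : - n%:Z + n%:Z = 0 by rewrite addNr.
have [u' [s' [uE' sE' e']]] := split (- n%:Z) (w (- n%:Z)).
have Dw : D (iter n F) (q (- n%:Z)) (w (- n%:Z)) = w 0 by rewrite D_iter_traj// en.
have Du0 : D (iter n F) (q (- n%:Z)) u' = 0.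
  have h1 := Du n _ _ uE'; have h2 := Ds n _ _ sE'; rewrite en in h1 h2.
  have h3 : D (iter n F) (q (- n%:Z)) u' \in Es 0.
    have -> : D (iter n F) (q (- n%:Z)) u' = w 0 - D (iter n F) (q (- n%:Z)) s'.
      by rewrite -Dw e' linearD addrK.
    by rewrite rpredB.
  have : D (iter n F) (q (- n%:Z)) u' \in (Eu 0%R :&: Es 0%R)%VS by rewrite memv_cap h1.
  by rewrite (hS 0).2 memv0 => /eqP.
have us' : u' = 0.
  have := hu n _ _ uE'; rewrite Du0 normr0 !mulr0 => h.
  by apply/eqP; rewrite -normr_le0 (le_trans _ h)// ler_peMl.
have := hs n _ _ sE'; rewrite -[s'](add0r s') -us' -e' Dw => h.
by rewrite (le_trans h)// !ler_pM2l.
Qed.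

End NoBoundedTrajectory.

End Iterates.

(** * Uniform expansivity by compactness *)

Section UniformExpansivity.
Variable R : realType.
Implicit Types (u v w x y z : plane R) (a b s t : R).

Lemma cvg_D2 (F : plane R -> plane R) M C (T : Type) (U : set_system T) (FU : Filter U)
    (p q : T -> plane R) x v : C11 F M C ->
  p n @[n --> U] --> x -> q n @[n --> U] --> v -> D F (p n) (q n) @[n --> U] --> D F x v.
Proof.
move=> [_ M0 C0 hM hC] px qv; apply/cvgrPdist_le => e e0 /=.
have e2 : 0 < e / 2 / (C * (`|v| + 1)) by rewrite !divr_gt0// mulr_gt0// ltr_wpDl.
have e3 : 0 < Num.min (e / 2 / M) 1 by rewrite lt_min !divr_gt0/=.
have n1 : \forall n \near U, `|x - p n| <= e / 2 / (C * (`|v| + 1)).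
  by move/cvgr_dist_le : px => /(_ _ e2).
have n2 : \forall n \near U, `|v - q n| <= Num.min (e / 2 / M) 1.
  by move/cvgr_dist_le : qv => /(_ _ e3).
near=> n.
have h1 : `|x - p n| <= e / 2 / (C * (`|v| + 1)) by near: n.
have : `|v - q n| <= Num.min (e / 2 / M) 1 by near: n.
rewrite le_min => /andP[h2 h3].
have -> : D F x v - D F (p n) (q n) = (D F x (q n) - D F (p n) (q n)) + D F x (v - (q n)).
  by rewrite linearB; apply: peq; rewrite !pE; ring.
rewrite (le_trans (ler_normD _ _))// [e](splitr e) lerD//.
- rewrite (le_trans (hC _ _ _))//.
  have h4 : `|q n| <= `|v| + 1.
    rewrite -[(q n)](subKr v) (le_trans (ler_normB _ _))// lerD2l //.
  rewrite ler_pdivlMr ?mulr_gt0 ?ltr_wpDl// in h1; apply: le_trans h1.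
  by rewrite -mulrA mulrCA ler_wpM2l// ler_pM2l.
- rewrite (le_trans (hM _ _))// mulrC -ler_pdivlMr//.
Unshelve. all: by end_near. Qed.

Lemma continuous_circ : continuous (@circ R).
Proof.
have c1 : continuous (fun b : R => 2 * pi * b) by move=> a; apply: cvgMr; exact: cvg_id.
apply: continuous_pair.
  by apply: continuous_compose c1 _; exact: continuous_cos.
by apply: continuous_compose c1 _; exact: continuous_sin.
Qed.

(** The lattice is a fibre of a continuous map into a product of circles. *)
Lemma closed_zpt : closed [set k : plane R | zpt k].
Proof.
have -> : [set k : plane R | zpt k] =
    (fun k : plane R => (circ (k.1 : R), circ (k.2 : R)) : plane R * plane R) @^-1` [set (circ 0, circ 0)].
  apply/seteqP; split => k /=.
    by move=> /andP[k1 k2]; congr (_, _); apply: circ_int; rewrite subr0.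
  move=> -[h1 h2 h3 h4].
  have e1' : circ (k.1 : R) = circ 0 by rewrite /circ h1 h2.
  have e2' : circ (k.2 : R) = circ 0 by rewrite /circ h3 h4.
  by apply/andP; have := circ_inj e1'; have := circ_inj e2'; rewrite !subr0.
apply: preimage_closed; last first.
  by apply: accessible_closed_set1; apply: hausdorff_accessible; exact: norm_hausdorff.
move=> k _; have cid := @continuous_id (plane R).
apply: (continuous_pair (f := fun k : plane R => circ (k.1 : R)) (g := fun k : plane R => circ (k.2 : R))).
  by apply: (continuous_compose (continuous_fst cid)); exact: continuous_circ.
by apply: (continuous_compose (continuous_snd cid)); exact: continuous_circ.
Qed.

Section Compactness.
Variables (f : torus R -> torus R) (F G : plane R -> plane R) (A : 'M[int]_2).
Variables M C M' C' : R.
Hypothesis lF : is_lift f F.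
Hypothesis cF : C11 F M C.
Hypothesis cG : C11 G M' C'.
Hypothesis FK : cancel F G.
Hypothesis GK : cancel G F.
Hypothesis hA : forall x k, zpt k -> F (x + k) = F x + lin A k.
Hypothesis hf : anosov f F.

Let dF : forall x, differentiable F x. Proof. by case: cF. Qed.
Let dG : forall x, differentiable G x. Proof. by case: cG. Qed.

(** [Negz n] stands for [- (n + 1)], whence the shift to [n.+1] iterates of the inverse. *)
Definition zorb x (i : int) : plane R :=
  match i with Posz n => iter n F x | Negz n => iter n.+1 G x end.

Definition ztraj x v (i : int) : plane R :=
  match i with Posz n => D (iter n F) x v | Negz n => D (iter n.+1 G) x v end.

Lemma zorbS x i : F (zorb x i) = zorb x (i + 1).
Proof.
case: i => [n|[|n]]; first by rewrite -[Posz n + 1]/(Posz (n + 1)) addn1.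
- by rewrite /= GK.
- have -> : Negz n.+1 + 1 = Negz n by rewrite !NegzE; lia.
  exact: (GK (iter n.+1 G x)).
Qed.

Lemma DFG x v : D F (G x) (D G x v) = v.
Proof. exact: (D_iterK 1 x v GK dG dF). Qed.

Lemma ztrajS x v i : D F (zorb x i) (ztraj x v i) = ztraj x v (i + 1).
Proof.
case: i => [n|[|n]]; first by rewrite -[Posz n + 1]/(Posz (n + 1)) addn1 /ztraj D_iterS.
- have -> : Negz 0 + 1 = 0 by [].
  exact: (etrans (DFG x v) (esym (D_iter0 F x v))).
- have -> : Negz n.+1 + 1 = Negz n by rewrite !NegzE; lia.
  rewrite /ztraj (D_iterS n.+1) //; exact: (DFG (iter n.+1 G x)).
Qed.

(** Along an ultrafilter all the sequences that stay in compact sets converge at once; this replaces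
    a diagonal extraction over the integer times. *)
Lemma ultra_limit (U : set_system nat) (V : topologicalType) (K : set V) (a : nat -> V) :
  UltraFilter U -> compact K -> (\forall n \near U, K (a n)) ->
  exists2 p, K p & a @ U --> p.
Proof.
move=> UU cK nK.
have UI : UltraFilter (a @ U).
  split; first exact: fmap_proper_filter.
  move=> H PH sub; apply/seteqP; split => // B HB.
  have [//|nB] := in_ultra_setVsetC (a @^-1` B) UU.
  have HnB : H (~` B) by apply: sub; exact: nB.
  have := filterI HB HnB; rewrite setICr => H0.
  by case: (@filter_not_empty _ H PH (H0 _)).
move: cK; rewrite compact_ultra => h.
have [p [Kp ap]] := h (a @ U) UI nK.
by exists p.
Qed.

(** Otherwise there are unit vectors whose trajectories stay below 2 on longer and longer windows
    around time 0; recentred by the lattice, they have as limit a bounded full trajectory of norm 1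
    at time 0, against [no_bounded_trajectory]. This is how constants attached to single orbits
    become uniform. *)
Lemma uniform_expansivity : exists N : nat, forall x v, exists n : nat, (n <= N)%N /\
  (2 * `|v| <= `|D (iter n F) x v| \/ 2 * `|v| <= `|D (iter n G) x v|).
Proof.
apply: contrapT => hN.
have {hN} /choice[p hp] : forall N : nat, exists p : plane R * plane R, `|p.2| = 1 /\
    forall n, (n <= N)%N -> `|D (iter n F) p.1 p.2| <= 2 /\ `|D (iter n G) p.1 p.2| <= 2.
  move=> N; apply: contrapT => h; apply: hN; exists N => x v.
  apply: contrapT => h'; apply: h.
  have v0 : `|v| != 0.
    apply/eqP => v0; apply: h'; exists 0%N; split => //; left.
    by rewrite D_iter0 v0 mulr0.
  have vp : 0 < `|v| by rewrite lt_def v0 normr_ge0.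
  exists (x, `|v|^-1 *: v); split; first by rewrite /= normrZ gtr0_norm ?invr_gt0// mulVf.
  move=> n nN /=; rewrite !linearZ /= !normrZ !gtr0_norm ?invr_gt0//.
  split; rewrite mulrC ler_pdivrMr// leNgt; apply/negP => /ltW h2; apply: h'; exists n; split => //; by [left|right].
have [U [UU hU]] : exists U : set_system nat, UltraFilter U /\ nbhs \oo `<=` U.
  exact: ultraFilterLemma.
have PU : ProperFilter U by exact: ultra_proper.
have /choice[k0 hk0] : forall x, exists k, zpt k /\ (`[0, 1] `*` `[0, 1] : set (plane R)) (x - k).
  by move=> x; have [k zk [h1 h2]] := floor_pt x; exists k; split.
(* Orbits may leave every compact set, so each point is brought back to the unit square by a lattice
   vector of its own; derivatives are not affected. *)
pose a i N := zorb (p N).1 i - k0 (zorb (p N).1 i).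
pose b i N := ztraj (p N).1 (p N).2 i.
have /choice[q hq] : forall i : int, exists q : plane R, a i N @[N --> U] --> q.
  move=> i; have [|q _ hq] := @ultra_limit U _ _ (a i) UU (@compact_square R); last by exists q.
  by apply: nearW => N; case: (hk0 (zorb (p N).1 i)).
have b2 i : \forall N \near U, `|b i N - 0| <= 2.
  apply: hU; exists `|i|%N => // N /= iN; rewrite subr0.
  by case: i iN => n iN /=; [case: ((hp N).2 n iN)|case: ((hp N).2 n.+1 iN)].
have /choice[w hw] : forall i : int, exists w : plane R, b i N @[N --> U] --> w.
  move=> i; have [|w _ hw] := @ultra_limit U _ _ (b i) UU (@compact_box R 0 2); last by exists w.
  by near=> N; apply/in_box; near: N.
have cFF : continuous F by move=> ?; exact: differentiable_continuous.
(* [F] sends lattice translates to lattice translates, and the lattice is closed: the limit is an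
   orbit modulo the lattice. *)
have qS i : zpt (F (q i) - q (i + 1)).
  apply: (@closed_cvg _ _ U _ (fun N => F (a i N) - a (i + 1) N) _ closed_zpt).
    apply: nearW => N /=; rewrite /a.
    have [z1 _] := hk0 (zorb (p N).1 i); have [z2 _] := hk0 (zorb (p N).1 (i + 1)).
    rewrite hA ?zptN// zorbS opprD opprK addrAC addrA subrr add0r.
    by rewrite zptD// lin_zpt// zptN.
  apply: cvgB; last exact: hq.
  by apply: (@cvg_comp _ _ _ (a i) F); [exact: hq|exact: cFF].
have wS i : D F (q i) (w i) = w (i + 1).
  have h1 : D F (a i N) (b i N) @[N --> U] --> D F (q i) (w i).
    exact: (cvg_D2 _ cF (hq i) (hw i)).
  have e : (fun N => D F (a i N) (b i N)) = b (i + 1).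
    apply/funext => N; rewrite /b -ztrajS /a.
    have [z1 _] := hk0 (zorb (p N).1 i).
    exact: (D_iter_translate 1 _ _ dF hA (zptN z1)).
  rewrite e in h1.
  exact: (cvg_unique _ h1 (hw (i + 1))).
have wB i : `|w i| <= 2.
  apply: (@closed_cvg _ _ U _ (fun N => `|b i N|) [set r : R | r <= 2]).
  - exact: closed_le.
  - by near=> N; rewrite /= -[b i N]subr0; near: N.
  - by apply: cvg_norm; exact: hw.
have w1 : `|w 0| = 1.
  have h : `|b 0 N| @[N --> U] --> `|w 0| by apply: cvg_norm; exact: hw.
  have e : (fun N => `|b 0 N|) = fun=> 1.
    by apply/funext => N; rewrite /b /= D_iter0; case: (hp N).
  rewrite e in h; exact: esym (cvg_unique _ (cvg_cst _) h).
have := no_bounded_trajectory lF dF hA hf qS wS wB.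
by move=> w0; move: w1; rewrite w0 normr0 => /eqP; rewrite eq_sym oner_eq0.
Unshelve. all: by end_near. Qed.

End Compactness.
End UniformExpansivity.

(** * A splitting with uniform constants *)

Section UniformSplitting.
Variable R : realType.
Implicit Types (u v w x y z : plane R) (a b s t : R).

Lemma bernoulli_sub (y : R) n : 0 <= y <= 1 -> 1 - n%:R * y <= (1 - y) ^+ n.
Proof.
move=> /andP[y0 y1]; elim: n => [|n IH]; first by rewrite mul0r subr0 expr0.
rewrite exprS -natr1; have : 0 <= (n%:R : R) by rewrite ler0n.
move: IH; move: ((1 - y) ^+ n) (n%:R : R) => p q IH q0.
have h1 : (1 - y) * (1 - q * y) <= (1 - y) * p by rewrite ler_wpM2l// subr_ge0.
have : 0 <= q * y ^+ 2 by rewrite mulr_ge0// sqr_ge0.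
nra.
Qed.

Lemma archi_pow2 (a b : R) : 0 < a -> exists k : nat, b / 2 ^+ k < a.
Proof.
move=> a0; have [n n0 hn] := nat_gt (b / a).
exists n; rewrite ltr_pdivrMr ?exprn_gt0// mulrC -ltr_pdivrMr// (lt_trans hn)//.
have : (n < 2 ^ n)%N by exact: ltn_expl.
by rewrite -(ltr_nat R) natrX.
Qed.

(** The dominating index [m] may lie on either side of [n]. The bound [b], halved again and again,
    first gives [p n <= A] with [A] independent of [b]; from there every block of [N.+1] indices
    halves the bound valid beyond it. *)
Lemma seq_contraction (M : R) (N : nat) : 1 <= M -> exists K th : R, [/\ 1 <= K, 0 < th < 1 &
  forall (p : nat -> R) (b : R), (forall n, 0 <= p n <= b) ->
    (forall n, p n.+1 <= M * p n) ->
    (forall n, (N.+1 <= n)%N -> exists2 m, (n <= m + N.+1)%N & 2 * p n <= p m) ->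
    forall n, p n <= K * th ^+ n * p 0%N].
Proof.
move=> M1; pose L : R := N.+1%:R; have L1 : 1 <= L by rewrite ler1n.
(* By Bernoulli's inequality [th ^+ N.+1] is at least 1/2, so decay at rate [th] is implied by one
   halving per block. *)
pose th : R := 1 - (2 * L)^-1.
have L2 : 0 < 2 * L by lra.
have iL : 0 < (2 * L)^-1 <= 2^-1.
  by rewrite invr_gt0 L2/= lef_pV2 ?posrE//; lra.
have /andP[iL1 iL2] := iL.
have y01 (y : R) : 0 < y -> y <= 2^-1 -> 0 < 1 - y < 1 /\ 0 <= y <= 1.
  by move=> y0 y1; split; apply/andP; split; lra.
have [th0 y01'] := y01 _ iL1 iL2.
have /andP[tp t1] := th0.
have thN : 2^-1 <= th ^+ N.+1.
  move: y01' => /(@bernoulli_sub _ N.+1); rewrite -/L -/th; apply: le_trans.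
  by have -> : L * (2 * L)^-1 = 2^-1; [field; rewrite gt_eqF; lra | lra].
exists (M ^+ N.+1 / th ^+ N.+1), th; split => //.
  rewrite ler_pdivlMr ?exprn_gt0// mul1r.
  have h1 : th ^+ N.+1 <= 1 by apply: exprn_ile1; exact: ltW.
  by rewrite (le_trans h1)// exprn_ege1.
move=> p b p0 pS pN; pose A := M ^+ N.+1 * p 0%N.
have A0 : 0 <= A by rewrite mulr_ge0 ?exprn_ge0//; [lra|case/andP: (p0 0%N)].
have pA n : (n <= N.+1)%N -> p n <= A.
  have h : p n <= M ^+ n * p 0%N.
    elim: n => [|n IH]; first by rewrite mul1r.
    by rewrite (le_trans (pS n))// exprS -mulrA ler_pM2l//; lra.
  move=> nN; rewrite (le_trans h)// ler_wpM2r//; first by case/andP: (p0 0%N).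
  by rewrite ler_weXn2l.
have pb k n : p n <= Num.max A (b / 2 ^+ k).
  elim: k n => [|k IH] n; first by rewrite expr0 divr1 le_max; case/andP: (p0 n) => _ ->; rewrite orbT.
  case: (leqP n N.+1) => [/pA h|/ltnW/pN[m _ h]]; first by rewrite le_max h.
  have := le_trans h (IH m); rewrite exprS invfM mulrCA.
  rewrite !le_max => /orP[h1|h1]; apply/orP; [left|right]; lra.
have pA' n : p n <= A.
  rewrite leNgt; apply/negP => h.
  have [k hk] := archi_pow2 b (le_lt_trans A0 h).
  by have := pb k n; rewrite leNgt gt_max h hk.
have dec k n : (k * N.+1 <= n)%N -> p n <= A / 2 ^+ k.
  elim: k n => [|k IH] n; first by rewrite expr0 divr1.
  rewrite mulSn => h.
  have [m hm h1] := pN n (leq_trans (leq_addr _ _) h).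
  have := IH m; rewrite exprS invfM mulrCA => /(_ _).
  have : (k * N.+1 <= m)%N by move: h hm; rewrite addnC => h hm; have := leq_trans h hm; rewrite leq_add2r.
  move=> h2 /(_ h2) h3; lra.
move=> n; set k := (n %/ N.+1)%N.
have hk : (k * N.+1 <= n)%N by exact: leq_divM.
have hk' : (n <= N.+1 * k.+1)%N by rewrite mulnC ltnW// ltn_ceil.
have h1 := dec _ _ hk.
apply: le_trans h1 _; rewrite /A.
have -> : M ^+ N.+1 / th ^+ N.+1 * th ^+ n * p 0%N = M ^+ N.+1 * p 0%N * (th ^+ n / th ^+ N.+1) by ring.
rewrite ler_wpM2l// ler_pdivlMr ?exprn_gt0//.
have h2 : (2 ^+ k)^-1 <= th ^+ (N.+1 * k).
  by rewrite exprM -exprVn lerXn2r ?nnegrE ?invr_ge0// exprn_ge0// ltW.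
apply: le_trans (ler_wpM2r _ h2) _; first by rewrite exprn_ge0// ltW.
rewrite -exprD addnC -mulnS; rewrite ler_wiXn2l//; exact: ltW.
Qed.

Lemma geometric_small (c e th : R) : 0 < th -> th < 1 -> 0 < e ->
  exists n : nat, c * th ^+ n < e.
Proof.
move=> th0 th1 e0; apply: contrapT => h.
have h' n : (th^-1) ^+ n * e <= c.
  rewrite exprVn mulrC ler_pdivrMr ?exprn_gt0// leNgt.
  by apply/negP => h''; apply: h; exists n.
have : 1 < th^-1 by rewrite invf_gt1.
by move=> /geometric_bounded_eq0/(_ (ltW e0) h') e00; move: e0; rewrite e00 ltxx.
Qed.

(** Completes a nonzero vector to a basis. [cross v (rot90 v)] is the squared Euclidean norm, hence
    lies between 1 and 2 when [v] has maximum norm 1. *)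
Definition rot90 (v : plane R) : plane R := (- (v.2 : R), v.1).

Lemma pnorm_rot90 v : `|rot90 v| = `|v|.
Proof. by rewrite !pnormE /= normrN maxC. Qed.

Lemma cross_rot90 v : `|v| ^+ 2 <= cross v (rot90 v).
Proof.
rewrite /cross /= mulrN opprK -!expr2 pnormE.
have h (a : R) : `|a| ^+ 2 = a ^+ 2 by rewrite real_normK ?num_real.
by case: (leP `|v.1| `|v.2|) => _; rewrite h ?lerDl ?lerDr sqr_ge0.
Qed.

Section Frame.
Variables (f : torus R -> torus R) (F G : plane R -> plane R) (A : 'M[int]_2).
Variables M C M' C' : R.
Hypothesis lF : is_lift f F.
Hypothesis cF : C11 F M C.
Hypothesis cG : C11 G M' C'.
Hypothesis FK : cancel F G.
Hypothesis GK : cancel G F.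
Hypothesis hA : forall x k, zpt k -> F (x + k) = F x + lin A k.
Hypothesis hf : anosov f F.

Let dF : forall x, differentiable F x. Proof. by case: cF. Qed.
Let dG : forall x, differentiable G x. Proof. by case: cG. Qed.

Definition bounded_traj (H : plane R -> plane R) x v : Prop :=
  exists b, forall n, `|D (iter n H) x v| <= b.

(* Uniform expansivity rules out that a norm along a bounded half-orbit fails
   to be dominated by one a bounded time earlier. *)
Lemma contraction_of_bounded (H H' : plane R -> plane R) (m c : R) (N : nat) :
  C11 H m c -> (forall x, differentiable H' x) -> cancel H H' ->
  (forall x v, exists n : nat, (n <= N)%N /\
    (2 * `|v| <= `|D (iter n H) x v| \/ 2 * `|v| <= `|D (iter n H') x v|)) ->
  exists K th : R, [/\ 1 <= K, 0 < th < 1 & forall x v, bounded_traj H x v ->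
     forall n, `|D (iter n H) x v| <= K * th ^+ n * `|v|].
Proof.
move=> cH dH' HK hN; have [dH m0 _ hm _] := cH.
have m1 : 1 <= Num.max 1 m by rewrite le_max lexx.
have [K [th [K1 th01 hK]]] := seq_contraction N m1.
exists K, th; split => // x v [b hb] n.
have := hK (fun n => `|D (iter n H) x v|) b; rewrite D_iter0; apply.
- by move=> i; rewrite normr_ge0 hb.
- move=> i; rewrite D_iterS// (le_trans (hm _ _))// ler_wpM2r// le_max lexx orbT//.
- move=> i iN; have [l [lN]] := hN (iter i H x) (D (iter i H) x v).
  have li : (l <= i)%N by rewrite (leq_trans lN)// (leq_trans _ iN).
  case=> h.
  + exists (l + i)%N; first by rewrite addnAC leq_addl.
    by rewrite D_iterD.
  + exists (i - l)%N; first by move: lN li; lia.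
    have e : i = (l + (i - l))%N by rewrite subnKC.
    move: e h; move: (i - l)%N => k -> h.
    suff <- : D (iter l H') (iter (l + k) H x) (D (iter (l + k) H) x v) = D (iter k H) x v by [].
    by rewrite D_iterD// iterD D_iterK.
Qed.

Lemma bounded_traj_add (H : plane R -> plane R) x v w s t :
  bounded_traj H x v -> bounded_traj H x w -> bounded_traj H x (s *: v + t *: w).
Proof.
move=> [b hb] [c hc]; exists (`|s| * b + `|t| * c) => n.
rewrite linearD !linearZ /= (le_trans (ler_normD _ _))// !normrZ.
by rewrite lerD// ler_wpM2l.
Qed.

(** The splitting along the orbit of [x] has constants that depend on [x]; only the boundedness of
    the past of [Eu] and of the future of [Es] is kept. *)
Lemma bounded_splitting x : exists u s : plane R, [/\ u != 0, s != 0, bounded_traj G x u, bounded_traj F x s &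
  forall v, exists u' s' : plane R, [/\ bounded_traj G x u', bounded_traj F x s' & v = u' + s' :> plane R]].
Proof.
pose q i := zorb F G x i.
have hq i : zpt (F (q i) - q (i + 1)).
  by rewrite /q (zorbS GK) subrr /zpt /= rpred0.
have [Eu [Es [hdim hS hinv [c [lam [c0 lam1 hcl]]]]]] := hf.2 _ (splitting_orbit lF hq).
have lam0 n : 0 < lam ^+ n by rewrite exprn_gt0// (lt_trans ltr01).
have lge n : 1 <= lam ^+ n by rewrite exprn_ege1// ltW.
have bs v : v \in Es 0 -> bounded_traj F x v.
  move=> vE; exists (c * (2 * `|v|)) => n.
  have := (hcl n 0).2 v vE; rewrite (tD_iter dF hA) /q /= => h.
  rewrite (le_trans (enorm_ge _))// (le_trans h)// -!mulrA ler_pM2l//.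
  rewrite (le_trans _ (enorm_le _))// ler_piMl ?invf_le1//.
  by rewrite (le_trans _ (enorm_ge _)).
have bu v : v \in Eu 0 -> bounded_traj G x v.
  move=> vE; exists (c * (2 * `|v|)) => n.
  (* Invariance is an equality of subspaces, so an unstable vector at time 0 has an unstable
     ancestor at time [- n], which the expansion bounds. *)
  have [w wE ew] : exists2 w, w \in Eu (- n%:Z) & D (iter n F) (q (- n%:Z)) w = v.
    have en : - n%:Z + n%:Z = 0 by rewrite addNr.
    have surj k : (k <= n)%N -> forall v, v \in Eu (- n%:Z + k%:Z) ->
        exists2 w, w \in Eu (- n%:Z) & D (iter k F) (q (- n%:Z)) w = v.
      elim: k => [_ v' vE'|k IH kn v' vE'].
        by exists v'; [rewrite addr0 in vE'|rewrite D_iter0].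
      move: vE'; rewrite addzS => vE'.
      have : [set` Eu (- n%:Z + k%:Z + 1)] v' by [].
      rewrite -(hinv (- n%:Z + k%:Z)).1 => -[w wE hw].
      have [w' wE' hw'] := IH (ltnW kn) w wE.
      exists w' => //; rewrite D_iterS// hw' -hw (DF_pseudo dF hA hq).
      by rewrite -[tD F _ w]/(tD (iter 1 F) _ w) (tD_iter dF hA).
    by have [|w wE hw] := surj n (leqnn n) v; [rewrite en|exists w].
  have := (hcl n (- n%:Z)).1 w wE; rewrite (tD_iter dF hA) ew => h.
  have -> : D (iter n G) x v = w.
    rewrite -ew; have e : x = iter n F (q (- n%:Z)).
      rewrite /q; case: (n) => // k; rewrite -NegzE /zorb; exact: esym (iter_cancelK k.+1 GK x).
    by rewrite e D_iterK.
  rewrite (le_trans (enorm_ge _))//.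
  have h1 : c^-1 * enorm w <= enorm v.
    apply: le_trans h; rewrite -mulrA ler_pM2l ?invr_gt0// ler_peMl//.
    exact: le_trans (enorm_ge _).
  by rewrite -ler_pdivrMl// (le_trans h1)// enorm_le.
have ex (E : {vspace plane R}) : \dim E = 1%N -> exists2 v, v != 0 & v \in E.
  move=> dE; exists (vpick E); last exact: memv_pick.
  by rewrite vpick0 -dimv_eq0 dE.
have [u u0 uE] := ex _ (hdim 0).1; have [z z0 zE] := ex _ (hdim 0).2.
exists u, z; split; [by []|by []|exact: bu|exact: bs|] => v.
have : v \in (Eu 0%R + Es 0%R)%VS by rewrite (hS 0).1 memvf.
case/memv_addP => u' uE' [z' zE' ->]; exists u', z'; split => //; [exact: bu|exact: bs].
Qed.

(** The signs of [eu] and [es] are arbitrary, so no continuity of the vectors can be asked. The last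
    clause characterizes the two lines dynamically; their invariance follows from it. *)
Definition hyperbolic_frame (eu es : plane R -> plane R) (K th k0 : R) : Prop :=
  [/\ [/\ 1 <= K, 0 < th < 1 & 0 < k0],
      forall x, [/\ `|eu x| = 1, `|es x| = 1 & k0 <= `|cross (eu x) (es x)|],
      forall n x, `|D (iter n F) x (es x)| <= K * th ^+ n,
      forall n x, `|D (iter n G) x (eu x)| <= K * th ^+ n &
      (forall x v, bounded_traj F x v -> cross v (es x) = 0) /\
      (forall x v, bounded_traj G x v -> cross v (eu x) = 0)].

(** Expansivity turns bounded half-trajectories into contracted ones with common [K] and [th]. The
    angle is bounded below because a stable vector nearly parallel to [eu x] would have to grow
    under a fixed iterate. *)
Lemma exists_hyperbolic_frame : exists eu es K th k0, hyperbolic_frame eu es K th k0.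
Proof.
have transF n x v : bounded_traj F x v -> bounded_traj F (iter n F x) (D (iter n F) x v).
  by move=> [b hb]; exists b => m; rewrite -D_iterD.
have transG n x v : bounded_traj G x v -> bounded_traj G (iter n F x) (D (iter n F) x v).
  move=> h; elim: n => [|n [b hb]]; first by rewrite D_iter0.
  exists (Num.max b `|D (iter n.+1 F) x v|) => -[|m].
    by rewrite D_iter0 le_max lexx orbT.
  rewrite le_max -addn1 D_iterD// -[X in `|D _ _ X|]/(D G _ _) D_iterS//.
  have := D_iterK 1 (iter n F x) (D (iter n F) x v) FK dF dG.
  by rewrite /= FK => ->; rewrite hb.
have [N hN] := uniform_expansivity lF cF cG GK hA hf.
have [Ks [ts [Ks1 /andP[ts0 ts1] hs]]] := contraction_of_bounded cF dG FK hN.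
have hN' x v : exists n : nat, (n <= N)%N /\
    (2 * `|v| <= `|D (iter n G) x v| \/ 2 * `|v| <= `|D (iter n F) x v|).
  by have [n [nN h]] := hN x v; exists n; split => //; case: h; [right|left].
have [Ku [tu [Ku1 /andP[tu0 tu1] hu]]] := contraction_of_bounded cG dF GK hN'.
pose K := Num.max Ks Ku; pose th := Num.max ts tu.
have K1 : 1 <= K by rewrite le_max Ks1.
have th0 : 0 < th by rewrite lt_max ts0.
have th1 : th < 1 by rewrite gt_max ts1.
have {}hs x v n : bounded_traj F x v -> `|D (iter n F) x v| <= K * th ^+ n * `|v|.
  move=> /hs/(_ n)/le_trans; apply; rewrite ler_wpM2r// ler_pM ?exprn_ge0 ?(ltW ts0)//; [lra|by rewrite le_max lexx|].
  by rewrite lerXn2r ?nnegrE ?(ltW ts0) ?(ltW th0)// le_max lexx.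
have {}hu x v n : bounded_traj G x v -> `|D (iter n G) x v| <= K * th ^+ n * `|v|.
  move=> /hu/(_ n)/le_trans; apply; rewrite ler_wpM2r// ler_pM ?exprn_ge0 ?(ltW tu0)//; [lra|by rewrite le_max lexx orbT|].
  by rewrite lerXn2r ?nnegrE ?(ltW tu0) ?(ltW th0)// le_max lexx orbT.
have K0 : 0 < K by lra.
have dec (c e : R) : 0 < e -> exists n : nat, c * th ^+ n < e by exact: geometric_small.
have disj x v : bounded_traj F x v -> bounded_traj G x v -> v = 0.
  move=> [b hb] [c hc].
  have hq i : zpt (F (zorb F G x i) - zorb F G x (i + 1)).
    by rewrite (zorbS GK) subrr /zpt /= rpred0.
  have hw i : `|ztraj F G x v i| <= Num.max b c.
    by case: i => n; rewrite le_max ?hb ?hc ?orbT.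
  have := no_bounded_trajectory lF dF hA hf hq (ztrajS cF cG GK x v) hw.
  by rewrite /= D_iter0.
have /choice[p hp] x : exists p : plane R * plane R,
    [/\ p.1 != 0, p.2 != 0, bounded_traj G x p.1 & bounded_traj F x p.2].
  by have [u [z [u0 z0 bu bz _]]] := bounded_splitting x; exists (u, z).
pose eu x := `|(p x).1|^-1 *: (p x).1; pose es x := `|(p x).2|^-1 *: (p x).2.
have bZ H x v (c : R) : bounded_traj H x v -> bounded_traj H x (c *: v).
  by move=> h; have := bounded_traj_add 0 c h h; rewrite scale0r add0r.
have eu1 x : `|eu x| = 1.
  by case: (hp x) => u0 _ _ _; rewrite normrZ ger0_norm ?invr_ge0// mulVf// normr_eq0.
have es1 x : `|es x| = 1.
  by case: (hp x) => _ u0 _ _; rewrite normrZ ger0_norm ?invr_ge0// mulVf// normr_eq0.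
have beu x : bounded_traj G x (eu x) by apply: bZ; case: (hp x).
have bes x : bounded_traj F x (es x) by apply: bZ; case: (hp x).
have Teu n x : 1 <= K * th ^+ n * `|D (iter n F) x (eu x)|.
  have := hu _ _ n (transG n _ _ (beu x)).
  by rewrite D_iterK// eu1.
clearbody eu es.
have [n hn] := dec K 4^-1 (ltac:(by rewrite invr_gt0)).
have [_ M0 _ _ _] := cF.
(* Since [K * th ^+ n < 1/4], the vector [eu x] grows by more than 4 in [n] steps; the term
   [2^-1 / M ^+ n] keeps the part of [es x] across [eu x] below 1/2 during them. *)
pose k0 := Num.min 2^-1 (2^-1 / M ^+ n).
have Mn0 : 0 < M ^+ n by rewrite exprn_gt0.
have k00 : 0 < k0 by rewrite lt_min invr_gt0 ltr0n /= divr_gt0// invr_gt0.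
exists eu, es, K, th, k0; split.
- by split => //; rewrite th0.
- move=> x; split => //; rewrite leNgt; apply/negP => hk.
  pose Je := rot90 (eu x).
  have c1 : 1 <= cross (eu x) Je.
    by have := cross_rot90 (eu x); rewrite eu1 expr1n.
  have c0 : 0 < cross (eu x) Je by lra.
  have J1 : `|Je| = 1 by rewrite pnorm_rot90.
  have e := cramer_div (es x) (lt0r_neq0 c0).
  set a := cross (es x) Je / _ in e; set b := cross (eu x) (es x) / _ in e.
  have hb : `|b| < k0.
    rewrite /b normrM (le_lt_trans _ hk)// ler_piMr// normfV (gtr0_norm c0) invf_le1//.
  have hb1 : `|b| < 2^-1 by move: hb; rewrite lt_min => /andP[].
  have hb2 : `|b| * M ^+ n < 2^-1.
    by move: hb; rewrite lt_min => /andP[_]; rewrite ltr_pdivlMr// exprn_gt0.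
  clearbody a b.
  have ha : 2^-1 < `|a|.
    have := es1 x; rewrite e => e1; have := ler_normD (a *: eu x) (b *: Je).
    rewrite e1 !normrZ eu1 J1 !mulr1 => h1.
    by have h2 : 1 <= `|a| + `|b| := h1; lra.
  have hT : 4 < `|D (iter n F) x (eu x)|.
    have := Teu n x; have : 0 <= K * th ^+ n by rewrite mulr_ge0 ?exprn_ge0 ?ltW.
    move: hn; move: (K * _) `|_| => r q; nra.
  have hes : `|D (iter n F) x (es x)| < 4^-1.
    by rewrite (le_lt_trans (hs _ _ n (bes x)))// es1 mulr1.
  have hJ : `|D (iter n F) x (b *: Je)| < 2^-1.
    rewrite linearZ normrZ (le_lt_trans _ hb2)// ler_wpM2l//.
    by rewrite (le_trans (D_iter_le _ _ _ cF))// J1 mulr1.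
  have : `|D (iter n F) x (a *: eu x)| < 1.
    have -> : a *: eu x = es x - b *: Je by rewrite [in RHS]e addrK.
    rewrite linearB (le_lt_trans (ler_normB _ _))//; lra.
  rewrite linearZ normrZ; nra.
- by move=> m x; have := hs _ _ m (bes x); rewrite es1 mulr1.
- by move=> m x; have := hu _ _ m (beu x); rewrite eu1 mulr1.
- split => x v bv; apply/eqP/negPn/negP => ne.
  + have : eu x = 0.
      apply: (disj x) => //; rewrite (cramer_div (eu x) ne); exact: bounded_traj_add.
    by move=> /(congr1 (fun v => `|v|)); rewrite eu1 normr0 => /eqP; rewrite oner_eq0.
  + have : es x = 0.
      apply: (disj x) => //; rewrite (cramer_div (es x) ne); exact: bounded_traj_add.
    by move=> /(congr1 (fun v => `|v|)); rewrite es1 normr0 => /eqP; rewrite oner_eq0.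
Qed.

End Frame.
End UniformSplitting.

(** * Lipschitz continuity of the line fields *)

Section LineFields.
Variable R : realType.
Implicit Types (u v w x y z : plane R) (a b s t : R).

Lemma cross0_parallel v w : cross v w = 0 -> `|w| = 1 ->
  exists2 c : R, v = c *: w & `|c| = `|v|.
Proof.
move=> vw w1; have h := cross_rot90 w; rewrite w1 expr1n in h.
have n0 : cross w (rot90 w) != 0 by rewrite gt_eqF// (lt_le_trans ltr01).
have e : v = (cross v (rot90 w) / cross w (rot90 w)) *: w.
  by rewrite [LHS](cramer_div v n0) (crossC w v) vw oppr0 mul0r scale0r addr0.
by eexists; [exact: e|have := congr1 Num.norm e; rewrite normrZ w1 mulr1].
Qed.

Lemma C11_id : C11 (@id (plane R)) 1 1.
Proof.
split=> //.
- by move=> z v; rewrite D_id mul1r.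
- by move=> z w v; rewrite !D_id subrr normr0 mul1r mulr_ge0.
Qed.

Lemma C11_comp (F H : plane R -> plane R) M C M' C' :
  C11 F M C -> C11 H M' C' -> C11 (F \o H) (M * M') (C * M' ^+ 2 + M * C').
Proof.
move=> cF cH; have [dF M0 C0 hM hC] := cF; have [dH M0' C0' hM' hC'] := cH.
have DFH z v : D (F \o H) z v = D F (H z) (D H z v) by exact: D_comp.
split.
- by move=> z; apply: differentiable_comp.
- exact: mulr_gt0.
- by rewrite addr_gt0// mulr_gt0// exprn_gt0.
- by move=> z v; rewrite DFH (le_trans (hM _ _))// -mulrA ler_pM2l.
move=> z w v; rewrite !DFH.
have -> : D F (H z) (D H z v) - D F (H w) (D H w v) =
   (D F (H z) (D H z v) - D F (H w) (D H z v)) + D F (H w) (D H z v - D H w v).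
  by rewrite linearB /= addrA subrK.
rewrite (le_trans (ler_normD _ _))// !mulrDl lerD//.
  apply: le_trans (hC _ _ _) _.
  have h1 : `|H z - H w| <= M' * `|z - w| by exact: F_lip cH w z.
  have -> : C * M' ^+ 2 * `|z - w| * `|v| = C * (M' * `|z - w|) * (M' * `|v|) by ring.
  by rewrite ler_pM// ?mulr_ge0// ?(ltW C0)// ler_pM2l.
by rewrite (le_trans (hM _ _))// -!mulrA ler_pM2l// mulrA.
Qed.

Lemma C11_iter (F : plane R -> plane R) M C n : C11 F M C ->
  exists M' C', C11 (iter n F) M' C'.
Proof.
move=> cF; elim: n => [|n [M' [C' IH]]]; first by exists 1, 1; exact: C11_id.
by exists (M * M'), (C * M' ^+ 2 + M * C'); exact: C11_comp.
Qed.

(* Either the pair is far apart, or the defect [q] is controlled by the defect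
   one step later, at a distance that has not grown too much. *)
Lemma defect_le (q d f : plane R -> plane R -> R) (T : plane R -> plane R) (d0 a : R) :
  0 < d0 -> 0 <= a ->
  (forall x y, q x y <= 2) -> (forall x y, 0 <= d x y) ->
  (forall x y, d0 <= d x y \/
     [/\ q x y <= f x y * q (T x) (T y) + a * d x y,
         f x y * d (T x) (T y) <= d x y / 2 & 0 <= f x y <= 4^-1]) ->
  exists2 L, 0 < L & forall x y, q x y <= L * d x y.
Proof.
move=> d00 a0 q2 dge h.
(* [2 / d0] settles the far pairs, where [q <= 2]; [2 * a] absorbs the error, since
   [L / 2 + a <= L]. *)
pose L := 2 / d0 + 2 * a.
have L0 : 0 < L by rewrite ltr_pwDl ?divr_gt0// mulr_ge0.
have P n x y : q x y <= L * d x y + 2 / 4 ^+ n.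
  elim: n x y => [|n IH] x y; case: (h x y) => [far|[h1 h2 /andP[f0 f1]]].
  - by rewrite expr0 divr1 (le_trans (q2 x y))// lerDr mulr_ge0// ltW.
  - by rewrite expr0 divr1 (le_trans (q2 x y))// lerDr mulr_ge0// ltW.
  - rewrite (le_trans (q2 x y))//.
    have : 2 <= L * d x y.
      have -> : 2 = 2 / d0 * d0 by rewrite divfK// gt_eqF.
      have h3 : 0 <= 2 / d0 by rewrite divr_ge0// ltW.
      by rewrite ler_pM// ?(ltW d00)// lerDl mulr_ge0.
    have : 0 <= 2 / 4 ^+ n.+1 :> R by rewrite divr_ge0// exprn_ge0.
    lra.
  - have h3 := ler_wpM2l f0 (IH (T x) (T y)).
    have h4 : L * (f x y * d (T x) (T y)) <= L * (d x y / 2) by rewrite ler_pM2l.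
    have h5 : f x y * (2 / 4 ^+ n) <= 4^-1 * (2 / 4 ^+ n).
      by rewrite ler_wpM2r// divr_ge0// exprn_ge0.
    have h6 : 2 * a * d x y <= L * d x y.
      by rewrite ler_wpM2r// lerDr divr_ge0// ltW.
    rewrite exprS invfM mulrCA; move: h1 h3 h4 h5 h6; rewrite mulrDr.
    move: (2 / 4 ^+ n) (d x y) (d (T x) (T y)) (q x y) (q (T x) (T y)) (f x y) => p e e' r r' g.
    by move=> *; nra.
exists L => // x y; rewrite leNgt; apply/negP => lt.
have [k] := archi_pow2 2 (ltac:(by rewrite subr_gt0; exact: lt) : 0 < q x y - L * d x y).
apply/negP; rewrite -leNgt lerBlDl (le_trans (P k x y))// lerD2l.
by rewrite ler_wpM2l// lef_pV2 ?posrE ?exprn_gt0// lerXn2r ?nnegrE// ler_nat.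
Qed.

Section Lipschitz.
Variables (T : plane R -> plane R) (M C j : R) (e e' : plane R -> plane R) (k0 sg : R).
Hypothesis cT : C11 T M C.
Hypothesis j0 : j != 0.
Hypothesis hj : forall x u v, cross (D T x u) (D T x v) = j * cross u v.
Hypothesis hk0 : 0 < k0.
Hypothesis ne : forall x, [/\ `|e' x| = 1, `|e x| = 1 & k0 <= `|cross (e' x) (e x)|].
Hypothesis inv_e : forall x, cross (D T x (e x)) (e (T x)) = 0.
Hypothesis inv_e' : forall x, cross (D T x (e' x)) (e' (T x)) = 0.
Hypothesis hsg : 0 < sg <= 1.
Hypothesis sgk : 32 * sg <= k0 ^+ 2.
Hypothesis con : forall x, `|D T x (e x)| <= sg.
Hypothesis exp : forall x, 1 <= sg * `|D T x (e' x)|.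

(** [D T] multiplies areas by [j] and contracts [e] by the rate [S], so the defect at a pair is
    [S x * S y / |j|] times the defect at its image, plus an error linear in the distance. Distances
    grow at most like [U], and [S * U] is comparable to [|j|]: what remains is a factor of order
    [S y], which is small. *)
Lemma line_field_lipschitz : exists2 L, 0 < L &
  forall x y, `|cross (e x) (e y)| <= L * `|x - y|.
Proof.
have [dT M0 C0 hM hC] := cT; have /andP[sg0 sg1] := hsg.
have ne1 x : `|e x| = 1 by case: (ne x).
have ne1' x : `|e' x| = 1 by case: (ne x).
have nek x : k0 <= `|cross (e' x) (e x)| by case: (ne x).
have k2 : k0 <= 2.
  by rewrite (le_trans (nek 0))// (le_trans (norm_cross _ _))// ne1 ne1' !mulr1.
have jp : 0 < `|j| by rewrite normr_gt0.
pose S x := `|D T x (e x)|; pose U x := `|D T x (e' x)|.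
(* Up to the angle, [S x * U x] is the determinant; its constancy is what makes this bound
   uniform. *)
have US x : S x * U x <= 2 * `|j| / k0.
  have [a ea na] := cross0_parallel (inv_e x) (ne1 _).
  have [b eb nb] := cross0_parallel (inv_e' x) (ne1' _).
  have := hj x (e' x) (e x); rewrite ea eb crossZl crossZr => /(congr1 Num.norm).
  rewrite !normrM na nb -/(S x) -/(U x) => h.
  rewrite ler_pdivlMr//.
  have h1 : `|cross (e' x) (e x)| <= 2 by rewrite (le_trans (norm_cross _ _))// ne1 ne1' !mulr1.
  have h2 : `|j| * `|cross (e' x) (e x)| <= `|j| * 2 by rewrite ler_pM2l.
  rewrite mulrC [2 * _]mulrC (le_trans _ h2)// -h mulrCA mulrA [X in _ <= X]mulrA [U x * S x]mulrC.
  have -> : S x * k0 * U x = S x * U x * k0 by ring.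
  by rewrite ler_wpM2l ?mulr_ge0 ?normr_ge0.
have U1 x : 1 <= sg * U x by exact: exp.
have Ss x : 0 <= S x <= sg by rewrite normr_ge0 con.
have SleU x : S x <= U x.
  have /andP[a b] := Ss x; have c := U1 x; have d : 0 <= U x by exact: normr_ge0.
  have : sg * U x <= U x by rewrite ler_piMl.
  lra.
have Dx x v : S x * `|D T x v| <= 8 * `|j| / k0 ^+ 2 * `|v|.
  have n0 : cross (e' x) (e x) != 0 by rewrite -normr_gt0 (lt_le_trans hk0).
  have h := cramer_div v n0.
  have hc1 : `|cross v (e x) / cross (e' x) (e x)| <= 2 / k0 * `|v|.
    rewrite normrM normfV ler_pdivrMr ?normr_gt0// (le_trans (norm_cross _ _))// ne1 mulr1.
    have -> : 2 * `|v| = 2 / k0 * `|v| * k0 by field; exact: lt0r_neq0.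
    by rewrite ler_wpM2l// mulr_ge0// divr_ge0// ltW.
  have hc2 : `|cross (e' x) v / cross (e' x) (e x)| <= 2 / k0 * `|v|.
    rewrite normrM normfV ler_pdivrMr ?normr_gt0// (le_trans (norm_cross _ _))// ne1' mul1r.
    have -> : 2 * `|v| = 2 / k0 * `|v| * k0 by field; exact: lt0r_neq0.
    by rewrite ler_wpM2l// mulr_ge0// divr_ge0// ltW.
  move: h hc1 hc2; set a := _ / cross _ _; set b := _ / cross _ _; clearbody a b => h hc1 hc2.
  have h3 : `|D T x v| <= 2 / k0 * `|v| * U x + 2 / k0 * `|v| * S x.
    rewrite [in leLHS]h linearD !linearZ /= (le_trans (ler_normD _ _))// !normrZ.
    by rewrite lerD// ler_wpM2r.
  have h4 : `|D T x v| <= 4 / k0 * `|v| * U x.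
    have c0 : 0 <= 2 / k0 * `|v| by rewrite mulr_ge0// divr_ge0// ltW.
    have := ler_wpM2l c0 (SleU x).
    have -> : 4 / k0 * `|v| * U x = 2 / k0 * `|v| * U x + 2 / k0 * `|v| * U x by ring.
    by lra.
  have /andP[S0 _] := Ss x.
  apply: le_trans (ler_wpM2l S0 h4) _.
  have -> : S x * (4 / k0 * `|v| * U x) = (4 / k0 * `|v|) * (S x * U x) by ring.
  have -> : 8 * `|j| / k0 ^+ 2 * `|v| = (4 / k0 * `|v|) * (2 * `|j| / k0) by field; exact: lt0r_neq0.
  by rewrite ler_wpM2l// mulr_ge0// divr_ge0// ltW.
(* Below this distance the quadratic term of Taylor's formula contributes at most a quarter of [|j|]
   per unit of distance. *)
pose d0 := `|j| / (4 * C).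
apply: (defect_le (f := fun x y => S x * S y / `|j|) (T := T) (d0 := d0) (a := 2 * sg * C / `|j|)).
- by rewrite divr_gt0// mulr_gt0.
- by rewrite ltW// divr_gt0// !mulr_gt0.
- by move=> x y; rewrite (le_trans (norm_cross _ _))// !ne1 !mulr1.
- by move=> x y.
move=> x y; case: (leP d0 `|x - y|) => [far|near]; [by left|right].
have /andP[Sx0 Sx1] := Ss x; have /andP[Sy0 Sy1] := Ss y.
split.
- have [a ea na] := cross0_parallel (inv_e x) (ne1 _).
  have [b eb nb] := cross0_parallel (inv_e y) (ne1 _).
  have := hj x (e x) (e y).
  have -> : D T x (e y) = D T y (e y) + (D T x (e y) - D T y (e y)) by rewrite addrC subrK.
  rewrite crossDr ea eb !crossZl crossZr => /(congr1 Num.norm).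
  rewrite normrM => h.
  have : `|j| * `|cross (e x) (e y)| <= S x * S y * `|cross (e (T x)) (e (T y))| + sg * (2 * (C * `|x - y|)).
    rewrite -h (le_trans (ler_normD _ _))// !normrM na nb -/(S x) -/(S y) mulrA lerD2l.
    rewrite ler_pM// (le_trans (norm_cross _ _))// ne1 mul1r ler_pM2l//.
    by rewrite -eb (le_trans (hC _ _ _))// ne1 mulr1.
  rewrite mulrC -ler_pdivlMr// => /le_trans; apply.
  by rewrite le_eqVlt; apply/orP; left; apply/eqP; field; exact: lt0r_neq0.
- have h1 : `|T x - T y| <= `|D T x (x - y)| + C * `|x - y| * `|x - y|.
    have := F_taylor cT x y; rewrite expr2 mulrA [`|y - x|]distrC => h.
    have -> : T x - T y = D T x (x - y) - (T y - T x - D T x (y - x)).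
      by rewrite -[y - x]opprB linearN /= opprK; apply: peq; rewrite !pE; ring.
    by rewrite (le_trans (ler_normB _ _))// lerD2l.
  have h2 := Dx x (x - y).
  have h3 : S x * (C * `|x - y| * `|x - y|) <= 4^-1 * `|j| * `|x - y|.
    rewrite mulrA ler_wpM2r//.
    have -> : 4^-1 * `|j| = 1 * (C * d0) by rewrite /d0; field; exact: lt0r_neq0.
    by rewrite ler_pM ?mulr_ge0 ?(ltW C0)// ?(le_trans Sx1)// ler_pM2l// ltW.
  have h4 := ler_wpM2l Sx0 h1; rewrite mulrDr in h4.
  have h5 : S y * (S x * `|T x - T y|) <= sg * ((8 / k0 ^+ 2 + 4^-1) * `|j| * `|x - y|).
    rewrite ler_pM// ?mulr_ge0// (le_trans h4)// (le_trans (lerD h2 h3))//.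
    by rewrite le_eqVlt; apply/orP; left; apply/eqP; field; exact: lt0r_neq0.
  have -> : S x * S y / `|j| * `|T x - T y| = S y * (S x * `|T x - T y|) / `|j| by ring.
  rewrite ler_pdivrMr// (le_trans h5)//.
  (* [32 * sg <= k0 ^+ 2] is calibrated for this: one quarter from here and one from [sg <= 1] give
     the factor 1/2 that [defect_le] demands. *)
  have h6 : sg * (8 / k0 ^+ 2) <= 4^-1.
    rewrite mulrA ler_pdivrMr ?exprn_gt0//.
    by move: sgk; move: (k0 ^+ 2) => q; lra.
  have -> : sg * ((8 / k0 ^+ 2 + 4^-1) * `|j| * `|x - y|) = (sg * (8 / k0 ^+ 2) + sg * 4^-1) * (`|j| * `|x - y|) by ring.
  rewrite [leRHS]mulrAC [leRHS]mulrC [`|x - y| * `|j|]mulrC -[X in _ <= X]mulrC.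
  have q0 : 0 <= `|j| * `|x - y| by rewrite mulr_ge0.
  rewrite mulrC [leRHS]mulrC.
  move: q0 h6 sg1; move: (`|j| * `|x - y|) (sg * (8 / k0 ^+ 2)) => p q p0 hq hs; nra.
- have h : S x * S y / `|j| <= 2 / k0 * (sg * sg).
    rewrite ler_pdivrMr//.
    have h1 : S x <= S x * (sg * U x) by rewrite ler_peMr.
    have h2 : S x * (sg * U x) <= sg * (2 * `|j| / k0) by rewrite mulrCA ler_pM2l.
    have -> : 2 / k0 * (sg * sg) * `|j| = sg * (2 * `|j| / k0) * sg by ring.
    by rewrite ler_pM// (le_trans h1).
  rewrite divr_ge0 ?mulr_ge0//= (le_trans h)//.
  have -> : 2 / k0 * (sg * sg) = 2 * sg * sg / k0 by ring.
  rewrite ler_pdivrMr//.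
  have : k0 ^+ 2 <= 2 * k0 by rewrite expr2 ler_pM2r.
  have : sg * sg <= sg by rewrite ler_piMr// ltW.
  rewrite -mulrA; move: sgk; move: (k0 ^+ 2) (sg * sg) => p q; lra.
Qed.

End Lipschitz.

Section FrameInvariance.
Variables (F G : plane R -> plane R) (eu es : plane R -> plane R) (K th k0 : R).
Hypothesis dF : forall x, differentiable F x.
Hypothesis dG : forall x, differentiable G x.
Hypothesis FK : cancel F G.
Hypothesis GK : cancel G F.
Hypothesis hfr : hyperbolic_frame F G eu es K th k0.

(** Time reversal: each result on the stable field yields one on the unstable field with [F] and [G]
    exchanged. *)
Lemma frame_sym : hyperbolic_frame G F es eu K th k0.
Proof.
have [h1 h2 h3 h4 [h5 h6]] := hfr; split => //.
by move=> x; have [a b c] := h2 x; split => //; rewrite crossC normrN.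
Qed.

Lemma frame_s n x : cross (D (iter n F) x (es x)) (es (iter n F x)) = 0.
Proof.
have [[K1 /andP[t0 t1] _] _ h3 _ [h5 _]] := hfr; apply: h5; exists K => m.
rewrite -D_iterD// (le_trans (h3 _ _))// ler_piMr//; first by lra.
by apply: exprn_ile1; exact: ltW.
Qed.

End FrameInvariance.

Section FrameExpansion.
Variables (F G : plane R -> plane R) (eu es : plane R -> plane R) (K th k0 : R).
Hypothesis dF : forall x, differentiable F x.
Hypothesis dG : forall x, differentiable G x.
Hypothesis FK : cancel F G.
Hypothesis GK : cancel G F.
Hypothesis hfr : hyperbolic_frame F G eu es K th k0.

Lemma frame_u n x : cross (D (iter n F) x (eu x)) (eu (iter n F x)) = 0.
Proof.
have e : x = iter n G (iter n F x) by rewrite (iter_cancelK n FK).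
move: e; move: (iter n F x) => y ->.
have := frame_s dG (frame_sym hfr) n y.
move=> /cross0_parallel[|c ec _]; first by case: hfr => _ /(_ (iter n G y))[].
have <- : D (iter n F) (iter n G y) (D (iter n G) y (eu y)) = eu y by exact: D_iterK.
by rewrite ec linearZ crossZr crossvv mulr0.
Qed.

Lemma frame_grow n x : 1 <= K * th ^+ n * `|D (iter n F) x (eu x)|.
Proof.
have [_ hn _ h4 _] := hfr.
have [|c ec nc] := cross0_parallel (frame_u n x); first by case: (hn (iter n F x)).
have [e1 _ _] := hn x.
have /(congr1 Num.norm) := D_iterK n x (eu x) FK dF dG.
rewrite e1 ec linearZ !normrZ => h; rewrite -[leLHS]h.
have [-> _ _] := hn (iter n F x); rewrite mulr1 [leLHS]mulrC.
by apply: ler_wpM2r => //; exact: h4.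
Qed.

(** An iterate of [F] has the same invariant lines, and a contraction as strong as
    [line_field_lipschitz] requires. *)
Lemma frame_lipschitz M C j : C11 F M C -> j != 0 ->
  (forall x u v, cross (D F x u) (D F x v) = j * cross u v) ->
  exists2 L, 0 < L & forall x y, `|cross (es x) (es y)| <= L * `|x - y|.
Proof.
move=> cF j0 hj; have [[K1 /andP[t0 t1] k00] hn h3 _ _] := hfr.
have K0 : 0 < K by lra.
have [n hn'] : exists n : nat, K * th ^+ n < Num.min 1 (k0 ^+ 2 / 32).
  by apply: geometric_small; rewrite // lt_min ltr01 divr_gt0// exprn_gt0.
move: hn'; rewrite lt_min => /andP[s1 s2].
have [M' [C' cT]] := C11_iter n cF.
apply: (line_field_lipschitz (e' := eu) (k0 := k0) (sg := K * th ^+ n) (j := j ^+ n) cT) => //.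
- by rewrite expf_neq0.
- by move=> x u v; exact: D_iter_cross.
- by move=> x; exact: frame_s dF hfr n x.
- by move=> x; exact: frame_u.
- by rewrite mulr_gt0 ?exprn_gt0//= ltW.
- by rewrite mulrC -ler_pdivlMr// ltW.
- by move=> x; exact: frame_grow.
Qed.

End FrameExpansion.
End LineFields.

(** * Foliation boxes *)

Section ScalarODE.
Variable R : realType.
Implicit Types (a b s t : R).

Lemma mvt_abs (h dh : R -> R) (lo hi b : R) :
  (forall s, lo <= s <= hi -> is_derive s 1 h (dh s)) ->
  (forall s, lo <= s <= hi -> `|dh s| <= b) ->
  forall s t, lo <= s <= hi -> lo <= t <= hi -> `|h t - h s| <= b * `|t - s|.
Proof.
move=> hd hb; have main s t : lo <= s <= hi -> lo <= t <= hi -> s <= t ->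
    `|h t - h s| <= b * `|t - s|.
  move=> /andP[s1 s2] /andP[t1 t2] st.
  have inr r : s <= r <= t -> lo <= r <= hi.
    by move=> /andP[r1 r2]; rewrite (le_trans s1)// (le_trans r2).
  have [r rst ->] := MVT_cc st (fun r hr => hd r (inr r hr)).
  by rewrite normrM ler_wpM2r// hb// inr.
move=> s t hs ht; have [st|/ltW ts] := leP s t; first exact: main.
by rewrite distrC [`|t - s|]distrC; exact: main.
Qed.

Lemma is_derive_derive1 (P : R -> R) s a : derivable P s 1 -> derive1 P s = a -> is_derive s 1 P a.
Proof. by move=> dP <-; apply: DeriveDef => //; rewrite derive1E. Qed.

Lemma antiderivative (f : R -> R) a : continuous f ->
  exists P : R -> R, forall s, a < s -> is_derive s 1 P (f s).
Proof.
move=> cf; exists (fun x => \int[lebesgue_measure]_(t in `[a, x]) f t)%R => s s0.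
have [] := @continuous_FTC1_closed R f a s (s + 1) _ _ s0 (cf s).
- by rewrite ltrDl.
- apply: continuous_compact_integrable; first exact: segment_compact.
  exact: continuous_subspaceT.
by move=> h1 h2; exact: is_derive_derive1 h1 h2.
Qed.

(** The intervals of radius [c / 2 ^+ k] around [y k] are nested; the supremum of their left ends
    lies in all of them. *)
Lemma geometric_limit (y : nat -> R) c : (forall k, `|y k.+1 - y k| <= c / 2 ^+ k.+1) ->
  exists l, forall k, `|l - y k| <= c / 2 ^+ k.
Proof.
move=> hy.
have p0 k : 0 < (2 : R) ^+ k by rewrite exprn_gt0.
have half k : c / 2 ^+ k = c / 2 ^+ k.+1 + c / 2 ^+ k.+1.
  by rewrite exprS; field; exact: lt0r_neq0.
have mon k m : y k - c / 2 ^+ k <= y (k + m)%N - c / 2 ^+ (k + m) /\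
               y (k + m)%N + c / 2 ^+ (k + m) <= y k + c / 2 ^+ k.
  elim: m => [|m [h1 h2]]; first by rewrite addn0.
  rewrite addnS; have := hy (k + m)%N; have := half (k + m)%N.
  by rewrite ler_norml => e /andP[h3 h4]; split; lra.
have c0 k : 0 <= c / 2 ^+ k by rewrite half addr_ge0// (le_trans _ (hy k)).
have lo k m : y m - c / 2 ^+ m <= y k + c / 2 ^+ k.
  have [h1 _] := mon m k; have [_ h2] := mon k m; rewrite [(m + k)%N]addnC in h1.
  have := c0 (k + m)%N; lra.
pose S := [set y m - c / 2 ^+ m | m in [set: nat]].
have S0 : S !=set0 by exists (y 0%N - c / 2 ^+ 0); exists 0%N.
exists (sup S) => k; rewrite ler_distlC; apply/andP; split.
  by rewrite lerBlDr; apply: ge_sup => // _ [m _ <-].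
rewrite -lerBlDr; apply: ub_le_sup; last by exists k.
by exists (y 0%N + c / 2 ^+ 0) => _ [m _ <-].
Qed.

Definition cl (tau s : R) : R := Num.max (- tau) (Num.min tau s).

Lemma cl_in tau s : 0 <= tau -> `|cl tau s| <= tau.
Proof.
move=> t0; rewrite /cl ler_norml le_max lexx ge_max ge_min lexx /= andbT; lra.
Qed.

Lemma cl_id tau s : `|s| <= tau -> cl tau s = s.
Proof. by rewrite /cl ler_norml => /andP[h1 h2]; rewrite (min_r h2) (max_r h1). Qed.

Lemma cl_lip tau s t : 0 <= tau -> `|cl tau s - cl tau t| <= `|s - t|.
Proof.
move=> t0; have t1 : - tau <= tau by lra.
have h1 := ler_norm (s - t); have h2 := ler_norm (t - s); rewrite distrC in h2.
move: h1 h2; move: `|s - t| => q h1 h2.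
rewrite ler_norml /cl.
case: (leP tau s) => s1; case: (leP tau t) => t2; rewrite ?(max_r t1).
- by apply/andP; split; lra.
- by case: (leP (- tau) t) => ?; apply/andP; split; lra.
- by case: (leP (- tau) s) => ?; apply/andP; split; lra.
- by case: (leP (- tau) s) => ?; case: (leP (- tau) t) => ?; apply/andP; split; lra.
Qed.

Lemma lip_continuous (f : R -> R) b : (forall s t, `|f s - f t| <= b * `|s - t|) -> continuous f.
Proof.
move=> hf s; apply/cvgrPdist_lt => e e0.
have b0 : 0 <= b.
  by have := hf 1 0; rewrite subr0 normr1 mulr1; apply: le_trans.
near=> t; rewrite (le_lt_trans (hf _ _))//.
have : `|s - t| < e / (b + 1).
  near: t; apply: cvgr_dist_lt => //.
  by rewrite divr_gt0// ltr_wpDl.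
rewrite ltr_pdivlMr ?ltr_wpDl// => h.
have : 0 <= `|s - t| by []. nra.
Unshelve. all: by end_near. Qed.

Lemma continuous_cl tau : 0 <= tau -> continuous (cl tau).
Proof. by move=> t0; apply: (@lip_continuous _ 1) => s t; rewrite mul1r cl_lip. Qed.

Section Picard.
Variables (g : R -> R -> R) (L B tau : R).
Hypothesis tau01 : 0 < tau <= 1.
Hypothesis cg : continuous (fun p : R * R => g p.1 p.2).
Hypothesis L0 : 0 <= L.
Hypothesis gL : forall s a b, `|g s a - g s b| <= L * `|a - b|.
Hypothesis gB : forall s a, `|g s a| <= B.
Hypothesis Lt : L * tau <= 4^-1.

Let tau0 : 0 < tau. Proof. by case/andP: tau01. Qed.
Let tau1 : tau <= 1. Proof. by case/andP: tau01. Qed.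

Lemma picard_step (y0 : R) (phi : R -> R) : continuous phi ->
  exists psi : R -> R, [/\ psi 0 = y0, continuous (psi \o cl tau) &
    forall s, `|s| <= tau -> is_derive s 1 psi (g s (phi s))].
Proof.
move=> cphi.
have cf : continuous (fun s => g s (phi s)).
  apply: (continuous_compose (f := fun s => (s, phi s)) (g := fun p : R * R => g p.1 p.2)) => //.
  by apply: continuous_pair => //; exact: continuous_id.
(* The primitive is differentiable only to the right of its base point; -2 lies left of
   [[- tau, tau]] because [tau <= 1]. *)
have [P hP] := @antiderivative _ (-2) cf.
have hP' s : -2 < s -> is_derive s 1 (fun s => P s - P 0 + y0) (g s (phi s)).
  move=> /hP h; apply: is_derive_eq; rewrite addr0 subr0 //.
have ltau s : `|s| <= tau -> -2 < s.
  by rewrite ler_norml => /andP[] h _; have := tau1; lra.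
exists (fun s => P s - P 0 + y0); split.
- by rewrite subrr add0r.
- move=> s; apply: continuous_comp; first exact: continuous_cl (ltW tau0) _.
  have h := hP' _ (ltau _ (cl_in s (ltW tau0))).
  exact/differentiable_continuous/derivable1_diffP/(@ex_derive _ _ _ _ _ _ _ h).
- by move=> s hs; exact: hP' (ltau _ hs).
Qed.

(** Picard iteration: [L * tau <= 1/4] divides the error by more than 2 at each step. The iterates
    are composed with [cl tau] so that they are continuous on the whole line. *)
Lemma picard (y0 : R) : exists Y : R -> R, Y 0 = y0 /\
  forall s, `|s| <= tau -> is_derive s 1 Y (g s (Y s)).
Proof.
have B0 : 0 <= B by rewrite (le_trans _ (gB 0 0)).
have tin : forall s, `|s| <= tau -> - tau <= s <= tau by move=> s; rewrite ler_norml.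
have t00 : - tau <= 0 <= tau by rewrite oppr_le0 (ltW tau0).
have near_sol (psi phi dpsi dphi : R -> R) b : psi 0 = y0 -> phi 0 = y0 ->
    (forall s, `|s| <= tau -> is_derive s 1 psi (dpsi s)) ->
    (forall s, `|s| <= tau -> is_derive s 1 phi (dphi s)) ->
    (forall s, `|s| <= tau -> `|dpsi s - dphi s| <= b) ->
    forall s, `|s| <= tau -> `|psi s - phi s| <= b * tau.
  move=> e1 e2 h1 h2 hb s hs.
  have b0 : 0 <= b by rewrite (le_trans _ (hb 0 _))// normr0 ltW.
  have h : forall r, - tau <= r <= tau -> is_derive r 1 (fun s => psi s - phi s) (dpsi r - dphi r).
    move=> r; rewrite -ler_norml => hr; have := h1 r hr; have := h2 r hr => ? ?.
    exact: is_deriveB.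
  have hb' r : - tau <= r <= tau -> `|dpsi r - dphi r| <= b by rewrite -ler_norml; exact: hb.
  have := mvt_abs h hb' t00 (tin _ hs).
  rewrite e1 e2 subrr !subr0 => /le_trans; apply; exact: ler_wpM2l.
have /choice[F hF] (phi : R -> R) : exists psi : R -> R, continuous phi ->
    [/\ psi 0 = y0, continuous (psi \o cl tau) &
    forall s, `|s| <= tau -> is_derive s 1 psi (g s (phi s))].
  have [h|h] := pselect (continuous phi).
    by have [psi hpsi] := picard_step y0 h; exists psi.
  by exists phi.
pose y := fix y k := if k is k'.+1 then F (y k' \o cl tau) else (fun _ => y0).
have cy k : continuous (y k \o cl tau).
  elim: k => [|k IH]; first by move=> s; exact: cvg_cst.
  by have [] := hF _ IH.
have y0k k : y k 0 = y0 by case: k => // k; have [] := hF _ (cy k).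
have dy k s : `|s| <= tau -> is_derive s 1 (y k.+1) (g s (y k s)).
  by move=> hs; have [_ _ /(_ s hs)] := hF _ (cy k); rewrite /= cl_id.
pose c := 2 * B.
have half k : c / 2 ^+ k = c / 2 ^+ k.+1 + c / 2 ^+ k.+1.
  by rewrite exprS; field; rewrite lt0r_neq0// exprn_gt0.
have c0 k : 0 <= c / 2 ^+ k by rewrite divr_ge0 ?exprn_ge0// mulr_ge0.
have yd k s : `|s| <= tau -> `|y k.+1 s - y k s| <= c / 2 ^+ k.+1.
  elim: k s => [|k IH] s hs.
    have := @near_sol (y 1%N) (y 0%N) (fun s => g s (y 0%N s)) (fun=> 0) B (y0k 1%N) (y0k 0%N) (dy 0%N).
    move=> /(_ (fun r _ => is_derive_cst y0 r 1)) /(_ _ s hs) /le_trans; apply.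
      by move=> r _; rewrite subr0.
    by have := ler_wpM2l B0 tau1; rewrite expr1 /c; lra.
  have hb r : `|r| <= tau -> `|g r (y k.+1 r) - g r (y k r)| <= L * (c / 2 ^+ k.+1).
    by move=> hr; rewrite (le_trans (gL _ _ _))// ler_wpM2l// IH.
  have := near_sol _ _ _ _ _ (y0k k.+2) (y0k k.+1) (dy k.+1) (dy k) hb s hs.
  move=> /le_trans; apply; rewrite mulrAC mulrC.
  have := ler_wpM2l (c0 k.+1) Lt; have := c0 k.+2; rewrite (half k.+1); lra.
have /choice[Y hY] s : exists l : R, forall k, `|l - y k (cl tau s)| <= c / 2 ^+ k.
  by apply: geometric_limit => k; rewrite yd// cl_in// ltW.
have cY : continuous Y.
  move=> s; apply/cvgrPdist_lt => e e0.
  have [k hk] := archi_pow2 c (ltac:(by rewrite divr_gt0) : 0 < e / 3).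
  near=> r; have h1 := hY s k; have h2 := hY r k.
  have : `|y k (cl tau s) - y k (cl tau r)| < e / 3.
    near: r; move: (cy k s) => /cvgrPdist_lt; apply; exact: divr_gt0.
  move: h1 h2; rewrite !ler_distlC ltr_distlC ltr_distlC => /andP[? ?] /andP[? ?] /andP[? ?].
  by apply/andP; split; lra.
have [psi [psi0 _ dpsi]] := picard_step y0 cY.
exists psi; split => // s hs.
(* [psi] integrates the field along the limit [Y]; it solves the equation once the two agree, both
   being within a multiple of [2 ^ - k] of the iterates. *)
suff e : psi s = Y s by rewrite e; exact: dpsi.
have hk k : `|psi s - Y s| <= c / 2 ^+ k.
  have hb r : `|r| <= tau -> `|g r (Y r) - g r (y k r)| <= L * (c / 2 ^+ k).
    by move=> hr; rewrite (le_trans (gL _ _ _))// ler_wpM2l//; have := hY r k; rewrite cl_id.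
  have h1 := near_sol _ _ _ _ _ psi0 (y0k k.+1) dpsi (dy k) hb s hs.
  have h2 := hY s k.+1; rewrite cl_id// in h2.
  have h3 : L * (c / 2 ^+ k) * tau <= c / 2 ^+ k.+1.
    rewrite mulrAC mulrC; have := ler_wpM2l (c0 k) Lt; have := c0 k.+1; rewrite (half k); lra.
  rewrite (le_trans (ler_distD (y k.+1 s) _ _))// (half k) lerD ?(le_trans h1)//.
  by rewrite distrC.
apply/eqP; rewrite -subr_eq0 -normr_eq0 eq_le normr_ge0 andbT leNgt; apply/negP => h.
by have [k] := archi_pow2 c h; apply/negP; rewrite -leNgt.
Unshelve. all: by end_near. Qed.

(** Gronwall's inequality by iteration: a bound [x] on the deviation improves to [(m + x) / 4],
    whose fixed point is [m / 3]. *)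
Lemma ode_gap (Y1 Y2 : R -> R) :
  (forall s, `|s| <= tau -> is_derive s 1 Y1 (g s (Y1 s))) ->
  (forall s, `|s| <= tau -> is_derive s 1 Y2 (g s (Y2 s))) ->
  forall s, `|s| <= tau -> `|(Y1 s - Y2 s) - (Y1 0 - Y2 0)| <= `|Y1 0 - Y2 0| / 3.
Proof.
move=> d1 d2; pose de s := Y1 s - Y2 s; pose m := `|Y1 0 - Y2 0|.
have m0 : 0 <= m by exact: normr_ge0.
have B0 : 0 <= B by rewrite (le_trans _ (gB 0 0)).
have tin : forall s, `|s| <= tau -> - tau <= s <= tau by move=> s; rewrite ler_norml.
have gap b : (forall s, `|s| <= tau -> `|g s (Y1 s) - g s (Y2 s)| <= b) ->
    forall s, `|s| <= tau -> `|de s - de 0| <= b * tau.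
  move=> hb s hs.
  have h r : - tau <= r <= tau -> is_derive r 1 de (g r (Y1 r) - g r (Y2 r)).
    by rewrite -ler_norml => hr; have := d1 r hr; have := d2 r hr => ? ?; exact: is_deriveB.
  have hb' r : - tau <= r <= tau -> `|g r (Y1 r) - g r (Y2 r)| <= b by rewrite -ler_norml; exact: hb.
  have := mvt_abs h hb' (tin 0 _) (tin _ hs); rewrite normr0 subr0.
  move=> /(_ (ltW tau0)) /le_trans; apply; apply: ler_wpM2l => //.
  by rewrite (le_trans _ (hb 0 _))// normr0 ltW.
have P k s : `|s| <= tau -> `|de s - de 0| <= m / 3 + 2 * B / 2 ^+ k.
  elim: k s => [|k IH] s hs.
    have /gap/(_ s hs) : forall s, `|s| <= tau -> `|g s (Y1 s) - g s (Y2 s)| <= 2 * B.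
      move=> r _; rewrite (le_trans (ler_normB _ _))//.
      by have := gB r (Y1 r); have := gB r (Y2 r); lra.
    move=> /le_trans; apply; rewrite expr0 divr1.
    have := ler_wpM2l B0 tau1; lra.
  have c0 : 0 <= 2 * B / 2 ^+ k by rewrite divr_ge0 ?exprn_ge0// mulr_ge0.
  have /gap/(_ s hs) : forall s, `|s| <= tau ->
      `|g s (Y1 s) - g s (Y2 s)| <= L * (4 / 3 * m + 2 * B / 2 ^+ k).
    move=> r hr; rewrite (le_trans (gL _ _ _))// ler_wpM2l//.
    have := IH r hr; have := ler_normD (de r - de 0) (de 0); rewrite subrK -/(de r) -/m.
    by rewrite /de /m; lra.
  move=> /le_trans; apply; rewrite mulrAC exprS invfM.
  have c1 : 0 <= 4 / 3 * m + 2 * B / 2 ^+ k by lra.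
  have := ler_wpM2r c1 Lt; move: c0; move: (2 ^+ k)^-1 => q; lra.
move=> s hs; rewrite leNgt; apply/negP => h.
have [k] := archi_pow2 (2 * B) (ltac:(by rewrite subr_gt0; exact: h) : 0 < `|de s - de 0| - m / 3).
by apply/negP; rewrite -leNgt lerBlDl P.
Qed.

End Picard.
End ScalarODE.

Section FoliationBox.
Variable R : realType.
Implicit Types (p q u v w x y z : plane R) (a b s t : R).
Variables (e : plane R -> plane R) (L : R).
Hypothesis ne : forall x, `|e x| = 1.
Hypothesis L0 : 0 < L.
Hypothesis eL : forall x y, `|cross (e x) (e y)| <= L * `|x - y|.

Definition bpt p s a : plane R := p + s *: e p + a *: rot90 (e p).
(** The solution [a] of [cross (e q) (e p + a *: rot90 (e p)) = 0]: the direction at [q] read as a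
    slope in the frame at [p]. It does not depend on the sign of [e q]. *)
Definition slope p q : R := cross (e p) (e q) / cross (e q) (rot90 (e p)).

Lemma bpt_dist p s a s' a' : `|bpt p s a - bpt p s' a'| <= `|s - s'| + `|a - a'|.
Proof.
have -> : bpt p s a - bpt p s' a' = (s - s') *: e p + (a - a') *: rot90 (e p).
  by apply: peq; rewrite !pE; ring.
by rewrite (le_trans (ler_normD _ _))// !normrZ pnorm_rot90 ne !mulr1.
Qed.

Lemma bpt0 p : bpt p 0 0 = p.
Proof. by rewrite /bpt !scale0r !addr0. Qed.

Lemma cross_frame p : 1 <= cross (e p) (rot90 (e p)) <= 2.
Proof.
have := cross_rot90 (e p); rewrite ne expr1n => -> /=.
rewrite (le_trans (ler_norm _))// (le_trans (norm_cross _ _))//.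
by rewrite pnorm_rot90 ne !mulr1.
Qed.

Lemma slope_bounds p q : L * `|q - p| <= 8^-1 ->
  [/\ 2^-1 <= `|cross (e q) (rot90 (e p))|, `|slope p q| <= 4^-1 &
      cross (e q) (e p + slope p q *: rot90 (e p)) = 0].
Proof.
move=> h.
have h1 : `|cross (e p) (e q)| <= 8^-1 by rewrite (le_trans (eL _ _))// distrC.
have h2 : 2^-1 <= `|cross (e q) (rot90 (e p))|.
  have := congr1 Num.norm (cramer (e p) (rot90 (e p)) (e q)).
  rewrite normrZ ne mulr1 => h3.
  have := ler_normD (cross (e q) (rot90 (e p)) *: e p) (cross (e p) (e q) *: rot90 (e p)).
  have /andP[c1 _] := cross_frame p.
  rewrite -h3 !normrZ pnorm_rot90 ne !mulr1 (ger0_norm (le_trans ler01 c1)) => h4.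
  have h5 : cross (e p) (rot90 (e p)) <= `|cross (e q) (rot90 (e p))| + `|cross (e p) (e q)| := h4.
  lra.
split => //.
  rewrite /slope normrM normfV ler_pdivrMr; last by rewrite (lt_le_trans _ h2).
  lra.
rewrite crossDr crossZr /slope divfK; last by rewrite -normr_gt0 (lt_le_trans _ h2).
by rewrite [in X in X + _]crossC addNr.
Qed.

Lemma slope_lip p q q' : L * `|q - p| <= 8^-1 -> L * `|q' - p| <= 8^-1 ->
  `|slope p q - slope p q'| <= 8 * L * `|q - q'|.
Proof.
move=> /slope_bounds[h1 _ _] /slope_bounds[h2 _ _].
have n1 : cross (e q) (rot90 (e p)) != 0 by rewrite -normr_gt0 (lt_le_trans _ h1).
have n2 : cross (e q') (rot90 (e p)) != 0 by rewrite -normr_gt0 (lt_le_trans _ h2).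
have -> : slope p q - slope p q' = cross (e p) (rot90 (e p)) * cross (e q') (e q) /
    (cross (e q) (rot90 (e p)) * cross (e q') (rot90 (e p))).
  (* Plücker relation: it exhibits the difference of slopes as a multiple of the defect between [q']
     and [q]. *)
  have ext : cross (e p) (e q) * cross (e q') (rot90 (e p)) -
    cross (e p) (e q') * cross (e q) (rot90 (e p)) =
    cross (e p) (rot90 (e p)) * cross (e q') (e q) by rewrite /cross; ring.
  by rewrite -ext /slope; field; rewrite n1 n2.
rewrite normrM normfV ler_pdivrMr; last by rewrite normr_gt0 mulf_neq0.
have /andP[c1 c2] := cross_frame p.
rewrite !normrM (ger0_norm (le_trans ler01 c1)).
have h3 : cross (e p) (rot90 (e p)) * `|cross (e q') (e q)| <= 2 * (L * `|q - q'|).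
  by rewrite ler_pM// ?(le_trans ler01 c1)// (le_trans (eL _ _))// distrC.
rewrite (le_trans h3)//.
have h4 : 4^-1 <= `|cross (e q) (rot90 (e p))| * `|cross (e q') (rot90 (e p))|.
  have -> : 4^-1 = 2^-1 * 2^-1 :> R by field.
  by rewrite ler_pM.
have h5 : 0 <= L * `|q - q'| by rewrite mulr_ge0// ltW.
have := ler_wpM2l h5 h4; lra.
Qed.

(** In the frame of [e p], the curve [s |-> bpt p s (Y s t)] is the leaf that crosses the
    transversal [s = 0] at height [t], and [g] is its slope. The second clause says that the
    holonomy between transversals distorts distances by at most a third. *)
Definition box_frame (rho : R) p (Y g : R -> R -> R) : Prop :=
  [/\ forall s t, `|s| <= rho -> `|t| <= rho ->
       [/\ Y 0 t = t, is_derive s 1 (Y^~ t) (g s t), `|g s t| <= 4^-1 &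
           cross (e (bpt p s (Y s t))) (e p + g s t *: rot90 (e p)) = 0],
      forall s t t', `|s| <= rho -> `|t| <= rho -> `|t'| <= rho ->
       `|(Y s t - Y s t') - (t - t')| <= `|t - t'| / 3,
      forall s s' t, `|s| <= rho -> `|s'| <= rho -> `|t| <= rho ->
       `|Y s t - Y s' t| <= `|s - s'| / 4 &
      forall s s' t t', `|s| <= rho -> `|s'| <= rho -> `|t| <= rho -> `|t'| <= rho ->
       `|g s t - g s' t'| <= 16 * L * (`|s - s'| + `|t - t'|)].

(** Leaves are the solutions of the scalar equation whose right-hand side is [slope]. The size [rho]
    depends on [L] alone, hence is the same around every point. *)
Lemma foliation_box : exists2 rho, 0 < rho <= 1 & forall p, exists Y g, box_frame rho p Y g.
Proof.
have gap_arith (y z t : R) : y <= z + t -> z <= t / 3 -> y <= 4 / 3 * t by lra.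
have sum_arith (d y z s t : R) : d <= y + z -> y <= 4 / 3 * t -> z <= s / 4 -> 0 <= s -> 0 <= t ->
  s + d <= 2 * (s + t) by lra.
pose rho := Num.min 1 (32 * L)^-1.
have L32 : 0 < 32 * L by rewrite mulr_gt0.
have r0 : 0 < rho by rewrite lt_min ltr01 invr_gt0.
have r1 : rho <= 1 by rewrite ge_min lexx.
have Lr : L * rho <= 32^-1.
  have : rho <= (32 * L)^-1 by rewrite ge_min lexx orbT.
  move=> h; have := ler_wpM2l (ltW L32) h; rewrite mulfV ?lt0r_neq0//; lra.
exists rho; first by rewrite r0.
move=> p.
have near s a : `|s| <= 2 * rho -> `|a| <= 2 * rho -> L * `|bpt p s a - p| <= 8^-1.
  move=> hs ha; have := bpt_dist p s a 0 0; rewrite bpt0 !subr0 => h.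
  have : L * `|bpt p s a - p| <= L * (4 * rho) by rewrite ler_pM2l//; lra.
  lra.
have r20 : 0 <= 2 * rho by lra.
pose c := cl (2 * rho).
have cin s : `|c s| <= 2 * rho by exact: cl_in.
(* Clamping both coordinates at [2 * rho] makes the slope field global, bounded and Lipschitz;
   solutions with [|s|] and [|t|] at most [rho] stay where the clamp is the identity. *)
pose gc s a := slope p (bpt p (c s) (c a)).
have gcL s a s' a' : `|gc s a - gc s' a'| <= 8 * L * (`|s - s'| + `|a - a'|).
  rewrite (le_trans (slope_lip (near _ _ _ _) (near _ _ _ _)))//.
  rewrite ler_pM2l ?mulr_gt0// (le_trans (bpt_dist _ _ _ _ _))//.
  by rewrite lerD// cl_lip.
have gcB s a : `|gc s a| <= 4^-1 by have [] := slope_bounds (near _ _ (cin s) (cin a)).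
have gcL2 s a b : `|gc s a - gc s b| <= 8 * L * `|a - b|.
  by have := gcL s a s b; rewrite subrr normr0 add0r.
have cgc : continuous (fun p : R * R => gc p.1 p.2).
  have c1 : continuous (fun w : R * R => w.1) by apply: continuous_fst; exact: continuous_id.
  have c2 : continuous (fun w : R * R => w.2) by apply: continuous_snd; exact: continuous_id.
  move=> z; apply/cvgrPdist_lt => d d0.
  have L8 : 0 < 8 * L by rewrite mulr_gt0.
  near=> w.
  rewrite (le_lt_trans (gcL _ _ _ _))//.
  have h1 : `|z.1 - w.1| < d / (8 * L) / 2.
    by near: w; have /cvgrPdist_lt := c1 z; apply; rewrite !divr_gt0.
  have h2 : `|z.2 - w.2| < d / (8 * L) / 2.
    by near: w; have /cvgrPdist_lt := c2 z; apply; rewrite !divr_gt0.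
  have h3 : `|z.1 - w.1| + `|z.2 - w.2| < d / (8 * L) by lra.
  by move: h3; rewrite ltr_pdivlMr// mulrC.
have r01 : 0 < rho <= 1 by rewrite r0.
have L80 : 0 <= 8 * L by rewrite mulr_ge0// ltW.
have Lt : 8 * L * rho <= 4^-1 by rewrite -mulrA; lra.
have /choice[Y' hY'] t : exists Y : R -> R, Y 0 = t /\ forall s, `|s| <= rho -> is_derive s 1 Y (gc s (Y s)).
  exact: (picard r01 cgc L80 gcL2 gcB Lt t).
pose Y s t := Y' t s.
have Ylip s s' t : `|s| <= rho -> `|s'| <= rho -> `|Y s t - Y s' t| <= `|s - s'| / 4.
  rewrite [`|s| <= _]ler_norml [`|s'| <= _]ler_norml => hs hs'; rewrite mulrC.
  apply: (@mvt_abs _ (Y' t) (fun s => gc s (Y' t s)) (- rho) rho) => //.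
  by move=> r; rewrite -ler_norml; exact: (hY' t).2.
have Y0 t : Y 0 t = t by exact: (hY' t).1.
have rr : `|0 : R| <= rho by rewrite normr0 ltW.
have Yin s t : `|s| <= rho -> `|t| <= rho -> `|Y s t| <= 2 * rho.
  move=> hs ht; have := Ylip s 0 t hs rr; rewrite Y0 subr0 => h.
  have := ler_normD (Y s t - t) t; rewrite subrK; lra.
have rin s : `|s| <= rho -> `|s| <= 2 * rho by lra.
have gcE s t : `|s| <= rho -> `|t| <= rho -> gc s (Y s t) = slope p (bpt p s (Y s t)).
  by move=> hs ht; rewrite /gc /c !cl_id//; [exact: Yin|exact: rin].
have gap s t t' : `|s| <= rho -> `|(Y s t - Y s t') - (t - t')| <= `|t - t'| / 3.
  move=> hs; have := ode_gap r01 L80 gcL2 gcB Lt (hY' t).2 (hY' t').2 hs.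
  by rewrite (hY' t).1 (hY' t').1.
exists Y, (fun s t => gc s (Y s t)); split.
- move=> s t hs ht; split => //; first exact: (hY' t).2.
  rewrite gcE//; have [] // := slope_bounds (near _ _ (rin _ hs) (Yin _ _ hs ht)).
- by move=> s t t' hs _ _; exact: gap.
- by move=> s s' t hs hs' _; exact: Ylip.
move=> s s' t t' hs hs' ht ht'.
rewrite (le_trans (gcL _ _ _ _))//.
have h1 := Ylip s s' t' hs hs'; have h2 := gap s t t' hs.
have h3 : `|Y s t - Y s t'| <= 4 / 3 * `|t - t'|.
  have h := ler_normD (Y s t - Y s t' - (t - t')) (t - t'); rewrite subrK in h; exact: gap_arith h h2.
have h4 := ler_distD (Y s t') (Y s t) (Y s' t').
have n1 : 0 <= `|s - s'| by []. have n2 : 0 <= `|t - t'| by [].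
have h5 : `|s - s'| + `|Y s t - Y s' t'| <= 2 * (`|s - s'| + `|t - t'|).
  by apply: sum_arith h4 h3 h1 _ _.
rewrite (_ : 16 * L * _ = 8 * L * (2 * (`|s - s'| + `|t - t'|))); last by ring.
exact: ler_wpM2l h5.
Unshelve. all: by end_near. Qed.

End FoliationBox.

(** * Areas and bounded densities *)

Section PlaneMeasure.
Variable R : realType.
Implicit Types (u v w x y z p q : plane R) (a b s t : R).
Local Notation leb := (@lebesgue_measure R).

Lemma measurable_affine (k1 k2 c : R) :
  measurable_fun [set: mplane R] (fun z : mplane R => k1 * z.1 + k2 * z.2 + c).
Proof.
apply: measurable_funD => //; apply: measurable_funD; apply: measurable_funM => //.
Qed.

Lemma measurable_strip (k1 k2 c b : R) :
  measurable [set z : mplane R | `|k1 * z.1 + k2 * z.2 + c| <= b].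
Proof.
have -> : [set z : mplane R | `|k1 * z.1 + k2 * z.2 + c| <= b] =
    (fun z : mplane R => k1 * z.1 + k2 * z.2 + c) @^-1` `[- b, b].
  by apply/seteqP; split => z /=; rewrite in_itv /= ler_norml.
rewrite -[X in measurable X]setTI; apply: measurable_affine => //.
Qed.

Lemma lebesgue_interval (c b : R) : 0 <= b ->
  leb [set y : R | `|y - c| <= b] = (2 * b)%:E.
Proof.
move=> b0.
have -> : [set y : R | `|y - c| <= b] = [set` `[c - b, c + b]].
  apply/seteqP; split => y /=; rewrite in_itv /= ler_distl //.
rewrite lebesgue_measure_itv /= lte_fin.
case: ltP => h; first by rewrite -EFinB; congr (_%:E); ring.
by congr (_%:E); lra.
Qed.

Lemma integral_interval (c a b : R) : 0 <= a -> 0 <= b ->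
  (\int[leb]_x ((2 * b)%:E * (\1_[set y : R | `|y - c| <= a] x)%:E) = (4 * a * b)%:E)%E.
Proof.
move=> a0 b0; have mI : measurable [set y : R | `|y - c| <= a].
  have -> : [set y : R | `|y - c| <= a] = [set` `[c - a, c + a]].
    by apply/seteqP; split => y /=; rewrite in_itv /= ler_distl.
  exact: measurable_itv.
rewrite ge0_integralZl//.
- rewrite integral_indic// setIT [X in (_ * X)%E](_ : _ = (2 * a)%:E); last exact: lebesgue_interval.
  by rewrite -EFinM; congr (_%:E); ring.
- by apply/measurable_EFinP; exact: measurable_indic.
- by rewrite lee_fin mulr_ge0.
Qed.

Lemma area_shear (x0 y0 k a b : R) : 0 <= a -> 0 <= b ->
  area [set z : mplane R | `|z.1 - x0| <= a /\ `|z.2 - y0 - k * (z.1 - x0)| <= b] = (4 * a * b)%:E.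
Proof.
move=> a0 b0; rewrite -(integral_interval x0 a0 b0) /area /product_measure1.
apply: eq_integral => x _ /=; rewrite indicE.
have [hx|hx] := pselect (`|x - x0| <= a); [rewrite mem_set//|rewrite memNset//].
  rewrite mule1 -(lebesgue_interval (y0 + k * (x - x0)) b0); congr (leb _).
  apply/seteqP; split => y; rewrite xsectionE /= opprD addrA; first by case.
  by split.
rewrite mule0; have -> : xsection [set z : mplane R | `|z.1 - x0| <= a /\ `|z.2 - y0 - k * (z.1 - x0)| <= b] x = set0.
  by apply/seteqP; split => y; rewrite xsectionE //= => -[].
by rewrite measure0.
Qed.

(** Sections are taken in the other variable; the two iterated measures agree by uniqueness of the
    product measure. *)
Lemma area_shear' (x0 y0 k a b : R) : 0 <= a -> 0 <= b ->
  area [set z : mplane R | `|z.2 - y0| <= a /\ `|z.1 - x0 - k * (z.2 - y0)| <= b] = (4 * a * b)%:E.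
Proof.
move=> a0 b0.
have mS : measurable [set z : mplane R | `|z.2 - y0| <= a /\ `|z.1 - x0 - k * (z.2 - y0)| <= b].
  have -> : [set z : mplane R | `|z.2 - y0| <= a /\ `|z.1 - x0 - k * (z.2 - y0)| <= b] =
      [set z : mplane R | `|0 * z.1 + 1 * z.2 + - y0| <= a] `&`
      [set z : mplane R | `|1 * z.1 + (- k) * z.2 + (- x0 + k * y0)| <= b].
    have h1 (z : mplane R) : 0 * z.1 + 1 * z.2 + - y0 = z.2 - y0 by ring.
    have h2 (z : mplane R) : 1 * z.1 + (- k) * z.2 + (- x0 + k * y0) = z.1 - x0 - k * (z.2 - y0) by ring.
    by rewrite predeqE => z /=; rewrite h1 h2.
  by apply: measurableI; exact: measurable_strip.
rewrite -(integral_interval y0 a0 b0) /area.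
rewrite (@product_measure_unique _ _ _ _ _ leb leb (leb \x^ leb)%E _ _ mS); last first.
  by move=> X Y mX mY; exact: product_measure2E.
rewrite /product_measure2; apply: eq_integral => x _ /=; rewrite indicE.
have [hx|hx] := pselect (`|x - y0| <= a); [rewrite mem_set//|rewrite memNset//].
  rewrite mule1 -(lebesgue_interval (x0 + k * (x - y0)) b0); congr (leb _).
  apply/seteqP; split => y; rewrite ysectionE /= opprD addrA; first by case.
  by split.
rewrite mule0; have -> : ysection [set z : mplane R | `|z.2 - y0| <= a /\ `|z.1 - x0 - k * (z.2 - y0)| <= b] x = set0.
  by apply/seteqP; split => y; rewrite ysectionE //= => -[].
by rewrite measure0.
Qed.

(** When [|cross u w| = |u|], this is the parallelogram centred at [p] with half-sides [a *: u] and
    [b *: w]. *)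
Definition strip u w p a b : set (mplane R) :=
  [set z : mplane R | `|cross (z - p : plane R) w| <= a * `|u| /\
                      `|cross u (z - p : plane R)| <= b * `|u|].

(* The parallelogram of sides along [u] and a coordinate direction: choosing
   the coordinate direction most transverse to [u] makes it a sheared
   rectangle. *)
Lemma area_strip u : u != 0 -> exists w,
  [/\ `|w| = 1, `|cross u w| = `|u| & forall p a b, 0 <= a -> 0 <= b ->
    measurable (strip u w p a b) /\ area (strip u w p a b) = (4 * a * b * `|u|)%:E].
Proof.
move=> u0; have nu : 0 < `|u| by rewrite normr_gt0.
have mstrip w p a b : measurable (strip u w p a b).
  have -> : strip u w p a b =
    [set z : mplane R | `|w.2 * z.1 + (- (w.1 : R)) * z.2 + (- cross p w)| <= a * `|u|] `&`
    [set z : mplane R | `|(- (u.2 : R)) * z.1 + u.1 * z.2 + (- cross u p)| <= b * `|u|].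
    apply/seteqP; split => z /= [h1 h2]; split.
    - by rewrite (le_trans _ h1)// le_eqVlt; apply/orP; left; apply/eqP; congr (`|_|); rewrite /cross !pE; ring.
    - by rewrite (le_trans _ h2)// le_eqVlt; apply/orP; left; apply/eqP; congr (`|_|); rewrite /cross !pE; ring.
    - by rewrite (le_trans _ h1)// le_eqVlt; apply/orP; left; apply/eqP; congr (`|_|); rewrite /cross !pE; ring.
    - by rewrite (le_trans _ h2)// le_eqVlt; apply/orP; left; apply/eqP; congr (`|_|); rewrite /cross !pE; ring.
  by apply: measurableI; exact: measurable_strip.
case: (leP `|u.2 : R| `|u.1 : R|) => h.
- have e : `|u| = `|u.1 : R| by rewrite pnormE max_l.
  have n1 : 0 < `|u.1 : R| by rewrite -e.
  have n1' : (u.1 : R) != 0 by rewrite -normr_gt0.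
  exists (e2 R); split; first exact: pnorm_e2.
    by rewrite e /cross /= mulr1 mulr0 subr0.
  move=> p a b a0 b0; split; first exact: mstrip.
  have -> : strip u (e2 R) p a b = [set z : mplane R | `|z.1 - p.1| <= a * `|u| /\ `|z.2 - p.2 - (u.2 / u.1) * (z.1 - p.1)| <= b].
    apply/seteqP; split => z /= [h1 h2]; split.
    + by move: h1; rewrite /cross /= mulr1 mulr0 subr0.
    + move: h2; rewrite /cross e -ler_pdivrMr// -normfV -normrM => h2.
      rewrite (le_trans _ h2)// le_eqVlt; apply/orP; left; apply/eqP; congr (`|_|).
      by rewrite !pE; field.
    + by rewrite /cross /= mulr1 mulr0 subr0.
    + rewrite /cross e -ler_pdivrMr// -normfV -normrM.
      rewrite (le_trans _ h2)// le_eqVlt; apply/orP; left; apply/eqP; congr (`|_|).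
      by rewrite !pE; field.
  by rewrite area_shear ?mulr_ge0//; congr (_%:E); ring.
- have e : `|u| = `|u.2 : R| by rewrite pnormE max_r// ltW.
  have n1 : 0 < `|u.2 : R| by rewrite -e.
  have n1' : (u.2 : R) != 0 by rewrite -normr_gt0.
  exists (e1 R); split; first exact: pnorm_e1.
    by rewrite e /cross /= mulr1 mulr0 sub0r normrN.
  move=> p a b a0 b0; split; first exact: mstrip.
  have -> : strip u (e1 R) p a b = [set z : mplane R | `|z.2 - p.2| <= a * `|u| /\ `|z.1 - p.1 - (u.1 / u.2) * (z.2 - p.2)| <= b].
    apply/seteqP; split => z /= [h1 h2]; split.
    + by move: h1; rewrite /cross /= mulr1 mulr0 sub0r normrN.
    + move: h2; rewrite /cross e -ler_pdivrMr// -normfV -normrM => h2.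
      rewrite -normrN (le_trans _ h2)// le_eqVlt; apply/orP; left; apply/eqP; congr (`|_|).
      by rewrite !pE; field.
    + by rewrite /cross /= mulr1 mulr0 sub0r normrN.
    + rewrite /cross e -ler_pdivrMr// -normfV -normrM.
      rewrite -normrN (le_trans _ h2)// le_eqVlt; apply/orP; left; apply/eqP; congr (`|_|).
      by rewrite !pE; field.
  by rewrite area_shear' ?mulr_ge0//; congr (_%:E); ring.
Qed.

(** The sigma-algebra of [mplane] is the product one, so an open set is written as a countable union
    of closed squares with rational centres and radii [1 / (k + 1)]. *)
Lemma open_measurable_plane (U : set (plane R)) : open U -> measurable (U : set (mplane R)).
Proof.
move=> oU.
pose Q (q1 q2 : rat) (k : nat) : set (mplane R) :=
  [set z : mplane R | `|1 * z.1 + 0 * z.2 + - ratr q1| <= k.+1%:R^-1] `&`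
  [set z : mplane R | `|0 * z.1 + 1 * z.2 + - ratr q2| <= k.+1%:R^-1].
pose B (q1 q2 : rat) (k : nat) := if pselect (Q q1 q2 k `<=` U) then Q q1 q2 k else set0.
have -> : U = \bigcup_(q1 : rat) \bigcup_(q2 : rat) \bigcup_(k : nat) B q1 q2 k.
  apply/seteqP; split => z.
    move=> Uz; have /nbhs_ballP[r /= r0 hr] := open_nbhs_nbhs (conj oU Uz : open_nbhs z U).
    have [n n0 hn] := nat_gt (4 / r).
    case: n n0 hn => [|n] n0 hn; first by rewrite ltxx in n0.
    have i0 : 0 < (n.+1%:R : R)^-1 by rewrite invr_gt0.
    have ir : 4 * (n.+1%:R : R)^-1 < r by rewrite ltr_pdivrMr// mulrC -ltr_pdivrMr.
    have ex (c : R) : exists q : rat, `|c - ratr q| <= (n.+1%:R : R)^-1.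
      move: i0; move: ((n.+1%:R : R)^-1) => i i0.
      have /rat_in_itvoo[q] : c - i < c + i by lra.
      by rewrite in_itv /= => /andP[h1 h2]; exists q; rewrite ler_distl; apply/andP; split; lra.
    have [q1 h1] := ex z.1; have [q2 h2] := ex z.2.
    exists q1 => //; exists q2 => //; exists n => //.
    have Qz : Q q1 q2 n z by split => /=; rewrite ?mul1r ?mul0r ?addr0 ?add0r.
    rewrite /B; case: pselect => // -[]; move=> y [] /=.
    rewrite ?mul1r ?mul0r ?addr0 ?add0r => h3 h4.
    apply: hr; rewrite /= -ball_normE /=; apply: (@le_lt_trans _ _ (4 * (n.+1%:R : R)^-1)) => //.
    apply: pnorm_le; rewrite !pE.
      move: h1 h3 i0; move: ((n.+1%:R : R)^-1) => i; rewrite !ler_norml => /andP[? ?] /andP[? ?] ?; apply/andP; split; lra.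
    move: h2 h4 i0; move: ((n.+1%:R : R)^-1) => i; rewrite !ler_norml => /andP[? ?] /andP[? ?] ?; apply/andP; split; lra.
  by move=> [q1 _ [q2 _ [k _]]]; rewrite /B; case: pselect => // h /h.
apply: bigcupT_measurable_rat => q1; apply: bigcupT_measurable_rat => q2.
apply: bigcupT_measurable => k; rewrite /B; case: (is_left _); last exact: measurable0.
by apply: measurableI; exact: measurable_strip.
Qed.

Lemma compact_measurable_plane (K : set (plane R)) : compact K -> measurable (K : set (mplane R)).
Proof.
move=> cK; have : closed K by apply: compact_closed cK; exact: norm_hausdorff.
by move=> /closed_openC/open_measurable_plane/measurableC; rewrite setCK.
Qed.

End PlaneMeasure.

(** * Arcs parametrized by length *)

Section Arcs.
Variable R : realType.

Lemma lip_within (V W : normedModType R) (A : set V) (f : V -> W) (b : R) : 0 <= b ->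
  (forall x y, A x -> A y -> `|f x - f y| <= b * `|x - y|) -> {within A, continuous f}.
Proof.
move=> b0 hf; apply/subspace_continuousP => x Ax; apply/cvgrPdist_lt => e e0; near=> y.
have Ay : A y by near: y; exact: withinT.
have : `|x - y| < e / (b + 1).
  near: y; apply: (@cvgr_dist_lt _ _ _ _ _ id x); first exact: cvg_within.
  by rewrite divr_gt0// ltr_wpDl.
rewrite ltr_pdivlMr ?ltr_wpDl// mulrDr mulr1 mulrC => h.
rewrite (le_lt_trans (hf _ _ Ax Ay))// (le_lt_trans _ h)// lerDl//.
Unshelve. all: by end_near. Qed.

Implicit Types (u v w p q : plane R) (a b s t : R).

(** A pigeonhole argument: an arc of finite length has no room for the points of a fine square grid,
    if these are separated proportionally to the mesh. *)
Lemma no_square_in_arc (gam : R -> plane R) (l d : R) (pt : R -> R -> plane R) : 0 < d ->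
  (forall a b, 0 <= a <= l -> 0 <= b <= l -> `|gam a - gam b| <= `|a - b|) ->
  (forall s t s' t', 0 <= s <= 1 -> 0 <= t <= 1 -> 0 <= s' <= 1 -> 0 <= t' <= 1 ->
    `|s - s'| <= d * `|pt s t - pt s' t'| /\ `|t - t'| <= d * `|pt s t - pt s' t'|) ->
  ~ (forall s t, 0 <= s <= 1 -> 0 <= t <= 1 -> exists2 a, 0 <= a <= l & gam a = pt s t).
Proof.
move=> d0 gl sep cov.
(* The [N ^ 2] nodes are [1 / (N d)]-separated, while the arc is cut into at most [l N d + 1] pieces
   of that length; [N > l d + 1] makes the nodes outnumber the pieces. *)
have [N N0 hN] := nat_gt (l * d + 1).
pose f (i : 'I_N) : R := i%:R / N%:R.
have f01 i : 0 <= f i <= 1.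
  by rewrite divr_ge0//= ler_pdivrMr// mul1r ler_nat ltnW.
have /choice[tau htau] (ij : 'I_N * 'I_N) : exists a, 0 <= a <= l /\ gam a = pt (f ij.1) (f ij.2).
  by have [a a1 a2] := cov _ _ (f01 ij.1) (f01 ij.2); exists a.
have l0 : 0 <= l.
  have [a /andP[a1 a2] _] := cov 0 0 (ltac:(by rewrite lexx ler01)) (ltac:(by rewrite lexx ler01)).
  exact: le_trans a2.
have Nd : 0 < N%:R * d by rewrite mulr_gt0.
pose K := (Num.truncn (l * (N%:R * d))).+1.
have hK x : 0 <= x <= l -> (Num.truncn (x * (N%:R * d)) < K)%N.
  move=> /andP[x0 xl]; rewrite ltnS; apply: le_truncn.
  by rewrite ler_pM2r.
pose g ij : 'I_K := Ordinal (hK _ (htau ij).1).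
have ginj : injective g.
  move=> ij ij' /(congr1 val) /= e; apply/eqP; rewrite -[_ == _]negbK; apply/negP => ne.
  have [h1 h2] := htau ij; have [h1' h2'] := htau ij'.
  have t1 : `|tau ij * (N%:R * d) - tau ij' * (N%:R * d)| < 1.
    have p0 a : 0 <= a <= l -> 0 <= a * (N%:R * d) by move=> /andP[? _]; rewrite mulr_ge0// ltW.
    have /andP[a1 a2] := truncn_itv (p0 _ h1); have /andP[a3 a4] := truncn_itv (p0 _ h1').
    rewrite e in a1 a2; rewrite -natr1 in a2 a4.
    by rewrite ltr_norml; apply/andP; split; lra.
  have t2 : `|tau ij - tau ij'| * (N%:R * d) < 1.
    by rewrite -[X in _ * X](ger0_norm (ltW Nd)) -normrM mulrBl.
  have t3 : `|pt (f ij.1) (f ij.2) - pt (f ij'.1) (f ij'.2)| * (N%:R * d) < 1.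
    by rewrite (le_lt_trans _ t2)// ler_pM2r// -h2 -h2' gl.
  have [s1 s2] := sep _ _ _ _ (f01 ij.1) (f01 ij.2) (f01 ij'.1) (f01 ij'.2).
  have fne (i i' : 'I_N) : i != i' -> 1 <= `|f i - f i'| * N%:R.
    move=> ii; rewrite -[N%:R]ger0_norm// -normrM mulrBl !divfK ?lt0r_neq0//.
    have : (i : nat) != i' by [].
    rewrite neq_ltn => /orP[h|h]; [rewrite distrC|]; rewrite -natrB ?(ltnW h)// ger0_norm// ler1n subn_gt0//.
  have b0 (a : R) : a <= d * `|pt (f ij.1) (f ij.2) - pt (f ij'.1) (f ij'.2)| -> a * N%:R < 1.
    move=> h; have := ler_wpM2r (ler0n R N) h; rewrite [d * _]mulrC -mulrA [d * _]mulrC => h'.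
    exact: le_lt_trans h' t3.
  move: ne; rewrite -pair_eqE /pair_eq negb_and => /orP[/fne|/fne]; apply/negP; rewrite -ltNge; exact: b0.
have := leq_card g ginj; rewrite card_prod !card_ord.
rewrite -(ler_nat R) natrM /K -natr1 => h.
have h1 : (Num.truncn (l * (N%:R * d)))%:R <= l * (N%:R * d) by rewrite truncn_le mulr_ge0// ltW.
have h2 : (l * d + 1) * N%:R < N%:R * N%:R by rewrite ltr_pM2r.
have h3 : 1 <= N%:R :> R by rewrite ler1n -(ltr_nat R).
have e1 : l * (N%:R * d) = l * d * N%:R by ring.
rewrite mulrDl mul1r in h2; lra.
Qed.

Lemma continuous_measurable_plane (g : R -> plane R) : continuous g ->
  measurable_fun setT (g : measurableTypeR R -> mplane R).
Proof.
move=> cg; apply/measurable_fun_pairP; split; apply: continuous_measurable_fun.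
  exact: continuous_fst.
exact: continuous_snd.
Qed.

(** The coordinate [ka] is continuous and injective along the arc, hence monotone, so a window of
    coordinates is an interval of arc length. Its length is at least the chord, since the speed is
    at most 1; above it is bounded through [M] and the minimal speed 1/2. *)
Lemma arc_window (gam dgam : R -> plane R) (ka dka : R -> R) (c : R -> plane R) (l rho : R) :
  0 < l ->
  (forall a, is_derive a 1 gam (dgam a)) -> (forall a, 2^-1 <= `|dgam a| <= 1) ->
  (forall a, is_derive a 1 ka (dka a)) ->
  (forall a, 0 <= a <= l -> `|ka a| <= rho /\ gam a = c (ka a)) ->
  (forall s, `|s| <= rho -> exists2 a, 0 <= a <= l & ka a = s) ->
  {in `[0, l] &, injective ka} ->
  forall s1 s2 M, - rho <= s1 -> s1 < s2 -> s2 <= rho -> 0 < M ->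
  (forall s s', s1 <= s <= s2 -> s1 <= s' <= s2 -> `|c s - c s'| <= M * `|s - s'|) ->
  exists a b, [/\ 0 <= a, a < b, b <= l, forall x : R, 0 <= x <= l -> (s1 <= ka x <= s2) = (a <= x <= b) &
    `|c s2 - c s1| <= b - a <= 2 * M * (s2 - s1)].
Proof.
move=> l0 dg ng dk inl onto inj s1 s2 M sl s12 sr M0 hM.
have ck : continuous ka.
  by move=> a; apply/differentiable_continuous/derivable1_diffP/(@ex_derive _ _ _ _ _ _ _ (dk a)).
have [x1 x1l e1] : exists2 a, 0 <= a <= l & ka a = s1.
  by apply: onto; rewrite ler_norml sl (le_trans (ltW s12)).
have [x2 x2l e2] : exists2 a, 0 <= a <= l & ka a = s2.
  by apply: onto; rewrite ler_norml sr andbT (le_trans sl (ltW s12)).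
have [a [b [a0 ab bl hw [ea eb]]]] : exists a b, [/\ 0 <= a, a < b, b <= l,
    forall x, 0 <= x <= l -> (s1 <= ka x <= s2) = (a <= x <= b) &
    `|ka b - ka a| = s2 - s1 /\ `|c (ka b) - c (ka a)| = `|c s2 - c s1|].
  have /andP[x10 x1l'] := x1l; have /andP[x20 x2l'] := x2l.
  have d0 : `|s2 - s1| = s2 - s1 by rewrite ger0_norm// subr_ge0 ltW.
  have := @itv_continuous_inj_mono R ka `[0, l] (continuous_subspaceT ck) inj.
  case=> [/le_mono_in mo|/le_nmono_in mo].
  - have lek x y : 0 <= x <= l -> 0 <= y <= l -> (ka x <= ka y) = (x <= y).
      by move=> hx hy; apply: mo; rewrite in_itv.
    exists x1, x2; rewrite e1 e2 d0; split => //.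
      by rewrite ltNge -lek// e1 e2 -ltNge.
    by move=> x xl; rewrite -e1 -e2 !lek.
  - have lek x y : 0 <= x <= l -> 0 <= y <= l -> (ka x <= ka y) = (y <= x).
      by move=> hx hy; apply: mo; rewrite in_itv.
    exists x2, x1; rewrite e1 e2 distrC d0 distrC; split => //.
      by rewrite ltNge -lek// e1 e2 -ltNge.
    by move=> x xl; rewrite -e1 -e2 !lek// andbC.
have in0l x : a <= x <= b -> 0 <= x <= l.
  by move=> /andP[h1 h2]; rewrite (le_trans a0)// (le_trans h2).
exists a, b; split => //; apply/andP; split.
  rewrite -eb; have [_ <-] := inl b (in0l b ltac:(by rewrite (ltW ab) lexx)).
  have [_ <-] := inl a (in0l a ltac:(by rewrite (ltW ab) lexx)).
  have := mvt_curve_le (B := 1) (ltW ab) (fun x _ => dg x) (fun x _ => (andP (ng x)).2).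
  by rewrite mul1r.
have [|xi /itvP hxi] := MVT ab (fun x _ => dk x); first exact: continuous_subspaceT.
move=> /(congr1 Num.norm); rewrite ea normrM (ger0_norm (_ : 0 <= b - a)) ?subr_ge0 ?(ltW ab)// => e.
(* At the mean value point the inequality between increments passes to the limit of difference
   quotients; [M] only controls [c] inside the window, so the increment is taken small enough to
   stay there. *)
have key : `|dgam xi| <= M * `|dka xi|.
  have /is_derive_cvg/cvg_norm c1 := dg xi; have /is_derive_cvg/cvg_norm c2 := dk xi.
  have /andP[xa xb] : a < xi < b by rewrite !hxi.
  have hI : \forall h \near (0 : R)^', `|h| < Num.min (xi - a) (b - xi).
    by apply: dnbhs0_lt; rewrite lt_min !subr_gt0 xa.
  have c3 : M * `|h^-1 *: (ka (h + xi) - ka xi)| @[h --> (0 : R)^'] --> M * `|dka xi|.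
    by apply: cvgM => //; exact: cvg_cst.
  apply: (ler_cvg_to c1 c3) => /=; near=> h.
  have : `|h| < Num.min (xi - a) (b - xi) by near: h.
  rewrite lt_min !ltr_norml => /andP[/andP[h1 h2] /andP[h3 h4]].
  have hx : a <= h + xi <= b by apply/andP; split; lra.
  have hxi' : a <= xi <= b by rewrite !ltW.
  have i1 := in0l _ hx; have i2 := in0l _ hxi'.
  rewrite !normrZ mulrCA ler_wpM2l//.
  by have [_ ->] := inl _ i1; have [_ ->] := inl _ i2; apply: hM; rewrite hw.
have /andP[g1 _] := ng xi.
have ba : 0 <= b - a by rewrite subr_ge0 ltW.
have := ler_wpM2r ba (le_trans g1 key); rewrite -[M * _ * _]mulrA -e; lra.
Unshelve. all: by end_near. Qed.

(** * Areas and plaque lengths in one foliated box *)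

Section BoxComparison.
Variables (leaf : plane R -> set (plane R)) (H : R -> R -> plane R) (S : plane R -> R).
Variables (rho La : R).
Hypothesis rho0 : 0 < rho.
Hypothesis La0 : 0 < La.
Hypothesis leaf_trans : forall u v w, leaf u v -> leaf v w -> leaf u w.
Hypothesis leafH : forall s s' t, `|s| <= rho -> `|s'| <= rho -> `|t| <= rho -> leaf (H s t) (H s' t).
Hypothesis Hlip : forall s t s' t', `|s| <= rho -> `|t| <= rho -> `|s'| <= rho -> `|t'| <= rho ->
  `|H s t - H s' t'| <= La * (`|s - s'| + `|t - t'|).
Hypothesis Hexp : forall s t s' t', `|s| <= rho -> `|t| <= rho -> `|s'| <= rho -> `|t'| <= rho ->
  `|s - s'| <= La * `|H s t - H s' t'| /\ `|t - t'| <= La * `|H s t - H s' t'|.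
Hypothesis Sder : forall (gam : R -> plane R) a v, is_derive a 1 gam v ->
  exists w : R, is_derive a 1 (fun x => S (gam x)) w.
Hypothesis SH : forall s t, `|s| <= rho -> `|t| <= rho -> S (H s t) = s.

Definition hbox : set (plane R) := [set z | exists s t, [/\ `|s| <= rho, `|t| <= rho & z = H s t]].
Definition hline t : set (plane R) := [set z | exists2 s, `|s| <= rho & z = H s t].

Lemma Hinj s t s' t' : `|s| <= rho -> `|t| <= rho -> `|s'| <= rho -> `|t'| <= rho ->
  H s t = H s' t' -> s = s' /\ t = t'.
Proof.
move=> h1 h2 h3 h4 e; have [] := Hexp h1 h2 h3 h4.
by rewrite e subrr normr0 mulr0 !normr_le0 !subr_eq0 => /eqP -> /eqP ->.
Qed.

Let sc a : R := rho * (2 * a - 1).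
Let sc_in a : 0 <= a <= 1 -> `|sc a| <= rho.
Proof. by move=> /andP[h1 h2]; rewrite /sc normrM gtr0_norm// ler_piMr ?(ltW rho0)// ler_norml; lra. Qed.
Let sc_inv s : `|s| <= rho -> exists2 a, 0 <= a <= 1 & sc a = s.
Proof.
rewrite ler_norml => /andP[h1 h2]; exists ((s / rho + 1) / 2).
  have : -1 <= s / rho <= 1 by rewrite ler_pdivlMr// ler_pdivrMr// mulN1r mul1r h1.
  by lra.
by rewrite /sc; field; exact: lt0r_neq0.
Qed.
Let sc_sub a b : sc a - sc b = 2 * rho * (a - b). Proof. by rewrite /sc; ring. Qed.

Let h (z : plane R) : plane R := H (sc z.1) (sc z.2).

Let hcont : {within @unit_square R, continuous h}.
Proof.
apply: (@lip_within _ _ _ _ (La * (4 * rho))); first by rewrite !mulr_ge0// ltW.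
move=> z w [/=]; rewrite !in_itv /= => h1 h2 [/=]; rewrite !in_itv /= => h3 h4.
rewrite (le_trans (Hlip (sc_in h1) (sc_in h2) (sc_in h3) (sc_in h4)))//.
have r2 : `|2 * rho| = 2 * rho by rewrite gtr0_norm// mulr_gt0.
rewrite -[leRHS]mulrA ler_pM2l// !sc_sub ![`|2 * rho * _|]normrM r2.
have := norm1_le (z - w); have := norm2_le (z - w); rewrite !pE => n1 n2.
have r20 : 0 <= 2 * rho by rewrite mulr_ge0// ltW.
have := ler_wpM2l r20 n1; have := ler_wpM2l r20 n2; lra.
Qed.

Lemma hbox_image : h @` @unit_square R = hbox.
Proof.
apply/seteqP; split => z.
  move=> [[a b]] [/=]; rewrite !in_itv /= => ha hb <-.
  by exists (sc a), (sc b); split => //; exact: sc_in.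
move=> [s [t [hs ht ->]]]; have [a ha ea] := sc_inv hs; have [b hb eb] := sc_inv ht.
by exists (a, b); [split; rewrite /= in_itv|rewrite /h /= ea eb].
Qed.

Lemma hbox_foliated : foliated_box leaf hbox.
Proof.
exists h; split.
- exact: hcont.
- move=> z w; rewrite !inE => -[/=]; rewrite !in_itv /= => h1 h2 [/=]; rewrite !in_itv /= => h3 h4.
  move=> /(Hinj (sc_in h1) (sc_in h2) (sc_in h3) (sc_in h4))[e1' e2'].
  have i : injective sc.
    move=> a b e; apply/eqP; rewrite -subr_eq0; have := sc_sub a b; rewrite e subrr => /esym/eqP.
    by rewrite mulf_eq0 mulf_eq0 pnatr_eq0 /= (gt_eqF rho0).
  by apply: peq; exact: i.
- exact: hbox_image.
- by move=> s s' t; rewrite !in_itv /= => ? ? ?; apply: leafH; exact: sc_in.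
Qed.

Lemma hbox_measurable : measurable (hbox : set (mplane R)).
Proof.
rewrite -hbox_image; apply: compact_measurable_plane.
by apply: continuous_compact; [exact: hcont|exact: compact_square].
Qed.

Lemma hline_connected t : `|t| <= rho -> connected (hline t).
Proof.
move=> ht; have -> : hline t = (fun a => H (sc a) t) @` `[0, 1].
  apply/seteqP; split => z.
    by move=> [s hs ->]; have [a ha ea] := sc_inv hs; exists a; rewrite /= ?in_itv ?ea.
  by move=> [a]; rewrite /= in_itv /= => ha <-; exists (sc a) => //; exact: sc_in.
apply: connected_continuous_connected; first exact: segment_connected.
apply: (@lip_within _ _ _ _ (La * (2 * rho))); first by rewrite !mulr_ge0// ltW.
move=> a b /=; rewrite !in_itv /= => ha hb.
rewrite (le_trans (Hlip (sc_in ha) ht (sc_in hb) ht))// subrr normr0 addr0 sc_sub normrM.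
have r2 : `|2 * rho| = 2 * rho by rewrite gtr0_norm// mulr_gt0.
by rewrite r2 [leLHS]mulrA.
Qed.

(** A component that met a second horizontal line would, by connectedness, contain all the lines in
    between, a bi-Lipschitz image of a square; but the plaque is a rectifiable arc, which
    [no_square_in_arc] forbids to cover one. *)
Lemma plaque_hline s t (gam : R -> plane R) l : `|s| <= rho -> `|t| <= rho ->
  (forall a b, 0 <= a <= l -> 0 <= b <= l -> `|gam a - gam b| <= `|a - b|) ->
  gam @` `[0, l] = plaque leaf hbox (H s t) -> plaque leaf hbox (H s t) = hline t.
Proof.
move=> hs ht gl eP.
have inB s' t' : `|s'| <= rho -> `|t'| <= rho -> hbox (H s' t') by move=> h1 h2; exists s', t'.
have lineP s' t' : `|s'| <= rho -> `|t'| <= rho ->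
    plaque leaf hbox (H s t) (H s' t') -> hline t' `<=` plaque leaf hbox (H s t).
  move=> hs' ht' hP.
  have [lx _] : (leaf (H s t) `&` hbox) (H s' t') by exact: connected_component_sub hP.
  have -> : plaque leaf hbox (H s t) = connected_component (leaf (H s t) `&` hbox) (H s' t').
    exact: same_connected_component.
  apply: connected_component_max; [by exists s'| |exact: hline_connected].
  move=> _ [r hr ->]; split; [exact: leaf_trans lx (leafH hs' hr ht')|exact: inB].
have Px : plaque leaf hbox (H s t) (H s t).
  by apply: connected_component_refl; split; [exact: leafH|exact: inB].
apply/seteqP; split; last exact: lineP Px.
move=> z Pz; have [lz [s' [t' [hs' ht' ez]]]] : (leaf (H s t) `&` hbox) z by exact: connected_component_sub Pz.
suff <- : t' = t by exists s'.
apply/eqP; rewrite -[_ == _]negbK; apply/negP => tt'.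
have /choice[T hT] (w : plane R) : exists b : R, hbox w -> exists2 r, `|r| <= rho /\ `|b| <= rho & w = H r b.
  have [[r [b [h1 h2 e]]]|nb] := pselect (hbox w); last by exists 0.
  by exists b => _; exists r.
have TE r b : `|r| <= rho -> `|b| <= rho -> T (H r b) = b.
  move=> h1 h2; have [r' [h3 h4] e] := hT _ (inB _ _ h1 h2).
  by have [_ <-] := Hinj h1 h2 h3 h4 e.
have PB w : plaque leaf hbox (H s t) w -> hbox w by move=> /connected_component_sub[].
have Tc : connected (T @` plaque leaf hbox (H s t)).
  apply: connected_continuous_connected; first exact: component_connected.
  apply: (@lip_within _ _ _ _ La); first exact: ltW.
  move=> w w' /PB[r [b [h1 h2 ->]]] /PB[r' [b' [h3 h4 ->]]].
  by rewrite !TE//; case: (Hexp h1 h2 h3 h4).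
(* The transverse coordinate of the connected plaque takes every value between [t] and [t'], and a
   line that the plaque meets is contained in it. *)
have mid b : Num.min t t' <= b <= Num.max t t' -> hline b `<=` plaque leaf hbox (H s t).
  move=> hb.
  have [w Pw e] : (T @` plaque leaf hbox (H s t)) b.
    move/connected_intervalP: Tc => Ti.
    have Tt : (T @` plaque leaf hbox (H s t)) t by exists (H s t) => //; exact: TE.
    have Tt' : (T @` plaque leaf hbox (H s t)) t' by exists z => //; rewrite ez TE.
    move: hb; case: (leP t t') => tt; move=> hbb; [exact: (Ti _ _ Tt Tt' _ hbb)|exact: (Ti _ _ Tt' Tt _ hbb)].
  have [r [h1 h2] ew] := hT _ (PB _ Pw); rewrite e in h2 ew.
  by apply: (lineP r) => //; rewrite -ew.
have d0 : 0 < `|t' - t| by rewrite normr_gt0 subr_eq0.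
pose pt a b := H (sc a) (t + b * (t' - t)).
have hmid b : 0 <= b <= 1 -> Num.min t t' <= t + b * (t' - t) <= Num.max t t'.
  move=> /andP[b0 b1]; case: (leP t t') => hh; apply/andP; split; nra.
have hmid' b : 0 <= b <= 1 -> `|t + b * (t' - t)| <= rho.
  move=> /hmid; move: ht ht'; rewrite !ler_norml => /andP[? ?] /andP[? ?].
  by case: (leP t t') => hh /andP[? ?]; apply/andP; split; lra.
apply: (@no_square_in_arc gam l (La / (2 * rho) + La / `|t' - t|) pt) => //.
- by rewrite addr_gt0// divr_gt0// mulr_gt0.
- move=> a b a' b' ha hb ha' hb'.
  have [h1 h2] := Hexp (sc_in ha) (hmid' _ hb) (sc_in ha') (hmid' _ hb').
  rewrite sc_sub normrM gtr0_norm ?mulr_gt0// in h1.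
  have e3 : t + b * (t' - t) - (t + b' * (t' - t)) = (b - b') * (t' - t) by ring.
  rewrite e3 normrM in h2.
  have n0 : 0 <= `|pt a b - pt a' b'| by [].
  split.
  - rewrite mulrDl; apply: ler_wpDr; first by rewrite mulr_ge0// divr_ge0// ltW.
    by rewrite mulrAC ler_pdivlMr ?mulr_gt0// mulrC.
  - rewrite mulrDl; apply: ler_wpDl; first by rewrite mulr_ge0// divr_ge0 ?mulr_ge0 ?(ltW rho0) ?(ltW La0).
    by rewrite mulrAC ler_pdivlMr.
- move=> a b ha hb.
  have : plaque leaf hbox (H s t) (pt a b).
    by apply: (mid (t + b * (t' - t))); [exact: hmid|exists (sc a) => //; exact: sc_in].
  by rewrite -eP => -[x]; rewrite /= in_itv /= => hx ex; exists x.
Qed.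

(** [lam] is length divided by the total length [l] of the plaque. This [l] is not controlled, but
    it is common to all windows of one plaque and cancels when two of them are compared. *)
Lemma normalized_length_window s t (lam : probability (mplane R) R) : `|s| <= rho -> `|t| <= rho ->
  normalized_length (plaque leaf hbox (H s t)) lam ->
  exists2 l, 0 < l &
   (forall X : set (mplane R), measurable X -> (forall r, `|r| <= rho -> ~ X (H r t)) -> lam X = 0%E) /\
   forall s1 s2 M, - rho <= s1 -> s1 < s2 -> s2 <= rho -> 0 < M ->
    (forall s s', s1 <= s <= s2 -> s1 <= s' <= s2 -> `|H s t - H s' t| <= M * `|s - s'|) ->
    forall X : set (mplane R), measurable X ->
    ((forall r, `|r| <= rho -> X (H r t) -> s1 <= r <= s2) -> (lam X <= (l^-1 * (2 * M * (s2 - s1)))%:E)%E) /\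
    ((forall r, s1 <= r <= s2 -> X (H r t)) -> ((l^-1 * `|H s2 t - H s1 t|)%:E <= lam X)%E).
Proof.
move=> hs ht [gam [l [l0 [[dgam _] ngam] inj eP hlam]]].
have dg a : is_derive a 1 gam ('D_1 gam a).
  by apply: DeriveDef => //; apply/derivable1_diffP; exact: dgam.
(* Euclidean speed 1 is a speed between 1/2 and 1 for the maximum norm. *)
have ng a : 2^-1 <= `|'D_1 gam a| <= 1.
  have h1 := enorm_ge ('D_1 gam a); have h2 := enorm_le ('D_1 gam a); rewrite ngam in h1 h2.
  by apply/andP; split; [lra|].
have gl a b : 0 <= a <= l -> 0 <= b <= l -> `|gam a - gam b| <= `|a - b|.
  move=> _ _.
  have main x y : x <= y -> `|gam y - gam x| <= 1 * (y - x).
    by move=> xy; apply: (mvt_curve_le xy (fun x _ => dg x)) => x' _; have /andP[] := ng x'.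
  have [ab|/ltW ab] := leP a b.
    by rewrite distrC [`|a - b|]distrC ger0_norm ?subr_ge0// -[b - a]mul1r main.
  by rewrite ger0_norm ?subr_ge0// -[a - b]mul1r main.
have eL := plaque_hline hs ht gl eP; rewrite eL in eP.
exists l => //.
have /choice[dka hdka] a : exists w : R, is_derive a 1 (fun x => S (gam x)) w by exact: Sder (dg a).
have inl a : 0 <= a <= l -> `|S (gam a)| <= rho /\ gam a = H (S (gam a)) t.
  move=> ha; have : (gam @` `[0, l]) (gam a) by exists a; rewrite //= in_itv.
  by rewrite eP => -[r hr e]; rewrite e SH.
have onto r : `|r| <= rho -> exists2 a, 0 <= a <= l & S (gam a) = r.
  move=> hr; have : hline t (H r t) by exists r.
  by rewrite -eP => -[a]; rewrite /= in_itv /= => ha e; exists a => //; rewrite e SH.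
have injS : {in `[0, l] &, injective (fun x => S (gam x))}.
  move=> a b; rewrite !in_itv /= => ha hb e.
  have [_ e1] := inl _ ha; have [_ e2] := inl _ hb.
  by apply: inj; rewrite ?in_itv//= e1 e2 e.
split.
  move=> X mX hX; rewrite hlam//.
  suff -> : (`[0, l] `&` gam @^-1` X = set0) by rewrite measure0 mule0.
  apply/seteqP; split => // a [/=]; rewrite in_itv /= => /inl[hS ->]; exact: hX.
move=> s1 s2 M h1 h12 h2 M0 hM X mX.
have [a [b [a0 ab bl hw /andP[h3 h4]]]] := arc_window l0 dg ng hdka inl onto injS h1 h12 h2 M0 hM.
have li : 0 < l^-1 by rewrite invr_gt0.
rewrite hlam//.
have mg : measurable (`[0%R, l] `&` gam @^-1` X : set (measurableTypeR R)).
  apply: measurableI; first exact: measurable_itv.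
  have cg : continuous gam.
    by move=> x; apply/differentiable_continuous/derivable1_diffP/(@ex_derive _ _ _ _ _ _ _ (dg x)).
  by rewrite -[X in measurable X]setTI; exact: continuous_measurable_plane.
have lab : lebesgue_measure [set` `[a, b]] = (b - a)%:E.
  by rewrite lebesgue_measure_itv /= lte_fin ab -EFinB.
split => hX.
- rewrite EFinM lee_pmul2l ?lte_fin// (@le_trans _ _ (b - a)%:E)// ?lee_fin//.
  rewrite -lab; apply: le_measure; rewrite ?inE//.
  move=> x [/=]; rewrite !in_itv /= => hx; have [hS ->] := inl _ hx.
  by move=> /(hX _ hS); rewrite hw.
- rewrite EFinM lee_pmul2l ?lte_fin// (@le_trans _ _ (b - a)%:E)// ?lee_fin//.
  rewrite -lab; apply: le_measure; rewrite ?inE//.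
  move=> x /=; rewrite !in_itv /= => hx.
  have hx' : 0 <= x <= l by have /andP[? ?] := hx; rewrite (le_trans a0)//= (le_trans _ bl).
  by split => //; have [_ ->] := inl _ hx'; apply: hX; rewrite hw.
Qed.

(** The bounds on [r] hold only almost everywhere; its clamped version has the same integrals and is
    nonnegative everywhere, so that monotonicity applies. *)
Lemma density_integral (Cb : R) (lam : probability (mplane R) R) (r : mplane R -> R) (X : set (mplane R)) :
  1 < Cb -> measurable_fun [set: mplane R] r -> measurable X ->
  {ae lam, forall y, Cb^-1 <= r y <= Cb} ->
  (Cb^-1%:E * lam X <= \int[lam]_(y in X) (r y)%:E <= Cb%:E * lam X)%E.
Proof.
move=> C1 mr mX hr.
have C0 : 0 < Cb by lra.
have iC : Cb^-1 <= Cb by rewrite (@le_trans _ _ 1)// ?invf_le1// ltW.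
pose rc y := Num.max Cb^-1 (Num.min Cb (r y)).
have rcb y : Cb^-1 <= rc y <= Cb by rewrite /rc le_max lexx /= ge_max iC ge_min lexx.
have mrc : measurable_fun X rc.
  apply: measurable_funS (subsetT X) _ => //.
  by apply: measurable_maxr => //; apply: measurable_minr.
have -> : (\int[lam]_(y in X) (r y)%:E = \int[lam]_(y in X) (rc y)%:E)%E.
  apply: ae_eq_integral => //.
  - by apply/measurable_EFinP; exact: measurable_funS (subsetT X) _.
  - exact/measurable_EFinP.
  apply: filterS hr => y /andP[h1 h2] _; congr (_%:E).
  by rewrite /rc (min_r h2) (max_r h1).
have i0 : 0 <= Cb^-1 by rewrite invr_ge0 ltW.
apply/andP; split.
  rewrite -integral_cst//; apply: ge0_le_integral => //.
  - exact/measurable_EFinP.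
  - by move=> y _; rewrite lee_fin; have /andP[] := rcb y.
rewrite -integral_cst//; apply: ge0_le_integral => //.
- by move=> y _; rewrite lee_fin (le_trans i0)//; have /andP[] := rcb y.
- exact/measurable_EFinP.
- by move=> y _; rewrite lee_fin; have /andP[] := rcb y.
Qed.

(** On each plaque the conditional mass of [X1] is at most [Cb * 4 * M * eps / l] and, when the
    plaque is at height at most [eta], that of [X2] is at least [m0 / (Cb * l)]. The ratio is free
    of [l], and integrating the inequality over the box compares the areas. *)
Lemma ubd_box_compare (Cb : R) (m : plane R -> probability (mplane R) R) : 1 < Cb ->
  disintegration leaf hbox m ->
  {ae @area R, forall x, hbox x ->
    exists (lam : probability (mplane R) R) (r : mplane R -> R),
      [/\ normalized_length (plaque leaf hbox x) lam,
          measurable_fun [set: mplane R] r,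
          forall E : set (mplane R), measurable E -> m x E = (\int[lam]_(y in E) (r y)%:E)%E &
          {ae lam, forall y, Cb^-1 <= r y <= Cb}]} ->
  forall (s1 s2 eps eta M m0 : R) (X1 X2 : set (mplane R)),
  0 < eps -> `|s1| + eps <= rho -> `|s2| + eps <= rho -> eta <= rho -> 0 < M -> 0 < m0 ->
  measurable X1 -> measurable X2 ->
  (forall z, X1 z -> exists s t, [/\ `|s - s1| <= eps, `|t| <= eta & z = H s t]) ->
  (forall s t, `|s - s2| <= eps -> `|t| <= eta -> X2 (H s t)) ->
  (forall s s' t, `|s - s1| <= eps -> `|s' - s1| <= eps -> `|t| <= eta ->
     `|H s t - H s' t| <= M * `|s - s'|) ->
  (forall t, `|t| <= eta -> m0 <= `|H (s2 + eps) t - H (s2 - eps) t|) ->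
  (area X1 <= (Cb ^+ 2 * (4 * M * eps / m0))%:E * area X2)%E.
Proof.
move=> C1 [_ _ dmeas dint] hae s1 s2 eps eta M m0 X1 X2 e0 hs1 hs2 heta M0 m00 mX1 mX2 hX1 hX2 hM hm.
have arith (i n r : R) : i <= n -> - i <= n -> n + eps <= r ->
    [/\ - r <= i - eps, i - eps < i + eps & i + eps <= r].
  by move=> h1 h2 h3; split; lra.
have C0 : 0 < Cb by lra.
have win s i : `|i| + eps <= rho -> (`|s - i| <= eps) = (i - eps <= s <= i + eps).
  by move=> _; rewrite ler_distl.
have wrho s i : `|i| + eps <= rho -> `|s - i| <= eps -> `|s| <= rho.
  by move=> h1 h2; rewrite -(subrK i s) (le_trans (ler_normD _ _))// addrC (le_trans _ h1)// lerD2l.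
have bnd i : `|i| + eps <= rho -> [/\ - rho <= i - eps, i - eps < i + eps & i + eps <= rho].
  by move=> h1; apply: arith h1; rewrite ?ler_norm// -normrN ler_norm.
set Q := Cb ^+ 2 * (4 * M * eps / m0).
have Q0 : 0 <= Q by rewrite ltW// !mulr_gt0 ?invr_gt0// exprn_gt0.
have X1B : X1 `<=` hbox.
  move=> z /hX1[s [t [h1 h2 ->]]]; exists s, t; split => //; first exact: wrho h1.
  exact: le_trans heta.
have pw : {ae @area R, forall x, hbox x -> (m x X1 <= Q%:E * m x X2)%E}.
  apply: (@filterS _ _ (ae_filter_ringOfSetsType (@area R)) _ _ _ hae) => x hx Bx; have [lam [r [nl mr mI rae]]] := hx Bx.
  have [s [t [hs ht ex]]] := Bx; rewrite ex in nl.
  have [l l0 [W0 W]] := normalized_length_window hs ht nl.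
  have /andP[_ d1] := density_integral C1 mr mX1 rae.
  have /andP[d2 _] := density_integral C1 mr mX2 rae.
  rewrite mI// mI//.
  have [teta|teta] := leP `|t| eta; last first.
    (* Plaques at height above [eta] do not meet [X1]. *)
    have z1 : lam X1 = 0%E.
      apply: W0 => // q hq /hX1[s' [t' [h1 h2 e]]].
      have ht' : `|t'| <= rho by exact: le_trans heta.
      have [_ et] := Hinj hq ht (wrho _ _ hs1 h1) ht' e.
      by move: teta; rewrite et ltNge h2.
    rewrite z1 mule0 in d1; apply: le_trans d1 _; rewrite mule_ge0// ?lee_fin//.
    by apply: le_trans d2; rewrite mule_ge0// lee_fin invr_ge0 ltW.
  have [a1 a2 a3] := bnd _ hs1; have [b1 b2 b3] := bnd _ hs2.
  have w1 : (lam X1 <= (l^-1 * (2 * M * (s1 + eps - (s1 - eps))))%:E)%E.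
    apply: (W _ _ _ a1 a2 a3 M0 _ _ mX1).1.
      by move=> s' s'' h1 h2; apply: hM => //; rewrite win.
    move=> q hq /hX1[s' [t' [h1 h2 e]]].
    have ht' : `|t'| <= rho by exact: le_trans heta.
    by have [-> _] := Hinj hq ht (wrho _ _ hs1 h1) ht' e; rewrite -win.
  have w2 : ((l^-1 * `|H (s2 + eps) t - H (s2 - eps) t|)%:E <= lam X2)%E.
    apply: (W _ _ La b1 b2 b3 La0 _ _ mX2).2.
      move=> s' s'' h1 h2; have /wrho h3 := hs2; rewrite -!(win _ _ hs2) in h1 h2.
      have := Hlip (h3 _ h1) ht (h3 _ h2) ht; by rewrite subrr normr0 addr0.
    by move=> q hq; apply: hX2 => //; rewrite win.
  have w3 : ((l^-1 * m0)%:E <= lam X2)%E.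
    by apply: le_trans w2; rewrite lee_fin ler_pM2l ?invr_gt0// hm.
  apply: (le_trans d1); apply: (@le_trans _ _ (Q%:E * (Cb^-1%:E * lam X2))%E); last first.
    by rewrite lee_pmul// ?mule_ge0// lee_fin// invr_ge0 ltW.
  apply: (@le_trans _ _ (Cb%:E * (l^-1 * (2 * M * (s1 + eps - (s1 - eps))))%:E)%E).
    by rewrite lee_pmul2l// lte_fin.
  apply: (@le_trans _ _ (Q%:E * (Cb^-1%:E * (l^-1 * m0)%:E))%E).
    rewrite -!EFinM lee_fin le_eqVlt; apply/orP; left; apply/eqP; rewrite /Q.
    by field; rewrite !lt0r_neq0.
  rewrite lee_pmul// ?mule_ge0 ?lee_fin// ?invr_ge0 ?mulr_ge0 ?invr_ge0 ?(ltW C0) ?(ltW l0) ?(ltW m00)//.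
  by rewrite lee_pmul2l ?lte_fin ?invr_gt0.
have -> : area X1 = area (hbox `&` X1) by congr (area _); rewrite setIidr.
rewrite -dint//.
apply: (@le_trans _ _ (\int[@area R]_(x in hbox) (Q%:E * m x X2))%E).
  apply: ae_ge0_le_integral => //.
  - exact: hbox_measurable.
  - exact: dmeas.
  - by move=> x _; rewrite mule_ge0// lee_fin.
  - by apply: emeasurable_funM => //; exact: dmeas.
rewrite ge0_integralZl//; first last.
- exact: dmeas.
- exact: hbox_measurable.
rewrite dint// lee_pmul// ?lee_fin//.
apply: le_measure; rewrite ?inE//.
by apply: measurableI => //; exact: hbox_measurable.
Qed.

End BoxComparison.

End Arcs.

(** * Images of thin boxes around a point of a plaque *)

Section LocalBox.
Variable R : realType.
Implicit Types (u v w z q : plane R) (a b s t : R).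

Lemma is_derive_mull a s : is_derive s 1 (fun r : R => a * r) a.
Proof.
have := is_derive_affine (0 : R^o) (a : R^o) s.
by rewrite (_ : (fun r : R => 0 + r *: (a : R^o)) = (fun r : R => a * r))//; apply/funext => r; rewrite add0r mulrC.
Qed.

Lemma near_small (k c : R) : 0 < c -> \forall eps \near (0 : R)^'+, k * eps <= c.
Proof.
move=> c0; near=> eps.
have e0 : 0 < eps by near: eps; exact: nbhs_right_gt.
have h : eps <= c / (`|k| + 1).
  by near: eps; apply: nbhs_right_le; rewrite divr_gt0// ltr_wpDl.
rewrite (le_trans (ler_wpM2r (ltW e0) (ler_norm k)))//.
rewrite (le_trans (ler_wpM2l (normr_ge0 k) h))//.
by rewrite mulrA ler_pdivrMr ?ltr_wpDl// mulrC mulrDr mulr1 [c * _]mulrC lerDl ltW.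
Unshelve. all: by end_near. Qed.

Variables (Phi Psi : plane R -> plane R) (M C M' C' j : R).
Hypothesis cPhi : C11 Phi M C.
Hypothesis cPsi : C11 Psi M' C'.
Hypothesis j0 : j != 0.
Hypothesis hj : forall x u v, cross (D Phi x u) (D Phi x v) = j * cross u v.
Hypothesis PhiK : cancel Phi Psi.
Hypothesis PsiK : cancel Psi Phi.
Variables (e : plane R -> plane R) (L rho : R) (p : plane R) (Y g : R -> R -> R).
Hypothesis ne : forall x, `|e x| = 1.
Hypothesis L0 : 0 < L.
Hypothesis hbf : box_frame e L rho p Y g.

Let f1 := e p.
Let f2 := rot90 f1.
Let cr := cross f1 f2.
Let cr1 : 1 <= cr <= 2. Proof. exact: cross_frame. Qed.
Let n1 : `|f1| = 1. Proof. exact: ne. Qed.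
Let n2 : `|f2| = 1. Proof. by rewrite pnorm_rot90. Qed.

Definition box_pt s t : plane R := bpt e p s (Y s t).
Definition box_tan s t : plane R := f1 + g s t *: f2.

Lemma box_pt_derive s t : `|s| <= rho -> `|t| <= rho -> is_derive s 1 (box_pt^~ t) (box_tan s t).
Proof.
move=> hs ht; have [/(_ s t hs ht)[_ dY _ _] _ _ _] := hbf.
have d1 (i : R) : is_derive s 1 (fun r : R => i * r) i.
  exact: is_derive_mull.
have -> : box_pt^~ t = (fun r : R => ((p.1 + f1.1 * r + Y r t * f2.1, p.2 + f1.2 * r + Y r t * f2.2) : plane R)).
  by apply/funext => r; apply: peq; rewrite /box_pt /bpt -/f1 -/f2 !pE /=; ring.
have -> : box_tan s t = (f1.1 + g s t * f2.1, f1.2 + g s t * f2.2) :> plane R.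
  by apply: peq; rewrite /box_tan !pE.
have aff (i1 i2 i3 : R) : is_derive s 1 (fun r => i1 + i2 * r + Y r t * i3) (i2 + g s t * i3).
  have d2 := is_deriveD (is_deriveD (is_derive_cst i1 s 1) (d1 i2)) (is_deriveZ i3 dY).
  have -> : (fun r => i1 + i2 * r + Y r t * i3) = (cst i1 + (fun r : R => i2 * r) + i3 *: (Y^~ t))%R.
    by apply/funext => r; rewrite /GRing.add /= /GRing.scale /= [Y r t * _]mulrC.
  by apply: is_derive_eq d2 _; rewrite add0r [g s t * _]mulrC.
by apply: is_derive_pair; exact: aff.
Qed.

Lemma box_pt_lip s t s' t' : `|s| <= rho -> `|t| <= rho -> `|s'| <= rho -> `|t'| <= rho ->
  `|box_pt s t - box_pt s' t'| <= 2 * (`|s - s'| + `|t - t'|).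
Proof.
move=> hs ht hs' ht'; have [_ h1 h2 _] := hbf.
rewrite (le_trans (bpt_dist ne _ _ _ _ _))//.
have h3 := h1 s t t' hs ht ht'; have h4 := h2 s s' t' hs hs' ht'.
have h5 := ler_distD (Y s t') (Y s t) (Y s' t').
have := ler_normD (Y s t - Y s t' - (t - t')) (t - t'); rewrite subrK.
have : 0 <= `|s - s'| by []. have : 0 <= `|t - t'| by []. lra.
Qed.

Lemma box_coord z : z = p + (cross (z - p) f2 / cr) *: f1 + (cross f1 (z - p) / cr) *: f2.
Proof.
have c0 : cr != 0 by rewrite gt_eqF//; have /andP[h _] := cr1; rewrite (lt_le_trans ltr01).
by rewrite -addrA -(cramer_div (z - p) c0) addrC subrK.
Qed.

Lemma bpt_coord s a : cross (bpt e p s a - p) f2 / cr = s /\ cross f1 (bpt e p s a - p) / cr = a.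
Proof.
have c0 : cr != 0 by rewrite gt_eqF//; have /andP[h _] := cr1; rewrite (lt_le_trans ltr01).
have -> : bpt e p s a - p = s *: f1 + a *: f2 by apply: peq; rewrite /bpt !pE; ring.
by rewrite crossDl crossDr !crossZl !crossZr !crossvv !mulr0 addr0 add0r !mulfK.
Qed.

Lemma coord_le v : `|cross v f2 / cr| <= 2 * `|v| /\ `|cross f1 v / cr| <= 2 * `|v|.
Proof.
have /andP[c1 _] := cr1; have c0 : 0 < cr by rewrite (lt_le_trans ltr01).
have h a : `|a| <= 2 * `|v| -> `|a / cr| <= 2 * `|v|.
  move=> ha; rewrite normrM normfV (gtr0_norm c0) ler_pdivrMr// (le_trans ha)//.
  by rewrite ler_peMr// mulr_ge0.
by split; apply: h; rewrite (le_trans (norm_cross _ _))// ?n1 ?n2 ?mulr1 ?mul1r.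
Qed.

Lemma box_pt_exp s t s' t' : `|s| <= rho -> `|t| <= rho -> `|s'| <= rho -> `|t'| <= rho ->
  `|s - s'| <= 4 * `|box_pt s t - box_pt s' t'| /\ `|t - t'| <= 4 * `|box_pt s t - box_pt s' t'|.
Proof.
move=> hs ht hs' ht'; have [_ h1 h2 _] := hbf.
have [es ey] := bpt_coord s (Y s t); have [es' ey'] := bpt_coord s' (Y s' t').
have [] := coord_le (box_pt s t - box_pt s' t').
have -> : cross (box_pt s t - box_pt s' t') f2 / cr = s - s'.
  by rewrite -{2}es -{2}es' -mulrBl -crossNl -crossDl; congr (cross _ _ / _); apply: peq; rewrite !pE; ring.
have -> : cross f1 (box_pt s t - box_pt s' t') / cr = Y s t - Y s' t'.
  by rewrite -[X in _ = X - _]ey -[X in _ = _ - X]ey' -mulrBl -crossNr -crossDr; congr (cross _ _ / _); apply: peq; rewrite !pE; ring.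
move=> k1 k2.
have h3 := h1 s t t' hs ht ht'; have h4 := h2 s s' t' hs hs' ht'.
have h5 := ler_distD (Y s' t') (Y s t) (Y s t'); rewrite [`|Y s' t' - _|]distrC in h5.
have := ler_normD (- (Y s t - Y s t' - (t - t'))) (Y s t - Y s t').
rewrite normrN; have -> : - (Y s t - Y s t' - (t - t')) + (Y s t - Y s t') = t - t' by ring.
have : 0 <= `|s - s'| by []. have : 0 <= `|t - t'| by [].
have : 0 <= `|box_pt s t - box_pt s' t'| by []. lra.
Qed.

Lemma box_tan_le s t : `|s| <= rho -> `|t| <= rho -> `|box_tan s t| <= 2.
Proof.
move=> hs ht; have [/(_ s t hs ht)[_ _ hg _] _ _ _] := hbf.
rewrite (le_trans (ler_normD _ _))// normrZ n1 n2; lra.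
Qed.

Lemma box_tan_lip s t s' t' : `|s| <= rho -> `|t| <= rho -> `|s'| <= rho -> `|t'| <= rho ->
  `|box_tan s t - box_tan s' t'| <= 16 * L * (`|s - s'| + `|t - t'|).
Proof.
move=> hs ht hs' ht'; have [_ _ _ hg] := hbf.
have -> : box_tan s t - box_tan s' t' = (g s t - g s' t') *: f2 by apply: peq; rewrite !pE; ring.
by rewrite normrZ n2 mulr1 hg.
Qed.

Lemma box_tan_cross s t : cross (box_tan s t) f2 = cr.
Proof. by rewrite crossDl crossZl crossvv mulr0 addr0. Qed.

Variables (s0 : R) (de : R).
Hypothesis hs0 : `|s0| < rho.
Hypothesis hde : 0 < de <= 1.
Let q := box_pt s0 0.
Let v := box_tan s0 0.
Let u := D Phi q v.
Let w := D Phi q f2.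
Hypothesis hdw : 8 * (de * `|w|) <= `|u|.
Variable we : plane R.
Hypothesis nwe : `|we| = 1.
Hypothesis cwe : `|cross u we| = `|u|.

Let H s t := Phi (box_pt s t).

Let rho0 : 0 < rho. Proof. by rewrite (le_lt_trans _ hs0). Qed.
Let de0 : 0 < de. Proof. by case/andP: hde. Qed.
Let zr : `|0 : R| <= rho. Proof. by rewrite normr0 ltW. Qed.
Let s0r : `|s0| <= rho. Proof. exact: ltW. Qed.
Let jp : 0 < `|j|. Proof. by rewrite normr_gt0. Qed.

Let shift_le (eps r : R) : `|s0| + eps <= rho -> `|r - s0| <= eps -> `|r| <= rho.
Proof. by move=> he hr; rewrite -(subrK s0 r) (le_trans (ler_normD _ _))// addrC (le_trans _ he)// lerD2l. Qed.

Let pair_le (a b d eps : R) : a <= eps -> b <= d -> d <= eps -> 2 * (a + b) <= 4 * eps.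
Proof. by lra. Qed.

Let cuw : `|j| <= `|cross u w| <= 2 * `|j|.
Proof.
rewrite hj box_tan_cross normrM; have /andP[c1 c2] := cr1.
by rewrite (gtr0_norm (lt_le_trans ltr01 c1)) [2 * _]mulrC ler_peMr// ler_pM2l.
Qed.

Let u0 : 0 < `|u|.
Proof.
rewrite normr_gt0; apply/eqP => uz; have /andP[h _] := cuw.
by move: h; rewrite uz cross0l normr0 leNgt jp.
Qed.

(** [D Phi] and the tangents of the leaves are Lipschitz, so on a small enough box all the
    velocities of image plaques are within [|u| / 2] of [u]; the mean value inequality integrates
    this. *)
Lemma box_window : \forall eps \near (0 : R)^'+, [/\ 0 < eps, `|s0| + eps <= rho, de * eps <= rho &
  forall s s' t, `|s - s0| <= eps -> `|s' - s0| <= eps -> `|t| <= de * eps ->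
    `|H s t - H s' t - (s - s') *: u| <= `|u| / 2 * `|s - s'|].
Proof.
have [dPhi M0 C0 hM hC] := cPhi.
near=> eps.
have e0 : 0 < eps by near: eps; exact: nbhs_right_gt.
have h1 : 1 * eps <= rho - `|s0| by near: eps; apply: near_small; rewrite subr_gt0.
have h2 : (C * 4 * 2 + M * (16 * L * 2)) * eps <= `|u| / 2 by near: eps; apply: near_small; rewrite divr_gt0.
have /andP[_ d1] := hde.
have dee : de * eps <= eps by rewrite ler_piMl// ltW.
have he : `|s0| + eps <= rho by rewrite -lerBrDl -[eps]mul1r.
have der : de * eps <= rho by rewrite (le_trans dee)// (le_trans _ he)// lerDr.
split => //; move=> s s' t hs hs' ht.
have inr r : `|r - s0| <= eps -> `|r| <= rho by exact: shift_le he.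
have tr : `|t| <= rho by exact: le_trans der.
pose c r := H r t - r *: u; pose dc r := D Phi (box_pt r t) (box_tan r t) - u.
have dcd r : `|r - s0| <= eps -> is_derive r 1 c (dc r).
  move=> hr; have d2 : is_derive r 1 (fun r : R => H r t) (D Phi (box_pt r t) (box_tan r t)).
    by apply: (is_derive_comp2 (dPhi _)); apply: box_pt_derive => //; exact: inr.
  have d3 : is_derive r 1 (fun r : R => r *: u) u.
    by have := is_derive_affine (0 : plane R) u r; under eq_fun do rewrite add0r.
  exact: is_deriveB.
have dcb r : `|r - s0| <= eps -> `|dc r| <= `|u| / 2.
  move=> hr; apply: le_trans h2; have rr := inr r hr.
  have -> : dc r = (D Phi (box_pt r t) (box_tan r t) - D Phi q (box_tan r t)) + D Phi q (box_tan r t - v).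
    by rewrite /dc linearB /= -/u addrA subrK.
  rewrite (le_trans (ler_normD _ _))// mulrDl lerD//.
    rewrite (le_trans (hC _ _ _))//.
    have k1 : `|box_pt r t - q| <= 4 * eps.
      by rewrite (le_trans (box_pt_lip rr tr s0r zr))// subr0 (pair_le hr ht dee).
    have -> : C * 4 * 2 * eps = C * (4 * eps) * 2 by ring.
    by rewrite ler_pM ?mulr_ge0 ?(ltW C0)// ?box_tan_le// ler_pM2l.
  rewrite (le_trans (hM _ _))// -mulrA ler_pM2l//.
  rewrite (le_trans (box_tan_lip rr tr s0r zr))// subr0.
  have -> : 16 * L * 2 * eps = 16 * L * (eps + eps) by ring.
  by rewrite ler_pM2l ?mulr_gt0// lerD// (le_trans ht).
have main r r' : `|r - s0| <= eps -> `|r' - s0| <= eps -> r <= r' -> `|c r' - c r| <= `|u| / 2 * (r' - r).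
  rewrite !ler_distl => /andP[a1 a2] /andP[a3 a4] rr'.
  have inn x : r <= x <= r' -> `|x - s0| <= eps.
    by move=> /andP[b1 b2]; rewrite ler_distl (le_trans a1)// (le_trans b2).
  apply: (mvt_curve_le rr') => x hx; [exact: dcd (inn x hx)|exact: dcb (inn x hx)].
have ec r r' : H r t - H r' t - (r - r') *: u = c r - c r'.
  by apply: peq; rewrite /c !pE; ring.
rewrite ec; have [ss|/ltW ss] := leP s' s.
  by rewrite (ger0_norm (_ : 0 <= s - s')) ?subr_ge0// main.
by rewrite distrC [`|s - s'|]distrC (ger0_norm (_ : 0 <= s' - s)) ?subr_ge0// main.
Unshelve. all: by end_near. Qed.

Let rem s := Y s 0 - Y s0 0 - g s0 0 * (s - s0).

(** The slope is Lipschitz, so a leaf departs from its tangent only quadratically; the departure is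
    negligible against the half-height [de * eps]. *)
Let rem_le (eps s : R) : 0 < eps -> `|s0| + eps <= rho -> `|s - s0| <= eps -> `|rem s| <= 16 * L * eps ^+ 2.
Proof.
move=> e0 he hs; have [hY _ _ hg] := hbf.
have inr r : `|r - s0| <= eps -> `|r| <= rho by exact: shift_le he.
pose c r := Y r 0 - g s0 0 * r; pose dc r := g r 0 - g s0 0.
have cd r : s0 - eps <= r <= s0 + eps -> is_derive r 1 c (dc r).
  rewrite -ler_distl => hr; have [_ d1 _ _] := hY r 0 (inr r hr) zr.
  have d2 : is_derive r 1 (fun r : R => g s0 0 * r) (g s0 0).
    exact: is_derive_mull.
  exact: is_deriveB.
have cb r : s0 - eps <= r <= s0 + eps -> `|dc r| <= 16 * L * eps.
  rewrite -ler_distl => hr; rewrite (le_trans (hg r s0 0 0 (inr r hr) s0r zr zr))//.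
  by rewrite subrr normr0 addr0 ler_pM2l ?mulr_gt0.
have i0 : s0 - eps <= s0 <= s0 + eps by rewrite -ler_distl subrr normr0 ltW.
have is' : s0 - eps <= s <= s0 + eps by rewrite -ler_distl.
have := mvt_abs cd cb i0 is'.
have -> : c s - c s0 = rem s by rewrite /c /rem; ring.
move=> /le_trans; apply; rewrite expr2 mulrA ler_wpM2l// !mulr_ge0 ?ltW//.
Qed.

(** To first order the image is the parallelogram with half-sides [eps *: u] and [(de * eps) *: w];
    the Taylor remainder and the bending of the leaf are quadratic in [eps]. The width across [u] is
    of order [de * eps * |j| / |u|], because [|cross u w|] lies between [|j|] and [2 * |j|]. *)
Lemma box_upper : \forall eps \near (0 : R)^'+,
  forall s t, `|s - s0| <= eps -> `|t| <= de * eps ->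
    strip u we (Phi q) (8 * eps) (5 * de * eps * `|j| / `|u|) (H s t).
Proof.
have tau_bound (T y i t r l d h : R) : T <= y + r -> y <= i + t -> i <= t / 3 -> t <= h ->
  r <= l -> l <= d -> 2 * d = h -> 0 <= h -> T <= 2 * h by lra.
have sum3 (a b c i m : R) : a <= b + c -> b <= m -> c <= m -> i <= m -> a + i <= 3 * m by lra.
have sum2 (a b i m : R) : a <= 2 * m * (2 * b) -> i <= b * m -> a + i <= 5 * (b * m) by lra.
have three (a m : R) : 0 <= m -> a <= 3 * m -> 2 * a <= 8 * m by lra.
have [dPhi M0 C0 hM hC] := cPhi.
near=> eps.
have e0 : 0 < eps by near: eps; exact: nbhs_right_gt.
have h1 : 1 * eps <= rho - `|s0| by near: eps; apply: near_small; rewrite subr_gt0.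
have h2 : 16 * L * eps <= de / 2 by near: eps; apply: near_small; rewrite divr_gt0.
have h3 : 16 * C * eps <= `|u| by near: eps; exact: near_small.
have h4 : 32 * C * `|u| * eps <= de * `|j| by near: eps; apply: near_small; rewrite mulr_gt0.
have he : `|s0| + eps <= rho by rewrite -lerBrDl -[eps]mul1r.
have /andP[_ d1] := hde.
have dee : de * eps <= eps by rewrite ler_piMl// ltW.
have der : de * eps <= rho by rewrite (le_trans dee)// (le_trans _ he)// lerDr.
move=> s t hs ht.
have sr : `|s| <= rho := shift_le he hs.
have tr : `|t| <= rho by exact: le_trans der.
have [_ hgap _ _] := hbf.
pose tau := (Y s t - Y s 0) + rem s.
have et : box_pt s t - q = (s - s0) *: v + tau *: f2.
  by apply: peq; rewrite /q /v /box_pt /bpt /box_tan /tau /rem -/f1 -/f2 !pE; ring.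
have tau_le : `|tau| <= 2 * (de * eps).
  have k1 := hgap s t 0 sr tr zr; rewrite subr0 in k1.
  have k2 := ler_normD (Y s t - Y s 0 - t) t; rewrite subrK in k2.
  have k3 := rem_le e0 he hs.
  have k4 : 16 * L * eps ^+ 2 <= de / 2 * eps by rewrite expr2 mulrA ler_wpM2r// ltW.
  have k5 : `|tau| <= `|Y s t - Y s 0| + `|rem s| := ler_normD _ _.
  apply: (tau_bound _ _ _ _ _ _ _ _ k5 k2 k1 ht k3 k4); last by rewrite mulr_ge0// ltW.
  by field.
pose E := H s t - Phi q - D Phi q (box_pt s t - q).
have E_le : `|E| <= 16 * C * eps ^+ 2.
  rewrite (le_trans (F_taylor cPhi q (box_pt s t)))//.
  have k : `|box_pt s t - q| <= 4 * eps.
    by rewrite (le_trans (box_pt_lip sr tr s0r zr))// subr0 (pair_le hs ht dee).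
  have -> : 16 * C * eps ^+ 2 = C * (4 * eps) ^+ 2 by ring.
  by rewrite ler_pM2l// lerXn2r// nnegrE// mulr_ge0// ltW.
have eH : H s t - Phi q = (s - s0) *: u + tau *: w + E.
  have eL : D Phi q (box_pt s t - q) = (s - s0) *: u + tau *: w by rewrite et linearD !linearZ.
  by rewrite -eL /E [RHS]addrC subrK.
have E1 : `|E| <= eps * `|u|.
  by rewrite (le_trans E_le)// expr2 mulrA [eps * `|u|]mulrC ler_wpM2r// ltW.
clearbody E; split; rewrite /= eH.
- have k1 : `|(s - s0) *: u + tau *: w + E| <= 3 * (eps * `|u|).
    rewrite (le_trans (ler_normD _ _))//.
    have k2 := ler_normD ((s - s0) *: u) (tau *: w); rewrite [X in _ <= X + _]normrZ [X in _ <= _ + X]normrZ in k2.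
    have k3 : `|s - s0| * `|u| <= eps * `|u| by rewrite ler_wpM2r.
    have k4 : `|tau| * `|w| <= eps * `|u|.
      rewrite (le_trans (ler_wpM2r (normr_ge0 w) tau_le))//.
      have -> : 2 * (de * eps) * `|w| = eps * (2 * (de * `|w|)) by ring.
      rewrite ler_pM2l// (le_trans _ hdw)// ler_wpM2r ?mulr_ge0 ?(ltW de0)// ler_nat//.
    exact: sum3 k2 k3 k4 E1.
  rewrite (le_trans (norm_cross _ _))// nwe mulr1 -mulrA.
  by apply: three k1; rewrite mulr_ge0// ltW.
- rewrite divfK ?lt0r_neq0//.
  rewrite !crossDr !crossZr crossvv mulr0 add0r (le_trans (ler_normD _ _))//.
  rewrite normrM; have /andP[_ k1] := cuw.
  have k2 : `|tau| * `|cross u w| <= 2 * (de * eps) * (2 * `|j|) by rewrite ler_pM.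
  have k3 : `|cross u E| <= 2 * (`|u| * (16 * C * eps ^+ 2)).
    by rewrite (le_trans (norm_cross _ _))// ler_pM2l// ler_pM2l.
  have k4 : 2 * (`|u| * (16 * C * eps ^+ 2)) <= de * `|j| * eps.
    have -> : 2 * (`|u| * (16 * C * eps ^+ 2)) = 32 * C * `|u| * eps * eps by ring.
    by rewrite ler_wpM2r// ltW.
  have -> : 5 * de * eps * `|j| = 5 * (`|j| * (de * eps)) by ring.
  apply: sum2 k2 _; apply: le_trans k3 (le_trans k4 _).
  by rewrite [de * _]mulrC mulrA.
Unshelve. all: by end_near. Qed.

(** The inclusion opposite to [box_upper], by Taylor's formula for the inverse [Psi] at [Phi q]: a
    strip of a fixed fraction of the size is pulled back into the box. *)
Lemma box_lower : \forall eps \near (0 : R)^'+,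
  forall z, strip u we (Phi q) (eps / 4) (de * eps * `|j| / `|u| / 4) z ->
    exists s t, [/\ `|s - s0| <= eps, `|t| <= de * eps & z = H s t].
Proof.
have quarter (x b m i : R) : 8 * (m * b) <= i -> x <= m / 4 * b -> x <= i / 32 by lra.
have half_u (x y i : R) : 0 <= i -> x <= i / 4 + 2 * y -> y <= i / 32 -> x <= i / 2 by lra.
have three2 (x y i : R) : 0 <= i -> x <= i / 2 -> y <= i / 32 -> x + y <= i by lra.
have small_K (k l d : R) : 0 <= l -> 5 * k + 16 * l <= d / 8 -> k <= d / 40 by lra.
have small_E (x i k d m : R) : x <= m / 2 -> i <= 2 * k -> k <= d / 40 -> d <= m -> 0 <= m -> x + i <= m by lra.
have trip (x i : R) : 0 <= i -> i <= 2 * x -> 4^-1 * i <= 2 * x by lra.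
have y_sum (b i x r l k d : R) : b <= d / 4 -> i <= 2 * k -> x <= 2 * k -> r <= l -> 5 * k + l <= d / 8 ->
  0 <= k -> 0 <= d -> b + i + x + r <= d / 2 by lra.
have slope2 (x y z i : R) : x <= y + z -> y <= z / 3 -> z <= i -> 0 <= i -> x <= 2 * i by lra.
have end_low (yd y y0 d : R) : yd - y0 <= - d + d / 3 -> y0 - d / 2 <= y -> 0 <= d -> yd <= y by lra.
have end_up (yd y y0 d : R) : d - d / 3 <= yd - y0 -> y <= y0 + d / 2 -> 0 <= d -> y <= yd by lra.
have [dPsi M0' C0' hM' hC'] := cPsi; have [dPhi _ _ _ _] := cPhi.
near=> eps.
have e0 : 0 < eps by near: eps; exact: nbhs_right_gt.
have h1 : 1 * eps <= rho - `|s0| by near: eps; apply: near_small; rewrite subr_gt0.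
pose K := C' * `|u| ^+ 2.
have h2 : (5 * K + 16 * L) * eps <= de / 8 by near: eps; apply: near_small; rewrite divr_gt0.
have he : `|s0| + eps <= rho by rewrite -lerBrDl -[eps]mul1r.
have /andP[_ d1] := hde.
have dee : de * eps <= eps by rewrite ler_piMl// ltW.
have der : de * eps <= rho by rewrite (le_trans dee)// (le_trans _ he)// lerDr.
have dep : 0 < de * eps by rewrite mulr_gt0.
have K0 : 0 <= K by rewrite mulr_ge0 ?exprn_ge0// ltW.
have eu0 : 0 <= eps * `|u| by rewrite mulr_ge0// ltW.
have nuw : cross u w != 0 by rewrite -normr_gt0; have /andP[k _] := cuw; rewrite (lt_le_trans jp).
have [_ hgap hYs _] := hbf.
move=> z [hz1 hz2]; move: (z : plane R) hz1 hz2 => {}z hz1 hz2.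
pose a := cross (z - Phi q) w / cross u w; pose b := cross u (z - Phi q) / cross u w.
have ez : z - Phi q = a *: u + b *: w by exact: cramer_div.
have hb : `|b| <= de * eps / 4.
  rewrite /b normrM normfV ler_pdivrMr ?normr_gt0// (le_trans hz2)//.
  have -> : de * eps * `|j| / `|u| / 4 * `|u| = de * eps / 4 * `|j| by field; exact: lt0r_neq0.
  by rewrite ler_wpM2l ?divr_ge0 ?(ltW dep)//; have /andP[] := cuw.
have bw : `|b| * `|w| <= eps * `|u| / 32.
  have k : `|b| * `|w| <= de * eps / 4 * `|w| by rewrite ler_wpM2r.
  apply: quarter k; rewrite (_ : 8 * _ = eps * (8 * (de * `|w|))); last by ring.
  by rewrite ler_pM2l.
have ha : `|a| <= eps / 2.
  have k1 : cross (z - Phi q) we = a * cross u we + b * cross w we.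
    by rewrite ez crossDl !crossZl.
  have k2 : `|a| * `|u| <= eps / 4 * `|u| + 2 * (`|b| * `|w|).
    have k3 : a * cross u we = cross (z - Phi q) we - b * cross w we by rewrite k1 addrK.
    rewrite -cwe -normrM k3 (le_trans (ler_normB _ _))// lerD//; first by rewrite cwe.
    rewrite normrM mulrCA ler_wpM2l// (le_trans (norm_cross _ _))// nwe mulr1//.
  have k4 : `|a| * `|u| <= eps / 2 * `|u|.
    by rewrite mulrAC; apply: half_u bw => //; rewrite [eps * _ / _]mulrAC.
  by rewrite ler_pM2r in k4.
clearbody a b.
have hzq : `|z - Phi q| <= eps * `|u|.
  rewrite ez (le_trans (ler_normD _ _))// !normrZ.
  by apply: three2 bw => //; rewrite mulrAC ler_wpM2r.
have DPsi x : D Psi (Phi q) (D Phi q x) = x.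
  have := D_comp (F := Psi) (G := Phi) (x := q) x (dPhi q) (dPsi _) => <-.
  have -> : Psi \o Phi = id by apply/funext => i /=.
  by rewrite D_id.
(* The remainder of [Psi], whose differential sends [u] and [w] back to [v] and [f2]. *)
pose E := Psi z - q - (a *: v + b *: f2).
have E_le : `|E| <= K * eps ^+ 2.
  have k := F_taylor cPsi (Phi q) z.
  have eD : D Psi (Phi q) (z - Phi q) = a *: v + b *: f2.
    by rewrite ez linearD !linearZ /=; congr (a *: _ + b *: _); exact: DPsi.
  rewrite PhiK eD in k.
  rewrite (le_trans k)//; have -> : K * eps ^+ 2 = C' * (eps * `|u|) ^+ 2 by rewrite /K; ring.
  by rewrite ler_pM2l// lerXn2r// nnegrE// mulr_ge0// ltW.
clearbody K.
pose s := cross (Psi z - p) f2 / cr; pose y := cross f1 (Psi z - p) / cr.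
have eP : Psi z = bpt e p s y by exact: box_coord.
have [E1 E2] := coord_le E.
have [c1 c2] := bpt_coord s0 (Y s0 0).
have crn : cr != 0 by rewrite gt_eqF//; have /andP[k _] := cr1; rewrite (lt_le_trans ltr01).
have dP : Psi z - p = (q - p) + a *: v + b *: f2 + E.
  by rewrite /E; apply: peq; rewrite !pE; ring.
have es : s - s0 = a + cross E f2 / cr.
  have cq : cross (q - p) f2 = s0 * cr by rewrite -[in RHS]c1 divfK.
  have gen x1 x2 : cross (x1 + a *: v + b *: f2 + x2) f2 = cross x1 f2 + a * cr + cross x2 f2.
    by rewrite !crossDl !crossZl crossvv box_tan_cross mulr0 addr0.
  rewrite /s dP gen cq; field.
  exact: crn.
have cf1v : cross f1 v = g s0 0 * cr by rewrite /v /box_tan crossDr crossZr crossvv add0r.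
have ey : y - Y s0 0 = a * g s0 0 + b + cross f1 E / cr.
  have cq : cross f1 (q - p) = Y s0 0 * cr by rewrite -[in RHS]c2 divfK.
  have gen x1 x2 : cross f1 (x1 + a *: v + b *: f2 + x2) =
      cross f1 x1 + a * (g s0 0 * cr) + b * cr + cross f1 x2.
    by rewrite !crossDr !crossZr cf1v.
  rewrite /y dP gen cq; field.
  exact: crn.
have Ke : K * eps ^+ 2 <= de * eps / 40.
  apply: (small_K _ (L * eps ^+ 2)); first by rewrite mulr_ge0 ?exprn_ge0// ltW.
  have -> : 5 * (K * eps ^+ 2) + 16 * (L * eps ^+ 2) = (5 * K + 16 * L) * eps * eps by ring.
  by rewrite [de * eps / 8]mulrAC; apply: ler_wpM2r h2; exact: ltW.
have hs : `|s - s0| <= eps.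
  rewrite es (le_trans (ler_normD _ _))//; apply: small_E ha _ Ke dee (ltW e0).
  by rewrite (le_trans E1)// ler_wpM2l.
have sr : `|s| <= rho := shift_le he hs.
have hy : `|y - Y s 0| <= de * eps / 2.
  have k1 : y - Y s 0 = b + cross f1 E / cr - g s0 0 * (cross E f2 / cr) - rem s.
    have k2 : y = Y s0 0 + (a * g s0 0 + b + cross f1 E / cr) by rewrite -ey addrC subrK.
    have k3 : cross E f2 / cr = s - s0 - a by rewrite es; ring.
    by rewrite k2 k3 /rem; ring.
  have k4 := rem_le e0 he hs.
  have [/(_ s0 0 s0r zr)[_ _ gl _] _ _ _] := hbf.
  have k5 : `|g s0 0 * (cross E f2 / cr)| <= 2 * (K * eps ^+ 2).
    rewrite normrM (le_trans (ler_wpM2r (normr_ge0 _) gl))//.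
    apply: (trip (K * eps ^+ 2)) => //; by rewrite (le_trans E1)// ler_wpM2l.
  have k6 := ler_normB (b + cross f1 E / cr - g s0 0 * (cross E f2 / cr)) (rem s).
  have k7 := ler_normB (b + cross f1 E / cr) (g s0 0 * (cross E f2 / cr)).
  have k8 := ler_normD b (cross f1 E / cr).
  have k9 := ler_wpM2r (ltW e0) h2; rewrite k1.
  have k10 : (5 * K + 16 * L) * eps * eps = 5 * (K * eps ^+ 2) + 16 * L * eps ^+ 2 by ring.
  have k11 := le_trans E2 (ler_wpM2l (ler0n R 2) E_le).
  have k12 : 5 * (K * eps ^+ 2) + 16 * L * eps ^+ 2 <= de * eps / 8 by rewrite -k10 (le_trans k9)// mulrAC.
  apply: (le_trans k6); apply: (le_trans (lerD (le_trans k7 (lerD k8 (lexx _))) (lexx _))).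
  have k13 : 0 <= K * eps ^+ 2 by rewrite mulr_ge0// exprn_ge0// ltW.
  exact: y_sum hb k11 k5 k4 k12 k13 (ltW dep).
(* The values of [Y s] at heights [- (de * eps)] and [de * eps] are at least [2/3 * de * eps] away
   from [Y s 0], on either side, and [y] is within half of [de * eps]; the clamp only serves to have
   continuity on the whole line. *)
have [t ht et] : exists2 t, - (de * eps) <= t <= de * eps & Y s t = y.
  pose Yc t := Y s (cl rho t).
  have Yr t : `|t| <= de * eps -> Yc t = Y s t by move=> ht; rewrite /Yc cl_id// (le_trans ht).
  have cY : continuous Yc.
    apply: (@lip_continuous _ _ 2) => t t'.
    have i1 : `|cl rho t| <= rho by exact: cl_in (ltW rho0).
    have i2 : `|cl rho t'| <= rho by exact: cl_in (ltW rho0).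
    have k1 := hgap s _ _ sr i1 i2; have k2 := cl_lip t t' (ltW rho0).
    have k3 := ler_normD (Yc t - Yc t' - (cl rho t - cl rho t')) (cl rho t - cl rho t'); rewrite subrK in k3.
    exact: slope2 k3 k1 k2 (normr_ge0 _).
  have n0 : `|de * eps| <= de * eps by rewrite ger0_norm// ltW.
  have n0' : `|- (de * eps)| <= de * eps by rewrite normrN.
  have le2 : - (de * eps) <= de * eps by rewrite (le_trans (ler_norm _)).
  have k1 := hgap s (de * eps) 0 sr (le_trans n0 der) zr.
  have k2 := hgap s (- (de * eps)) 0 sr (le_trans n0' der) zr.
  rewrite !subr0 ?normrN (gtr0_norm dep) in k1 k2.
  move: k1 k2 hy; rewrite !ler_distl => /andP[k1 k1'] /andP[k2 k2'] /andP[k3 k3'].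
  have [|t ht et] := IVT le2 (continuous_subspaceT cY) (_ : Num.min (Yc (- (de * eps))) (Yc (de * eps)) <= y <= Num.max (Yc (- (de * eps))) (Yc (de * eps))).
    rewrite !Yr// ge_min le_max; apply/andP; split; apply/orP; [left|right].
      exact: end_low k2' k3 (ltW dep).
    exact: end_up k1 k3' (ltW dep).
  exists t; first by move: ht; rewrite in_itv.
  by rewrite -et Yr// ler_norml -[_ && _]/(_ <= t <= _); move: ht; rewrite in_itv.
exists s, t; split => //; first by rewrite ler_norml.
by rewrite /H /box_pt et -eP PsiK.
Unshelve. all: by end_near. Qed.

End LocalBox.

(** * Growth along unstable plaques *)

Section UnstableComparison.
Variable R : realType.

Lemma is_derive_comb (f g : R -> R) (a df dg i k c : R) : is_derive a 1 f df -> is_derive a 1 g dg ->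
  is_derive a 1 (fun b => i * f b + k * g b + c) (i * df + k * dg).
Proof.
move=> d1 d2.
have d3 := is_deriveD (is_deriveD (is_deriveZ i d1) (is_deriveZ k d2)) (is_derive_cst c a 1).
by rewrite addr0 in d3; exact: d3.
Qed.

Lemma half_error_upper (a b u d : R) : 0 <= u -> 0 <= d ->
  a <= u / 2 * d -> b <= a + d * u -> b <= 2 * u * d.
Proof. by move=> u0 d0; have := mulr_ge0 u0 d0; lra. Qed.

Lemma half_error_lower (a b u e : R) : a <= u / 2 * (2 * e) -> 2 * e * u <= b + a -> e * u <= b.
Proof. lra. Qed.

Implicit Types (u v w x y z p : plane R) (s t : R).
Variables (F G : plane R -> plane R) (M C M' C' j : R).
Hypothesis cF : C11 F M C.
Hypothesis cG : C11 G M' C'.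
Hypothesis FK : cancel F G.
Hypothesis GK : cancel G F.
Hypothesis j0 : j != 0.
Hypothesis hj : forall x u v, cross (D F x u) (D F x v) = j * cross u v.
Variables (eu es : plane R -> plane R) (K th k0 L rho : R).
Hypothesis hfr : hyperbolic_frame F G eu es K th k0.
Hypothesis L0 : 0 < L.
Hypothesis rho0 : 0 < rho.

Let dF : forall x, differentiable F x. Proof. by case: cF. Qed.
Let dG : forall x, differentiable G x. Proof. by case: cG. Qed.
Let K0 : 0 < K. Proof. by case: hfr => -[h _ _] _ _ _ _; rewrite (lt_le_trans ltr01). Qed.
Let neu x : `|eu x| = 1. Proof. by case: hfr => _ /(_ x)[]. Qed.

(** Pasts under the bijective lift are unique and given by [G], and the two norms are equivalent. *)
Lemma unstable_leafP x y : unstable_leaf F x y <->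
  (fun n => `|iter n G x - iter n G y|) @ \oo --> (0 : R).
Proof.
have pastG z : past_orbit F z (fun n => iter n G z) by split => // n /=; rewrite GK.
split.
  move=> [xs [ys [hx hy h]]].
  have ex : xs = fun n => iter n G x.
    by apply/funext; elim => [|n IH] /=; [exact: hx.1|rewrite -IH -(hx.2 n) FK].
  have ey : ys = fun n => iter n G y.
    by apply/funext; elim => [|n IH] /=; [exact: hy.1|rewrite -IH -(hy.2 n) FK].
  rewrite ex ey in h; apply: (squeeze_cvgr _ (cvg_cst 0) h); apply: nearW => n.
  by rewrite normr_ge0 enorm_ge.
move=> h; exists (fun n => iter n G x), (fun n => iter n G y); split => //.
have h2 : (fun n => 2 * `|iter n G x - iter n G y|) @ \oo --> (0 : R).
  by rewrite -(mulr0 2); apply: cvgM => //; exact: cvg_cst.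
apply: (squeeze_cvgr _ (cvg_cst 0) h2); apply: nearW => n.
by rewrite enorm_le (le_trans (normr_ge0 _) (enorm_ge _)).
Qed.

Lemma unstable_leaf_trans x y z : unstable_leaf F x y -> unstable_leaf F y z -> unstable_leaf F x z.
Proof.
move=> /unstable_leafP h1 /unstable_leafP h2; apply/unstable_leafP.
have h3 : (fun n => `|iter n G x - iter n G y| + `|iter n G y - iter n G z|) @ \oo --> (0 : R).
  by rewrite -(addr0 0); apply: cvgD.
apply: (squeeze_cvgr _ (cvg_cst 0) h3); apply: nearW => n.
by rewrite normr_ge0 /= ler_distD.
Qed.

Section Box.
Variables (p : plane R) (Y g : R -> R -> R).
Hypothesis hbf : box_frame eu L rho p Y g.

Local Notation bp s t := (box_pt eu p Y s t).
Local Notation bt s t := (box_tan eu p g s t).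

Lemma box_tan_parallel s t : `|s| <= rho -> `|t| <= rho ->
  exists2 c, bt s t = c *: eu (bp s t) & `|c| = `|bt s t|.
Proof.
move=> hs ht; apply: cross0_parallel; last exact: neu.
have [/(_ s t hs ht)[_ _ _ h] _ _ _] := hbf.
by rewrite crossC h oppr0.
Qed.

Lemma box_tan_bounds s t : `|s| <= rho -> `|t| <= rho -> 2^-1 <= `|bt s t| <= 2.
Proof.
move=> hs ht; rewrite (box_tan_le neu hbf)// andbT.
have [/(_ s t hs ht)[_ _ h _] _ _ _] := hbf.
have := ler_normB (bt s t) (g s t *: rot90 (eu p)).
rewrite /box_tan addrK normrZ pnorm_rot90 !neu; lra.
Qed.

Lemma box_backward m s s' t : `|s| <= rho -> `|s'| <= rho -> `|t| <= rho ->
  `|iter m G (bp s t) - iter m G (bp s' t)| <= 2 * K * th ^+ m * `|s - s'|.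
Proof.
move=> hs hs' ht; have [[_ /andP[t0 _] _] _ _ hG _] := hfr.
have main r r' : `|r| <= rho -> `|r'| <= rho -> r <= r' ->
    `|iter m G (bp r' t) - iter m G (bp r t)| <= 2 * K * th ^+ m * (r' - r).
  rewrite !ler_norml => /andP[a1 a2] /andP[a3 a4] rr'.
  have inn a : r <= a <= r' -> `|a| <= rho.
    by move=> /andP[b1 b2]; rewrite ler_norml (le_trans a1)// (le_trans b2).
  apply: (@mvt_curve_le _ (fun a => iter m G (bp a t)) (fun a => D (iter m G) (bp a t) (bt a t))) => //.
    move=> a ha; apply: (is_derive_comp2 (differentiable_iter m dG _)).
    exact: (box_pt_derive hbf (inn _ ha) ht).
  move=> a ha; have [c ec nc] := box_tan_parallel (inn _ ha) ht.
  rewrite ec linearZ normrZ nc -mulrA; have /andP[_ b2] := box_tan_bounds (inn _ ha) ht.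
  by apply: ler_pM => //; exact: hG.
have [ss|/ltW ss] := leP s' s.
  by rewrite (ger0_norm (_ : 0 <= s - s')) ?subr_ge0// main.
by rewrite distrC [`|s - s'|]distrC (ger0_norm (_ : 0 <= s' - s)) ?subr_ge0// main.
Qed.

(** Backward iteration first undoes [iter n F], then contracts the plaque by [box_backward]. *)
Lemma box_leaf n s s' t : `|s| <= rho -> `|s'| <= rho -> `|t| <= rho ->
  unstable_leaf F (iter n F (bp s t)) (iter n F (bp s' t)).
Proof.
move=> hs hs' ht; apply/unstable_leafP; apply/cvgrPdist_lt => e e0.
have [[_ /andP[t0 t1] _] _ _ _ _] := hfr.
have [m hm] := geometric_small (2 * K * (`|s - s'| + 1)) t0 t1 e0.
near=> k; rewrite sub0r normrN normr_id.
have km : (n + m <= k)%N by near: k; exact: nbhs_infty_ge.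
have -> : k = ((k - n) + n)%N by rewrite subnK// (leq_trans (leq_addr _ _) km).
have mk : (m <= k - n)%N by rewrite leq_subRL ?(leq_trans (leq_addr _ _) km).
move: (k - n)%N mk => i mi.
rewrite !iterD !(iter_cancelK n FK) (le_lt_trans (box_backward i hs hs' ht))//.
apply: le_lt_trans hm; rewrite -[leRHS]mulrA [(`|s - s'| + 1) * _]mulrC mulrA.
rewrite ler_pM ?mulr_ge0 ?exprn_ge0 ?(ltW t0) ?(ltW K0)// ?lerDl//.
by rewrite ler_pM2l ?mulr_gt0// ler_wiXn2l// ltW.
Unshelve. all: by end_near. Qed.

End Box.

Hypothesis hUBD : UBD (unstable_leaf F).

Let crr p : cross (eu p) (rot90 (eu p)) != 0.
Proof. by have /andP[h _] := cross_frame neu p; rewrite gt_eqF// (lt_le_trans ltr01). Qed.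

(* Boxes around two points of a plaque, so thin that the n-th iterate is nearly
   linear on them, have images of comparable areas; bounded densities then force
   their unstable lengths to be comparable, whatever n is. *)
Lemma plaque_growth : exists2 ka : R, 0 < ka & forall n p (Y g : R -> R -> R),
  box_frame eu L rho p Y g -> forall s1 s2, `|s1| < rho -> `|s2| < rho ->
  `|D (iter n F) (box_pt eu p Y s2 0) (box_tan eu p g s2 0)| <=
    ka * `|D (iter n F) (box_pt eu p Y s1 0) (box_tan eu p g s1 0)|.
Proof.
have [Cb [Cb1 hU]] := hUBD.
(* 5120 is [8 * 160 * 4]: 8 comes from [4 * M * eps / m0], 160 from the area of the outer strip
   around the second image, 4 from that of the inner strip in the first. *)
have [N [Np NE]] : exists N : R, 0 < N /\ N = 8 * (8 * (8 * 10)) by eexists; split; last reflexivity; rewrite !mulr_gt0.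
exists (N * Cb ^+ 2); first by rewrite mulr_gt0// exprn_gt0// (lt_trans ltr01).
move=> n p Y g hbf s1 s2 hs1 hs2.
have [Mn [Cn cFn]] := C11_iter n cF; have [Mn' [Cn' cGn]] := C11_iter n cG.
have [dFn Mn0 _ _ _] := cFn; have [dGn Mn0' _ _ _] := cGn.
have jn0 : j ^+ n != 0 by rewrite expf_neq0.
have hjn x u v : cross (D (iter n F) x u) (D (iter n F) x v) = j ^+ n * cross u v by exact: D_iter_cross.
have FnK := iter_cancelK n FK; have GnK := iter_cancelK n GK.
pose bp := box_pt eu p Y; pose bt := box_tan eu p g.
pose H s t := iter n F (bp s t).
(* Reads the coordinate [s] of a point of the image box from its preimage; it is differentiable
   along every differentiable curve. *)
pose S z := cross (iter n G z - p) (rot90 (eu p)) / cross (eu p) (rot90 (eu p)).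
pose La := 2 * Mn + 4 * Mn'.
have La0 : 0 < La by rewrite addr_gt0// mulr_gt0.
have leafH s s' t : `|s| <= rho -> `|s'| <= rho -> `|t| <= rho -> unstable_leaf F (H s t) (H s' t).
  exact: (box_leaf hbf).
have Hlip s t s' t' : `|s| <= rho -> `|t| <= rho -> `|s'| <= rho -> `|t'| <= rho ->
    `|H s t - H s' t'| <= La * (`|s - s'| + `|t - t'|).
  move=> h1 h2 h3 h4; rewrite (le_trans (F_lip cFn (bp s' t') (bp s t)))//.
  have k := box_pt_lip neu hbf h1 h2 h3 h4.
  have n0 : 0 <= `|s - s'| + `|t - t'| by rewrite addr_ge0.
  rewrite (le_trans (ler_wpM2l (ltW Mn0) k))// mulrCA mulrA ler_wpM2r// lerDl.
  by rewrite mulr_ge0// ltW.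
have Hexp s t s' t' : `|s| <= rho -> `|t| <= rho -> `|s'| <= rho -> `|t'| <= rho ->
    `|s - s'| <= La * `|H s t - H s' t'| /\ `|t - t'| <= La * `|H s t - H s' t'|.
  move=> h1 h2 h3 h4; have [k1 k2] := box_pt_exp neu hbf h1 h2 h3 h4.
  have k3 := F_lip cGn (H s' t') (H s t); rewrite !FnK in k3.
  have k4 : 4 * `|bp s t - bp s' t'| <= La * `|H s t - H s' t'|.
    rewrite (le_trans (ler_wpM2l (ler0n R 4) k3))// mulrA ler_wpM2r// lerDr.
    by rewrite mulr_ge0// ltW.
  by split; [exact: le_trans k1 k4|exact: le_trans k2 k4].
have Sder (gam : R -> plane R) (a : R) v : is_derive a 1 gam v ->
    exists w : R, is_derive a 1 (fun b : R => S (gam b)) w.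
  move=> dg; have dc := is_derive_comp2 (dGn (gam a)) dg.
  have d1 := is_derive_fst dc; have d2 := is_derive_snd dc.
  set f2 := rot90 (eu p) in S *; set cr := cross _ _ in S *.
  have Sz z : S z = (f2.2 / cr) * (iter n G z).1 + (- (f2.1 : R) / cr) * (iter n G z).2 + - cross p f2 / cr.
    by rewrite /S; move: (iter n G z) => z'; rewrite /cross !pE; ring.
  eexists; rewrite (_ : (fun b : R => S (gam b)) = (fun b : R => (f2.2 / cr) * (iter n G (gam b)).1 +
    (- (f2.1 : R) / cr) * (iter n G (gam b)).2 + - cross p f2 / cr)); last by apply/funext => b.
  exact: (is_derive_comb _ _ _ d1 d2).
have SH s t : `|s| <= rho -> `|t| <= rho -> S (H s t) = s.
  by move=> _ _; rewrite /S FnK; have [] := bpt_coord p neu s (Y s t).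
have [m [hdis hae]] := hU _ (hbox_foliated rho0 La0 leafH Hlip Hexp).
have cmp := ubd_box_compare rho0 La0 unstable_leaf_trans leafH Hlip Hexp Sder SH Cb1 hdis hae.
set u2 := D _ _ (box_tan eu p g s2 0); set u1 := D _ _ (box_tan eu p g s1 0).
pose w2 := D (iter n F) (bp s2 0) (rot90 (eu p)); pose w1 := D (iter n F) (bp s1 0) (rot90 (eu p)).
have jp : 0 < `|j ^+ n| by rewrite normr_gt0.
have ugt s : 0 < `|D (iter n F) (bp s 0) (bt s 0)|.
  rewrite normr_gt0; apply/eqP => uz; have := hjn (bp s 0) (bt s 0) (rot90 (eu p)).
  rewrite uz cross0l => /esym/eqP; rewrite mulf_eq0 (negbTE jn0) /=.
  by rewrite /bt box_tan_cross (negbTE (crr p)).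
have u10 : 0 < `|u1| by exact: ugt.
have u20 : 0 < `|u2| by exact: ugt.
have [we1 [nw1 cw1 st1]] := area_strip (ltac:(by rewrite -normr_gt0) : u1 != 0).
have [we2 [nw2 cw2 st2]] := area_strip (ltac:(by rewrite -normr_gt0) : u2 != 0).
(* A single ratio of height to length serves both boxes, so that their images have areas of the same
   order. *)
have [de [de01 hd1 hd2]] : exists de, [/\ 0 < de <= 1, 8 * (de * `|w1|) <= `|u1| & 8 * (de * `|w2|) <= `|u2|].
  near (0 : R)^'+ => de.
  have d1 : 0 < de by near: de; exact: nbhs_right_gt.
  have d2 : 1 * de <= 1 by near: de; exact: near_small.
  have d3 : 8 * `|w1| * de <= `|u1| by near: de; exact: near_small.
  have d4 : 8 * `|w2| * de <= `|u2| by near: de; exact: near_small.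
  by exists de; split; [rewrite d1 -[de]mul1r|rewrite [de * _]mulrC mulrA|rewrite [de * _]mulrC mulrA].
have de0 : 0 < de by case/andP: de01.
have near1 := box_window cFn jn0 hjn neu L0 hbf hs1 de01.
have near2 := box_window cFn jn0 hjn neu L0 hbf hs2 de01.
have near3 := box_lower cFn cGn jn0 hjn FnK GnK neu L0 hbf hs1 de01 hd1 nw1 cw1.
have near4 := box_upper cFn jn0 hjn neu L0 hbf hs2 de01 hd2 nw2.
near (0 : R)^'+ => eps.
have [e0 r1 dr win1] : [/\ 0 < eps, `|s1| + eps <= rho, de * eps <= rho &
  forall s s' t, `|s - s1| <= eps -> `|s' - s1| <= eps -> `|t| <= de * eps ->
    `|H s t - H s' t - (s - s') *: u1| <= `|u1| / 2 * `|s - s'|] by near: eps; exact: near1.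
have [_ r2 _ win2] : [/\ 0 < eps, `|s2| + eps <= rho, de * eps <= rho &
  forall s s' t, `|s - s2| <= eps -> `|s' - s2| <= eps -> `|t| <= de * eps ->
    `|H s t - H s' t - (s - s') *: u2| <= `|u2| / 2 * `|s - s'|] by near: eps; exact: near2.
have X1in : forall z, strip u1 we1 (H s1 0) (eps / 4) (de * eps * `|j ^+ n| / `|u1| / 4) z ->
    exists s t, [/\ `|s - s1| <= eps, `|t| <= de * eps & z = H s t] by near: eps; exact: near3.
have X2in : forall s t, `|s - s2| <= eps -> `|t| <= de * eps ->
    strip u2 we2 (H s2 0) (8 * eps) (5 * de * eps * `|j ^+ n| / `|u2|) (H s t) by near: eps; exact: near4.
have dej : 0 < de * eps * `|j ^+ n| by rewrite !mulr_gt0.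
have a1 : 0 <= eps / 4 by rewrite divr_ge0// ltW.
have b1 : 0 <= de * eps * `|j ^+ n| / `|u1| / 4 by rewrite !divr_ge0// ltW.
have a2 : 0 <= 8 * eps by rewrite mulr_ge0// ltW.
have b2 : 0 <= 5 * de * eps * `|j ^+ n| / `|u2| by rewrite divr_ge0// -!mulrA mulr_ge0// mulrA ltW.
have [m1 ar1] := st1 (H s1 0) _ _ a1 b1; have [m2 ar2] := st2 (H s2 0) _ _ a2 b2.
have M0 : 0 < 2 * `|u1| by rewrite mulr_gt0.
have m00 : 0 < eps * `|u2| by rewrite mulr_gt0.
have hM s s' t : `|s - s1| <= eps -> `|s' - s1| <= eps -> `|t| <= de * eps ->
    `|H s t - H s' t| <= 2 * `|u1| * `|s - s'|.
  move=> i1 i2 i3; have k := win1 s s' t i1 i2 i3.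
  have := ler_normD (H s t - H s' t - (s - s') *: u1) ((s - s') *: u1); rewrite subrK normrZ.
  by apply: half_error_upper (normr_ge0 _) (normr_ge0 _) k.
have hm t : `|t| <= de * eps -> eps * `|u2| <= `|H (s2 + eps) t - H (s2 - eps) t|.
  move=> i3; have eps0 := ltW e0.
  have i1 : `|s2 + eps - s2| <= eps by rewrite addrC addKr ger0_norm.
  have i2 : `|s2 - eps - s2| <= eps by rewrite addrC addKr normrN ger0_norm.
  have k := win2 _ _ t i1 i2 i3.
  have ee : s2 + eps - (s2 - eps) = 2 * eps by ring.
  rewrite ee in k.
  have := ler_normB (H (s2 + eps) t - H (s2 - eps) t) (H (s2 + eps) t - H (s2 - eps) t - (2 * eps) *: u2).
  rewrite opprB addrCA subrr addr0 normrZ.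
  by move: k; rewrite (ger0_norm (_ : 0 <= 2 * eps)) ?mulr_ge0//; exact: half_error_lower.
have := cmp s1 s2 eps (de * eps) _ _ _ _ e0 r1 r2 dr M0 m00 m1 m2 X1in X2in hM hm.
(* Both areas are multiples of [de * eps ^ 2 * |j ^ n|]; once this is cancelled only the ratio of
   [|u2|] to [|u1|] is left. *)
rewrite ar1 ar2 -EFinM lee_fin.
have e1 : 4 * (eps / 4) * (de * eps * `|j ^+ n| / `|u1| / 4) * `|u1| = (de * eps * `|j ^+ n| * eps) / 4.
  by field; exact: lt0r_neq0.
have e2 : Cb ^+ 2 * (4 * (2 * `|u1|) * eps / (eps * `|u2|)) * (4 * (8 * eps) * (5 * de * eps * `|j ^+ n| / `|u2|) * `|u2|)
   = (de * eps * `|j ^+ n| * eps) / 4 * (N * Cb ^+ 2 * `|u1| / `|u2|).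
  by rewrite NE; field; rewrite !lt0r_neq0.
rewrite e1 e2 ler_pMr ?divr_gt0 ?mulr_gt0//.
by rewrite ler_pdivlMr// mul1r.
Unshelve. all: by end_near. Qed.

End UnstableComparison.

(** * Uniform growth along the unstable direction *)

Section UniformGrowth.
Variable R : realType.
Implicit Types (u v w x y z p q : plane R) (s t : R).

Lemma direction_near (e e' : plane R) : `|e| = 1 -> `|e'| = 1 ->
  exists c d, [/\ e = c *: e' + d *: rot90 e', `|d| <= `|cross e e'|, `|c| <= 1 + `|d| & 1 - `|d| <= `|c|].
Proof.
move=> n1 n2; have h := cross_rot90 e'; rewrite n2 expr1n in h.
have c0 : 0 < cross e' (rot90 e') by rewrite (lt_le_trans ltr01).
have := cramer_div e (lt0r_neq0 c0).
set c := _ / _; set d := _ / _ => ee.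
have nr : `|rot90 e'| = 1 by rewrite pnorm_rot90.
exists c, d; split => //.
- by rewrite normrM normfV (gtr0_norm c0) ler_pdivrMr// crossC normrN ler_peMr.
- have := ler_normB e (d *: rot90 e'); rewrite {1}ee addrK !normrZ n1 n2 nr; lra.
- have := ler_normD (c *: e') (d *: rot90 e'); rewrite -ee !normrZ n1 n2 nr; lra.
Qed.

Variables (F G : plane R -> plane R) (M C M' C' j : R).
Hypothesis cF : C11 F M C.
Hypothesis cG : C11 G M' C'.
Hypothesis FK : cancel F G.
Hypothesis GK : cancel G F.
Variables (eu es : plane R -> plane R) (K th k0 Lu Ls : R).
Hypothesis hfr : hyperbolic_frame F G eu es K th k0.
Hypothesis Lu0 : 0 < Lu.
Hypothesis Ls0 : 0 < Ls.
Hypothesis hLu : forall x y, `|cross (eu x) (eu y)| <= Lu * `|x - y|.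

Let dF : forall x, differentiable F x. Proof. by case: cF. Qed.
Let dG : forall x, differentiable G x. Proof. by case: cG. Qed.
Let K1 : 1 <= K. Proof. by case: hfr => -[]. Qed.
Let K0 : 0 < K. Proof. exact: lt_le_trans ltr01 K1. Qed.
Let th0 : 0 < th. Proof. by case: hfr => -[_ /andP[]]. Qed.
Let th1 : th < 1. Proof. by case: hfr => -[_ /andP[]]. Qed.
Let k00 : 0 < k0. Proof. by case: hfr => -[]. Qed.
Let neu x : `|eu x| = 1. Proof. by case: hfr => _ /(_ x)[]. Qed.
Let nes x : `|es x| = 1. Proof. by case: hfr => _ /(_ x)[]. Qed.
Let kus x : k0 <= `|cross (eu x) (es x)|. Proof. by case: hfr => _ /(_ x)[]. Qed.

Definition ugrowth (n : nat) (x : plane R) : R := `|D (iter n F) x (eu x)|.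
Local Notation U := ugrowth.

Lemma ugrowth_ge0 n x : 0 <= U n x. Proof. exact: normr_ge0. Qed.

Lemma ugrowthS n x : U n.+1 x = U n x * U 1 (iter n F x).
Proof.
rewrite /ugrowth D_iterS//.
have [c -> nc] := cross0_parallel (frame_u dF dG FK GK hfr n x) (neu _).
by rewrite linearZ !normrZ neu mulr1.
Qed.

Lemma ugrowth1_ge z : 1 <= M' * U 1 z.
Proof.
have [_ _ _ hm _] := cG.
by have := hm (F z) (D F z (eu z)); rewrite (D_iterK 1 z (eu z) FK dF dG) neu.
Qed.

(** Both [D F] and the line of [eu] are Lipschitz; the lower bound of [ugrowth1_ge] turns the
    additive error into a multiplicative one. *)
Lemma ugrowth1_lip : exists2 b, 0 < b & forall z w, U 1 z <= (1 + b * `|z - w|) * U 1 w.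
Proof.
have [_ M0 C0 hm hc] := cF; have [_ M0' _ _ _] := cG.
exists (Lu + (M * Lu + C) * M').
  by rewrite addr_gt0// mulr_gt0// addr_gt0// mulr_gt0.
move=> z w; rewrite /ugrowth.
have [c [d [e1 hd hcc _]]] := direction_near (neu z) (neu w).
have h1 : `|D F z (eu z)| <= `|D F w (eu z)| + C * `|z - w|.
  have := hc z w (eu z); rewrite neu mulr1.
  have := ler_normD (D F z (eu z) - D F w (eu z)) (D F w (eu z)); rewrite subrK; lra.
have h2 : `|D F w (eu z)| <= (1 + Lu * `|z - w|) * U 1 w + M * (Lu * `|z - w|).
  have d1 : `|d| <= Lu * `|z - w| by exact: le_trans hd (hLu _ _).
  rewrite e1 linearD !linearZ (le_trans (ler_normD _ _))// !normrZ lerD//.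
    by rewrite ler_wpM2r// (le_trans hcc)// lerD2l.
  by rewrite mulrC ler_pM// (le_trans (hm _ _))// pnorm_rot90 neu mulr1.
have h3 := ugrowth1_ge w; rewrite /ugrowth /= in h2 h3 *.
have n0 : 0 <= (M * Lu + C) * `|z - w| by rewrite mulr_ge0// addr_ge0// ?mulr_ge0// ltW.
have := ler_wpM2l n0 h3; move: (`|D F w (eu w)|) h2 => a h2; move: h1 h2.
move: (`|z - w|) => l; move: `|D F w _| => a'; move: `|_| => a''.
lra.
Qed.

(** Orbits of two points of a stable plaque approach each other like [th ^ i], so the ratio of the
    growths is at most the product of the factors [1 + a * th ^ i], bounded by the exponential of a
    geometric series. *)
Lemma stable_plaque_growth (L' rho : R) : 0 < rho -> exists2 k, 0 < k & forall n p (Y g : R -> R -> R),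
  box_frame es L' rho p Y g -> forall s1 s2, `|s1| <= rho -> `|s2| <= rho ->
  U n (box_pt es p Y s1 0) <= k * U n (box_pt es p Y s2 0).
Proof.
move=> rho0; have [b b0 hb] := ugrowth1_lip.
pose a := b * (2 * K * (2 * rho)).
have a0 : 0 < a by rewrite /a !mulr_gt0.
have th1' : 0 < 1 - th by rewrite subr_gt0.
exists (expR (a / (1 - th))) => [|n p Y g hbf s1 s2 h1 h2]; first exact: expR_gt0.
set x := box_pt _ _ _ _ _; set y := box_pt _ _ _ _ _.
have rr : `|0 : R| <= rho by rewrite normr0 ltW.
have hd i : b * `|iter i F x - iter i F y| <= a * th ^+ i.
  have k := box_backward cF (frame_sym hfr) hbf i h1 h2 rr.
  have k2 : `|s1 - s2| <= 2 * rho by have := ler_normB s1 s2; lra.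
  rewrite /a -!mulrA ler_pM2l// (le_trans k)// -!mulrA ler_pM2l// ler_pM2l//.
  by rewrite mulrA [leLHS]mulrC ler_wpM2r// exprn_ge0// ltW.
suff main : U n x <= expR (a * ((1 - th ^+ n) / (1 - th))) * U n y.
  rewrite (le_trans main)// ler_wpM2r ?ugrowth_ge0// ler_expR ler_pM2l//.
  by rewrite ler_pdivrMr// mulVf ?lt0r_neq0// gerBl exprn_ge0// ltW.
elim: n => [|n IH].
  by rewrite expr0 subrr mul0r mulr0 expR0 mul1r /ugrowth !D_iter0 !neu.
rewrite (ugrowthS n x) (ugrowthS n y).
have -> : a * ((1 - th ^+ n.+1) / (1 - th)) = a * ((1 - th ^+ n) / (1 - th)) + a * th ^+ n.
  by rewrite exprS; field; exact: lt0r_neq0.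
rewrite expRD mulrACA ler_pM ?ugrowth_ge0//.
rewrite (le_trans (hb _ (iter n F y)))// ler_wpM2r ?ugrowth_ge0//.
by rewrite (le_trans _ (expR_ge1Dx _))// lerD2l.
Qed.

Lemma box_frame_flat (e : plane R -> plane R) (L rho : R) p (Y g : R -> R -> R) s : (forall x, `|e x| = 1) -> 0 < L -> 0 < rho ->
  box_frame e L rho p Y g -> `|s| <= rho -> `|Y s 0| <= 16 * L * s ^+ 2.
Proof.
move=> ne L0 rho0 [h1 _ _ h4] hs.
have rr : `|0 : R| <= rho by rewrite normr0 ltW.
have g0 : g 0 0 = 0.
  have [Y0 _ _] := h1 0 0 rr rr.
  rewrite Y0 /bpt !scale0r !addr0 crossDr crossvv add0r crossZr => /eqP.
  have /andP[h _] := cross_frame ne p.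
  by rewrite mulf_eq0 => /orP[/eqP//|]; rewrite gt_eqF// (lt_le_trans ltr01).
have hg r : `|r| <= rho -> `|g r 0| <= 16 * L * `|r|.
  by move=> hr; have := h4 r 0 0 0 hr rr rr rr; rewrite g0 !subr0 normr0 addr0.
have Y0 : Y 0 0 = 0 by have [] := h1 0 0 rr rr.
have inn r : - `|s| <= r <= `|s| -> `|r| <= `|s| by rewrite ler_norml.
have hmv := @mvt_abs _ (fun r => Y r 0) (fun r => g r 0) (- `|s|) `|s| (16 * L * `|s|) _ _ 0 s.
have sq : `|s| * `|s| = s ^+ 2 by rewrite -expr2 real_normK ?num_real.
rewrite -sq mulrA; move: hmv; rewrite Y0 !subr0; apply.
- by move=> r /inn hr; have [] := h1 r 0 (le_trans hr hs) rr.
- by move=> r /inn hr; rewrite (le_trans (hg r (le_trans hr hs)))// ler_pM2l// mulr_gt0.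
- by rewrite oppr_le0 normr_ge0.
- by rewrite -ler_norml.
Qed.

(** Local product structure with a uniform radius: seen from the unstable plaque of [x], the stable
    plaque of [y] is nearly a straight transverse line through a point close to 0, so it must
    cross. *)
Lemma plaques_meet (rhou rhos : R) : 0 < rhou -> 0 < rhos -> exists2 de : R, 0 < de & forall x y Yu gu Ys gs,
  box_frame eu Lu rhou x Yu gu -> box_frame es Ls rhos y Ys gs -> `|x - y| <= de ->
  exists s t, [/\ `|s| < rhou, `|t| < rhos & box_pt eu x Yu s 0 = box_pt es y Ys t 0].
Proof.
move=> ru0 rs0; pose W := 16 * (Lu + Ls).
have W0 : 0 < W by rewrite mulr_gt0// addr_gt0.
(* [r] makes the quadratic bending of both plaques, of order [W * r ^ 2], a small fraction of
   [k0 * r]; then [de] is chosen small against [k0 * r]. *)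
have [r [r0 rs ru rW]] : exists r : R, [/\ 0 < r, 2 * r <= rhos, 8 * r <= rhou & 8 * (8 * W) * r <= k0 / 16].
  near (0 : R)^'+ => r.
  have i1 : 0 < r by near: r; exact: nbhs_right_gt.
  have i2 : 2 * r <= rhos by near: r; exact: near_small.
  have i3 : 8 * r <= rhou by near: r; exact: near_small.
  have i4 : 8 * (8 * W) * r <= k0 / 16 by near: r; apply: near_small; exact: divr_gt0.
  by exists r.
have [de [d0 dr du dk]] : exists de : R, [/\ 0 < de, 1 * de <= r, 8 * Lu * de <= k0 /\ 8 * Lu * de <= 1 & 32 * de <= k0 * r].
  near (0 : R)^'+ => a.
  have i1 : 0 < a by near: a; exact: nbhs_right_gt.
  have i2 : 1 * a <= r by near: a; exact: near_small.
  have i3 : 8 * Lu * a <= k0 by near: a; exact: near_small.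
  have i4 : 8 * Lu * a <= 1 by near: a; exact: near_small.
  have i5 : 32 * a <= k0 * r by near: a; apply: near_small; exact: mulr_gt0.
  by exists a.
have rs1 : r <= rhos by move: rs r0; lra.
have ru6 : 6 * r < rhou by move: ru r0; lra.
have rs2 : r < rhos by move: rs r0; lra.
have psi_arith (t b a bb c Y : R) : b <= 2 * t -> Y <= c / 4 -> c <= a -> a <= 2 * b -> bb <= 2 * b ->
  bb + Y <= 5 * t by lra.
have ka_arith (k d n c : R) : 0 < k -> k * (1 - d) - 2 * d <= n -> 8 * d <= 1 -> 8 * d <= k -> 
  k * (8 * d) <= k * 1 -> k * c <= k * 2 -> k / 4 * c <= n by lra.
have near_arith (b c t y : R) : b <= t + y -> y <= t / 4 -> c <= r -> t <= r -> c + b <= 3 * r.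
  by move: r0; lra.
have est_arith (Y T c d w : R) : c <= 2 * d -> Y <= W * (6 ^+ 2 * r ^+ 2) -> T <= W * r ^+ 2 * 2 ->
  8 * (8 * W) * r * r <= k0 / 16 * r -> 0 <= W * r ^+ 2 -> 32 * w <= k0 * r -> d <= w ->
  c + T + Y <= k0 / 8 * r by rewrite !expr2; lra.
have pos1 (X k : R) : X - - (r * k) <= k0 / 8 * r -> k0 / 4 * r <= k * r -> 0 < k0 * r -> X <= 0 by lra.
have pos2 (X k : R) : - (k0 / 8 * r) <= X - r * k -> k0 / 4 * r <= k * r -> 0 < k0 * r -> 0 <= X by lra.
have neg1 (X k : R) : X - r * k <= k0 / 8 * r -> k0 / 4 * r <= - k * r -> 0 < k0 * r -> X <= 0 by lra.
have neg2 (X k : R) : - (k0 / 8 * r) <= X - - (r * k) -> k0 / 4 * r <= - k * r -> 0 < k0 * r -> 0 <= X by lra.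
exists de => // x y Yu gu Ys gs hu hs xy; rewrite mul1r in dr.
pose f1 := eu x; pose f2 := rot90 f1; pose cr := cross f1 f2.
have /andP[cr1 cr2] : 1 <= cr <= 2 by exact: cross_frame.
have cr0 : 0 < cr by rewrite (lt_le_trans ltr01).
pose be t : plane R := box_pt es y Ys t 0.
pose aa z := cross (z - x) f2 / cr; pose bb z := cross f1 (z - x) / cr.
(* Height of the stable point [be t] above the unstable plaque of [x]. It is within [k0 / 8 * r] of
   [t * ka], with [|ka|] at least [k0 / 4], so it changes sign on [[- r, r]]. *)
pose psi t := bb (be (cl r t)) - Yu (cl rhou (aa (be (cl r t)))) 0.
have rr : `|0 : R| <= rhou by rewrite normr0 ltW.
have rr' : `|0 : R| <= rhos by rewrite normr0 ltW.
have clr t : `|cl r t| <= rhos by rewrite (le_trans (cl_in _ (ltW r0))).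
have cont : continuous psi.
  apply: (@lip_continuous _ _ 5) => t t'.
  have k1 := box_pt_lip nes hs (clr t) rr' (clr t') rr'.
  rewrite subrr normr0 addr0 in k1.
  have k2 : `|be (cl r t) - be (cl r t')| <= 2 * `|t - t'|.
    by rewrite (le_trans k1)// ler_pM2l// cl_lip// ltW.
  have [_ _ h3 _] := hu.
  have k3 := h3 _ _ 0 (cl_in (aa (be (cl r t))) (ltW ru0)) (cl_in (aa (be (cl r t'))) (ltW ru0)) rr.
  have k4 := cl_lip (aa (be (cl r t))) (aa (be (cl r t'))) (ltW ru0).
  have [k5 k6] := coord_le (e:=eu) x neu (be (cl r t) - be (cl r t')).
  have k7 : aa (be (cl r t)) - aa (be (cl r t')) = cross (be (cl r t) - be (cl r t')) f2 / cr.
    by rewrite /aa -mulrBl -crossNl -crossDl opprB addrA subrK.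
  have k8 : bb (be (cl r t)) - bb (be (cl r t')) = cross f1 (be (cl r t) - be (cl r t')) / cr.
    by rewrite /bb -mulrBl -crossNr -crossDr opprB addrA subrK.
  rewrite -/f1 -/f2 -/cr -k7 in k5; rewrite -/f1 -/f2 -/cr -k8 in k6.
  rewrite /psi opprD addrACA (le_trans (ler_normD _ _))//.
  rewrite -opprD normrN.
  exact: psi_arith k2 k3 k4 k5 k6.
pose ka := cross f1 (es y) / cr.
have hka : k0 / 4 <= `|ka|.
  have [c [d [e1 hd hc1 hc2]]] := direction_near (neu x) (neu y).
  have d1 : `|d| <= Lu * `|x - y| by exact: le_trans hd (hLu _ _).
  have d2 : `|d| <= Lu * de by rewrite (le_trans d1)// ler_pM2l.
  have e2 : cross f1 (es y) = c * cross (eu y) (es y) + d * cross (rot90 (eu y)) (es y).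
    by rewrite /f1 e1 crossDl !crossZl.
  have n2 := norm_cross (rot90 (eu y)) (es y); rewrite pnorm_rot90 neu nes !mulr1 in n2.
  have e3 : k0 * (1 - `|d|) - 2 * `|d| <= `|cross f1 (es y)|.
    have t1 : k0 * (1 - `|d|) <= `|c * cross (eu y) (es y)|.
      rewrite normrM mulrC; have [i|i] := leP 0 (1 - `|d|).
        by rewrite ler_pM// ltW.
      rewrite (@le_trans _ _ 0) ?mulr_ge0//; apply: mulr_le0_ge0; exact: ltW.
    have t2 : `|d * cross (rot90 (eu y)) (es y)| <= 2 * `|d| by rewrite normrM mulrC ler_wpM2r.
    have := ler_normB (cross f1 (es y)) (d * cross (rot90 (eu y)) (es y)); rewrite {1}e2 addrK; lra.
  rewrite normrM normfV (gtr0_norm cr0) ler_pdivlMr//.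
  have [du1 du2] := du.
  have d3 : 8 * `|d| <= 1 by rewrite (le_trans _ du2)// -mulrA ler_pM2l.
  have d4 : 8 * `|d| <= k0 by rewrite (le_trans _ du1)// -mulrA ler_pM2l.
  have d5 := ler_wpM2l (ltW k00) d3; have d6 := ler_wpM2l (ltW k00) cr2.
  exact: ka_arith k00 e3 d3 d4 d5 d6.
have bey t : be t - x = (y - x) + (t *: es y + Ys t 0 *: rot90 (es y)).
  by apply: peq; rewrite /be /box_pt /bpt !pE; ring.
have rt t : `|t| <= r -> `|t| <= rhos.
  by move=> ht; rewrite (le_trans ht).
have near_aa t : `|t| <= r -> `|aa (be t)| <= 6 * r.
  move=> ht; have ht' := rt t ht.
  have [_ _ h3 _] := hs; have := h3 t 0 0 ht' rr' rr'.
  have [-> _ _ _] : [/\ Ys 0 0 = 0, True, True & True] by have [/(_ 0 0 rr' rr')[]] := hs.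
  rewrite !subr0 => y2.
  have nbe : `|be t - x| <= 3 * r.
    rewrite bey (le_trans (ler_normD _ _))// distrC.
    have := ler_normD (t *: es y) (Ys t 0 *: rot90 (es y)).
    rewrite !normrZ pnorm_rot90 nes !mulr1 => h.
    exact: near_arith h y2 (le_trans xy dr) ht.
  have [c1 c2] := coord_le (e:=eu) x neu (be t - x).
  by rewrite /aa (le_trans c1)// (_ : 6 * r = 2 * (3 * r)) ?ler_pM2l//; ring.
have est t : `|t| <= r -> `|psi t - t * ka| <= k0 / 8 * r.
  move=> ht; rewrite /psi (cl_id ht); have ht' := rt t ht.
  have y1 := box_frame_flat nes Ls0 rs0 hs ht'.
  have a1 := near_aa t ht.
  have a2 : `|aa (be t)| <= rhou by rewrite (le_trans a1)// ltW.
  have y3 := box_frame_flat neu Lu0 ru0 hu a2.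
  rewrite (cl_id a2).
  have bE : bb (be t) - t * ka = cross f1 (y - x) / cr + Ys t 0 * (cross f1 (rot90 (es y)) / cr).
    by rewrite /bb bey !crossDr !crossZr /ka; ring.
  have [_ c3] := coord_le (e:=eu) x neu (y - x); have [_ c4] := coord_le (e:=eu) x neu (rot90 (es y)).
  rewrite pnorm_rot90 nes mulr1 in c4.
  rewrite -/f1 -/f2 -/cr in c3 c4.
  rewrite addrAC bE (le_trans (ler_normB _ _))// (le_trans (lerD (ler_normD _ _) (lexx _)))//.
  rewrite (normrM (Ys t 0)).
  have sq (a b : R) : `|a| <= b -> a ^+ 2 <= b ^+ 2.
    by move=> h; rewrite -real_normK ?num_real// lerXn2r ?nnegrE// (le_trans _ h).
  have z1 : `|Ys t 0| <= W * r ^+ 2.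
    rewrite (le_trans y1)// ler_pM ?sqr_ge0 ?mulr_ge0 ?(ltW Ls0)//; last exact: sq.
    by rewrite ler_pM2l// lerDr ltW.
  have z2 : `|Yu (aa (be t)) 0| <= W * (6 * r) ^+ 2.
    rewrite (le_trans y3)// ler_pM ?sqr_ge0 ?mulr_ge0 ?(ltW Lu0)//; last exact: sq.
    by rewrite ler_pM2l// lerDl ltW.
  have z3 : `|Ys t 0| * `|cross f1 (rot90 (es y)) / cr| <= W * r ^+ 2 * 2.
    by apply: ler_pM.
  have z4 := ler_wpM2r (ltW r0) rW.
  have z5 : 0 <= W * r ^+ 2 by rewrite mulr_ge0 ?sqr_ge0// ltW.
  rewrite distrC in xy.
  by rewrite exprMn in z2; exact: est_arith c3 z2 z3 z4 z5 dk xy.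
have hr1 : `|- r| <= r by rewrite normrN gtr0_norm.
have hr2 : `|r| <= r by rewrite gtr0_norm.
have s1 := est _ hr1; have s2 := est _ hr2.
have kr := ler_wpM2r (ltW r0) hka; have krp : 0 < k0 * r by exact: mulr_gt0.
have [t tin t0] : exists2 t, t \in `[(- r), r]%R & psi t = 0.
  apply: IVT.
  - by rewrite (le_trans (ler_norm _)).
  - exact: continuous_subspaceT.
  - move: s1 s2 kr krp; rewrite ge_min le_max !ler_norml.
    move: (psi (- r)) (psi r) => X1 X2 /andP[i1 i2] /andP[i3 i4].
    rewrite mulNr in i1 i2.
    have [kp|kp] := leP 0 ka.
      rewrite (ger0_norm kp) => i5 i6; apply/andP; split; apply/orP; [left|right].
        exact: pos1 i2 i5 i6.
      exact: pos2 i3 i5 i6.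
    rewrite (ltr0_norm kp) => i5 i6; apply/andP; split; apply/orP; [right|left].
      exact: neg1 i4 i5 i6.
    exact: neg2 i1 i5 i6.
have tr : `|t| <= r by move: tin; rewrite in_itv /= ler_norml.
have [aar a6] : `|aa (be t)| < rhou /\ `|aa (be t)| <= rhou.
  have a6 := near_aa t tr; have aar : `|aa (be t)| < rhou by exact: le_lt_trans ru6.
  by split => //; exact: ltW.
exists (aa (be t)), t; split => //.
  exact: le_lt_trans rs2.
rewrite -/(be t) [RHS](box_coord (e:=eu) x neu) -/f1 -/f2 -/cr -/(aa _) -/(bb _).
rewrite /box_pt /bpt -/f1 -/f2; congr (_ + _ *: _).
by move/eqP: t0; rewrite /psi (cl_id tr) (cl_id a6) subr_eq0 => /eqP.
Unshelve. all: by end_near. Qed.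

(** In the basis [eu x], [es x] the coefficients of [v] are at most [2 * |v| / k0]; the image of
    [es x] is at most [K], hence at most [K ^ 2 * U n x], since [U n x] is at least [1 / K]. *)
Lemma D_iter_upper n x v : `|D (iter n F) x v| <= 2 / k0 * (1 + K ^+ 2) * U n x * `|v|.
Proof.
rewrite /ugrowth.
have c0 : 0 < `|cross (eu x) (es x)| by rewrite (lt_le_trans k00).
have c00 : cross (eu x) (es x) != 0 by rewrite -normr_gt0.
rewrite {1}(cramer_div v c00).
have bd a b : `|cross a b| <= 2 * `|v| -> `|cross a b / cross (eu x) (es x)| <= 2 * `|v| / k0.
  by move=> h; rewrite normrM normfV ler_pM ?invr_ge0//; rewrite lef_pV2.
have [_ _ hs _ _] := hfr.
have t1 : th ^+ n <= 1 by rewrite exprn_ile1// ltW.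
have := frame_grow dF dG FK GK hfr n x; set u := `|_| => h.
have h2 : 1 <= K * u.
  by rewrite (le_trans h)// ler_wpM2r ?normr_ge0// ger_pMr.
have h3 : `|D (iter n F) x (es x)| <= K ^+ 2 * u.
  by rewrite (le_trans (hs n x))// expr2 -mulrA ler_pM2l// (le_trans t1).
have ba := bd v (es x); have bb := bd (eu x) v.
have nb := norm_cross v (es x); have na := norm_cross (eu x) v.
rewrite nes mulr1 in nb; rewrite neu mul1r in na.
move: {ba bb nb na}(ba nb) (bb na); move: (cross v _ / _) (cross (eu x) v / _) => a b ba bb.
rewrite linearD !linearZ (le_trans (ler_normD _ _))// !normrZ.
have -> : 2 / k0 * (1 + K ^+ 2) * u * `|v| = 2 * `|v| / k0 * u + 2 * `|v| / k0 * (K ^+ 2 * u) by ring.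
by rewrite lerD ?ler_pM.
Qed.

Hypothesis hLs : forall x y, `|cross (es x) (es y)| <= Ls * `|x - y|.
Hypothesis j0 : j != 0.
Hypothesis hj : forall x u v, cross (D F x u) (D F x v) = j * cross u v.
Hypothesis hUBD : UBD (unstable_leaf F).

(** [plaque_growth] is about tangent vectors of the box, of norm between 1/2 and 2; passing to unit
    vectors costs the factor 4. *)
Lemma unstable_plaque_growth (rho : R) : 0 < rho -> exists2 k, 0 < k & forall n p (Y g : R -> R -> R),
  box_frame eu Lu rho p Y g -> forall s1 s2, `|s1| < rho -> `|s2| < rho ->
  U n (box_pt eu p Y s1 0) <= k * U n (box_pt eu p Y s2 0).
Proof.
move=> rho0; have [ka ka0 hka] := plaque_growth cF cG FK GK j0 hj hfr Lu0 rho0 hUBD.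
exists (4 * ka) => [|n p Y g hbf s1 s2 h1 h2]; first exact: mulr_gt0.
have rr : `|0 : R| <= rho by rewrite normr0 ltW.
have key s : `|s| < rho -> U n (box_pt eu p Y s 0) <= 2 * `|D (iter n F) (box_pt eu p Y s 0) (box_tan eu p g s 0)| /\
   `|D (iter n F) (box_pt eu p Y s 0) (box_tan eu p g s 0)| <= 2 * U n (box_pt eu p Y s 0).
  move=> /ltW hs; have /andP[b1 b2] := box_tan_bounds hfr hbf hs rr.
  have [c ec nc] := box_tan_parallel hfr hbf hs rr.
  have -> : `|D (iter n F) (box_pt eu p Y s 0) (box_tan eu p g s 0)| =
      `|box_tan eu p g s 0| * U n (box_pt eu p Y s 0) by rewrite -nc {1}ec linearZ normrZ.
  split; last by rewrite ler_wpM2r ?ugrowth_ge0.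
  by rewrite mulrA ler_peMl ?ugrowth_ge0//; move: b1; lra.
have [a1 _] := key s1 h1; have [_ a2] := key s2 h2.
rewrite (le_trans a1)// -(mulrA 4) (_ : 4 = 2 * 2 :> R); last by ring.
rewrite -mulrA ler_pM2l// (le_trans (hka n p Y g hbf s2 s1 h2 h1))//.
by rewrite mulrCA ler_pM2l.
Qed.

(** From [x] to [y] through the intersection point: first along the unstable plaque of [x], then
    along the stable plaque of [y]. *)
Lemma ugrowth_local : exists de k : R, [/\ 0 < de, 0 < k & forall n x y, `|x - y| <= de -> U n x <= k * U n y].
Proof.
have [ru /andP[ru0 _] hu] := foliation_box neu Lu0 hLu.
have [rs /andP[rs0 _] hs] := foliation_box nes Ls0 hLs.
have [ku ku0 hku] := unstable_plaque_growth ru0.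
have [ks ks0 hks] := stable_plaque_growth Ls rs0.
have [de de0 hde] := plaques_meet ru0 rs0.
exists de, (ku * ks); split => //; first exact: mulr_gt0.
move=> n x y xy; have [Yu [gu bu]] := hu x; have [Ys [gs bs]] := hs y.
have [s [t [hs1 /ltW ht e]]] := hde x y Yu gu Ys gs bu bs xy.
have z1 : `|0 : R| < ru by rewrite normr0.
have z2 : `|0 : R| <= rs by rewrite normr0 ltW.
have bp0 e' L rho p (Y g : R -> R -> R) : 0 < rho -> box_frame e' L rho p Y g -> box_pt e' p Y 0 0 = p.
  by move=> r0 [/(_ 0 0)]; rewrite normr0 (ltW r0) => -[]// h _ _ _ _ _ _; rewrite /box_pt h bpt0.
have := hku n x Yu gu bu 0 s z1 hs1; rewrite (bp0 _ _ _ _ _ _ ru0 bu) => k1.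
have := hks n y Ys gs bs t 0 ht z2; rewrite (bp0 _ _ _ _ _ _ rs0 bs) -e => k2.
by rewrite (le_trans k1)// -mulrA ler_pM2l.
Qed.

Variable A : 'M[int]_2.
Hypothesis hA : forall x k, zpt k -> F (x + k) = F x + lin A k.

(** [D (iter n F)] is periodic but [eu] is not, a lattice translation changing the past of the
    projected point; [eu (x + k)] is therefore treated as any unit vector at [x]. *)
Lemma ugrowth_translate : exists2 c : R, 0 < c & forall n x k, zpt k -> U n (x + k) <= c * U n x.
Proof.
exists (2 / k0 * (1 + K ^+ 2)); first by rewrite !mulr_gt0 ?invr_gt0// addr_gt0// exprn_gt0.
move=> n x k zk; rewrite {1}/ugrowth (D_iter_translate n x (eu (x + k)) dF hA zk).
by rewrite (le_trans (D_iter_upper _ _ _))// neu mulr1.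
Qed.

(** Lattice translations bring both points into the unit square, which a fixed number of steps of
    length [de] crosses; none of the constants depends on [n]. *)
Lemma ugrowth_uniform : exists2 k : R, 0 < k & forall n x y, U n x <= k * U n y.
Proof.
have [de [k [de0 k0' hk]]] := ugrowth_local.
have [c c0 hc] := ugrowth_translate.
have chain m n x y : `|x - y| <= m%:R * de -> U n x <= k ^+ m * U n y.
  elim: m x => [|m IH] x.
    by rewrite mul0r normr_le0 subr_eq0 => /eqP ->; rewrite mul1r.
  move=> h; pose z : plane R := x + (m.+1%:R)^-1 *: (y - x).
  have mm : 0 < m.+1%:R :> R by rewrite ltr0n.
  have e1 : `|x - z| <= de.
    by rewrite /z opprD addNKr normrN normrZ normfV ger0_norm ?ler0n// ler_pdivrMl// distrC.
  have e2 : `|z - y| <= m%:R * de.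
    have -> : z - y = (m%:R / m.+1%:R) *: (x - y).
      have -> : (m%:R / m.+1%:R : R) = 1 - (m.+1%:R)^-1.
        by rewrite -natr1; field; rewrite natr1; exact: lt0r_neq0.
      by apply: peq; rewrite /z !pE; ring.
    rewrite normrZ ger0_norm ?divr_ge0// (le_trans (ler_wpM2l _ h)) ?divr_ge0//.
    by rewrite mulrA divfK ?lt0r_neq0.
  by rewrite (le_trans (hk n x z e1))// exprS -mulrA ler_pM2l// IH.
have [m hm] : exists m : nat, 1 <= m%:R * de.
  have [m hm] := nat_gt de^-1; exists m.
  by rewrite -ler_pdivrMr// div1r ltW.
exists (c * (k ^+ m * c)) => [|n x y]; first by rewrite !mulr_gt0// exprn_gt0.
have [a za [hx1 hx2]] := floor_pt x; have [b zb [hy1 hy2]] := floor_pt y.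
have h1 : U n x <= c * U n (x - a) by rewrite -{1}(subrK a x) hc.
have h2 : U n (y - b) <= c * U n y by rewrite hc// zptN.
have h3 : `|x - a - (y - b)| <= m%:R * de.
  apply: le_trans hm; apply: pnorm_le.
    have -> : ((x - a - (y - b)).1 : R) = (x - a).1 - (y - b).1 by rewrite !pE.
    by move: hx1 hy1 => /andP[i1 i2] /andP[i3 i4]; rewrite ler_norml; lra.
  have -> : ((x - a - (y - b)).2 : R) = (x - a).2 - (y - b).2 by rewrite !pE.
  by move: hx2 hy2 => /andP[i1 i2] /andP[i3 i4]; rewrite ler_norml; lra.
rewrite (le_trans h1)// -!mulrA ler_pM2l// (le_trans (chain m n _ _ h3))// ler_pM2l ?exprn_gt0//.
Qed.

End UniformGrowth.

(** * Stokes formula and the Jacobian of the linear part *)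

Section Stokes.
Variable R : realType.
Implicit Types (a b c p q z : plane R) (h r s t u : R).

(** Trapezoidal rule for the integral of the form [cross (E, .)] along the segment from [p] to
    [q]. *)
Definition trap (E : plane R -> plane R) p q : R := 2^-1 * cross (E p + E q) (q - p).

Lemma sum_const_le (V : normedZmodType R) (N : nat) (f : 'I_N -> V) (c : R) :
  (forall i, `|f i| <= c) -> `|\sum_(i < N) f i| <= N%:R * c.
Proof.
move=> hf; rewrite (le_trans (ler_norm_sum _ _ _))//.
apply: (@le_trans _ _ (\sum_(i < N) c)); first by apply: ler_sum => i _; exact: hf.
by rewrite sumr_const card_ord mulr_natl.
Qed.

(** For an affine field the trapezoidal rule is exact and the circulation around a triangle is [tau]
    times its area; here [tau] plays the role of the trace of [L]. The quadrilateral is cut into two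
    triangles at [p0], and the remainder of [E] contributes the cubic error. *)
Lemma cell_stokes (E L : plane R -> plane R) (tau C r : R) p0 pa pc pb :
  (forall a c, cross (L a) c - cross (L c) a = tau * cross a c) ->
  (forall z, z \in [:: pa; pc; pb] -> `|z - p0| <= r /\ `|E z - E p0 - L (z - p0)| <= C * r ^+ 2) ->
  `|trap E p0 pa + trap E pa pc - trap E pb pc - trap E p0 pb
    - tau / 2 * (cross (pa - p0) (pc - p0) + cross (pc - p0) (pb - p0))| <= 4 * (C * r ^+ 3).
Proof.
move=> hL hz.
have [ha ea] := hz pa ltac:(by rewrite !inE eqxx).
have [hc ec] := hz pc ltac:(by rewrite !inE eqxx orbT).
have [hb eb] := hz pb ltac:(by rewrite !inE eqxx !orbT).
move: ha hb hc ea eb ec; have := hL (pa - p0) (pc - p0); have := hL (pc - p0) (pb - p0).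
have Ez z : E z = E p0 + L (z - p0) + (E z - E p0 - L (z - p0)) by apply: peq; rewrite !pE; ring.
rewrite /trap; move: (Ez pa) (Ez pb) (Ez pc).
have -> : pc - pa = (pc - p0) - (pa - p0) by rewrite opprB addrA subrK.
have -> : pc - pb = (pc - p0) - (pb - p0) by rewrite opprB addrA subrK.
move: (E pa - E p0 - L _) (E pb - E p0 - L _) (E pc - E p0 - L _) => fa fb fc.
move: (L (pa - p0)) (L (pb - p0)) (L (pc - p0)) => la lb lc.
move: (pa - p0) (pb - p0) (pc - p0) (E p0) => a b c e0 -> -> -> h1 h2 ha hb hc hfa hfb hfc.
have -> : 2^-1 * cross (e0 + (e0 + la + fa)) a + 2^-1 * cross (e0 + la + fa + (e0 + lc + fc)) (c - a) -
    2^-1 * cross (e0 + lb + fb + (e0 + lc + fc)) (c - b) - 2^-1 * cross (e0 + (e0 + lb + fb)) b -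
    tau / 2 * (cross a c + cross c b) =
  2^-1 * (cross fa c + cross fc (b - a) - cross fb c)
  + 2^-1 * ((cross la c - cross lc a - tau * cross a c) + (cross lc b - cross lb c - tau * cross c b)).
  by rewrite /cross !pE; field.
rewrite h1 h2 !subrr addr0 mulr0 addr0 normrM.
have r0 : 0 <= r by exact: le_trans (normr_ge0 _) ha.
have C0 : 0 <= C * r ^+ 2 by exact: le_trans (normr_ge0 _) hfa.
have k f w r' : `|f| <= C * r ^+ 2 -> `|w| <= r' -> `|cross f w| <= 2 * (C * r ^+ 2 * r').
  by move=> i1 i2; rewrite (le_trans (norm_cross _ _))// ler_pM2l// ler_pM.
have k1 := k _ _ _ hfa hc; have k2 := k _ _ _ hfb hc.
have k3 : `|cross fc (b - a)| <= 2 * (C * r ^+ 2 * (r + r)).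
  by apply: k hfc _; rewrite (le_trans (ler_normB _ _))// lerD.
have k4 := ler_normB (cross fa c + cross fc (b - a)) (cross fb c).
have k5 := ler_normD (cross fa c) (cross fc (b - a)).
rewrite ger0_norm ?invr_ge0// (_ : C * r ^+ 3 = C * r ^+ 2 * r); last by ring.
move: k1 k2 k3 k4 k5; rewrite mulrDr; move: (C * r ^+ 2 * r) => X; lra.
Qed.

Lemma cell_area P Q a b c (k h : R) : 0 <= h <= 1 -> `|P| <= k -> `|Q| <= k ->
  `|a - h *: P| <= k * h ^+ 2 -> `|b - h *: Q| <= k * h ^+ 2 ->
  `|c - (h *: P + h *: Q)| <= k * h ^+ 2 ->
  [/\ `|a| <= 3 * (k * h), `|b| <= 3 * (k * h), `|c| <= 3 * (k * h) &
  `|cross a c + cross c b - 2 * h ^+ 2 * cross P Q| <= 16 * (k ^+ 2 * h ^+ 3)].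
Proof.
move=> /andP[h0 h1] nP nQ.
have k0 : 0 <= k by exact: le_trans (normr_ge0 _) nP.
suff main ra rb rc : `|ra| <= k * h ^+ 2 -> `|rb| <= k * h ^+ 2 -> `|rc| <= k * h ^+ 2 ->
    [/\ `|h *: P + ra| <= 3 * (k * h), `|h *: Q + rb| <= 3 * (k * h), `|h *: P + h *: Q + rc| <= 3 * (k * h) &
    `|cross (h *: P + ra) (h *: P + h *: Q + rc) + cross (h *: P + h *: Q + rc) (h *: Q + rb)
      - 2 * h ^+ 2 * cross P Q| <= 16 * (k ^+ 2 * h ^+ 3)].
  have ea : h *: P + (a - h *: P) = a by rewrite addrC subrK.
  have eb : h *: Q + (b - h *: Q) = b by rewrite addrC subrK.
  have ec : h *: P + h *: Q + (c - (h *: P + h *: Q)) = c by rewrite addrC subrK.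
  by move=> ha hb hc; have := main _ _ _ ha hb hc; rewrite ea eb ec.
move=> ha hb hc.
have kh : k * h ^+ 2 <= k * h by rewrite ler_wpM2l// expr2 ler_piMr.
have nhP : `|h *: P| <= k * h by rewrite normrZ ger0_norm// mulrC ler_wpM2r.
have nhQ : `|h *: Q| <= k * h by rewrite normrZ ger0_norm// mulrC ler_wpM2r.
have nPQ : `|h *: P + h *: Q| <= k * h + k * h by rewrite (le_trans (ler_normD _ _))// lerD.
have kh0 : 0 <= k * h by rewrite mulr_ge0.
split.
- by have := ler_normD (h *: P) ra; lra.
- by have := ler_normD (h *: Q) rb; lra.
- by have := ler_normD (h *: P + h *: Q) rc; lra.
have -> : cross (h *: P + ra) (h *: P + h *: Q + rc) + cross (h *: P + h *: Q + rc) (h *: Q + rb)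
    - 2 * h ^+ 2 * cross P Q =
  cross (h *: P) rc + cross ra (h *: P + h *: Q) + cross ra rc
  + (cross (h *: P + h *: Q) rb + cross rc (h *: Q) + cross rc rb).
  by rewrite /cross !pE; ring.
have kc v w (x y : R) : `|v| <= x -> `|w| <= y -> `|cross v w| <= 2 * (x * y).
  by move=> i1 i2; rewrite (le_trans (norm_cross _ _))// ler_pM2l// ler_pM.
have c1 := kc _ _ _ _ nhP hc; have c2 := kc _ _ _ _ ha nPQ.
have c3 := kc _ _ _ _ ha (le_trans hc kh); have c4 := kc _ _ _ _ nPQ hb.
have c5 := kc _ _ _ _ hc nhQ; have c6 := kc _ _ _ _ hc (le_trans hb kh).
have n1 := ler_normD (cross (h *: P) rc + cross ra (h *: P + h *: Q) + cross ra rc)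
  (cross (h *: P + h *: Q) rb + cross rc (h *: Q) + cross rc rb).
have n2 := ler_normD (cross (h *: P) rc + cross ra (h *: P + h *: Q)) (cross ra rc).
have n3 := ler_normD (cross (h *: P) rc) (cross ra (h *: P + h *: Q)).
have n4 := ler_normD (cross (h *: P + h *: Q) rb + cross rc (h *: Q)) (cross rc rb).
have n5 := ler_normD (cross (h *: P + h *: Q) rb) (cross rc (h *: Q)).
have e : k * h ^+ 2 * (k * h) = k ^+ 2 * h ^+ 3 by ring.
have e' : k * h * (k * h ^+ 2) = k ^+ 2 * h ^+ 3 by ring.
rewrite !mulrDr !mulrDl e e' in c1 c2 c3 c4 c5 c6.
move: c1 c2 c3 c4 c5 c6 n1 n2 n3 n4 n5; move: (k ^+ 2 * h ^+ 3) => X.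
move: `|cross (h *: P) rc| `|cross ra (_ + _)| `|cross ra rc| `|cross (_ + _) rb| `|cross rc (h *: Q)| `|cross rc rb|.
move: `|_| `|_| `|_| `|_| `|_| => ? ? ? ? ? ? ? ? ? ? ?.
lra.
Qed.

Variables (E : plane R -> plane R) (L : plane R -> plane R -> plane R) (tau : plane R -> R).
Variables (Phi P Q : R -> R -> plane R) (C k : R).
Hypothesis k0 : 0 < k.
Hypothesis C0 : 0 < C.
Local Notation I t := (0 <= t <= 1).
Hypothesis hE0 : forall t u, I t -> I u -> `|E (Phi t u)| <= C.
Hypothesis hE1 : forall t u s r, I t -> I u -> I s -> I r ->
  `|E (Phi s r) - E (Phi t u)| <= C * `|Phi s r - Phi t u|.
Hypothesis hE2 : forall t u s r, I t -> I u -> I s -> I r ->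
  `|E (Phi s r) - E (Phi t u) - L (Phi t u) (Phi s r - Phi t u)| <= C * `|Phi s r - Phi t u| ^+ 2.
Hypothesis hL : forall z a c, cross (L z a) c - cross (L z c) a = tau z * cross a c.
Hypothesis htau : forall t u, I t -> I u -> `|tau (Phi t u)| <= C.
Hypothesis hP : forall t u, I t -> I u -> `|P t u| <= k.
Hypothesis hQ : forall t u, I t -> I u -> `|Q t u| <= k.
Hypothesis hPhi : forall t u s r (h : R), I t -> I u -> I s -> I r -> `|s - t| <= h -> `|r - u| <= h ->
  `|Phi s r - Phi t u - ((s - t) *: P t u + (r - u) *: Q t u)| <= k * h ^+ 2.

Section Grid.
Variable N : nat.
Hypothesis N0 : (0 < N)%N.

Definition node (i : nat) : R := i%:R / N%:R.
Let h : R := N%:R^-1.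
Let NR : 0 < N%:R :> R. Proof. by rewrite ltr0n. Qed.
Let h01 : 0 <= h <= 1. Proof. by rewrite invr_ge0 ler0n invf_le1// ler1n. Qed.

Lemma node0 : node 0 = 0. Proof. by rewrite /node mul0r. Qed.
Lemma nodeN : node N = 1. Proof. by rewrite /node divff// lt0r_neq0. Qed.
Lemma nodeS i : node i.+1 - node i = h.
Proof. by rewrite /node -mulrBl -natr1 addrC addKr mul1r. Qed.
Lemma node_in i : (i <= N)%N -> I (node i).
Proof. by move=> iN; rewrite /node divr_ge0//= ler_pdivrMr// mul1r ler_nat. Qed.

Definition hedge i l : R := trap E (Phi (node i) (node l)) (Phi (node i.+1) (node l)).
Definition vedge i l : R := trap E (Phi (node i) (node l)) (Phi (node i) (node l.+1)).

Definition circulation : R :=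
  \sum_(i < N) (hedge i 0 - hedge i N) + \sum_(l < N) (vedge N l - vedge 0 l).

Let dens t u : R := tau (Phi t u) * cross (P t u) (Q t u).

Lemma cell_estimate i l : (i < N)%N -> (l < N)%N ->
  `|hedge i l + vedge i.+1 l - hedge i l.+1 - vedge i l - h ^+ 2 * dens (node i) (node l)| <=
  (4 * 27 * (C * k ^+ 3) + 8 * (C * k ^+ 2)) * h ^+ 3.
Proof.
move=> iN lN; have ti := node_in (ltnW iN); have ti' := node_in iN.
have ul := node_in (ltnW lN); have ul' := node_in lN.
have /andP[h0 h1] := h01.
have hh : `|h| <= h by rewrite ger0_norm.
have z0 : `|0 : R| <= h by rewrite normr0.
set t := node i in ti *; set t' := node i.+1 in ti' *; set u := node l in ul *; set u' := node l.+1 in ul' *.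
have et : t' - t = h by exact: nodeS. have eu : u' - u = h by exact: nodeS.
have fa := hPhi ti ul ti' ul (h:=h); rewrite et subrr scale0r addr0 in fa.
have fb := hPhi ti ul ti ul' (h:=h); rewrite eu subrr scale0r add0r in fb.
have fc := hPhi ti ul ti' ul' (h:=h); rewrite et eu in fc.
have [na nb nc ar] := cell_area h01 (hP ti ul) (hQ ti ul) (fa hh z0) (fb z0 hh) (fc hh hh).
have := @cell_stokes E (L (Phi t u)) (tau (Phi t u)) C (3 * (k * h)) (Phi t u) (Phi t' u) (Phi t' u') (Phi t u') (hL _) => cs.
have kh : 0 <= 3 * (k * h) by rewrite !mulr_ge0// ltW.
have sq z : `|z| <= 3 * (k * h) -> C * `|z| ^+ 2 <= C * (3 * (k * h)) ^+ 2.
  by move=> hz; rewrite ler_pM2l// lerXn2r ?nnegrE.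
have st : forall z, z \in [:: Phi t' u; Phi t' u'; Phi t u'] -> `|z - Phi t u| <= 3 * (k * h) /\
    `|E z - E (Phi t u) - L (Phi t u) (z - Phi t u)| <= C * (3 * (k * h)) ^+ 2.
  move=> z; rewrite !inE => /or3P[] /eqP ->; split => //.
  - exact: le_trans (hE2 ti ul ti' ul) (sq _ na).
  - exact: le_trans (hE2 ti ul ti' ul') (sq _ nc).
  - exact: le_trans (hE2 ti ul ti ul') (sq _ nb).
move: {st}(cs st); rewrite -/(hedge i l) -/(vedge i.+1 l) -/(hedge i l.+1) -/(vedge i l) => st.
have ht := htau ti ul.
have ar2 : `|tau (Phi t u) / 2 * (cross (Phi t' u - Phi t u) (Phi t' u' - Phi t u) +
    cross (Phi t' u' - Phi t u) (Phi t u' - Phi t u)) - h ^+ 2 * dens t u| <= C * (8 * (k ^+ 2 * h ^+ 3)).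
  move: ar; rewrite /dens; move: (cross (Phi t' u - _) (Phi t' u' - _) + cross (Phi t' u' - _) (Phi t u' - _)) (cross (P t u) _) => S X ar.
  have -> : tau (Phi t u) / 2 * S - h ^+ 2 * (tau (Phi t u) * X) = tau (Phi t u) * ((S - 2 * h ^+ 2 * X) / 2).
    by field.
  rewrite normrM ler_pM// normrM (ger0_norm (_ : 0 <= 2^-1)) ?invr_ge0//; move: ar; lra.
move: st ar2; set T1 := hedge i l + _ - _ - _; set T2 := tau _ / 2 * _ => st ar2.
have -> : T1 - h ^+ 2 * dens t u = (T1 - T2) + (T2 - h ^+ 2 * dens t u) by rewrite addrA subrK.
rewrite (le_trans (ler_normD _ _))// (le_trans (lerD st ar2))// le_eqVlt; apply/orP; left.
by apply/eqP; ring.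
Qed.

Lemma circulationE : circulation =
  \sum_(i < N) \sum_(l < N) (hedge i l + vedge i.+1 l - hedge i l.+1 - vedge i l).
Proof.
transitivity (\sum_(i < N) \sum_(l < N) (hedge i l - hedge i l.+1) +
  \sum_(i < N) \sum_(l < N) (vedge i.+1 l - vedge i l)).
  rewrite /circulation; congr (_ + _).
    apply: eq_bigr => i _; rewrite -(big_mkord xpredT (fun l => hedge i l - hedge i l.+1)).
    by rewrite -opprB -telescope_sumr// -sumrN; apply: eq_bigr => l _; rewrite opprB.
  rewrite exchange_big /=; apply: eq_bigr => l _.
  by rewrite -(big_mkord xpredT (fun i => vedge i.+1 l - vedge i l)) telescope_sumr.
by rewrite -big_split /=; apply: eq_bigr => i _; rewrite -big_split /=; apply: eq_bigr => l _; ring.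
Qed.

(** Interior edges cancel, and [N ^ 2] cells with errors of order [h ^ 3] leave a total error of
    order [h]. The constant is displayed because it must not depend on [N]. *)
Lemma stokes_grid : exists2 c : R, c = (4 * 27 * (C * k ^+ 3) + 8 * (C * k ^+ 2)) &
  `|circulation - \sum_(i < N) \sum_(l < N) h ^+ 2 * dens (node i) (node l)| <= c * h.
Proof.
eexists; first reflexivity; set c := (X in X * h).
rewrite circulationE -sumrB.
have -> : c * h = N%:R * (N%:R * (c * h ^+ 3)).
  by rewrite /h; field; exact: lt0r_neq0.
apply: sum_const_le => i; rewrite -sumrB; apply: sum_const_le => l.
exact: cell_estimate.
Qed.

Lemma hedge_estimate i l : (i < N)%N -> (l <= N)%N ->
  `|hedge i l - h * cross (E (Phi (node i) (node l))) (P (node i) (node l))| <=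
  (2 * (C * k) + 9 * (C * k ^+ 2)) * h ^+ 2.
Proof.
move=> iN lN; have ti := node_in (ltnW iN); have ti' := node_in iN; have ul := node_in lN.
have /andP[h0 h1] := h01.
have hh : `|h| <= h by rewrite ger0_norm.
have z0 : `|0 : R| <= h by rewrite normr0.
rewrite /hedge.
have := hE0 ti ul; have := hE1 ti ul ti' ul.
have := hP ti ul; have := hPhi ti ul ti' ul (h:=h).
rewrite nodeS subrr scale0r addr0 => /(_ hh z0).
move: (P (node i) (node l)) (Phi (node i.+1) (node l)) (Phi (node i) (node l)) => p q z f1 f2 f3 f4.
have -> : trap E z q - h * cross (E z) p = cross (E z) (q - z - h *: p) + 2^-1 * cross (E q - E z) (q - z).
  by rewrite /trap /cross !pE; field.
have nq : `|q - z| <= 3 * (k * h).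
  have := ler_normD (q - z - h *: p) (h *: p); rewrite subrK normrZ ger0_norm//.
  have := ler_wpM2l h0 f2.
  have : k * h ^+ 2 <= k * h by rewrite ler_pM2l// expr2 ler_piMr.
  have : 0 <= k * h by rewrite mulr_ge0// ltW.
  by rewrite (mulrC h k); move: f1; lra.
have c1 : `|cross (E z) (q - z - h *: p)| <= 2 * (C * (k * h ^+ 2)).
  by rewrite (le_trans (norm_cross _ _))// ler_pM2l// ler_pM.
have c2 : `|cross (E q - E z) (q - z)| <= 2 * (C * (3 * (k * h)) * (3 * (k * h))).
  rewrite (le_trans (norm_cross _ _))// ler_pM2l// ler_pM// (le_trans f3)// ler_pM2l//.
rewrite (le_trans (ler_normD _ _))// normrM ger0_norm ?invr_ge0//.
rewrite (le_trans (lerD c1 (ler_wpM2l _ c2))) ?invr_ge0// le_eqVlt; apply/orP; left.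
by apply/eqP; field.
Qed.

End Grid.

(** The homotopy fixes its end points, so the vertical sides carry no circulation; the bottom side
    minus the top one equals the area integral up to an error that vanishes with the mesh. *)
Lemma curve_le_chord (b0 b1 a : R) :
  (forall u, I u -> Phi 0 u = Phi 0 0) -> (forall u, I u -> Phi 1 u = Phi 1 0) ->
  (forall t, I t -> b0 <= cross (E (Phi t 0)) (P t 0)) ->
  (forall t, I t -> `|cross (E (Phi t 1)) (P t 1)| <= b1) ->
  (forall t u, I t -> I u -> `|tau (Phi t u) * cross (P t u) (Q t u)| <= a) ->
  b0 <= b1 + a.
Proof.
have fin (x y z X S1 S2 y1 y2 e : R) : X <= z -> S1 - S2 - X <= y1 -> x - y2 <= S1 ->
    S2 <= y + y2 -> y1 + 2 * y2 <= e -> x <= y + z + e by lra.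
move=> cl0 cl1 hb0 hb1 ha.
pose c1 : R := 4 * 27 * (C * k ^+ 3) + 8 * (C * k ^+ 2); pose c2 : R := 2 * (C * k) + 9 * (C * k ^+ 2).
have c10 : 0 <= c1 + 2 * c2.
  by rewrite !addr_ge0 ?mulr_ge0 ?addr_ge0 ?mulr_ge0 ?exprn_ge0 ?ltW// mulr_gt0// ?exprn_gt0.
apply/ler_addgt0Pr => e e0.
have [N _ hN] := nat_gt ((c1 + 2 * c2) / e).
have N0 : (0 < N)%N.
  by rewrite -(ltr0n R) (le_lt_trans _ hN)// divr_ge0// ltW.
have NR : 0 < N%:R :> R by rewrite ltr0n.
pose h : R := N%:R^-1; have h0 : 0 <= h by rewrite invr_ge0.
have Nh : N%:R * h = 1 by rewrite mulfV// lt0r_neq0.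
have he : (c1 + 2 * c2) * h <= e.
  by rewrite /h ler_pdivrMr// [leRHS]mulrC -ler_pdivrMr// ltW.
have [c -> st] := stokes_grid N0.
have vz (l : nat) : (l < N)%N -> vedge N N l = 0 /\ vedge N 0 l = 0.
  move=> lN; rewrite /vedge nodeN// node0 !cl0 ?cl1 ?node_in ?(ltnW lN)//.
  rewrite ?(cl1 _ (node_in _ lN)) ?(cl1 _ (node_in _ (ltnW lN)))//.
  by rewrite /trap !subrr !cross0r !mulr0.
have inn i : (i <= N)%N -> I (node N i) by exact: node_in.
have area : `|\sum_(i < N) \sum_(l < N) h ^+ 2 * (tau (Phi (node N i) (node N l)) * cross (P (node N i) (node N l)) (Q (node N i) (node N l)))| <= a.
  have -> : a = N%:R * (N%:R * (h ^+ 2 * a)) by rewrite /h; field; exact: lt0r_neq0.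
  apply: sum_const_le => i; apply: sum_const_le => l.
  have iN := ltn_ord i; have lN := ltn_ord l.
  by rewrite normrM ger0_norm ?exprn_ge0// ler_wpM2l ?exprn_ge0// ha// inn// ltnW.
have ci : circulation N = \sum_(i < N) hedge N i 0 - \sum_(i < N) hedge N i N.
  rewrite /circulation sumrB [X in _ + X]big1 ?addr0// => l _.
  by have [-> ->] := vz l (ltn_ord l); rewrite subrr.
have bot : b0 - c2 * h <= \sum_(i < N) hedge N i 0.
  have -> : b0 - c2 * h = \sum_(i < N) (h * b0 - c2 * h ^+ 2).
    by rewrite sumr_const card_ord -[RHS]mulr_natl /h; field; exact: lt0r_neq0.
  apply: ler_sum => i _; have iN := ltn_ord i.
  have := hedge_estimate N0 iN (leq0n N); rewrite node0 ler_distl => /andP[h1 _].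
  by rewrite (le_trans _ h1)// lerB// ler_wpM2l// hb0 ?inn// ltnW.
have top : \sum_(i < N) hedge N i N <= b1 + c2 * h.
  have -> : b1 + c2 * h = \sum_(i < N) (h * b1 + c2 * h ^+ 2).
    by rewrite sumr_const card_ord -[RHS]mulr_natl /h; field; exact: lt0r_neq0.
  apply: ler_sum => i _; have iN := ltn_ord i.
  have := hedge_estimate N0 iN (leqnn N); rewrite nodeN// ler_distl => /andP[_ h1].
  by rewrite (le_trans h1)// lerD// ler_wpM2l// (le_trans (ler_norm _))// hb1 ?inn// ltnW.
rewrite ci in st; move: st; rewrite -/h -/c1; set X := \sum_(i < N) \sum_(l < N) _ in area * => st.
move: area st; rewrite !ler_norml => /andP[_ a1] /andP[_ a2].
move: a1 a2 bot top he; move: (\sum_(i < N) hedge N i 0) (\sum_(i < N) hedge N i N) => S1 S2.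
move=> i1 i2 i3 i4 i5; have i6 : c1 * h + 2 * (c2 * h) <= e by rewrite mulrA -mulrDl.
exact: fin i1 i2 i3 i4 i6.
Qed.

End Stokes.

Section Degree.
Variable R : realType.
Implicit Types (p q k x z : plane R).
Variables (F : plane R -> plane R) (A : 'M[int]_2) (M C j : R).
Hypothesis cF : C11 F M C.
Hypothesis hj : forall x u v, cross (D F x u) (D F x v) = j * cross u v.
Hypothesis hA : forall x k, zpt k -> F (x + k) = F x + lin A k.

(* Stokes for the form x dy, whose circulation is the enclosed area. *)
Lemma jacobian_lin : cross (lin A (e1 R)) (lin A (e2 R)) = j.
Proof.
have [dF M0 C0 hM hC] := cF.
(* [cross (E p)] of a displacement is [x dy], whose exterior derivative is the area form, so that
   [tau] is 1. *)
pose E p : plane R := (p.1, 0); pose L (z v : plane R) : plane R := (v.1, 0).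
pose Phi (t u : R) := F (t, u).
pose P (t u : R) := D F (t, u) (e1 R); pose Q (t u : R) := D F (t, u) (e2 R).
have nE p : `|E p| <= `|p| by apply: pnorm_le; rewrite /E /= ?norm1_le ?normr0.
have EB p q : E p - E q = E (p - q) by apply: peq; rewrite !pE /= ?subrr.
pose K := 1 + `|F 0| + M + C.
have K1 : 1 <= K by rewrite /K -!addrA lerDl !addr_ge0// ltW.
have KM : M <= K by have := normr_ge0 (F 0); move: C0; rewrite /K; lra.
have KC : C <= K by have := normr_ge0 (F 0); move: M0; rewrite /K; lra.
have K0 : 0 < K by rewrite (lt_le_trans ltr01).
have hL : forall z a c, cross (L z a) c - cross (L z c) a = 1 * cross a c.
  by move=> z a c; rewrite /L /cross /=; ring.
have hP t u : 0 <= t <= 1 -> 0 <= u <= 1 -> `|P t u| <= K.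
  by move=> _ _; rewrite (le_trans (hM _ _))// pnorm_e1 mulr1.
have hQ t u : 0 <= t <= 1 -> 0 <= u <= 1 -> `|Q t u| <= K.
  by move=> _ _; rewrite (le_trans (hM _ _))// pnorm_e2 mulr1.
have hE0 t u : 0 <= t <= 1 -> 0 <= u <= 1 -> `|E (Phi t u)| <= K.
  move=> /andP[t0 t1] /andP[u0 u1]; rewrite (le_trans (nE _))// /Phi.
  have := F_lip cF 0 (t, u); rewrite subr0 => h.
  have h2 : `|(t, u) : plane R| <= 1 by apply: pnorm_le; rewrite ger0_norm.
  have h3 := ler_wpM2l (ltW M0) h2.
  have := ler_normD (F (t, u) - F 0) (F 0); rewrite subrK.
  by move: h h3 C0; rewrite /K; lra.
have hE1 t u s r : 0 <= t <= 1 -> 0 <= u <= 1 -> 0 <= s <= 1 -> 0 <= r <= 1 ->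
    `|E (Phi s r) - E (Phi t u)| <= K * `|Phi s r - Phi t u|.
  by move=> _ _ _ _; rewrite EB (le_trans (nE _))// ler_peMl.
have hE2 t u s r : 0 <= t <= 1 -> 0 <= u <= 1 -> 0 <= s <= 1 -> 0 <= r <= 1 ->
    `|E (Phi s r) - E (Phi t u) - L (Phi t u) (Phi s r - Phi t u)| <= K * `|Phi s r - Phi t u| ^+ 2.
  by move=> _ _ _ _; rewrite EB /L -/(E _) subrr normr0 mulr_ge0// ?exprn_ge0// ltW.
have ht t u : 0 <= t <= 1 -> 0 <= u <= 1 -> `|1 : R| <= K by rewrite normr1.
have hPhi t u s r h : 0 <= t <= 1 -> 0 <= u <= 1 -> 0 <= s <= 1 -> 0 <= r <= 1 ->
    `|s - t| <= h -> `|r - u| <= h ->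
    `|Phi s r - Phi t u - ((s - t) *: P t u + (r - u) *: Q t u)| <= K * h ^+ 2.
  move=> _ _ _ _ h1 h2; have := F_taylor cF (t, u) (s, r).
  have h0 : 0 <= h by exact: le_trans (normr_ge0 _) h1.
  have -> : (s, r) - (t, u) = (s - t) *: e1 R + (r - u) *: e2 R :> plane R.
    by apply: peq; rewrite !pE /=; ring.
  rewrite linearD !linearZ -/(P t u) -/(Q t u) -/(Phi s r) -/(Phi t u) => h3.
  rewrite (le_trans h3)// ler_pM ?exprn_ge0 ?(ltW C0)// lerXn2r ?nnegrE//.
  by apply: pnorm_le; rewrite !pE /= ?mulr1 ?mulr0 ?addr0 ?add0r.
pose c : R := 4 * 27 * (K * K ^+ 3) + 8 * (K * K ^+ 2).
have c0 : 0 < c by rewrite /c addr_gt0// !mulr_gt0// exprn_gt0.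
(* Opposite sides of the image of the square differ by lattice vectors, whose effect on a trapezoid
   is exact; for every [N] the boundary sum telescopes to the determinant of [A]. *)
have tr k p q : trap E (p + k) (q + k) = trap E p q + k.1 * (q.2 - p.2).
  by rewrite /trap /cross /E !pE /=; field.
suff main e : 0 < e -> `|cross (lin A (e1 R)) (lin A (e2 R)) - j| <= e.
  apply/eqP; rewrite -subr_eq0 -normr_le0; apply/ler_addgt0Pr => e e0.
  by rewrite add0r main.
move=> e0; have [N N0 hN] := nat_gt (c / e).
have N0' : (0 < N)%N by rewrite -(ltr0n R).
have ht' t u : 0 <= t <= 1 -> 0 <= u <= 1 -> `|(fun=> 1 : R) (Phi t u)| <= K by rewrite /= normr1.
have [c' -> st] := @stokes_grid R E L (fun=> 1) Phi P Q K K K0 K0 hE2 hL ht' hP hQ hPhi N N0'.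
have dens : \sum_(i < N) \sum_(l < N) N%:R^-1 ^+ 2 *
   (1 * cross (P (node R N i) (node R N l)) (Q (node R N i) (node R N l))) = j.
  transitivity (\sum_(i < N) \sum_(l < N) N%:R^-1 ^+ 2 * j).
    apply: eq_bigr => i _; apply: eq_bigr => l _.
    by rewrite /P /Q hj mul1r (_ : cross (e1 R) (e2 R) = 1) ?mulr1// /cross /=; ring.
  rewrite !sumr_const card_ord -mulrnA -[LHS]mulr_natr natrM; field; exact: lt0r_neq0.
have z1 : zpt (e1 R) by rewrite /zpt /= rpred1 rpred0.
have z2 : zpt (e2 R) by rewrite /zpt /= rpred1 rpred0.
have ci : circulation E Phi N = cross (lin A (e1 R)) (lin A (e2 R)).
  rewrite /circulation.
  have t1 (i : nat) : hedge E Phi N i 0 - hedge E Phi N i N =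
     - (lin A (e2 R)).1 * ((Phi (node R N i.+1) 0).2 - (Phi (node R N i) 0).2).
    rewrite /hedge nodeN// node0.
    have p1 t : Phi t 1 = Phi t 0 + lin A (e2 R).
      by rewrite /Phi -hA//; congr F; apply: peq; rewrite !pE /=; ring.
    by rewrite !p1 tr; ring.
  have t2 (l : nat) : vedge E Phi N N l - vedge E Phi N 0 l =
     (lin A (e1 R)).1 * ((Phi 0 (node R N l.+1)).2 - (Phi 0 (node R N l)).2).
    rewrite /vedge nodeN// node0.
    have p1 u : Phi 1 u = Phi 0 u + lin A (e1 R).
      by rewrite /Phi -hA//; congr F; apply: peq; rewrite !pE /=; ring.
    by rewrite !p1 tr; ring.
  rewrite (eq_bigr _ (fun (i : 'I_N) _ => t1 i)) (eq_bigr _ (fun (i : 'I_N) _ => t2 i)).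
  rewrite -!mulr_sumr -(big_mkord xpredT (fun i => (Phi (node R N i.+1) 0).2 - (Phi (node R N i) 0).2)).
  rewrite -(big_mkord xpredT (fun i => (Phi 0 (node R N i.+1)).2 - (Phi 0 (node R N i)).2)).
  rewrite !telescope_sumr// nodeN// node0.
  have p1 : Phi 1 0 = Phi 0 0 + lin A (e1 R).
    by rewrite /Phi -hA//; congr F; apply: peq; rewrite !pE /=; ring.
  have p2 : Phi 0 1 = Phi 0 0 + lin A (e2 R).
    by rewrite /Phi -hA//; congr F; apply: peq; rewrite !pE /=; ring.
  by rewrite p1 p2 /cross !pE; ring.
move: st; rewrite ci dens => st; rewrite (le_trans st)//.
by rewrite ler_pdivrMr// [leRHS]mulrC -ler_pdivrMr// ltW.
Qed.

End Degree.

(** * A smooth vector field transverse to the unstable direction *)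

Section Bump.
Variable R : realType.
Implicit Types (s t x y B : R).

Definition pos x : R := Num.max 0 x.
(** Squaring the positive part makes the truncation differentiable with a Lipschitz derivative,
    [dcutoff]; the Stokes estimate asks for no more. *)
Definition cutoff t : R := pos (1 - t ^+ 2) ^+ 2.
Definition dcutoff t : R := - 4 * t * pos (1 - t ^+ 2).

Lemma pos_ge0 x : 0 <= pos x. Proof. by rewrite /pos le_max lexx. Qed.
Lemma pos_le1 x : x <= 1 -> pos x <= 1. Proof. by move=> h; rewrite /pos ge_max ler01. Qed.

Lemma pos_sqr x y : `|pos x - pos y| <= `|x - y| /\
  `|pos x ^+ 2 - pos y ^+ 2 - 2 * pos y * (x - y)| <= (x - y) ^+ 2.
Proof.
rewrite /pos; case: (leP 0 x) => hx; case: (leP 0 y) => hy; split.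
- by [].
- have -> : x ^+ 2 - y ^+ 2 - 2 * y * (x - y) = (x - y) ^+ 2 by ring.
  by rewrite ger0_norm ?sqr_ge0.
- by rewrite subr0 !ger0_norm ?subr_ge0//; lra.
- rewrite ger0_norm; nra.
- by rewrite sub0r normrN (ger0_norm hy) (ler0_norm (_ : x - y <= 0)); lra.
- have -> : 0 ^+ 2 - y ^+ 2 - 2 * y * (x - y) = y * (y - 2 * x) by ring.
  by rewrite ger0_norm; nra.
- by rewrite subrr normr0.
- by rewrite expr0n subrr mulr0 mul0r subrr normr0 sqr_ge0.
Qed.

Lemma cutoff01 t : 0 <= cutoff t <= 1.
Proof.
have h : pos (1 - t ^+ 2) <= 1 by apply: pos_le1; rewrite gerBl sqr_ge0.
by rewrite /cutoff exprn_ge0 ?pos_ge0//= exprn_ile1 ?pos_ge0.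
Qed.

Lemma cutoff_far t : 1 <= `|t| -> cutoff t = 0 /\ dcutoff t = 0.
Proof.
move=> h; have : 1 <= t ^+ 2 by rewrite -real_normK ?num_real// exprn_ege1.
move=> h2; have z : pos (1 - t ^+ 2) = 0 by rewrite /pos max_l// subr_le0.
by rewrite /cutoff /dcutoff z mulr0 expr0n.
Qed.

Lemma dcutoff_le t : `|dcutoff t| <= 4.
Proof.
have [h|h] := leP 1 `|t|; first by have [_ ->] := cutoff_far h; rewrite normr0.
have h1 : pos (1 - t ^+ 2) <= 1 by apply: pos_le1; rewrite gerBl sqr_ge0.
rewrite /dcutoff normrM (ger0_norm (pos_ge0 _)) normrM normrN normr_nat -[leRHS]mulr1.
by rewrite ler_pM ?mulr_ge0 ?pos_ge0// -[leRHS]mulr1 ler_pM2l// ltW.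
Qed.

Lemma cutoff_taylor B s t : 1 <= B -> `|s| <= B -> `|t| <= B ->
  `|cutoff s - cutoff t| <= 4 * B * `|s - t| /\
  `|cutoff s - cutoff t - dcutoff t * (s - t)| <= (4 * B ^+ 2 + 2) * `|s - t| ^+ 2.
Proof.
move=> B1 hs ht; pose x := 1 - s ^+ 2; pose y := 1 - t ^+ 2.
have [h1 h2] := pos_sqr x y.
have xy : x - y = - (s - t) * (s + t) by rewrite /x /y; ring.
have st : `|s + t| <= 2 * B by have := ler_normD s t; lra.
have lx : pos x <= 1 by apply: pos_le1; rewrite gerBl sqr_ge0.
have ly : pos y <= 1 by apply: pos_le1; rewrite gerBl sqr_ge0.
have px := pos_ge0 x; have py := pos_ge0 y.
have nxy : `|x - y| <= 2 * B * `|s - t|.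
  by rewrite xy normrM normrN mulrC ler_wpM2r.
split.
  rewrite /cutoff -/x -/y subr_sqr normrM.
  have h3 : `|pos x + pos y| <= 2 by rewrite ger0_norm ?addr_ge0//; lra.
  rewrite (le_trans (ler_pM _ _ (le_trans h1 nxy) h3))// le_eqVlt; apply/orP; left.
  by apply/eqP; ring.
have e : cutoff s - cutoff t - dcutoff t * (s - t) =
  (pos x ^+ 2 - pos y ^+ 2 - 2 * pos y * (x - y)) - 2 * pos y * (s - t) ^+ 2.
  by rewrite xy /cutoff /dcutoff -/x -/y; ring.
have sq : `|s - t| ^+ 2 = (s - t) ^+ 2 by rewrite real_normK ?num_real.
rewrite e (le_trans (ler_normB _ _))// [leRHS]mulrDl lerD//.
  rewrite (le_trans h2)// -(@real_normK _ (x - y)) ?num_real//.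
  have -> : 4 * B ^+ 2 * `|s - t| ^+ 2 = (2 * B * `|s - t|) ^+ 2 by ring.
  by rewrite lerXn2r ?nnegrE// (le_trans _ nxy).
have p0 : 0 <= 2 * pos y * (s - t) ^+ 2 by apply: mulr_ge0; [apply: mulr_ge0|exact: sqr_ge0].
rewrite sq (ger0_norm p0).
by rewrite ler_wpM2r ?sqr_ge0// -[leRHS]mulr1 ler_pM2l.
Qed.

Lemma cutoff2_taylor B r s s' t t' : 1 <= B -> `|s| <= B -> `|s'| <= B -> `|t| <= B -> `|t'| <= B ->
  `|s' - s| <= r -> `|t' - t| <= r ->
  `|cutoff s' * cutoff t' - cutoff s * cutoff t| <= 8 * B * r /\
  `|cutoff s' * cutoff t' - cutoff s * cutoff t -
    ((s' - s) * (dcutoff s * cutoff t) + (t' - t) * (cutoff s * dcutoff t))| <= (24 * B ^+ 2 + 4) * r ^+ 2.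
Proof.
move=> B1 hs hs' ht ht' ds dt; have r0 : 0 <= r by exact: le_trans (normr_ge0 _) ds.
have [a1 a2] := cutoff_taylor B1 hs' hs; have [b1 b2] := cutoff_taylor B1 ht' ht.
have /andP[f0 f1] := cutoff01 s; have /andP[g0 g1] := cutoff01 t; have /andP[g0' g1'] := cutoff01 t'.
have sq (d : R) : `|d| <= r -> (4 * B ^+ 2 + 2) * `|d| ^+ 2 <= (4 * B ^+ 2 + 2) * r ^+ 2.
  move=> h; apply: ler_wpM2l; last by rewrite lerXn2r ?nnegrE.
  by apply: addr_ge0 => //; apply: mulr_ge0 => //; exact: sqr_ge0.
have {a1}a1 : `|cutoff s' - cutoff s| <= 4 * B * r by rewrite (le_trans a1)// ler_wpM2l// mulr_ge0//; lra.
have {b1}b1 : `|cutoff t' - cutoff t| <= 4 * B * r by rewrite (le_trans b1)// ler_wpM2l// mulr_ge0//; lra.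
have {a2}a2 := le_trans a2 (sq _ ds); have {b2}b2 := le_trans b2 (sq _ dt).
move: (cutoff s) (cutoff s') (cutoff t) (cutoff t') (dcutoff s) (dcutoff t) f0 f1 g0 g1 g0' g1' a1 a2 b1 b2.
move=> f f' g g' df dg f0 f1 g0 g1 g0' g1' a1 a2 b1 b2.
have m1 x y (z : R) : 0 <= y -> y <= 1 -> `|x| <= z -> `|x * y| <= z.
  by move=> y0 y1 h; rewrite normrM (ger0_norm y0) (le_trans _ h)// ler_piMr.
split.
  have -> : f' * g' - f * g = (f' - f) * g' + (g' - g) * f by ring.
  have := ler_normD ((f' - f) * g') ((g' - g) * f).
  by have := m1 _ _ _ g0' g1' a1; have := m1 _ _ _ f0 f1 b1; lra.
have -> : f' * g' - f * g - ((s' - s) * (df * g) + (t' - t) * (f * dg)) =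
   (f' - f - df * (s' - s)) * g + (g' - g - dg * (t' - t)) * f + (f' - f) * (g' - g) by ring.
rewrite (le_trans (ler_normD _ _))// (le_trans (lerD (ler_normD _ _) (lexx _)))//.
have e1 := m1 _ _ _ g0 g1 a2; have e2 := m1 _ _ _ f0 f1 b2.
have e3 : `|(f' - f) * (g' - g)| <= 4 * B * r * (4 * B * r) by rewrite normrM ler_pM.
rewrite (le_trans (lerD (lerD e1 e2) e3))// le_eqVlt; apply/orP; left.
by apply/eqP; ring.
Qed.

(** Stands in for a partition of unity: [(1 - s) ^ 2 + s ^ 2] is at least 1/2, so the two active
    translates have enough total weight. *)
Lemma cutoff_pair s : 0 <= s <= 1 -> 2^-1 <= cutoff s + cutoff (s - 1).
Proof.
move=> /andP[s0 s1].
have h1 : 1 - s <= pos (1 - s ^+ 2).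
  by rewrite /pos le_max lerD2l lerN2 expr2 ler_piMl// orbT.
have h2 : s <= pos (1 - (s - 1) ^+ 2).
  by rewrite /pos le_max; apply/orP; right; nra.
have h3 : (1 - s) ^+ 2 <= cutoff s by rewrite /cutoff lerXn2r ?nnegrE ?pos_ge0// subr_ge0.
have h4 : s ^+ 2 <= cutoff (s - 1) by rewrite /cutoff lerXn2r ?nnegrE ?pos_ge0.
have := sqr_ge0 (2 * s - 1); move: h3 h4; move: (cutoff s) (cutoff (s - 1)) => a b; nra.
Qed.

End Bump.

Section SmoothField.
Variable R : realType.
Implicit Types (a b c p q v w z : plane R) (i k n N : nat) (s t r : R).

Lemma sum_two (V : zmodType) (f : nat -> V) N i : (i.+1 < N)%N ->
  (forall l, l != i -> l != i.+1 -> f l = 0) -> \sum_(l < N) f l = f i + f i.+1.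
Proof.
move=> iN hf; have iN' : (i < N)%N by exact: ltnW.
rewrite (bigD1 (Ordinal iN')) //= (bigD1 (Ordinal iN)) /=; last first.
  by rewrite -val_eqE /= gtn_eqF.
by rewrite big1 ?addr0// => l /andP[h1 h2]; apply: hf.
Qed.

Definition align a b : plane R := if 0 <= cross a (rot90 b) then b else - b.

Lemma align_eq a b : align a b = b \/ align a b = - b.
Proof. by rewrite /align; case: ifP; [left|right]. Qed.

Lemma align_near (eps : R) a b : `|a| = 1 -> `|b| = 1 -> `|cross a b| <= eps -> `|a - align a b| <= 2 * eps.
Proof.
move=> na nb hab.
suff main b' : `|b'| = 1 -> `|cross a b'| <= eps -> 0 <= cross a (rot90 b') -> `|a - b'| <= 2 * eps.
  rewrite /align; case: ifPn => [|]; first exact: main.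
  rewrite -ltNge => /ltW h; apply: main; rewrite ?normrN// ?crossNr ?normrN//.
  have -> : rot90 (- b) = - rot90 b by apply: peq; rewrite /rot90 !pE.
  by rewrite crossNr oppr_ge0.
move=> nb' hb' pos; have h := cross_rot90 b'; rewrite nb' expr1n in h.
have c0 : 0 < cross b' (rot90 b') by rewrite (lt_le_trans ltr01).
have := cramer_div a (lt0r_neq0 c0); set c := _ / _; set d := _ / _ => ea.
have nr : `|rot90 b'| = 1 by rewrite pnorm_rot90.
have cp : 0 <= c by rewrite divr_ge0// ltW.
have hd : `|d| <= eps.
  by rewrite /d normrM normfV (gtr0_norm c0) ler_pdivrMr// crossC normrN (le_trans hb')// ler_peMr// (le_trans (normr_ge0 _) hb').
clearbody c d.
have k1 := ler_normB a (d *: rot90 b'); rewrite {1}ea addrK !normrZ na nb' nr !mulr1 (ger0_norm cp) in k1.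
have k2 := ler_normD (c *: b') (d *: rot90 b'); rewrite -ea !normrZ na nb' nr !mulr1 (ger0_norm cp) in k2.
have -> : a - b' = (c - 1) *: b' + d *: rot90 b' by rewrite {1}ea scalerBl scale1r addrAC.
rewrite (le_trans (ler_normD _ _))// !normrZ nb' nr !mulr1.
have : `|c - 1| <= `|d| by rewrite ler_norml; apply/andP; split; move: k1 k2; lra.
by move: hd; lra.
Qed.

Variables (e : plane R -> plane R) (L : R).
Hypothesis ne : forall x, `|e x| = 1.
Hypothesis L0 : 0 < L.
Hypothesis eL : forall x y, `|cross (e x) (e y)| <= L * `|x - y|.
Variables (de k0 : R).
Hypothesis de0 : 0 < de.
Hypothesis k00 : 0 < k0.
Hypothesis Lde1 : 32 * (L * de) <= 1.
Hypothesis Lde2 : 64 * (L * de) <= k0.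

Variable q0 : plane R.
Definition knot i k : plane R := (q0.1 + i%:R * de, q0.2 + k%:R * de).

(** The sign of [e] at the knots is propagated along the bottom row, then by [vec] up each
    column. *)
Fixpoint row i : plane R :=
  if i is i'.+1 then align (row i') (e (knot i 0)) else e (knot 0 0).
Fixpoint vec i k : plane R :=
  if k is k'.+1 then align (vec i k') (e (knot i k)) else row i.

Let eps := L * de.

Lemma vec_eq i k : vec i k = e (knot i k) \/ vec i k = - e (knot i k).
Proof. by case: k => [|k]; [case: i => [|i]; [left|]|]; rewrite //=; exact: align_eq. Qed.

Lemma vec_norm i k : `|vec i k| = 1.
Proof. by case: (vec_eq i k) => ->; rewrite ?normrN ne. Qed.

Lemma vec_cross i k i' k' : `|cross (vec i k) (vec i' k')| <= L * `|knot i k - knot i' k'|.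
Proof.
by case: (vec_eq i k) => ->; case: (vec_eq i' k') => ->; rewrite ?crossNl ?crossNr ?normrN; exact: eL.
Qed.

Lemma knot_right i k : `|knot i k - knot i.+1 k| <= de.
Proof.
apply: pnorm_le; rewrite /knot !pE /=; last by rewrite subrr normr0 ltW.
by rewrite (_ : _ - _ = - de) ?normrN ?gtr0_norm// -natr1; ring.
Qed.

Lemma knot_up i k : `|knot i k - knot i k.+1| <= de.
Proof.
apply: pnorm_le; rewrite /knot !pE /=; first by rewrite subrr normr0 ltW.
by rewrite (_ : _ - _ = - de) ?normrN ?gtr0_norm// -natr1; ring.
Qed.

Lemma vec_up i k : `|vec i k - vec i k.+1| <= 2 * eps.
Proof.
apply: align_near; rewrite ?vec_norm// (le_trans (_ : _ <= L * `|knot i k - knot i k.+1|))//.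
  by case: (vec_eq i k) => ->; rewrite ?crossNl ?normrN; exact: eL.
by rewrite ler_pM2l// knot_up.
Qed.

(** Above the bottom row the coherence of neighbouring columns is not built in. A wrong sign would
    make two neighbours almost opposite although both are close to the coherent vectors below them,
    which the bound on [L * de] excludes. *)
Lemma vec_right i k : `|vec i k - vec i.+1 k| <= 2 * eps.
Proof.
elim: k => [|k IH].
  apply: align_near; rewrite ?(vec_norm i 0)// (le_trans (_ : _ <= L * `|knot i 0 - knot i.+1 0|))//.
    by case: (vec_eq i 0) => /= ->; rewrite ?crossNl ?normrN; exact: eL.
  by rewrite ler_pM2l// knot_right.
have h : `|cross (vec i k.+1) (vec i.+1 k.+1)| <= eps.
  by rewrite (le_trans (vec_cross _ _ _ _))// ler_pM2l// knot_right.
have := align_near (vec_norm i k.+1) (vec_norm i.+1 k.+1) h.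
case: (align_eq (vec i k.+1) (vec i.+1 k.+1)) => -> //; rewrite opprK => h2.
have u1 := vec_up i k; have u2 := vec_up i.+1 k; rewrite distrC in u1.
have n2 : `|vec i k.+1 + vec i k.+1| = 2.
  by rewrite -mulr2n normrMn vec_norm.
have k1 := ler_normD (vec i k.+1 + vec i.+1 k.+1) (vec i k.+1 - vec i.+1 k.+1).
have k2 := ler_distD (vec i k) (vec i k.+1) (vec i.+1 k.+1).
have k3 := ler_distD (vec i.+1 k) (vec i k) (vec i.+1 k.+1).
have k4 : vec i k.+1 + vec i.+1 k.+1 + (vec i k.+1 - vec i.+1 k.+1) = vec i k.+1 + vec i k.+1.
  by rewrite addrACA subrr addr0.
rewrite k4 n2 in k1; exfalso; move: Lde1 h2 IH u1 u2 k1 k2 k3; rewrite -/eps.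
move: `|_| `|_| `|_| `|_| `|_| `|_| => ? ? ? ? ? ?; lra.
Qed.

(** The weights sum to at least 1/4, and all values lie within [k0 / 4] of one of absolute value at
    least [k0 / 2]: a quarter of [k0] per unit of weight survives. *)
Lemma convex_transverse (x x' y y' c00 c01 c10 c11 : R) : k0 / 2 <= `|c00| ->
  `|c01 - c00| <= k0 / 4 -> `|c10 - c00| <= k0 / 4 -> `|c11 - c00| <= k0 / 4 ->
  0 <= x -> 0 <= x' -> 0 <= y -> 0 <= y' -> 2^-1 <= y + y' -> 2^-1 <= x + x' ->
  k0 / 16 <= `|x * y * c00 + x * y' * c01 + (x' * y * c10 + x' * y' * c11)|.
Proof.
move=> cv n1 n2 n3 a1 a2 b1 b2 hy hx.
have wt : 4^-1 <= (x + x') * (y + y').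
  by rewrite (_ : 4^-1 = 2^-1 * 2^-1) ?ler_pM// -invfM -natrM.
set S := (X in `|X|).
have SE : S = (x + x') * (y + y') * c00 + (x * y' * (c01 - c00) + x' * y * (c10 - c00) + x' * y' * (c11 - c00)).
  by rewrite /S; ring.
have b (a d : R) : 0 <= a -> `|d| <= k0 / 4 -> `|a * d| <= a * (k0 / 4).
  by move=> h1 h2; rewrite normrM ger0_norm// ler_wpM2l.
have m1 := b _ _ (mulr_ge0 a1 b2) n1; have m2 := b _ _ (mulr_ge0 a2 b1) n2.
have m3 := b _ _ (mulr_ge0 a2 b2) n3.
have w0 : 0 <= (x + x') * (y + y') by rewrite (le_trans _ wt).
have t1 : (x + x') * (y + y') * (k0 / 2) <= `|(x + x') * (y + y') * c00|.
  by rewrite normrM (ger0_norm w0) ler_wpM2l.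
set T := x * y' * (c01 - c00) + x' * y * (c10 - c00) + x' * y' * (c11 - c00) in SE.
have t2 : `|T| <= (x * y' + x' * y + x' * y') * (k0 / 4).
  rewrite /T (le_trans (ler_normD _ _))// [leRHS]mulrDl lerD// (le_trans (ler_normD _ _))//.
  by rewrite [leRHS]mulrDl lerD.
have t3 := ler_normB S T; rewrite {1}SE addrK in t3.
have t4 := ler_wpM2r (ltW k00) wt; have t5 := mulr_ge0 (mulr_ge0 a1 b1) (ltW k00).
by clearbody S T; move: t1 t2 t3 t4 t5; move: `|_ * c00| `|T| `|S| => ? ? ?; lra.
Qed.

Definition gx p : R := (p.1 - q0.1) / de.
Definition gy p : R := (p.2 - q0.2) / de.

Variable N : nat.
(** The bound [N.-2] keeps both knots [i] and [i.+1] of the cell around the point among the [N]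
    available ones. *)
Definition inbox p : Prop := 0 <= gx p <= N.-2%:R /\ 0 <= gy p <= N.-2%:R.
Hypothesis N2 : (2 <= N)%N.

(** A weighted sum that is not normalized: transversality needs a lower bound of the weights, not
    interpolation of [e]. *)
Definition mollified p : plane R :=
  \sum_(i < N) \sum_(k < N) (cutoff (gx p - i%:R) * cutoff (gy p - k%:R)) *: vec i k.
Definition mollx p : plane R :=
  \sum_(i < N) \sum_(k < N) (dcutoff (gx p - i%:R) * cutoff (gy p - k%:R) / de) *: vec i k.
Definition molly p : plane R :=
  \sum_(i < N) \sum_(k < N) (cutoff (gx p - i%:R) * dcutoff (gy p - k%:R) / de) *: vec i k.

Lemma active s : 0 <= s <= N.-2%:R -> exists i, [/\ (i.+1 < N)%N, 0 <= s - i%:R <= 1 &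
  forall l, l != i -> l != i.+1 -> 1 <= `|s - l%:R|].
Proof.
move=> /andP[s0 s1]; have /andP[t1 t2] := truncn_itv s0; exists (Num.truncn s).
have iN : (Num.truncn s <= N.-2)%N by rewrite -(ler_nat R) (le_trans t1).
rewrite -natr1 in t2; split.
- have e2 : N.-2.+2 = N by case: (N) N2 => [|[]].
  by rewrite -e2 !ltnS.
- by rewrite subr_ge0 t1 /=; lra.
move=> l l1 l2; case: (ltngtP l (Num.truncn s)) l1 => // li _.
  have h : (l.+1%:R : R) <= (Num.truncn s)%:R by rewrite ler_nat.
  by rewrite -natr1 in h; rewrite ger0_norm; lra.
have li2 : ((Num.truncn s).+2 <= l)%N by rewrite ltn_neqAle eq_sym l2 li.
have h : (((Num.truncn s).+2)%:R : R) <= l%:R by rewrite ler_nat.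
by rewrite -!natr1 in h; rewrite ler0_norm; lra.
Qed.

Lemma four_terms (f g : R -> R) p : inbox p ->
  (forall s, 1 <= `|s| -> f s = 0) -> (forall s, 1 <= `|s| -> g s = 0) ->
  exists i k, [/\ 0 <= gx p - i%:R <= 1, 0 <= gy p - k%:R <= 1 &
  \sum_(i < N) \sum_(k < N) (f (gx p - i%:R) * g (gy p - k%:R)) *: vec i k =
  (f (gx p - i%:R) * g (gy p - k%:R)) *: vec i k + (f (gx p - i%:R) * g (gy p - k%:R - 1)) *: vec i k.+1 +
  ((f (gx p - i%:R - 1) * g (gy p - k%:R)) *: vec i.+1 k + (f (gx p - i%:R - 1) * g (gy p - k%:R - 1)) *: vec i.+1 k.+1)].
Proof.
move=> [px py] hf hg.
have [i [iN hi oi]] := active px; have [k [kN hk ok]] := active py.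
exists i, k; split => //.
have e1 (s : R) l : s - l.+1%:R = s - l%:R - 1 by rewrite -natr1; ring.
rewrite (@sum_two _ (fun l => \sum_(k < N) (f (gx p - l%:R) * g (gy p - k%:R)) *: vec l k) N i)//.
  rewrite !(@sum_two _ (fun k => (f _ * g (gy p - k%:R)) *: vec _ k) N k)// ?e1//.
    by move=> l l1 l2; rewrite hg ?ok// mulr0 scale0r.
  by move=> l l1 l2; rewrite hg ?ok// mulr0 scale0r.
by move=> l l1 l2; rewrite big1// => m _; rewrite hf ?oi// mul0r scale0r.
Qed.

Lemma four_bound (f g : R -> R) (c : R) p : inbox p -> (forall s, 1 <= `|s| -> f s = 0) ->
  (forall s, 1 <= `|s| -> g s = 0) -> (forall s t, `|f s * g t| <= c) ->
  `|\sum_(i < N) \sum_(k < N) (f (gx p - i%:R) * g (gy p - k%:R)) *: vec i k| <= 4 * c.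
Proof.
move=> bp hf hg hc; have [i [k [_ _ ->]]] := four_terms bp hf hg.
have b s t l m : `|(f s * g t) *: vec l m| <= c by rewrite normrZ vec_norm mulr1.
rewrite (le_trans (ler_normD _ _))// (_ : 4 * c = (c + c) + (c + c)); last by ring.
by apply: lerD; rewrite (le_trans (ler_normD _ _))// lerD.
Qed.

Lemma cutoffM s t : `|cutoff s * cutoff t| <= 1.
Proof.
have /andP[a1 a2] := cutoff01 s; have /andP[b1 b2] := cutoff01 t.
by move: (cutoff s) (cutoff t) a1 a2 b1 b2 => x y a1 a2 b1 b2; rewrite ger0_norm ?mulr_ge0// mulr_ile1.
Qed.

Lemma cutoffdM s t : `|dcutoff s * cutoff t / de| <= 4 / de /\ `|cutoff s * dcutoff t / de| <= 4 / de.
Proof.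
have /andP[a1 a2] := cutoff01 s; have /andP[b1 b2] := cutoff01 t.
have d1 := dcutoff_le s; have d2 := dcutoff_le t.
move: (cutoff s) (cutoff t) (dcutoff s) (dcutoff t) a1 a2 b1 b2 d1 d2 => x y x' y' a1 a2 b1 b2 d1 d2.
rewrite !normrM (ger0_norm a1) (ger0_norm b1) normfV (gtr0_norm de0).
by split; rewrite ler_pM2r ?invr_gt0// -[leRHS]mulr1 1?[_ * `|_|]mulrC ler_pM.
Qed.

Lemma mollified_le p : inbox p -> `|mollified p| <= 4.
Proof.
move=> bp; rewrite -[leRHS]mulr1; apply: four_bound => // [s|s|s t]; last exact: cutoffM.
  by move=> /cutoff_far[].
by move=> /cutoff_far[].
Qed.

Lemma mollx_le p : inbox p -> `|mollx p| <= 4 * (4 / de) /\ `|molly p| <= 4 * (4 / de).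
Proof.
move=> bp; split.
  have := @four_bound (@dcutoff R) (fun t => cutoff t / de) (4 / de) p bp.
  rewrite /mollx; under [X in _ -> _ -> _ -> `|X| <= _]eq_bigr => i _ do under eq_bigr => k _ do rewrite mulrA.
  apply=> [s /cutoff_far[]//|s /cutoff_far[-> _]|s t]; first by rewrite mul0r.
  by rewrite mulrA; have [] := cutoffdM s t.
have := @four_bound (@cutoff R) (fun t => dcutoff t / de) (4 / de) p bp.
rewrite /molly; under [X in _ -> _ -> _ -> `|X| <= _]eq_bigr => i _ do under eq_bigr => k _ do rewrite mulrA.
apply=> [s /cutoff_far[]//|s /cutoff_far[_ ->]|s t]; first by rewrite mul0r.
by rewrite mulrA; have [] := cutoffdM s t.
Qed.

Lemma mollified_transverse p w : inbox p -> `|w| = 1 -> k0 <= `|cross w (e p)| ->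
  k0 / 16 <= `|cross (mollified p) w|.
Proof.
move=> bp nw hw.
have hf (s : R) : 1 <= `|s| -> cutoff s = 0 by move=> /cutoff_far[].
rewrite /mollified; have [i [k [hs ht ->]]] := four_terms bp hf hf.
have pk : `|knot i k - p| <= de.
  have de_ge := ltW de0.
  have kx : (knot i k - p).1 = - (gx p - i%:R) * de :> R.
    by rewrite /gx /knot !pE /=; field; exact: lt0r_neq0.
  have ky : (knot i k - p).2 = - (gy p - k%:R) * de :> R.
    by rewrite /gy /knot !pE /=; field; exact: lt0r_neq0.
  move/andP: hs => [s1 s2]; move/andP: ht => [t1 t2].
  by apply: pnorm_le; rewrite ?kx ?ky normrM normrN (gtr0_norm de0) ger0_norm// ler_piMl.
have cv : k0 / 2 <= `|cross (vec i k) w|.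
  have [c [d [ev hd hc1 hc2]]] := direction_near (vec_norm i k) (ne p).
  have d1 : `|d| <= eps.
    rewrite (le_trans hd)// (le_trans (_ : _ <= L * `|knot i k - p|))//; last by rewrite ler_pM2l.
    by case: (vec_eq i k) => ->; rewrite ?crossNl ?normrN; exact: eL.
  have t1 : k0 * (1 - `|d|) <= `|c * cross (e p) w|.
    rewrite normrM mulrC (crossC (e p)) normrN.
    have [j|j] := leP 0 (1 - `|d|); first by rewrite ler_pM// ltW.
    by rewrite (@le_trans _ _ 0) ?mulr_ge0// mulr_le0_ge0// ltW.
  have t2 : `|d * cross (rot90 (e p)) w| <= 2 * `|d|.
    rewrite normrM mulrC ler_wpM2r// (le_trans (norm_cross _ _))//.
    by rewrite pnorm_rot90 ne nw !mulr1.
  have := ler_normB (cross (vec i k) w) (d * cross (rot90 (e p)) w).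
  rewrite {1}ev crossDl !crossZl addrK => t3.
  have := ler_wpM2l (ltW k00) Lde1; rewrite -/eps => t4.
  have t5 := ler_wpM2l (ltW k00) d1.
  by move: t1 t2 t3 t4 t5 d1 Lde2; rewrite -/eps; lra.
have near c : `|vec i k - c| <= 4 * eps -> `|cross c w - cross (vec i k) w| <= k0 / 4.
  move=> h; have -> : cross c w - cross (vec i k) w = cross (c - vec i k) w by rewrite /cross !pE; ring.
  rewrite (le_trans (norm_cross _ _))// nw mulr1 distrC.
  have h' : `|vec i k - c| <= 4 * (L * de) by exact: h.
  by move: h' Lde2; move: (`|_ - c|) (L * de) => X Y; move: k00; lra.
have e0 : 0 <= eps by rewrite mulr_ge0// ltW.
have n1 := near (vec i k.+1) ltac:(by rewrite (le_trans (vec_up i k))// ler_wpM2r// ler_nat).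
have n2 := near (vec i.+1 k) ltac:(by rewrite (le_trans (vec_right i k))// ler_wpM2r// ler_nat).
have n3 : `|cross (vec i.+1 k.+1) w - cross (vec i k) w| <= k0 / 4.
  apply: near; have := ler_distD (vec i k.+1) (vec i k) (vec i.+1 k.+1).
  by have := vec_up i k; have := vec_right i k.+1; lra.
rewrite !crossDl !crossZl.
have := cutoff_pair hs; have := cutoff_pair ht.
have /andP[a1 _] := cutoff01 (gx p - i%:R); have /andP[a2 _] := cutoff01 (gx p - i%:R - 1).
have /andP[b1 _] := cutoff01 (gy p - k%:R); have /andP[b2 _] := cutoff01 (gy p - k%:R - 1).
move: cv n1 n2 n3 a1 a2 b1 b2.
move: (cross (vec i k) w) (cross (vec i k.+1) w) (cross (vec i.+1 k) w) (cross (vec i.+1 k.+1) w).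
move: (cutoff _) (cutoff _) (cutoff _) (cutoff _) => x x' y y' c00 c01 c10 c11.
exact: convex_transverse.
Qed.

Lemma mollified_taylor : exists2 C : R, 0 < C & forall p q, inbox p -> inbox q ->
  `|mollified q - mollified p| <= C * `|q - p| /\
  `|mollified q - mollified p - (((q - p).1 : R) *: mollx p + ((q - p).2 : R) *: molly p)| <= C * `|q - p| ^+ 2.
Proof.
pose B : R := N%:R; have B1 : 1 <= B by rewrite ler1n (leq_trans _ N2).
have B0 : 0 < B by rewrite (lt_le_trans ltr01).
pose C1 := 8 * B / de; pose C2 := (24 * B ^+ 2 + 4) / de ^+ 2.
have C10 : 0 < C1 by rewrite divr_gt0// mulr_gt0.
have C20 : 0 < C2 by rewrite divr_gt0 ?exprn_gt0// addr_gt0// mulr_gt0// exprn_gt0.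
exists (N%:R * (N%:R * (C1 + C2))); first by rewrite !mulr_gt0// addr_gt0.
have far s (l : nat) : 0 <= s <= N.-2%:R -> (l < N)%N -> `|s - l%:R| <= B.
  move=> /andP[s0 s1] lN; have h1 : (l%:R : R) <= N%:R by rewrite ler_nat ltnW.
  have h2 : (N.-2%:R : R) <= N%:R by rewrite ler_nat (leq_trans (leq_pred _) (leq_pred _)).
  have h3 : 0 <= (l%:R : R) by [].
  by rewrite ler_norml /B; apply/andP; split; lra.
move=> p q [px py] [qx qy].
pose r := `|q - p| / de; have r0 : 0 <= r by rewrite divr_ge0// ltW.
have gxB : gx q - gx p = (q - p).1 / de by rewrite /gx !pE /=; ring.
have gyB : gy q - gy p = (q - p).2 / de by rewrite /gy !pE /=; ring.
have dx l : `|(gx q - l%:R) - (gx p - l%:R)| <= r.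
  by rewrite opprB addrA subrK gxB normrM normfV (gtr0_norm de0) ler_pM2r ?invr_gt0// norm1_le.
have dy l : `|(gy q - l%:R) - (gy p - l%:R)| <= r.
  by rewrite opprB addrA subrK gyB normrM normfV (gtr0_norm de0) ler_pM2r ?invr_gt0// norm2_le.
have tay i k (iN : (i < N)%N) (kN : (k < N)%N) := cutoff2_taylor B1 (far _ _ px iN) (far _ _ qx iN) (far _ _ py kN) (far _ _ qy kN) (dx i) (dy k).
have e1 : 8 * B * r = C1 * `|q - p| by rewrite /C1 /r; ring.
have e2 : (24 * B ^+ 2 + 4) * r ^+ 2 = C2 * `|q - p| ^+ 2.
  by rewrite /C2 /r; field; exact: lt0r_neq0.
have n0 := normr_ge0 (q - p).
split.
  rewrite /mollified -sumrB -!mulrA; apply: sum_const_le => i.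
  rewrite -sumrB; apply: sum_const_le => k.
  rewrite -scalerBl normrZ vec_norm mulr1.
  have [h _] := tay i k (ltn_ord i) (ltn_ord k).
  by rewrite (le_trans h)// e1 ler_wpM2r// lerDl ltW.
rewrite /mollified /mollx /molly !scaler_sumr -sumrB -big_split /= -sumrB -!mulrA; apply: sum_const_le => i.
rewrite !scaler_sumr -sumrB -big_split /= -sumrB; apply: sum_const_le => k.
rewrite !scalerA -scalerBl -scalerDl -scalerBl normrZ vec_norm mulr1.
have [_ h] := tay i k (ltn_ord i) (ltn_ord k).
apply: (@le_trans _ _ (C2 * `|q - p| ^+ 2)); last by rewrite ler_wpM2r ?exprn_ge0// lerDr ltW.
rewrite -e2 (le_trans _ h)// le_eqVlt; apply/orP; left; apply/eqP; congr (`|_|).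
have -> : gx q - i%:R - (gx p - i%:R) = (q - p).1 / de by rewrite -gxB; ring.
have -> : gy q - k%:R - (gy p - k%:R) = (q - p).2 / de by rewrite -gyB; ring.
by ring.
Qed.

End SmoothField.

(** The invariant field is only Lipschitz up to sign, whereas Stokes' formula needs a differentiable
    one. The order of quantifiers matters: images under iterates leave every ball, so [r] is
    arbitrary, and [C] may grow with it through the number of knots; [T] may not, and does not,
    since only four knots act at each point. *)
Lemma smooth_transverse_field (R : realType) (e : plane R -> plane R) (L k0 : R) :
  (forall x, `|e x| = 1) -> 0 < L -> (forall x y, `|cross (e x) (e y)| <= L * `|x - y|) -> 0 < k0 ->
  exists2 T : R, 0 < T & forall r : R, exists (E : plane R -> plane R) (Df : plane R -> plane R -> plane R) (tau : plane R -> R), exists2 C : R, 0 < C &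
    (forall z a c, cross (Df z a) c - cross (Df z c) a = tau z * cross a c) /\
    forall p, `|p| <= r ->
    [/\ `|E p| <= 4, `|tau p| <= T,
        forall q, `|q| <= r -> `|E q - E p| <= C * `|q - p| /\
           `|E q - E p - Df p (q - p)| <= C * `|q - p| ^+ 2 &
        forall w, `|w| = 1 -> k0 <= `|cross w (e p)| -> k0 / 16 <= `|cross (E p) w|].
Proof.
move=> ne L0 eL k00.
have [de [de0 d1 d2]] : exists de : R, [/\ 0 < de, 32 * (L * de) <= 1 & 64 * (L * de) <= k0].
  near (0 : R)^'+ => a.
  have i1 : 0 < a by near: a; exact: nbhs_right_gt.
  have i2 : 32 * L * a <= 1 by near: a; exact: near_small.
  have i3 : 64 * L * a <= k0 by near: a; exact: near_small.
  by exists a; rewrite !mulrA.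
exists (2 * (4 * (4 / de))); first by apply: mulr_gt0 => //; apply: mulr_gt0 => //; apply: divr_gt0.
move=> r; pose q0 : plane R := (- r, - r).
have [N0 _ hN0] := nat_gt (2 * r / de); pose N := N0.+2.
have N2 : (2 <= N)%N by [].
have inb p : `|p| <= r -> inbox de q0 N p.
  move=> hp.
  have key (x : R) : `|x| <= r -> 0 <= (x - - r) / de <= N.-2%:R.
    rewrite ler_norml => /andP[x1 x2]; rewrite divr_ge0 ?(ltW de0) ?opprK//=; last by lra.
    by rewrite ler_pdivrMr// (le_trans (_ : _ <= 2 * r))//; [lra|rewrite -ler_pdivrMr// ltW].
  by split; apply: key; rewrite (le_trans _ hp)// ?norm1_le ?norm2_le.
have [C C0 hC] := mollified_taylor ne de0 q0 N2.
pose X := mollx e de q0 N; pose Z := molly e de q0 N.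
exists (mollified e de q0 N), (fun p v => (v.1 : R) *: X p + (v.2 : R) *: Z p), (fun p => (X p).1 + (Z p).2), C => //.
split=> [z a c|p hp]; first by rewrite /cross !pE; ring.
have bp := inb p hp; have [hX hZ] := mollx_le ne de0 N2 bp.
split; first exact: (mollified_le ne N2 bp).
- rewrite (le_trans (ler_normD _ _))// (_ : 2 * _ = 4 * (4 / de) + 4 * (4 / de)); last by ring.
  by rewrite lerD// ?(le_trans (norm1_le _))// (le_trans (norm2_le _)).
- by move=> q hq; exact: hC bp (inb q hq).
- by move=> w nw hw; exact: (mollified_transverse ne L0 eL de0 k00 d1 d2 N2 bp nw hw).
Unshelve. all: by end_near. Qed.

(** * Growth of the linear part *)

Section Homotopy.
Variable R : realType.
Implicit Types (u v w x y z p q : plane R) (h s t r : R).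

Lemma sign_constant (f : R -> R) (b : R) : 0 < b -> {within `[0, 1], continuous f} ->
  (forall t, 0 <= t <= 1 -> b <= `|f t|) ->
  (forall t, 0 <= t <= 1 -> b <= f t) \/ (forall t, 0 <= t <= 1 -> b <= - f t).
Proof.
move=> b0 cf hf.
have nz t : 0 <= t <= 1 -> f t != 0 by move=> ht; rewrite -normr_gt0 (lt_le_trans b0)// hf.
have pos0 : 0 <= (0 : R) <= 1 by rewrite lexx ler01.
have ivt t : 0 <= t <= 1 -> 0 < f 0 * f t.
  move=> /andP[t0 t1]; rewrite ltNge; apply/negP => h.
  have [||c hc fc] := @IVT R f 0 t 0 t0.
  - apply: continuous_subspaceW cf => x /=; rewrite !in_itv /= => /andP[x0 xt].
    by rewrite x0 (le_trans xt).
  - rewrite ge_min le_max; have [h0|h0] := ltP 0 (f 0).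
      by rewrite pmulr_rle0// in h; rewrite h orbT (ltW h0).
    have h0' : f 0 < 0 by rewrite lt_neqAle nz.
    by rewrite nmulr_rle0// in h; rewrite h orbT.
  move: hc; rewrite in_itv /= => /andP[c0 ct].
  by have /eqP := nz c ltac:(by rewrite c0 (le_trans ct)).
have [f0|f0] := ltP 0 (f 0); [left|right] => t ht; have := ivt t ht; have := hf t ht.
  by move=> h1; rewrite pmulr_rgt0// => h2; rewrite gtr0_norm in h1.
have {}f0 : f 0 < 0 by rewrite lt_neqAle nz.
by move=> h1; rewrite nmulr_rgt0// => h2; rewrite ltr0_norm in h1.
Qed.

Variables (H G : plane R -> plane R) (M C M' C' : R) (v : plane R).
Hypothesis cH : C11 H M C.
Hypothesis cG : C11 G M' C'.

Let beta t : plane R := H (t *: v).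
Let chord : plane R := H v - H 0.
Let phi t s : plane R := (1 - s) *: beta t + s *: (H 0 + t *: chord).
Let dphi t s : plane R := (1 - s) *: D H (t *: v) v + s *: chord.
Let ephi t : plane R := H 0 + t *: chord - beta t.

(** In the application [H] and [G] are both iterates of [F], so [G] is no inverse here: the curve
    [H (t *: v)] is deformed linearly to its chord, with fixed ends, and the result is pushed
    forward by [G]. *)
Definition homotopy t s : plane R := G (phi t s).
Definition homotopy1 t s : plane R := D G (phi t s) (dphi t s).
Definition homotopy2 t s : plane R := D G (phi t s) (ephi t).

Let a : R := M * `|v|.
Let a0 : 0 <= a. Proof. by have [_ M0 _ _ _] := cH; rewrite mulr_ge0// ltW. Qed.

Let nchord : `|chord| <= a.
Proof. by have := F_lip cH 0 v; rewrite subr0. Qed.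

Let nbeta t s : `|beta s - beta t| <= a * `|s - t|.
Proof.
rewrite (le_trans (F_lip cH (t *: v) (s *: v)))// -scalerBl normrZ.
by rewrite /a mulrA mulrAC.
Qed.

Let ndphi t s : 0 <= s <= 1 -> `|dphi t s| <= a.
Proof.
move=> /andP[s0 s1]; rewrite (le_trans (ler_normD _ _))// !normrZ (ger0_norm s0) ger0_norm ?subr_ge0//.
have [_ _ _ hM _] := cH; have h1 := ler_wpM2l (_ : 0 <= 1 - s) (hM (t *: v) v).
have h2 := ler_wpM2l s0 nchord.
have := h1 ltac:(by rewrite subr_ge0); rewrite -/a; lra.
Qed.

Let nephi t : 0 <= t <= 1 -> `|ephi t| <= 2 * a.
Proof.
move=> /andP[t0 t1].
have -> : ephi t = t *: chord - (beta t - beta 0).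
  have <- : H 0 = beta 0 by rewrite /beta scale0r.
  by apply: peq; rewrite /ephi !pE; ring.
rewrite (le_trans (ler_normB _ _))// normrZ (ger0_norm t0).
have := nbeta 0 t; rewrite subr0 (ger0_norm t0) => h.
have h1 := ler_wpM2l t0 nchord; have h2 := ler_wpM2r a0 t1.
by rewrite [t * a]mulrC in h1 h2; move: h h1 h2; lra.
Qed.

Lemma homotopy_side s : homotopy 0 s = homotopy 0 0 /\ homotopy 1 s = homotopy 1 0.
Proof.
rewrite /homotopy /phi /beta /chord !scale0r !scale1r addr0 [H 0 + _]addrC subrK.
by split; congr G; apply: peq; rewrite !pE; ring.
Qed.

Lemma homotopy_bottom t : homotopy t 0 = G (H (t *: v)) /\
  homotopy1 t 0 = D G (H (t *: v)) (D H (t *: v) v).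
Proof. by rewrite /homotopy /homotopy1 /phi /dphi !scale0r !addr0 subr0 !scale1r. Qed.

Lemma homotopy_top t : homotopy1 t 1 = D G (H 0 + t *: (H v - H 0)) (H v - H 0).
Proof. by rewrite /homotopy1 /phi /dphi !subrr !scale0r !add0r !scale1r. Qed.

(** The area swept by the linear homotopy depends on [H] and [v] alone, and [G] multiplies it by its
    Jacobian. *)
Lemma homotopy_area (j : R) t s : (forall x u w, cross (D G x u) (D G x w) = j * cross u w) ->
  0 <= t <= 1 -> 0 <= s <= 1 -> `|cross (homotopy1 t s) (homotopy2 t s)| <= `|j| * (4 * a ^+ 2).
Proof.
move=> hj ht hs; rewrite hj normrM ler_wpM2l// (le_trans (norm_cross _ _))//.
have -> : 4 * a ^+ 2 = 2 * (a * (2 * a)) by ring.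
by rewrite ler_pM2l// ler_pM// ?ndphi// nephi.
Qed.

Let phi_lip t s t' s' h : 0 <= t <= 1 -> 0 <= s <= 1 -> 0 <= t' <= 1 -> 0 <= s' <= 1 ->
  `|t' - t| <= h -> `|s' - s| <= h -> `|phi t' s' - phi t s| <= 4 * a * h.
Proof.
move=> ht /andP[_ _] _ /andP[s0 s1] h1 h2.
have -> : phi t' s' - phi t s = (1 - s') *: (beta t' - beta t) + s' *: ((t' - t) *: chord) + (s' - s) *: ephi t.
  by rewrite /phi /ephi; apply: peq; rewrite !pE; ring.
have h0 : 0 <= h by exact: le_trans (normr_ge0 _) h1.
have k1 : `|(1 - s') *: (beta t' - beta t)| <= 1 * (a * h).
  by rewrite normrZ ler_pM// ?ger0_norm ?subr_ge0 ?gerBl// (le_trans (nbeta _ _))// ler_wpM2l.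
have k2 : `|s' *: ((t' - t) *: chord)| <= 1 * (h * a).
  by rewrite !normrZ ger0_norm// ler_pM// ler_pM.
have k3 : `|(s' - s) *: ephi t| <= h * (2 * a) by rewrite normrZ ler_pM// nephi.
rewrite (le_trans (ler_normD _ _))// (le_trans (lerD (ler_normD _ _) (lexx _)))//.
rewrite (le_trans (lerD (lerD k1 k2) k3))// le_eqVlt; apply/orP; left.
by apply/eqP; ring.
Qed.

Lemma homotopy_regular : exists r k : R, [/\ 0 < k,
  forall t s, 0 <= t <= 1 -> 0 <= s <= 1 ->
    [/\ `|homotopy t s| <= r, `|homotopy1 t s| <= k & `|homotopy2 t s| <= k] &
  forall t s t' s' h, 0 <= t <= 1 -> 0 <= s <= 1 -> 0 <= t' <= 1 -> 0 <= s' <= 1 ->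
    `|t' - t| <= h -> `|s' - s| <= h ->
    `|homotopy t' s' - homotopy t s - ((t' - t) *: homotopy1 t s + (s' - s) *: homotopy2 t s)| <= k * h ^+ 2].
Proof.
have [_ M0' C0' hM' _] := cG; have [_ M0 C0 hM _] := cH.
pose b := C * `|v| ^+ 2; have b0 : 0 <= b by rewrite mulr_ge0 ?exprn_ge0// ltW.
exists (`|G (phi 0 0)| + M' * (4 * a * 1)), (1 + C' * (4 * a) ^+ 2 + M' * (b + 2 * a)).
have c1 : 0 <= C' * (4 * a) ^+ 2 by rewrite mulr_ge0 ?exprn_ge0 ?mulr_ge0// ltW.
have c2 : 0 <= M' * b by rewrite mulr_ge0// ltW.
have c3 : 0 <= M' * a by rewrite mulr_ge0// ltW.
split; first by move: c1 c2 c3; lra.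
- move=> t s ht hs; have z0 : 0 <= (0 : R) <= 1 by rewrite lexx ler01.
  have n01 (x : R) : 0 <= x <= 1 -> `|x - 0| <= 1 by move=> /andP[x0 x1]; rewrite subr0 ger0_norm.
  split.
  + have h1 := F_lip cG (phi 0 0) (phi t s).
    have h2 := ler_wpM2l (ltW M0') (phi_lip z0 z0 ht hs (n01 t ht) (n01 s hs)).
    have := ler_normD (G (phi t s) - G (phi 0 0)) (G (phi 0 0)); rewrite subrK /homotopy.
    by move: h1 h2; lra.
  + have h1 := hM' (phi t s) (dphi t s); have h2 := ler_wpM2l (ltW M0') (ndphi t hs).
    by rewrite /homotopy1 (le_trans h1)//; move: c1 c2 c3 h2; lra.
  have h1 := hM' (phi t s) (ephi t); have h2 := ler_wpM2l (ltW M0') (nephi ht).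
  by rewrite /homotopy2 (le_trans h1)//; move: c1 c2 c3 h2; lra.
move=> t s t' s' h ht hs ht' hs' h1 h2.
have h0 : 0 <= h by exact: le_trans (normr_ge0 _) h1.
set z := phi t s; set z' := phi t' s'.
have g1 := F_taylor cG z z'; have g2 := phi_lip ht hs ht' hs' h1 h2.
rewrite -/z -/z' in g2.
have g3 : `|z' - z - ((t' - t) *: dphi t s + (s' - s) *: ephi t)| <= (b + 2 * a) * h ^+ 2.
  have -> : z' - z - ((t' - t) *: dphi t s + (s' - s) *: ephi t) =
    (1 - s') *: (H (t' *: v) - H (t *: v) - D H (t *: v) (t' *: v - t *: v)) +
    ((t' - t) * (s' - s)) *: (chord - D H (t *: v) v).
    rewrite -scalerBl linearZ /z' /z /phi /dphi /ephi /beta; move: (D H _ v) => w.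
    by apply: peq; rewrite !pE; ring.
  have k1 := F_taylor cH (t *: v) (t' *: v).
  have k2 : C * `|t' *: v - t *: v| ^+ 2 <= b * h ^+ 2.
    rewrite -scalerBl normrZ /b -mulrA ler_pM2l// -exprMn lerXn2r ?nnegrE ?mulr_ge0//.
    by rewrite mulrC ler_wpM2l.
  have /andP[s0 s1] := hs'.
  have k3 : `|chord - D H (t *: v) v| <= 2 * a.
    by have := ler_normB chord (D H (t *: v) v); have := hM (t *: v) v; have := nchord; rewrite -/a; lra.
  rewrite (le_trans (ler_normD _ _))// [leRHS]mulrDl !normrZ lerD//.
    rewrite (le_trans _ k2)// (le_trans _ k1)// ler_piMl// ger0_norm ?subr_ge0// gerBl//.
  by rewrite [leRHS]mulrC expr2 ler_pM ?mulr_ge0// ler_pM.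
have -> : homotopy t' s' - homotopy t s - ((t' - t) *: homotopy1 t s + (s' - s) *: homotopy2 t s) =
   (G z' - G z - D G z (z' - z)) + D G z (z' - z - ((t' - t) *: dphi t s + (s' - s) *: ephi t)).
  have el : D G z ((t' - t) *: dphi t s + (s' - s) *: ephi t) =
    (t' - t) *: homotopy1 t s + (s' - s) *: homotopy2 t s by rewrite linearD !linearZ.
  by rewrite (linearB (D G z) (z' - z)) el addrA subrK.
rewrite (le_trans (ler_normD _ _))//.
have k1 : C' * `|z' - z| ^+ 2 <= C' * (4 * a) ^+ 2 * h ^+ 2.
  by rewrite -mulrA ler_pM2l// -exprMn lerXn2r ?nnegrE// mulr_ge0// mulr_ge0.
have k2 := le_trans (hM' z _) (ler_wpM2l (ltW M0') g3).
rewrite (le_trans (lerD (le_trans g1 k1) k2))// -subr_ge0.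
have -> : (1 + C' * (4 * a) ^+ 2 + M' * (b + 2 * a)) * h ^+ 2 - (C' * (4 * a) ^+ 2 * h ^+ 2 + M' * ((b + 2 * a) * h ^+ 2)) = h ^+ 2 by ring.
exact: exprn_ge0.
Qed.

End Homotopy.

(** * Stretching of a segment transverse to the stable direction *)

Section ChordBound.
Variable R : realType.
Implicit Types (u v w x y z p q : plane R) (h s t r : R).
Variables (F G : plane R -> plane R) (M C M' C' j : R).
Hypothesis cF : C11 F M C.
Hypothesis cG : C11 G M' C'.
Hypothesis FK : cancel F G.
Hypothesis GK : cancel G F.
Hypothesis hj : forall x u v, cross (D F x u) (D F x v) = j * cross u v.
Variables (eu es : plane R -> plane R) (K th k0 Ls kU : R).
Hypothesis hfr : hyperbolic_frame F G eu es K th k0.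
Hypothesis Ls0 : 0 < Ls.
Hypothesis hLs : forall x y, `|cross (es x) (es y)| <= Ls * `|x - y|.
Hypothesis kU0 : 0 < kU.
Local Notation U := (ugrowth F eu).
Hypothesis hU : forall n x y, U n x <= kU * U n y.

Let dF : forall x, differentiable F x. Proof. by case: cF. Qed.
Let dG : forall x, differentiable G x. Proof. by case: cG. Qed.
Let K1 : 1 <= K. Proof. by case: hfr => -[]. Qed.
Let K0 : 0 < K. Proof. exact: lt_le_trans ltr01 K1. Qed.
Let th0 : 0 < th. Proof. by case: hfr => -[_ /andP[]]. Qed.
Let th1 : th < 1. Proof. by case: hfr => -[_ /andP[]]. Qed.
Let k00 : 0 < k0. Proof. by case: hfr => -[]. Qed.
Let neu x : `|eu x| = 1. Proof. by case: hfr => _ /(_ x)[]. Qed.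
Let nes x : `|es x| = 1. Proof. by case: hfr => _ /(_ x)[]. Qed.
Let kus x : k0 <= `|cross (eu x) (es x)|. Proof. by case: hfr => _ /(_ x)[]. Qed.

Definition growth_bound : R := 2 / k0 * (1 + K ^+ 2) * kU.

Lemma growth_bound_gt0 : 0 < growth_bound.
Proof. by rewrite /growth_bound !mulr_gt0 ?invr_gt0// addr_gt0// exprn_gt0. Qed.

Lemma D_iter_ugrowth n x v : `|D (iter n F) x v| <= growth_bound * U n 0 * `|v|.
Proof.
rewrite (le_trans (D_iter_upper cF cG FK GK hfr n x v))// ler_wpM2r// /growth_bound -!mulrA.
by rewrite !ler_wpM2l ?invr_ge0 ?addr_ge0 ?exprn_ge0 ?hU// ltW.
Qed.

Lemma ugrowth_lower n x : 1 <= K * th ^+ n * U n x.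
Proof. exact: (frame_grow dF dG FK GK hfr n x). Qed.

Lemma ugrowth_gt0 n x : 0 < U n x.
Proof.
have h := ugrowth_lower n x; rewrite lt_neqAle ugrowth_ge0 andbT eq_sym; apply/eqP => z.
by rewrite z mulr0 ler10 in h.
Qed.

Lemma ugrowthD n m x : U (n + m) x = U m x * U n (iter m F x).
Proof.
rewrite /ugrowth D_iterD//.
have [c ec nc] := cross0_parallel (frame_u dF dG FK GK hfr m x) (neu _).
by rewrite -nc ec linearZ normrZ.
Qed.

(** Up to the angle, [|j| ^ n] is the product of [U n 0] and the norm of the image of [es 0], which
    is at most [K * th ^ n]. *)
Lemma jacobian_decay n : `|j| ^+ n <= 2 * K / k0 * th ^+ n * U n 0.
Proof.
have := D_iter_cross n 0 (eu 0) (es 0) dF hj => e.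
have h1 := norm_cross (D (iter n F) 0 (eu 0)) (D (iter n F) 0 (es 0)).
have [_ _ hs _ _] := hfr.
have h2 : `|j| ^+ n * k0 <= 2 * (U n 0 * (K * th ^+ n)).
  rewrite (le_trans (_ : _ <= `|j ^+ n * cross (eu 0) (es 0)|))//.
    by rewrite normrM normrX ler_wpM2l ?exprn_ge0.
  by rewrite -e (le_trans h1)// ler_pM2l// ler_wpM2l.
rewrite -ler_pdivlMr// in h2; rewrite (le_trans h2)// le_eqVlt; apply/orP; left.
by apply/eqP; ring.
Qed.

Lemma component_lower v x : `|v| / 2 * k0 <= `|cross v (es x)| ->
  exists a b, [/\ v = a *: eu x + b *: es x, `|v| * k0 / 4 <= `|a| & `|b| <= 2 * `|v| / k0].
Proof.
move=> hv; have c0 : 0 < `|cross (eu x) (es x)| by rewrite (lt_le_trans k00).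
have c00 : cross (eu x) (es x) != 0 by rewrite -normr_gt0.
have c2 : `|cross (eu x) (es x)| <= 2.
  by have := norm_cross (eu x) (es x); rewrite neu nes !mulr1.
eexists; eexists; split; first exact: cramer_div.
  rewrite normrM normfV ler_pdivlMr// (le_trans _ hv)//.
  have : 0 <= `|v| * k0 / 4 by rewrite !mulr_ge0// ltW.
  by move=> h; have := ler_wpM2l h c2; lra.
rewrite normrM normfV ler_pM ?invr_ge0//; last by rewrite lef_pV2.
by have := norm_cross (eu x) v; rewrite neu mul1r.
Qed.

(** The unstable component of [v] is stretched by [U n x] in a direction transverse to [E]; the
    stable component contributes a bounded error. *)
Lemma image_transverse (E : plane R -> plane R) n x v : `|v| / 2 * k0 <= `|cross v (es x)| ->
  (forall y, y = iter n F x -> `|E y| <= 4 /\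
     (forall w, `|w| = 1 -> k0 <= `|cross w (es y)| -> k0 / 16 <= `|cross (E y) w|)) ->
  `|v| * k0 ^+ 2 / 64 * U n x - 16 * K * `|v| / k0 <= `|cross (E (iter n F x)) (D (iter n F) x v)|.
Proof.
move=> hv hE; have [nE tE] := hE _ erefl.
have [a [b [ev ha hb]]] := component_lower hv.
have [c ec nc] := cross0_parallel (frame_u dF dG FK GK hfr n x) (neu _).
have [_ _ hs _ _] := hfr.
have t1 : `|v| * k0 ^+ 2 / 64 * U n x <= `|a * cross (E (iter n F x)) (D (iter n F) x (eu x))|.
  rewrite ec crossZr !normrM nc -/(U n x).
  have h := tE (eu (iter n F x)) (neu _) (kus _).
  rewrite (_ : _ * U n x = `|v| * k0 / 4 * (U n x * (k0 / 16))); last by field.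
  by rewrite ler_pM ?mulr_ge0 ?ugrowth_ge0 ?(ltW k00)// ler_wpM2l ?ugrowth_ge0.
have t2 : `|b * cross (E (iter n F x)) (D (iter n F) x (es x))| <= 16 * K * `|v| / k0.
  rewrite normrM (_ : 16 * _ * _ / _ = 2 * `|v| / k0 * (2 * (4 * K))); last by ring.
  rewrite ler_pM// (le_trans (norm_cross _ _))// ler_pM2l// ler_pM// (le_trans (hs n x))//.
  by rewrite ger_pMr// exprn_ile1// ltW.
have -> : cross (E (iter n F x)) (D (iter n F) x v) =
  a * cross (E (iter n F x)) (D (iter n F) x (eu x)) + b * cross (E (iter n F x)) (D (iter n F) x (es x)).
  by rewrite {1}ev linearD !linearZ crossDr !crossZr.
have := ler_normB (a * cross (E (iter n F x)) (D (iter n F) x (eu x)) + b * cross (E (iter n F x)) (D (iter n F) x (es x)))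
  (b * cross (E (iter n F x)) (D (iter n F) x (es x))).
rewrite addrK; move: t1 t2; move: `|a * _| `|b * _| `|_ + _| => ? ? ?; lra.
Qed.

(** [v] is a multiple of [eu 0] so short that [es] hardly turns along the segment, which keeps half
    of the angle available at 0. *)
Lemma transverse_segment : exists v, [/\ v != 0 &
  forall t, 0 <= t <= 1 -> `|v| / 2 * k0 <= `|cross v (es (t *: v))|].
Proof.
have fin (X Y Z d : R) : k0 * (1 - d) <= Y -> Y <= X + Z -> Z <= 2 * d ->
    k0 * (8 * d) <= k0 * 1 -> 8 * d <= k0 -> k0 / 2 <= X by move: k00; lra.
have [l [l0 l1 l2]] : exists l : R, [/\ 0 < l, 8 * Ls * l <= 1 & 8 * Ls * l <= k0].
  near (0 : R)^'+ => a.
  have i1 : 0 < a by near: a; exact: nbhs_right_gt.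
  have i2 : 8 * Ls * a <= 1 by near: a; exact: near_small.
  have i3 : 8 * Ls * a <= k0 by near: a; exact: near_small.
  by exists a.
have nv : `|l *: eu 0| = l by rewrite normrZ neu mulr1 gtr0_norm.
exists (l *: eu 0); split; first by rewrite -normr_gt0 nv.
move=> t /andP[t0 t1]; rewrite nv crossZl normrM (gtr0_norm l0) -mulrA ler_pM2l// mulrC.
set x := t *: _.
have nx : `|x| <= l by rewrite /x normrZ nv ger0_norm// ler_piMl// ltW.
have [c [d [ev hd _ hc]]] := direction_near (nes x) (nes 0).
have d1 : `|d| <= Ls * l.
  by rewrite (le_trans hd)// (le_trans (hLs _ _))// ler_pM2l// subr0.
have d2 : `|d * cross (eu 0) (rot90 (es 0))| <= 2 * `|d|.
  rewrite normrM mulrC ler_wpM2r// (le_trans (norm_cross _ _))//.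
  by rewrite pnorm_rot90 neu nes !mulr1.
have d3 : 8 * `|d| <= 1 by move: d1 l1; lra.
have d4 : 8 * `|d| <= k0 by move: d1 l2; lra.
have h1 : k0 * (1 - `|d|) <= `|c * cross (eu 0) (es 0)|.
  by rewrite normrM mulrC ler_pM ?(ltW k00)//; move: d3; lra.
have := ler_normB (cross (eu 0) (es x)) (d * cross (eu 0) (rot90 (es 0))).
rewrite {1}ev crossDr !crossZr addrK => h2.
have h3 := ler_wpM2l (ltW k00) d3.
exact: fin h1 h2 d2 h3 d4.
Unshelve. all: by end_near. Qed.

Let dist01 s t : 0 <= s <= 1 -> 0 <= t <= 1 -> `|s - t| <= 1.
Proof. by move=> /andP[? ?] /andP[? ?]; rewrite ler_norml; apply/andP; split; lra. Qed.

(* The chord is compared with the image curve through the form cross(E, .),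
   whose F^n-pullback is nearly closed: its differential has density of order
   j^n, negligible with respect to the growth of its values as n tends to
   infinity. *)
Lemma chord_inequality v m n (T : R) : v != 0 ->
  (forall t, 0 <= t <= 1 -> `|v| / 2 * k0 <= `|cross v (es (t *: v))|) -> 0 < T ->
  (forall r : R, exists (E : plane R -> plane R) (Df : plane R -> plane R -> plane R) (tau : plane R -> R),
    exists2 B : R, 0 < B &
    (forall z a c, cross (Df z a) c - cross (Df z c) a = tau z * cross a c) /\
    forall p, `|p| <= r ->
    [/\ `|E p| <= 4, `|tau p| <= T,
        forall q, `|q| <= r -> `|E q - E p| <= B * `|q - p| /\
           `|E q - E p - Df p (q - p)| <= B * `|q - p| ^+ 2 &
        forall w, `|w| = 1 -> k0 <= `|cross w (es p)| -> k0 / 16 <= `|cross (E p) w|]) ->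
  forall Mm Cm, C11 (iter m F) Mm Cm ->
  `|v| * k0 ^+ 2 / 64 / kU * U (n + m) 0 - 16 * K * `|v| / k0 <=
  8 * (growth_bound * U n 0 * `|iter m F v - iter m F 0|) + T * (`|j| ^+ n * (4 * (Mm * `|v|) ^+ 2)).
Proof.
move=> v0 hv T0 hfield Mm Cm cFm; have [Mn [Cn cFn]] := C11_iter n cF.
set b0 := _ - _; set b1 := 8 * _; set a := T * _.
have gb0 := ltW growth_bound_gt0.
have rhs0 : 0 <= b1 + a.
  have [_ Mm0 _ _ _] := cFm; apply: addr_ge0; apply: mulr_ge0 => //; last 1 first.
  - by apply: mulr_ge0; rewrite ?exprn_ge0// mulr_ge0// exprn_ge0// mulr_ge0// ltW.
  - by apply: mulr_ge0 => //; apply: mulr_ge0 => //; exact: ugrowth_ge0.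
  - exact: ltW.
have [b0p|b0n] := ltP 0 b0; last exact: le_trans b0n rhs0.
have [r [k [kp hb hreg]]] := homotopy_regular v cFm cFn.
have [E [Df [tau [B B0 [hDf hE]]]]] := hfield r.
pose Phi := homotopy (iter m F) (iter n F) v.
pose P := homotopy1 (iter m F) (iter n F) v; pose Q := homotopy2 (iter m F) (iter n F) v.
have hin t s : 0 <= t <= 1 -> 0 <= s <= 1 -> `|Phi t s| <= r by move=> ht hs; case: (hb t s ht hs).
have hP t s : 0 <= t <= 1 -> 0 <= s <= 1 -> `|P t s| <= k by move=> ht hs; case: (hb t s ht hs).
have hQ t s : 0 <= t <= 1 -> 0 <= s <= 1 -> `|Q t s| <= k by move=> ht hs; case: (hb t s ht hs).
have z0 : 0 <= (0 : R) <= 1 by rewrite lexx ler01.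
have z1 : 0 <= (1 : R) <= 1 by rewrite lexx ler01.
have nmE x : iter (n + m) F x = iter n F (iter m F x) by rewrite iterD.
have PhiE t : Phi t 0 = iter (n + m) F (t *: v).
  by have [e _] := homotopy_bottom (iter m F) (iter n F) v t; rewrite nmE.
have PE t : P t 0 = D (iter (n + m) F) (t *: v) v.
  by have [_ e] := homotopy_bottom (iter m F) (iter n F) v t; rewrite D_iterD.
pose f t := cross (E (Phi t 0)) (P t 0).
have hf t : 0 <= t <= 1 -> b0 <= `|f t|.
  move=> ht; rewrite /f PhiE PE; apply: le_trans (@image_transverse E (n + m)%N (t *: v) v (hv t ht) _).
    have h1 : U (n + m) 0 / kU <= U (n + m) (t *: v) by rewrite ler_pdivrMr// mulrC hU.
    have h2 : 0 <= `|v| * k0 ^+ 2 / 64 by apply: mulr_ge0 => //; apply: mulr_ge0 => //; exact: sqr_ge0.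
    rewrite /b0 lerD2r (_ : _ / kU * _ = `|v| * k0 ^+ 2 / 64 * (U (n + m) 0 / kU)); last by ring.
    exact: ler_wpM2l.
  move=> y ->; have := hin t 0 ht z0; rewrite PhiE => hy.
  by have [e1 _ _ e2] := hE _ hy.
have cf : {within `[0, 1], continuous f}.
  have [M1 [C1 [_ _ C10 _ hC1]]] := C11_iter (n + m) cF.
  apply: (@lip_within _ _ _ _ f (2 * (B * (2 * k) * k) + 2 * (4 * (C1 * `|v| * `|v|)))).
    by apply: addr_ge0; apply: mulr_ge0 => //; rewrite !mulr_ge0// ltW.
  move=> s t /=; rewrite !in_itv /= => hs ht.
  have st1 : `|s - t| <= 1 by exact: dist01.
  have d1 : `|Phi s 0 - Phi t 0| <= 2 * k * `|s - t|.
    have := hreg t 0 s 0 `|s - t| ht z0 hs z0 (lexx _); rewrite subrr normr0 => /(_ (normr_ge0 _)).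
    rewrite scale0r addr0 -/(Phi s 0) -/(Phi t 0) -/(P t 0) => h1.
    have := ler_normD (Phi s 0 - Phi t 0 - (s - t) *: P t 0) ((s - t) *: P t 0).
    rewrite subrK normrZ => h2.
    have h3 := ler_wpM2l (normr_ge0 (s - t)) (hP t 0 ht z0).
    have h4 : k * `|s - t| ^+ 2 <= k * `|s - t| by rewrite ler_pM2l// expr2 ler_piMl.
    by move: h1 h2 h3 h4; rewrite [_ * k]mulrC; lra.
  have d2 : `|E (Phi s 0) - E (Phi t 0)| <= B * (2 * k) * `|s - t|.
    have [_ _ e3 _] := hE _ (hin t 0 ht z0); have [e4 _] := e3 _ (hin s 0 hs z0).
    by rewrite (le_trans e4)// -mulrA ler_pM2l.
  have d3 : `|P s 0 - P t 0| <= C1 * `|v| * `|v| * `|s - t|.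
    rewrite !PE (le_trans (hC1 _ _ _))// -scalerBl normrZ.
    by rewrite le_eqVlt; apply/orP; left; apply/eqP; ring.
  have -> : f s - f t = cross (E (Phi s 0) - E (Phi t 0)) (P s 0) + cross (E (Phi t 0)) (P s 0 - P t 0).
    by rewrite /f /cross !pE; ring.
  rewrite (le_trans (ler_normD _ _))// [leRHS]mulrDl lerD// (le_trans (norm_cross _ _))//.
    rewrite -mulrA ler_pM2l// (_ : _ * `|s - t| = B * (2 * k) * `|s - t| * k); last by ring.
    by rewrite ler_pM// hP.
  rewrite -!mulrA ler_pM2l// ler_pM//; last by rewrite !mulrA.
  by have [] := hE _ (hin t 0 ht z0).
(* The integrand along the image curve is bounded away from 0, hence keeps its sign; replacing [E]
   by its opposite makes it positive. *)
suff main (E' : plane R -> plane R) (Df' : plane R -> plane R -> plane R) (tau' : plane R -> R) :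
    (forall z a c, cross (Df' z a) c - cross (Df' z c) a = tau' z * cross a c) ->
    (forall p, `|p| <= r -> [/\ `|E' p| <= 4, `|tau' p| <= T &
        forall q, `|q| <= r -> `|E' q - E' p| <= B * `|q - p| /\
           `|E' q - E' p - Df' p (q - p)| <= B * `|q - p| ^+ 2]) ->
    (forall t, 0 <= t <= 1 -> b0 <= cross (E' (Phi t 0)) (P t 0)) -> b0 <= b1 + a.
  have [hs|hs] := sign_constant b0p cf hf.
    by apply: main hDf _ hs => p hp; have [] := hE p hp.
  apply: (main (fun p => - E p) (fun p q => - Df p q) (fun p => - tau p)).
  - by move=> z u w; rewrite !crossNl mulNr -hDf; ring.
  - move=> p hp; have [e1 e2 e3 _] := hE p hp; split; rewrite ?normrN// => q hq.
    have [e4 e5] := e3 q hq; rewrite -!opprD !normrN; split => //.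
  - by move=> t ht; rewrite crossNl; exact: hs.
move=> {}hDf {}hE hs.
pose B' := B + 4 + T; have B'0 : 0 < B' by rewrite !addr_gt0.
have BB' : B <= B' by rewrite /B' -addrA lerDl addr_ge0// ltW.
apply: (@curve_le_chord _ E' Df' tau' Phi P Q B' k) => //.
- move=> t s ht hs'; have [e1 _ _] := hE _ (hin t s ht hs').
  by rewrite (le_trans e1)// /B'; move: B0 T0; lra.
- move=> t s t' s' ht hs1 ht' hs1'; have [_ _ e3] := hE _ (hin t s ht hs1).
  by have [e4 _] := e3 _ (hin t' s' ht' hs1'); rewrite (le_trans e4)// ler_wpM2r.
- move=> t s t' s' ht hs1 ht' hs1'; have [_ _ e3] := hE _ (hin t s ht hs1).
  by have [_ e4] := e3 _ (hin t' s' ht' hs1'); rewrite (le_trans e4)// ler_wpM2r ?exprn_ge0.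
- move=> t s ht hs'; have [_ e1 _] := hE _ (hin t s ht hs').
  by rewrite (le_trans e1)// /B'; move: B0 T0; lra.
- by move=> u _; have [] := homotopy_side (iter m F) (iter n F) v u.
- by move=> u _; have [] := homotopy_side (iter m F) (iter n F) v u.
- move=> t ht; have [e1 _ _] := hE _ (hin t 1 ht z1).
  rewrite (le_trans (norm_cross _ _))// /b1 (_ : 8 * _ = 2 * (4 * (growth_bound * U n 0 * `|iter m F v - iter m F 0|))); last by ring.
  by rewrite ler_pM2l// ler_pM// /P homotopy_top D_iter_ugrowth.
move=> t s ht hs'; rewrite normrM /a; have [_ e1 _] := hE _ (hin t s ht hs').
have hjn x u w : cross (D (iter n F) x u) (D (iter n F) x w) = j ^+ n * cross u w by exact: D_iter_cross.
by rewrite ler_pM// -normrX; exact: (homotopy_area v cFm hjn ht hs').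
Qed.

(** With [m] fixed, [chord_inequality] is divided by [U n 0] and [n] tends to infinity: both error
    terms are of order [th ^ n * U n 0], and the chord of the [m]-th image is what remains on the
    right. *)
Lemma chord_lower : exists (v : plane R) (c : R), 0 < c /\ forall m, c * U m 0 <= `|iter m F v - iter m F 0|.
Proof.
have [v [v0 hv]] := transverse_segment.
have [T T0 hT] := smooth_transverse_field nes Ls0 hLs k00.
pose c1 := `|v| * k0 ^+ 2 / 64 / kU / kU.
have nv : 0 < `|v| by rewrite normr_gt0.
have c10 : 0 < c1 by rewrite /c1 !divr_gt0// mulr_gt0// exprn_gt0.
have u0 := growth_bound_gt0.
have u8 : 0 < 8 * growth_bound by exact: mulr_gt0.
exists v, (c1 / (8 * growth_bound)); split; first exact: divr_gt0.
move=> m; rewrite mulrAC ler_pdivrMr//.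
have [Mm [Cm cFm]] := C11_iter m cF.
have [_ Mm0 _ _ _] := cFm.
apply/ler_addgt0Pr => e e0.
(* Collects the two errors: the constant one is multiplied by [1 <= K * th ^+ n * U n 0], the one in
   [|j| ^ n] is bounded by [jacobian_decay]. *)
pose B := 16 * K * `|v| / k0 * K + T * (2 * K / k0 * (4 * (Mm * `|v|) ^+ 2)).
have [n hn] := geometric_small B th0 th1 e0.
have h := chord_inequality n v0 hv T0 hT cFm.
have Un := ugrowth_gt0 n 0.
suff main : c1 * U m 0 * U n 0 <= (`|iter m F v - iter m F 0| * (8 * growth_bound) + e) * U n 0.
  by rewrite ler_pM2r in main.
have s1 : c1 * U m 0 * U n 0 <= `|v| * k0 ^+ 2 / 64 / kU * U (n + m) 0.
  rewrite ugrowthD (_ : c1 * _ * _ = `|v| * k0 ^+ 2 / 64 / kU * (U m 0 * (U n 0 / kU))); last by rewrite /c1; ring.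
  rewrite ler_wpM2l//; last by rewrite ler_wpM2l ?ugrowth_ge0// ler_pdivrMr// mulrC hU.
  by rewrite !mulr_ge0 ?invr_ge0 ?exprn_ge0// ltW.
have s2 : 16 * K * `|v| / k0 <= 16 * K * `|v| / k0 * K * th ^+ n * U n 0.
  have h0 : 0 <= 16 * K * `|v| / k0 by rewrite !mulr_ge0 ?invr_ge0// ltW.
  by have := ler_wpM2l h0 (ugrowth_lower n 0); rewrite mulr1 !mulrA.
have s3 : T * (`|j| ^+ n * (4 * (Mm * `|v|) ^+ 2)) <= T * (2 * K / k0 * (4 * (Mm * `|v|) ^+ 2)) * th ^+ n * U n 0.
  have h0 : 0 <= T * (4 * (Mm * `|v|) ^+ 2).
    by apply: mulr_ge0; [exact: ltW|apply: mulr_ge0 => //; exact: sqr_ge0].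
  have := ler_wpM2l h0 (jacobian_decay n).
  move: (_ ^+ 2) => X; rewrite (_ : T * (4 * X) * `|j| ^+ n = T * (`|j| ^+ n * (4 * X))); last by ring.
  by rewrite (_ : T * (4 * X) * _ = T * (2 * K / k0 * (4 * X)) * th ^+ n * U n 0)//; ring.
have s4 := ler_wpM2r (ltW Un) (ltW hn); rewrite /B 2!mulrDl in s4.
rewrite mulrDl (_ : _ * (8 * growth_bound) * _ = 8 * (growth_bound * U n 0 * `|iter m F v - iter m F 0|)); last by ring.
by move: s1 s2 s3 s4 h; lra.
Qed.

Variable A : 'M[int]_2.
Hypothesis hA : forall x k, zpt k -> F (x + k) = F x + lin A k.

Lemma lin_iter_upper n k : zpt k -> `|iter n (lin A) k| <= growth_bound * U n 0 * `|k|.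
Proof.
move=> zk; have [_ e] := iter_lift n 0 hA zk; rewrite add0r in e.
have -> : iter n (lin A) k = iter n F k - iter n F 0 by rewrite e addrC addKr.
rewrite -[X in _ * `|X|]subr0; apply: mvt_plane_le; first exact: differentiable_iter.
by move=> t _; exact: D_iter_ugrowth.
Qed.

Lemma lin_iter_lower : exists2 k, zpt k & forall n, U n 0 <= `|iter n (lin A) k|.
Proof.
have [v [c [c0 hc]]] := chord_lower; have u0 := growth_bound_gt0.
(* Rounding to a lattice vector costs at most [growth_bound * U n 0] after [n] further steps; [m] is
   chosen so that the stretching exceeds this cost by [U n 0]. *)
have [m hm] : exists m, 1 + growth_bound <= c / kU * U m 0.
  have [m hm] := geometric_small ((1 + growth_bound) * kU / c * K) th0 th1 ltr01.
  exists m; have Um := ugrowth_gt0 m 0.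
  have b0 : 0 <= (1 + growth_bound) * kU / c.
    by apply: divr_ge0; [apply: mulr_ge0|]; rewrite ?addr_ge0// ltW.
  have h := ler_wpM2l b0 (ugrowth_lower m 0); rewrite mulr1 !mulrA in h.
  have h2 := ler_wpM2r (ltW Um) (ltW hm); rewrite mul1r in h2.
  have h3 := le_trans h h2.
  rewrite ler_pdivrMr// in h3.
  by rewrite mulrAC ler_pdivlMr// [c * _]mulrC.
have [k zk [h1 h2]] := floor_pt (iter m F v - iter m F 0).
exists k => // n.
have nd : `|iter m F v - (iter m F 0 + k)| <= 1.
  rewrite opprD addrA; move: h1 h2 => /andP[? ?] /andP[? ?].
  by apply: pnorm_le; rewrite ger0_norm.
have [_ e] := iter_lift n (iter m F 0) hA zk.
have up : `|iter n F (iter m F v) - iter n F (iter m F 0 + k)| <= growth_bound * U n 0.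
  apply: mvt_plane_le; first exact: differentiable_iter.
  move=> t _; rewrite (le_trans (D_iter_ugrowth _ _ _))// ler_piMr//.
  by rewrite mulr_ge0 ?ugrowth_ge0// ltW.
have := hc (n + m)%N; rewrite !iterD ugrowthD => low.
have low2 : (1 + growth_bound) * U n 0 <= c * (U m 0 * U n (iter m F 0)).
  rewrite (le_trans (ler_wpM2r (ltW (ugrowth_gt0 n 0)) hm))//.
  rewrite (_ : c / kU * _ * _ = c * (U m 0 * (U n 0 / kU))); last by ring.
  by rewrite ler_pM2l// ler_wpM2l ?ugrowth_ge0// ler_pdivrMr// mulrC hU.
have tri := ler_distD (iter n F (iter m F 0 + k)) (iter n F (iter m F v)) (iter n F (iter m F 0)).
rewrite [X in _ + `|X|](_ : _ = iter n (lin A) k) in tri; last by rewrite e addrC addKr.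
by move: up low low2 tri; rewrite mulrDl mul1r; lra.
Qed.

End ChordBound.

(** * Spectrum of the linear part *)

Section LinearGrowth.
Variable R : realType.
Implicit Types (u v w x y z k : plane R).

(** [V] is a quadratic form, positive definite when [|t| < 1 + d] and nonincreasing along the
    recurrence when [d <= 1]. These two conditions place the roots of [X ^ 2 - t X + d] in the
    closed unit disc. *)
Lemma bounded_recurrence (t d : R) (y : nat -> R) : `|t| < 1 + d -> d <= 1 ->
  (forall n, y n.+2 = t * y n.+1 - d * y n) -> exists B, forall n, `|y n| <= B.
Proof.
move=> ht hd hy.
pose V n := (1 + d) * (y n.+1 ^+ 2 + y n ^+ 2) - 2 * t * y n.+1 * y n.
have Vdec n : V n.+1 <= V n.
  have e : V n - V n.+1 = (1 - d) * (t * y n.+1 - (1 + d) * y n) ^+ 2 by rewrite /V hy; ring.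
  by rewrite -subr_ge0 e mulr_ge0 ?sqr_ge0// subr_ge0.
have V0 n : V n <= V 0%N by elim: n => // n IH; exact: le_trans (Vdec n) IH.
have dt : 0 < 1 + d - `|t| by rewrite subr_gt0.
exists (1 + V 0%N / (1 + d - `|t|)) => n.
have low : (1 + d - `|t|) * (y n ^+ 2) <= V n.
  have h : 2 * t * y n.+1 * y n <= `|t| * (y n.+1 ^+ 2 + y n ^+ 2).
    rewrite (le_trans (ler_norm _))// !normrM normr_nat.
    have e (a : R) : a ^+ 2 = `|a| ^+ 2 by rewrite real_normK ?num_real.
    rewrite (e (y n.+1)) (e (y n)) -!mulrA mulrCA ler_wpM2l//.
    by have := sqr_ge0 (`|y n.+1| - `|y n|); rewrite sqrrB; lra.
  have h2 : 0 <= (1 + d - `|t|) * y n.+1 ^+ 2 by rewrite mulr_ge0 ?sqr_ge0// ltW.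
  by rewrite /V; move: h h2; move: (y n.+1 ^+ 2) (y n ^+ 2) => a b; lra.
have h : y n ^+ 2 <= V 0%N / (1 + d - `|t|).
  by rewrite ler_pdivlMr// mulrC (le_trans low).
have := sqr_ge0 (2 * `|y n| - 1); rewrite sqrrB expr1n mulr1 exprMn real_normK ?num_real//.
by move: h; move: (y n ^+ 2) (_ / _) => a b; lra.
Qed.

Variable A : 'M[int]_2.
Let tr : R := (A 0 0)%:~R + (A 1 1)%:~R.
Let dt : R := (A 0 0)%:~R * (A 1 1)%:~R - (A 0 1)%:~R * (A 1 0)%:~R.

Lemma lin_cayley x : lin A (lin A x) = tr *: lin A x - dt *: x.
Proof. by apply: peq; rewrite /lin !pE /tr /dt /=; ring. Qed.

Lemma lin_iter_linear n (a : R) x y : iter n (lin A) (a *: x + y) = a *: iter n (lin A) x + iter n (lin A) y.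
Proof.
elim: n => [//|n IH]; rewrite /= IH.
by apply: peq; rewrite /lin !pE /=; ring.
Qed.

Lemma lin_iter0 n : iter n (lin A) (0 : plane R) = 0.
Proof. by elim: n => //= n ->; apply: (@peq R); rewrite /lin /=; ring. Qed.

Lemma lin_iter_eigen n (mu : R) w : lin A w = mu *: w -> iter n (lin A) w = mu ^+ n *: w.
Proof.
move=> h; elim: n => [|n IH]; first by rewrite scale1r.
rewrite /= IH; have := lin_iter_linear 1 (mu ^+ n) w 0 => /=.
rewrite -[lin A 0]/(iter 1 (lin A) 0) lin_iter0.
by rewrite !addr0 h scalerA exprSr.
Qed.

Lemma eigenvalue_root (mu : R) : mu ^+ 2 - tr * mu + dt = 0 -> eigenvalue (map_mx intr A) mu.
Proof.
move=> h; rewrite eigenvalue_root_char /root -[X in X == _]/(_.[mu]).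
have s : size (char_poly (map_mx intr A : 'M[R]_2)) = 3%N by rewrite size_char_poly.
have mon : (char_poly (map_mx intr A : 'M[R]_2))`_2 = 1.
  by have /monicP := char_poly_monic (map_mx intr A : 'M[R]_2); rewrite /lead_coef s.
have trc : (char_poly (map_mx intr A : 'M[R]_2))`_1 = - tr.
  by rewrite (char_poly_trace (map_mx intr A : 'M[R]_2))// /mxtrace !big_ord_recl big_ord0 !mxE addr0 /tr; congr (- (_ + (A _ _)%:~R)); apply: val_inj.
have dtc : (char_poly (map_mx intr A : 'M[R]_2))`_0 = dt.
  rewrite char_poly_det sqrrN expr1n mul1r (expand_det_row _ 0) !big_ord_recl big_ord0 /cofactor !det_mx11 !mxE /=.
  have e01 : lift ord0 ord0 = 1 :> 'I_2 by apply: val_inj.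
  have e10 : lift 1 ord0 = 0 :> 'I_2 by apply: val_inj.
  rewrite !e01 ?e10 /dt; ring.
rewrite horner_coef s !big_ord_recl big_ord0 /= mon trc dtc /bump /= !addn0 expr0 expr1 addr0.
by apply/eqP; rewrite -[RHS]h; ring.
Qed.

Variables (s : nat -> R) (J K th b : R) (k0 : plane R).
Hypothesis J0 : 0 < J.
Hypothesis Jd : `|dt| = J.
Hypothesis K0 : 0 < K.
Hypothesis th0 : 0 < th.
Hypothesis th1 : th < 1.
Hypothesis b0 : 0 < b.
Hypothesis hgrow : forall n, 1 <= K * th ^+ n * s n.
Hypothesis hdecay : forall n, J ^+ n <= K * th ^+ n * s n.
Hypothesis hlow : forall n, s n <= `|iter n (lin A) k0|.
Hypothesis hup : forall n k, zpt k -> `|iter n (lin A) k| <= b * s n * `|k|.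

(** If the characteristic polynomial is positive at both [rho] and [- rho], the recurrence rescaled
    by [rho] is bounded, so the iterates of [k0] grow at most like [rho ^ n]; this is slower than
    the growth forced on [s n]. *)
Lemma large_root : exists2 x : R, Num.max 1 J < `|x| & x ^+ 2 - tr * x + dt <= 0.
Proof.
(* As [q] lies strictly between [th] and 1, [rho] lies strictly between [Mx] and [Mx / th], the rate
   at which [s n] must grow. *)
pose Mx := Num.max 1 J; pose q := (1 + th) / 2; pose rho := Mx * q / th.
have M1 : 1 <= Mx by rewrite le_max lexx.
have MJ : J <= Mx by rewrite le_max lexx orbT.
have q0 : 0 < q by rewrite divr_gt0// addr_gt0.
have q1 : q < 1 by rewrite /q ltr_pdivrMr//; move: th1; lra.
have qth : th < q by rewrite /q ltr_pdivlMr//; move: th1; lra.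
have M0 : 0 < Mx by rewrite (lt_le_trans ltr01).
have rho_gt : Mx < rho by rewrite /rho ltr_pdivlMr// ltr_pM2l.
have r0 : 0 < rho by rewrite (lt_trans M0).
have [hp|hp] := leP (rho ^+ 2 - tr * rho + dt) 0.
  by exists rho => //; rewrite gtr0_norm.
have [hm|hm] := leP (rho ^+ 2 + tr * rho + dt) 0.
  by exists (- rho); rewrite ?normrN ?gtr0_norm// sqrrN mulrN opprK.
exfalso.
have fin (x y z : R) : 0 < y ^+ 2 - x * y + z -> 0 < y ^+ 2 + x * y + z -> `|x| * y < y ^+ 2 + z.
  by case: (ger0P x) => _; lra.
pose t := tr / rho; pose d := dt / rho ^+ 2.
have rr : 0 < rho ^+ 2 by rewrite exprn_gt0.
have ht : `|t| < 1 + d.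
  have e : 1 + d = (rho ^+ 2 + dt) / rho ^+ 2 by rewrite /d; field; exact: lt0r_neq0.
  rewrite e /t normrM normfV (gtr0_norm r0) ltr_pdivlMr//.
  have -> : `|tr| / rho * rho ^+ 2 = `|tr| * rho by field; exact: lt0r_neq0.
  exact: fin hp hm.
have hd : d <= 1.
  rewrite /d ler_pdivrMr// mul1r (le_trans (ler_norm _))// Jd expr2 (le_trans MJ)//.
  by rewrite -[leLHS]mulr1 ler_pM ?(ltW M0) ?(ltW rho_gt)// (le_trans M1)// ltW.
have rec (c : plane R -> R) : (forall a x y, c (a *: x + y) = a * c x + c y) ->
    exists B, forall n, `|c (iter n (lin A) k0)| <= B * rho ^+ n.
  move=> hc; have [n|B hB] := @bounded_recurrence t d (fun n => c (iter n (lin A) k0) / rho ^+ n) ht hd.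
    have -> : iter n.+2 (lin A) k0 = tr *: iter n.+1 (lin A) k0 + (- dt *: iter n (lin A) k0 + 0).
      by rewrite addr0 scaleNr /= lin_cayley.
    have c00 : c 0 = 0 by have := hc (-1) 0 0; rewrite scaler0 addr0 mulN1r addNr.
    have rn : rho ^+ n != 0 by rewrite expf_neq0// lt0r_neq0.
    by rewrite !hc c00 /t /d !exprS; field; rewrite rn lt0r_neq0.
  exists B => n; have := hB n.
  by rewrite normrM normfV (gtr0_norm (exprn_gt0 n r0)) ler_pdivrMr ?exprn_gt0.
have [|B1 h1] := rec (fun p : plane R => p.1 : R); first by [].
have [|B2 h2] := rec (fun p : plane R => p.2 : R); first by [].
pose B := Num.max B1 B2.
have hB n : s n <= B * rho ^+ n.
  rewrite (le_trans (hlow n))//; apply: pnorm_le.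
    by rewrite (le_trans (h1 n))// ler_wpM2r ?exprn_ge0 ?(ltW r0)// le_max lexx.
  by rewrite (le_trans (h2 n))// ler_wpM2r ?exprn_ge0 ?(ltW r0)// le_max lexx orbT.
have [n hn] := geometric_small (K * B) q0 q1 ltr01.
have hM : Mx ^+ n <= K * th ^+ n * s n by rewrite /Mx; case: (leP 1 J) => _; rewrite ?expr1n.
have tn : 0 < th ^+ n by rewrite exprn_gt0.
have Mn : 0 < Mx ^+ n by rewrite exprn_gt0.
have h3 : Mx ^+ n <= K * B * q ^+ n * Mx ^+ n.
  have kt : 0 <= K * th ^+ n by rewrite mulr_ge0// ltW.
  rewrite (le_trans hM)// (le_trans (ler_wpM2l kt (hB n)))//.
  rewrite /rho expr_div_n exprMn le_eqVlt; apply/orP; left; apply/eqP.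
  by field; rewrite expf_neq0 ?lt0r_neq0.
by move: h3 hn; rewrite -[X in X <= _]mul1r ler_pM2r//; lra.
Qed.

(** A real point beyond [max 1 J] where the polynomial is not positive forces two real roots, one of
    modulus above [max 1 J] and the other, [J] divided by it, below 1. Upper growth comes from the
    expansion of [k0] in eigenvectors, lower growth from an eigenvector for [m1] bounded through the
    two basis vectors of the lattice. *)
Lemma hyperbolic_spectrum : exists m1 m2 c : R, [/\ 0 < c,
  m1 ^+ 2 - tr * m1 + dt = 0 /\ m2 ^+ 2 - tr * m2 + dt = 0,
  `|m1| * `|m2| = J, 1 < `|m1| /\ 0 < `|m2| < 1 &
  forall n, s n <= c * `|m1| ^+ n /\ `|m1| ^+ n <= c * s n].
Proof.
have [x hx px] := large_root.
pose D := tr ^+ 2 / 4 - dt.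
have D0 : 0 <= D by have := sqr_ge0 (x - tr / 2); rewrite /D; move: px; nra.
pose r := Num.sqrt D; have r0 : 0 <= r by exact: sqrtr_ge0.
have rr : r ^+ 2 = D by rewrite sqr_sqrtr.
have prod : (tr / 2 + r) * (tr / 2 - r) = dt.
  by rewrite (_ : _ * _ = tr ^+ 2 / 4 - r ^+ 2); [rewrite rr /D; ring|field].
have [m1 [m2 [em ep hm]]] : exists m1 m2 : R, [/\ m1 + m2 = tr, m1 * m2 = dt & `|x| <= `|m1|].
  have fac : (x - (tr / 2 + r)) * (x - (tr / 2 - r)) <= 0.
    by rewrite (_ : _ * _ = x ^+ 2 - tr * x + (tr ^+ 2 / 4 - r ^+ 2)); [rewrite rr /D; move: px; lra|field].
  have xb : tr / 2 - r <= x <= tr / 2 + r.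
    by move: fac r0; move: (tr / 2) => h; nra.
  move/andP: xb => [xl xu].
  have [xp|xn] := leP 0 x.
    exists (tr / 2 + r), (tr / 2 - r); split; first by field.
      by rewrite prod.
    by rewrite ger0_norm// ger0_norm// (le_trans xp).
  exists (tr / 2 - r), (tr / 2 + r); split; first by field.
    by rewrite mulrC prod.
  by rewrite ltr0_norm// ler0_norm ?lerN2// (le_trans xl)// ltW.
have {}hm : Num.max 1 J < `|m1| by exact: lt_le_trans hx hm.
move: hm; rewrite gt_max => /andP[hm1 hmJ].
have n1 : 0 < `|m1| by rewrite (lt_trans ltr01).
have nJ : `|m1| * `|m2| = J by rewrite -normrM ep.
have n2 : 0 < `|m2| by rewrite -(pmulr_rgt0 _ n1) nJ.
have n21 : `|m2| < 1 by rewrite -(ltr_pM2l n1) nJ mulr1.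
have m12 : m1 - m2 != 0.
  by rewrite subr_eq0; apply/eqP => e; move: n21 hm1; rewrite e; lra.
have nm : 0 < `|m1 - m2| by rewrite normr_gt0.
have Aeig v : lin A (lin A v - m2 *: v) = m1 *: (lin A v - m2 *: v) /\
    lin A (lin A v - m1 *: v) = m2 *: (lin A v - m1 *: v).
  have lB w a : lin A (w - a *: v) = lin A w - a *: lin A v by apply: peq; rewrite /lin !pE /=; ring.
  rewrite !lB lin_cayley -em -ep; split; apply: peq; rewrite !pE; ring.
(* By Cayley-Hamilton the nonzero columns of [A - m2] are eigenvectors for [m1]; both columns vanish
   only if [A] is scalar, against [m1 != m2]. *)
have [w w0 hw] : exists2 w, w != 0 & lin A w = m1 *: w.
  have [h|h] := eqVneq (lin A (e1 R) - m2 *: e1 R) 0; last by eexists; [exact: h|have [] := Aeig (e1 R)].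
  have [h'|h'] := eqVneq (lin A (e2 R) - m2 *: e2 R) 0; last by eexists; [exact: h'|have [] := Aeig (e2 R)].
  exfalso; move/eqP: m12; apply.
  have /(congr1 fst) := h; have /(congr1 snd) := h'; rewrite /lin /= /GRing.scale /= => h1 h2.
  by move: h1 h2 em; rewrite /tr !mulr1 !mulr0 => h1 h2 h3; move: h1 h2 h3; lra.
pose w1 := lin A k0 - m2 *: k0; pose w2 := lin A k0 - m1 *: k0.
pose c := 1 + (`|w1| + `|w2|) / `|m1 - m2| + 2 * b.
have s0 n : 0 < s n.
  have h := hgrow n; have t : 0 < K * th ^+ n by rewrite mulr_gt0// exprn_gt0.
  by rewrite -(pmulr_rgt0 _ t) (lt_le_trans ltr01).
exists m1, m2, c; split.
- by rewrite /c -addrA ltr_wpDr// addr_ge0 ?divr_ge0 ?addr_ge0// mulr_ge0// ltW.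
- by rewrite -em -ep; split; ring.
- exact: nJ.
- by rewrite hm1 n2 n21.
move=> n; split.
  have ek : (m1 - m2) *: k0 = w1 + (- 1) *: w2 by rewrite /w1 /w2; apply: peq; rewrite !pE; ring.
  have [h1 h2] := Aeig k0.
  have eI : (m1 - m2) *: iter n (lin A) k0 = m1 ^+ n *: w1 - m2 ^+ n *: w2.
    have <- : iter n (lin A) ((m1 - m2) *: k0 + 0) = (m1 - m2) *: iter n (lin A) k0.
      by rewrite lin_iter_linear lin_iter0 addr0.
    rewrite addr0 ek addrC lin_iter_linear (lin_iter_eigen n h1) (lin_iter_eigen n h2).
    by rewrite scaleN1r addrC.
  have h3 : `|m2| ^+ n <= `|m1| ^+ n.
    by rewrite lerXn2r ?nnegrE// ltW// (lt_trans n21).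
  have h4 : `|m1 - m2| * `|iter n (lin A) k0| <= (`|w1| + `|w2|) * `|m1| ^+ n.
    rewrite -normrZ eI (le_trans (ler_normB _ _))// !normrZ !normrX mulrDl.
    by rewrite [leRHS]addrC addrC lerD// mulrC ?ler_wpM2l.
  have {}h4 : `|iter n (lin A) k0| <= (`|w1| + `|w2|) / `|m1 - m2| * `|m1| ^+ n.
    by rewrite mulrAC ler_pdivlMr// mulrC.
  rewrite (le_trans (hlow n))// (le_trans h4)// ler_wpM2r ?exprn_ge0// /c.
  by have := ltW b0; lra.
have hwn : `|m1| ^+ n * `|w| <= 2 * b * s n * `|w|.
  rewrite -normrX -normrZ -(lin_iter_eigen n hw) {1}(e12E w).
  have -> : iter n (lin A) ((w.1 : R) *: e1 R + (w.2 : R) *: e2 R) =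
    (w.1 : R) *: iter n (lin A) (e1 R) + (w.2 : R) *: iter n (lin A) (e2 R).
    by rewrite lin_iter_linear -{1}[_ *: e2 R]addr0 lin_iter_linear lin_iter0 !addr0.
  have z1 : zpt (e1 R) by rewrite /zpt /= rpred1 rpred0.
  have z2 : zpt (e2 R) by rewrite /zpt /= rpred1 rpred0.
  have h1 := hup n z1; have h2 := hup n z2; rewrite pnorm_e1 mulr1 in h1; rewrite pnorm_e2 mulr1 in h2.
  rewrite (le_trans (ler_normD _ _))// !normrZ.
  have -> : 2 * b * s n * `|w| = `|w| * (b * s n) + `|w| * (b * s n) by ring.
  by rewrite lerD// ler_pM// ?norm1_le ?norm2_le.
rewrite ler_pM2r ?normr_gt0// in hwn.
rewrite (le_trans hwn)// ler_wpM2r ?(ltW (s0 n))// /c.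
by have : 0 <= (`|w1| + `|w2|) / `|m1 - m2|; [rewrite divr_ge0 ?addr_ge0|lra].
Qed.

End LinearGrowth.

(** * Lyapunov exponents *)

Section Exponents.
Variable R : realType.
Implicit Types (u v w x y z p : plane R).

Lemma growth_limit (y : nat -> R) (mu c : R) : 0 < c -> 0 < mu -> (forall n, 0 < y n) ->
  (forall n, y n <= c * mu ^+ n) -> (forall n, mu ^+ n <= c * y n) ->
  (fun n : nat => n%:R^-1 * ln (y n)) @ \oo --> ln mu.
Proof.
move=> c0 mu0 y0 h1 h2.
have lnX n : ln (mu ^+ n) = n%:R * ln mu by rewrite lnXn// mulr_natl.
have bd n : `|ln (y n) - n%:R * ln mu| <= ln c.
  have a1 : ln (y n) <= ln (c * mu ^+ n) by rewrite ler_ln ?posrE ?mulr_gt0 ?exprn_gt0.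
  have a2 : ln (mu ^+ n) <= ln (c * y n) by rewrite ler_ln ?posrE ?mulr_gt0 ?exprn_gt0.
  rewrite !lnM ?posrE ?exprn_gt0// !lnX in a1 a2.
  by rewrite ler_norml; apply/andP; split; move: a1 a2; lra.
apply/cvgrPdist_le => e e0.
have [N _ hN] := nat_gt (ln c / e).
near=> n.
have nN : (N <= n)%N by near: n; exact: nbhs_infty_ge.
have n1 : (0 < n)%N by near: n; exact: nbhs_infty_gt.
have nR : 0 < n%:R :> R by rewrite ltr0n.
have -> : ln mu - n%:R^-1 * ln (y n) = - (n%:R^-1 * (ln (y n) - n%:R * ln mu)).
  by field; exact: lt0r_neq0.
rewrite normrN normrM normfV (gtr0_norm nR) ler_pdivrMl// (le_trans (bd n))//.
rewrite -ler_pdivrMr// (le_trans (ltW hN))// ler_nat//.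
Unshelve. all: by end_near. Qed.

Lemma growth_limit_norm (w : nat -> plane R) (mu a b : R) : 0 < mu ->
  (forall n, `|w n| <= a * mu ^+ n) -> (forall n, mu ^+ n <= b * `|w n|) ->
  (fun n : nat => n%:R^-1 * ln (enorm (w n))) @ \oo --> ln mu.
Proof.
move=> mu0 h1 h2; have mun n : 0 < mu ^+ n by rewrite exprn_gt0.
have gt n : 0 < enorm (w n).
  apply: lt_le_trans (enorm_ge (w n)); rewrite lt_neqAle normr_ge0 andbT eq_sym.
  by apply/eqP => z; have := h2 n; rewrite z mulr0 leNgt mun.
have c0 : 0 < 1 + 2 * `|a| + `|b| by have := normr_ge0 a; have := normr_ge0 b; lra.
apply: (@growth_limit _ mu (1 + 2 * `|a| + `|b|)) => // n.
  rewrite (le_trans (enorm_le _))// (le_trans (ler_wpM2l _ (h1 n)))// mulrA ler_pM2r//.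
  by have := ler_norm a; have := normr_ge0 b; lra.
rewrite (le_trans (h2 n))// (le_trans (ler_wpM2r _ (ler_norm b)))//.
by rewrite ler_pM ?enorm_ge//; have := normr_ge0 a; lra.
Qed.

Variables (F G : plane R -> plane R) (M C M' C' j : R).
Hypothesis cF : C11 F M C.
Hypothesis cG : C11 G M' C'.
Hypothesis FK : cancel F G.
Hypothesis GK : cancel G F.
Hypothesis hj : forall x u v, cross (D F x u) (D F x v) = j * cross u v.
Variables (eu es : plane R -> plane R) (K th k0 kU m1 m2 c : R).
Hypothesis hfr : hyperbolic_frame F G eu es K th k0.
Hypothesis kU0 : 0 < kU.
Local Notation U := (ugrowth F eu).
Hypothesis hU : forall n x y, U n x <= kU * U n y.
Hypothesis c0 : 0 < c.
Hypothesis m1p : 1 < `|m1|.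
Hypothesis m2p : 0 < `|m2|.
Hypothesis m12 : `|m1| * `|m2| = `|j|.
Hypothesis hs1 : forall n, U n 0 <= c * `|m1| ^+ n.
Hypothesis hs2 : forall n, `|m1| ^+ n <= c * U n 0.

Let dF : forall x, differentiable F x. Proof. by case: cF. Qed.
Let k00 : 0 < k0. Proof. by case: hfr => -[]. Qed.
Let neu x : `|eu x| = 1. Proof. by case: hfr => _ /(_ x)[]. Qed.
Let nes x : `|es x| = 1. Proof. by case: hfr => _ /(_ x)[]. Qed.
Let kus x : k0 <= `|cross (eu x) (es x)|. Proof. by case: hfr => _ /(_ x)[]. Qed.
Let Ugt n x : 0 < U n x. Proof. exact: (ugrowth_gt0 cF cG FK GK hfr). Qed.
Let m10 : 0 < `|m1|. Proof. exact: lt_trans m1p. Qed.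

Let Jn n : `|j| ^+ n = `|m1| ^+ n * `|m2| ^+ n. Proof. by rewrite -m12 exprMn. Qed.

Let U_upper n x : U n x <= kU * c * `|m1| ^+ n.
Proof. by rewrite (le_trans (hU n x 0))// -mulrA ler_pM2l. Qed.

Let U_lower n x : `|m1| ^+ n <= c * kU * U n x.
Proof. by rewrite (le_trans (hs2 n))// -mulrA ler_pM2l. Qed.

(** Up to the angle, [|j| ^ n] is the product of [U n x] and the stable norm; [U n x] is comparable
    to [|m1| ^ n], which leaves [|m2| ^ n]. *)
Lemma stable_contraction n x : `|D (iter n F) x (es x)| <= 2 * (c * kU) / k0 * `|m2| ^+ n.
Proof.
have e := D_iter_cross n x (eu x) (es x) dF hj.
have [cu eu' nu] := cross0_parallel (frame_u dF (let: And5 d _ _ _ _ := cG in d) FK GK hfr n x) (neu _).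
have [cs es' ns] := cross0_parallel (frame_s dF hfr n x) (nes _).
have h1 : U n x * (`|D (iter n F) x (es x)| * k0) <= `|j| ^+ n * 2.
  have h : `|cross (D (iter n F) x (eu x)) (D (iter n F) x (es x))| <= `|j| ^+ n * 2.
    rewrite e normrM normrX ler_wpM2l ?exprn_ge0//.
    by have := norm_cross (eu x) (es x); rewrite neu nes !mulr1.
  apply: le_trans h; rewrite /ugrowth -nu -ns eu' es' crossZl crossZr !normrM.
  by rewrite ler_wpM2l// ler_wpM2l.
rewrite mulrAC ler_pdivlMr// -(ler_pM2l (Ugt n x)) (le_trans h1)// Jn.
have h2 := ler_wpM2r (ltW (exprn_gt0 n m2p)) (U_lower n x).
rewrite (_ : U n x * _ = 2 * (c * kU * U n x * `|m2| ^+ n)); last by ring.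
by rewrite mulrC ler_pM2l.
Qed.

Lemma stable_expansion n x : `|m2| ^+ n <= 2 * (kU * c) / k0 * `|D (iter n F) x (es x)|.
Proof.
have e := D_iter_cross n x (eu x) (es x) dF hj.
have h1 : `|j| ^+ n * k0 <= 2 * (U n x * `|D (iter n F) x (es x)|).
  rewrite (le_trans _ (norm_cross _ _))// e normrM normrX ler_wpM2l ?exprn_ge0//.
rewrite [leRHS]mulrAC ler_pdivlMr// -(ler_pM2l (exprn_gt0 n m10)) [leLHS]mulrA -Jn (le_trans h1)//.
have h2 := ler_wpM2r (normr_ge0 (D (iter n F) x (es x))) (U_upper n x).
rewrite (_ : `|m1| ^+ n * _ = 2 * (kU * c * `|m1| ^+ n * `|D (iter n F) x (es x)|)); last by ring.
by rewrite ler_pM2l.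
Qed.

(** Any vector off the stable line has this rate, which is why the unstable exponent does not depend
    on the past. The lower bound comes from [D F^n] scaling the area spanned with [es x] by
    [j ^ n]. *)
Lemma growth_of_unstable x v : cross v (es x) != 0 ->
  (fun n : nat => n%:R^-1 * ln (enorm (D (iter n F) x v))) @ \oo --> ln `|m1|.
Proof.
move=> hv; have cv : 0 < `|cross v (es x)| by rewrite normr_gt0.
apply: (@growth_limit_norm _ _ (growth_bound K k0 kU * c * `|v|) (4 * (c * kU) / k0 / `|cross v (es x)|)) => // n.
  rewrite (le_trans (D_iter_ugrowth cF cG FK GK hfr hU n x v))// mulrAC.
  rewrite (_ : _ * c * _ * _ = growth_bound K k0 kU * `|v| * (c * `|m1| ^+ n)); last by ring.
  by rewrite ler_wpM2l// mulr_ge0// ltW// (growth_bound_gt0 hfr).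
have e := D_iter_cross n x v (es x) dF hj.
rewrite mulrAC ler_pdivlMr// -(ler_pM2r (exprn_gt0 n m2p)).
have -> : `|m1| ^+ n * `|cross v (es x)| * `|m2| ^+ n = `|cross (D (iter n F) x v) (D (iter n F) x (es x))|.
  by rewrite e normrM normrX Jn; ring.
rewrite (le_trans (norm_cross _ _))//.
have h := ler_wpM2l (normr_ge0 (D (iter n F) x v)) (stable_contraction n x).
rewrite (_ : 4 * _ / _ * _ * _ = 2 * (`|D (iter n F) x v| * (2 * (c * kU) / k0 * `|m2| ^+ n))); last by ring.
by rewrite ler_pM2l.
Qed.

Lemma growth_of_stable x v : v != 0 -> cross v (es x) = 0 ->
  (fun n : nat => n%:R^-1 * ln (enorm (D (iter n F) x v))) @ \oo --> ln `|m2|.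
Proof.
move=> v0 hv; have nv : 0 < `|v| by rewrite normr_gt0.
have [a ev na] := cross0_parallel hv (nes x).
have nD n : `|D (iter n F) x v| = `|v| * `|D (iter n F) x (es x)| by rewrite {1}ev linearZ normrZ na.
apply: (@growth_limit_norm _ _ (`|v| * (2 * (c * kU) / k0)) (2 * (kU * c) / k0 / `|v|)) => // n.
  by rewrite nD -[leRHS]mulrA ler_pM2l//; exact: stable_contraction.
by rewrite nD [leRHS]mulrA divfK ?lt0r_neq0// stable_expansion.
Qed.

End Exponents.

Lemma dim1_vector (R : realType) (V : vectType R) (E : {vspace V}) : \dim E = 1%N -> exists2 v, v != 0 & v \in E.
Proof.
move=> dE; exists (vpick E); last exact: memv_pick.
by rewrite vpick0; apply/eqP => E0; rewrite E0 dimv0 in dE.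
Qed.

Theorem theorem2 (R : realType) (f : torus R -> torus R)
    (F : plane R -> plane R) (A : 'M[int]_2)
    (hF : is_lift f F)
    (hC2 : Ck_on 2 setT F)
    (hanosov : anosov f F)
    (hjac : constant_jacobian F)
    (hA : linearization f A)
    (hUBD : UBD (unstable_leaf F)) :
  exists lu ls : R,
    lin_exponent_u A lu /\ lin_exponent_s A ls /\
    forall x : torus R, lyapunov_u f F x lu /\ lyapunov_s f F x ls.
Proof.
have [M [C cF]] := lift_C11 hF hC2.
have [j j0 hj] := constant_jdet hF cF hanosov.1 hjac.
have [G [M' [C' [FK GK cG _ hjG]]]] := C11_inverse cF j0 hj.
have hAl := lift_linearization hF hA.
have [eu [es [K [th [k0 hfr]]]]] := exists_hyperbolic_frame hF cF cG FK GK hAl hanosov.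
have [dF _ _ _ _] := cF; have [dG _ _ _ _] := cG.
have [Ls Ls0 hLs] := frame_lipschitz dF dG FK GK hfr cF j0 hj.
have jV0 : j^-1 != 0 by rewrite invr_eq0.
have [Lu Lu0 hLu] := frame_lipschitz dG dF GK FK (frame_sym hfr) cG jV0 hjG.
have [kU kU0 hU] := ugrowth_uniform cF cG FK GK hfr Lu0 Ls0 hLu hLs j0 hj hUBD hAl.
have [k zk hlow] := lin_iter_lower cF cG FK GK hj hfr Ls0 hLs kU0 hU hAl.
have hup := lin_iter_upper cF cG FK GK hfr hU hAl.
have [[K1 /andP[th0 th1] k00] hn hbs _ [hbF _]] := hfr.
have K0 : 0 < K by rewrite (lt_le_trans ltr01).
have J0 : 0 < `|j| by rewrite normr_gt0.
have dtj : `|(A 0 0)%:~R * (A 1 1)%:~R - (A 0 1)%:~R * (A 1 0)%:~R : R| = `|j|.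
  by rewrite -(jacobian_lin cF hj hAl) /cross /lin /=; congr (`|_|); ring.
pose Kc := K + 2 * K / k0.
have Kc0 : 0 < Kc by rewrite addr_gt0// divr_gt0// mulr_gt0.
have grow n : 1 <= Kc * th ^+ n * ugrowth F eu n 0.
  rewrite (le_trans (ugrowth_lower cF cG FK GK hfr n 0))//.
  by rewrite ler_wpM2r ?ugrowth_ge0// ler_wpM2r ?exprn_ge0 ?(ltW th0)// lerDl divr_ge0 ?mulr_ge0// ltW.
have decay n : `|j| ^+ n <= Kc * th ^+ n * ugrowth F eu n 0.
  rewrite (le_trans (jacobian_decay cF hj hfr n))//.
  by rewrite ler_wpM2r ?ugrowth_ge0// ler_wpM2r ?exprn_ge0 ?(ltW th0)// lerDr ltW.
have [m1 [m2 [c [c0 [r1 r2] m12 [m1p /andP[m2p m2l]] hs]]]] :=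
  hyperbolic_spectrum J0 dtj Kc0 th0 th1 (growth_bound_gt0 hfr kU0) grow decay hlow hup.
have hs1 n := (hs n).1; have hs2 n := (hs n).2.
have gU := growth_of_unstable cF cG FK GK hj hfr kU0 hU c0 m1p m2p m12 hs1 hs2.
have gS := growth_of_stable cF cG FK GK hj hfr kU0 hU c0 m1p m2p m12 hs1 hs2.
exists (ln `|m1|), (ln `|m2|); split; [|split].
- by exists m1; split => //; exact: eigenvalue_root.
- by exists m2; split; rewrite ?m2p//; exact: eigenvalue_root.
have tDE n x v : tD (iter n F) x v = D (iter n F) (repr x) v by rewrite /tD DE.
(* A vector of [Eu 0] on the stable line would have bounded images, against its expansion; so every
   past yields a vector off that line. *)
have grU x v : unstable_vector f F x v -> growth_rate F x v (ln `|m1|).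
  move=> [v0 [p [Eu [Es [_ px [_ _ _ [b [lam [b0 lam1 hcl]]]] vE]]]]].
  rewrite /growth_rate; under eq_fun => n do rewrite tDE.
  apply: gU; apply/eqP => cv.
  have [a ev _] := cross0_parallel cv (let: And3 _ e _ := hn (repr x) in e).
  have le : enorm v <= 0.
    rewrite leNgt; apply/negP => nv.
    have nn : enorm v = 0.
      apply: (@geometric_bounded_eq0 _ lam (enorm v) (b * (2 * (`|a| * K))) lam1 (sqrtr_ge0 _)) => n.
      have [h _] := hcl n 0; have := h v vE; rewrite px tDE => h1.
      have h2 : `|D (iter n F) (repr x) v| <= `|a| * K.
        rewrite ev linearZ normrZ ler_wpM2l// (le_trans (hbs n _))//.
        by rewrite -[leRHS]mulr1 ler_wpM2l ?exprn_ile1// ltW.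
      rewrite -ler_pdivrMl// [leLHS]mulrA (le_trans h1)// (le_trans (enorm_le _))//.
      by rewrite ler_pM2l.
    by rewrite nn ltxx in nv.
  by have := lt_le_trans (enorm_gt0 v0) le; rewrite ltxx.
(* A vector of [Es 0] has a bounded future, hence lies on the line of [es]. *)
have grS x v : stable_vector f F x v -> growth_rate F x v (ln `|m2|).
  move=> [v0 [p [Eu [Es [_ px [_ _ _ [b [lam [b0 lam1 hcl]]]] vE]]]]].
  rewrite /growth_rate; under eq_fun => n do rewrite tDE.
  apply: gS => //; apply: hbF; exists (b * enorm v) => n.
  have [_ h] := hcl n 0; have := h v vE; rewrite px tDE => h1.
  rewrite (le_trans (enorm_ge _))// (le_trans h1)// ler_wpM2r ?sqrtr_ge0//.
  by rewrite ger_pMr// invf_le1 ?exprn_ege1 ?exprn_gt0 ?ltW// (lt_trans ltr01).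
move=> x.
(* The past given by the inverse lift provides a full orbit through [x], hence stable and unstable
   vectors to witness existence. *)
pose q i := zorb F G (repr x) i.
have hq i : zpt (F (q i) - q (i + 1)) by rewrite /q zorbS// subrr /zpt /= rpred0.
have orb := splitting_orbit hF hq.
have p0 : torus_proj (q 0) = x by exact: torus_repr.
have [Eu [Es hsp]] := hanosov.2 _ orb.
have [hdim _ _ _] := hsp; have [du ds] := hdim 0.
have [u u0 uE] := dim1_vector du; have [s s0 sE] := dim1_vector ds.
split; split.
- by exists u; split => //; exists (fun i => torus_proj (q i)), Eu, Es.
- exact: grU.
- by exists s; split => //; exists (fun i => torus_proj (q i)), Eu, Es.
- exact: grS.
Qed.
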